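(* Let $B=(-A)^{1/2}$, $c\in(-1,1)$, $\lambda>0$, and let $(P^c_t)_{t\ge0}$ be the Markov semigroup on $K\cap{\bf H}^c$ of the reflected stochastic Cahn–Hilliard equation with logarithmic free energy described in the context. Suppose $\pi^2>\lambda$. Then for every $p>1$ the Harnack inequality with power $p$ $$|P_t^c\phi|^p(y)\le P_t^c|\phi|^p(x)\,\exp\left\{\frac{p(\pi^2-\lambda)\pi^2|x-y|_{-1}^2}{2(p-1)\left(e^{(\pi^2-\lambda)\pi^2t}-1\right)}\right\}$$ holds for any $\phi\in B_b({\bf H}^c)$, $x,y\in K\cap{\bf H}^c$ and $t>0$. In particular, the log-Harnack inequality $$P_t^c\log\phi(y)\le\frac{(\pi^2-\lambda)\pi^2|x-y|_{-1}^2}{2\left(e^{(\pi^2-\lambda)\pi^2t}-1\right)}+\log P_t^c\phi(x)$$ holds for any $0<\phi\in B_b({\bf H}^c)$, $x,y\in K\cap{\bf H}^c$ and $t>0$.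
   Context: Spaces. $\langle\cdot,\cdot\rangle$ and $|\cdot|$ are the inner product and norm of $L^2(0,1)$. $A$ is the realization of $\partial^2/\partial\theta^2$ in $L^2(0,1)$ with homogeneous Neumann boundary condition, $D(A)=\{u\in H^2(0,1):u'(0)=u'(1)=0\}$. Its eigenbasis is $e_0\equiv1$, $e_n(\theta)=\sqrt2\cos(n\pi\theta)$ ($n\ge1$), $Ae_n=-(n\pi)^2e_n$. For $\gamma\in\mathbb R$ and $u=\sum_{n\ge0}u_ne_n$, $(-A)^{\gamma/2}u=\sum_{n\ge1}(n\pi)^\gamma u_ne_n$, $|u|_\gamma=\left(\sum_{n\ge1}(n\pi)^{2\gamma}u_n^2\right)^{1/2}$, $\bar u=\langle u,e_0\rangle=u_0$, $\|u\|_\gamma=(|u|_\gamma^2+\bar u^2)^{1/2}$, and $V_\gamma$ is the space of such $u$ with $\|u\|_\gamma<\infty$. Put ${\bf H}=V_{-1}$, ${\bf H}^c=\{u\in{\bf H}:\bar u=c\}$ with the metric $|x-y|_{-1}$, and $K=\{x\in L^2(0,1):x\in[-1,1]\text{ a.e.}\}$. $B_b({\bf H}^c)$ denotes the bounded measurable real functions on ${\bf H}^c$. Equation. Let $f(u)=\log\frac{1-u}{1+u}+\lambda u$ for $u\in(-1,1)$, $f(u)=+\infty$ for $u\le-1$, $f(u)=-\infty$ for $u\ge1$. The equation is formally $$\partial_tu=-\tfrac12A\{Au+f(u)+\eta_--\eta_+\}+B\dot W,\quad u(0)=x,$$ on $(0,1)$ with Neumann-type boundary conditions, where $\eta_\pm$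 are reflection measures at $\pm1$. For $x\in K$, a weak solution is a quadruplet $(u,\eta_+,\eta_-,W)$ on a filtered complete probability space $(\Omega,\mathcal F,(\mathcal F_t),\mathbb P)$ such that, almost surely where relevant: (i) for every $T>0$, $u\in C((0,T]\times[0,1];[-1,1])\cap C([0,T];{\bf H})$, $u(0)=x$, and $f(u)\in L^1([0,T]\times[0,1])$; (ii) $\eta_\pm$ are positive random measures on $[0,\infty)\times[0,1]$ with $\eta_\pm([\delta,T]\times[0,1])<\infty$ for all $0<\delta\le T$; (iii) $W$ is a cylindrical Wiener process on $L^2(0,1)$ independent of $x$, and $(u(t),W(t))$ is $(\mathcal F_t)$-adapted; (iv) for all $\phi\in D(A^2)$ and $0<\delta<t$, $$\langle u(t),\phi\rangle=\langle u(\delta),\phi\rangle-\tfrac12\int_\delta^t\langle u(s),A^2\phi\rangle ds-\tfrac12\int_\delta^t\langle f(u(s)),A\phi\rangle ds-\tfrac12\int_\delta^t\!\int_0^1A\phi\,d\eta_-+\tfrac12\int_\delta^t\!\int_0^1A\phi\,d\eta_++\int_\delta^t\langle B^*\phi,dW(s)\rangle,$$ where $\langle f(u(s)),A\phi\rangle$ is the $L^1$–$L^\infty$ duality; (v) $\int_0^\infty\!\int_0^1(1-u)\,d\eta_+=\int_0^\infty\!\int_0^1(1+u)\,d\eta_-=0$. A weak solution is strong if $u$ is adapted to the natural filtration of $W$. Known facts. For $c\in(-1,1)$ and $x\in K$ with $\bar x=c$ there is a unique (pathwise) strong solution $u(t;x)$; its mass is conserved, $\bar u(t;x)=\bar x$;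 and $(u(t;x))$ is a continuous Markov process with values in $K\cap{\bf H}^c$. Its semigroup is $P_t^c\phi(x)=\mathbb E[\phi(u(t;x))]$, $x\in K\cap{\bf H}^c$. *)

(* Defs.v *)
From mathcomp Require Import all_boot all_order all_algebra.
From mathcomp Require Import all_classical all_reals all_analysis.

Set Implicit Arguments.
Unset Strict Implicit.
Unset Printing Implicit Defensive.

Import Order.TTheory GRing.Theory Num.Theory.
Import numFieldNormedType.Exports.

Local Open Scope classical_set_scope.
Local Open Scope ring_scope.

Section spaces.
Context {R : realType}.
Local Notation mu := (@lebesgue_measure R).
Local Notation I01 := (`[0, 1]%classic : set R).
Implicit Types (g h u v : R -> R) (a b : nat -> R) (gamma c : R).

(* L^2(0,1) is handled through representatives R -> R, of which only the
   restriction to [0,1] matters. *)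
Definition L2 h : Prop :=
  measurable_fun I01 h /\
  mu.-integrable I01 (fun theta => (h theta ^+ 2)%:E).

Definition inner g h : R := \int[mu]_(theta in I01) (g theta * h theta).

Definition eigen (n : nat) (theta : R) : R :=
  if n == 0%N then 1 else Num.sqrt 2 * cos (n%:R * pi * theta).

Definition coef h : nat -> R := fun n => inner h (eigen n).

(* An element sum_n a_n e_n of V_gamma is its sequence of coefficients; for
   gamma < 0 it need not come from a function. *)
Definition seminormV gamma a : \bar R :=
  ((\sum_(1 <= n <oo) ((n%:R * pi) `^ (2 * gamma) * a n ^+ 2)%:E) `^ 2^-1)%E.

Definition normV gamma a : \bar R :=
  ((seminormV gamma a `^ 2 + (a 0%N ^+ 2)%:E) `^ 2^-1)%E.

Definition V gamma : set (nat -> R) := [set a | (normV gamma a < +oo)%E].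

Definition H : set (nat -> R) := V (-1).

Definition Hc c : set (nat -> R) := [set a | H a /\ a 0%N = c].

Definition K : set (R -> R) :=
  [set h | L2 h /\ {ae mu, forall theta, I01 theta ->
                                         -1 <= h theta <= 1}].

(* Borel sigma-algebra of a subspace X of H. On X = Hc c the distance
   normV (-1) (a - b) is seminormV (-1) (a \- b). *)
Definition open_in (X U : set (nat -> R)) : Prop :=
  U `<=` X /\
  forall a, U a -> exists2 r : R, 0 < r &
    forall b, X b -> (normV (-1) (b - a)%R < r%:E)%E -> U b.

Definition borel (X : set (nat -> R)) : set (set (nat -> R)) :=
  <<s X, open_in X >>.

(* B_b(H^c); the values of phi outside H^c are irrelevant. *)
Definition Bb c (phi : (nat -> R) -> R) : Prop :=
  (exists M : R, forall a, Hc c a -> `|phi a| <= M) /\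
  forall D : set R, measurable D -> borel (Hc c) (Hc c `&` phi @^-1` D).

Definition test_function h : Prop :=
  (forall (k : nat) (theta : R), derivable (derive1n k h) theta 1) /\
  exists a b : R, [/\ 0 < a, b < 1 &
    forall theta, ~ (a <= theta <= b) -> h theta = 0].

Definition weak_derivative u v : Prop :=
  forall h, test_function h -> inner u (derive1 h) = - inner v h.

(* Unbounded operators on L^2(0,1) are given by their graphs.
   graphA u v : u is in D(A) and A u = v; here u1 is the continuous
   representative of u', at which the boundary values are taken. *)
Definition graphA u v : Prop :=
  [/\ L2 u, L2 v &
    exists u1 : R -> R,
      [/\ {within I01, continuous u1}, weak_derivative u u1,
          weak_derivative u1 v, u1 0 = 0 & u1 1 = 0]].

(* The graph of (-A)^{gamma/2}. *)
Definition graph_powA gamma u v : Prop :=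
  [/\ L2 u, L2 v &
    forall n : nat,
      coef v n = if n == 0%N then 0 else (n%:R * pi) `^ gamma * coef u n].

Definition adjoint (B : (R -> R) -> (R -> R) -> Prop) u v : Prop :=
  [/\ L2 u, L2 v & forall g h, B g h -> inner h u = inner g v].

Definition flog (lambda u : R) : \bar R :=
  if u <= -1 then +oo%E else if 1 <= u then -oo%E
  else (ln ((1 - u) / (1 + u)) + lambda * u)%:E.

(* The centred Gaussian law with variance v. *)
Definition gauss (v : R) (D : set R) : \bar R :=
  if v == 0 then \d_(0 : R) D else normal_prob 0 (Num.sqrt v) D.

End spaces.

Section processes.
Context {R : realType} {d : measure_display} {Omega : measurableType d}.
Variable P : probability Omega R.
Local Notation mu := (@lebesgue_measure R).
Local Notation I01 := (`[0, 1]%classic : set R).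

Definition filtration (F : R -> set (set Omega)) : Prop :=
  (forall t : R, 0 <= t -> sigma_algebra setT (F t) /\ F t `<=` measurable) /\
  forall s t : R, 0 <= s -> s <= t -> F s `<=` F t.

(* An F-cylindrical Wiener process on L^2(0,1); W h t is <W(t), h>. *)
Definition cylindrical_wiener (F : R -> set (set Omega))
    (W : (R -> R) -> R -> Omega -> R) : Prop :=
  [/\ forall h, L2 h -> forall t : R, 0 <= t ->
        forall D : set R, measurable D -> F t (W h t @^-1` D),
      forall h, L2 h -> {ae P, forall w, W h 0 w = 0 /\
        {within [set t : R | 0 <= t], continuous (fun t => W h t w)}},
      forall (k : R) g h, L2 g -> L2 h -> forall t : R, 0 <= t ->
        {ae P, forall w, W (fun theta => k * g theta + h theta) t w
                         = k * W g t w + W h t w} &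
      forall h, L2 h -> forall s t : R, 0 <= s -> s < t ->
        forall D : set R, measurable D ->
        let E := [set w | D (W h t w - W h s w)] in
        P E = gauss ((t - s) * inner h h) D /\
        forall G : set Omega, F s G -> P (G `&` E) = (P G * P E)%E].

(* The natural filtration of W, completed by the P-null sets. *)
Definition natural_filtration (W : (R -> R) -> R -> Omega -> R) (t : R) :
    set (set Omega) :=
  <<s [set G | P.-negligible G \/
        exists h (s : R) (D : set R),
          [/\ L2 h, 0 <= s <= t, measurable D & G = W h s @^-1` D]] >>.

Definition adapted_H (F : R -> set (set Omega)) (u : Omega -> R -> R -> R) :
    Prop :=
  forall t : R, 0 <= t -> forall D : set (nat -> R), borel H D ->
    F t [set w | D (coef (u w t))].

(* Random measures on [0,oo) x [0,1] are kernels on R x R that vanish off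
   [0,oo) x [0,1]. The value of u at time 0 is only an L^2 class, so the
   contact conditions are integrals over times in (0,oo). The integrand B^* phi
   of the stochastic integral is constant in time and deterministic, so that
   the integral over [delta, t] is an increment of W (B^* phi). *)
Definition weak_solution (lambda : R) (B : (R -> R) -> (R -> R) -> Prop)
    (x : R -> R) (F : R -> set (set Omega)) (u : Omega -> R -> R -> R)
    (etap etam : R.-ker Omega ~> (measurableTypeR R * measurableTypeR R)%type)
    (W : (R -> R) -> R -> Omega -> R) : Prop :=
  [/\ {ae P, forall w, u w 0 = x /\
        forall T : R, 0 < T ->
        [/\ {within `]0, T] `*` I01,
               continuous (fun z : R * R => u w z.1 z.2)},
            forall t theta, 0 < t <= T -> 0 <= theta <= 1 ->
              -1 <= u w t theta <= 1,
            forall t, 0 <= t <= T -> H (coef (u w t)),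
            forall t, 0 <= t <= T ->
              normV (-1) (coef (u w s) - coef (u w t))%R
                @[s --> within (`[0, T] : set R) (nbhs t)] --> 0%E &
            (mu \x mu)%E.-integrable (`[0, T] `*` I01)
              (fun z : R * R => flog lambda (u w z.1 z.2))]},
      {ae P, forall w, forall eta, eta = etap \/ eta = etam ->
        eta w (~` (`[0, +oo[ `*` I01)) = 0%E /\
        forall delta T : R, 0 < delta <= T ->
          (eta w (`[delta, T] `*` I01) < +oo)%E},
      cylindrical_wiener F W /\ adapted_H F u,
      forall phi Aphi AAphi Bphi : R -> R,
        graphA phi Aphi -> graphA Aphi AAphi ->
        {within I01, continuous Aphi} ->
        adjoint B phi Bphi ->
        forall delta t : R, 0 < delta < t ->
        {ae P, forall w,
          inner (u w t) phi = inner (u w delta) phi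
            - 2^-1 * \int[mu]_(s in `[delta, t]) inner (u w s) AAphi
            - 2^-1 * fine (\int[mu]_(s in `[delta, t])
                \int[mu]_(theta in I01)
                  (flog lambda (u w s theta) * (Aphi theta)%:E))%E
            - 2^-1 * \int[etam w]_(z in `[delta, t] `*` I01) Aphi z.2
            + 2^-1 * \int[etap w]_(z in `[delta, t] `*` I01) Aphi z.2
            + (W Bphi t w - W Bphi delta w)} &
      {ae P, forall w,
        (\int[etap w]_(z in (`]0%R, +oo[%classic : set R) `*` I01) (1 - u w z.1 z.2)%:E
           = 0)%E /\
        (\int[etam w]_(z in (`]0%R, +oo[%classic : set R) `*` I01) (1 + u w z.1 z.2)%:E
           = 0)%E}].

Definition strong_solution (lambda : R) (B : (R -> R) -> (R -> R) -> Prop)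
    (x : R -> R) (F : R -> set (set Omega)) (u : Omega -> R -> R -> R)
    (W : (R -> R) -> R -> Omega -> R) : Prop :=
  (exists etap etam, weak_solution lambda B x F u etap etam W) /\
  adapted_H (natural_filtration W) u.

(* The semigroup of a family of solutions u x = u(.; x). It is
   extended-real-valued since it is also applied to log phi, which may be
   unbounded below. *)
Definition semigroup (u : (R -> R) -> Omega -> R -> R -> R) (t : R)
    (phi : (nat -> R) -> R) (x : R -> R) : \bar R :=
  'E_P[fun w => phi (coef (u x w t))].

End processes.

(* Main.v *)
(* The solution is approximated by an explicit chain driven by the same Wiener
   process. The state is truncated to the first [m] cosine modes, the
   logarithm in [f] is replaced by a bounded decreasing function [beta] of the
   Fejer mean of the state, and after every Euler step the state is projected
   onto the convex set of those [X] whose Fejer mean has values in [-1,1]. In the norm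
   with weights [rho m n / (n pi)^2] the projection is nonexpansive and the drift
   is dissipative. The Fejer mean of [u] is itself admissible, and the reflection
   measures act with the favourable sign, so that the chain converges to [u]
   almost surely along nested limits.

   One Euler step is followed by independent one-dimensional Gaussian kicks. A
   Harnack inequality with exponent [eps + C |x-y|^2] passes through a step by
   shifting each of finitely many kicks by a multiple of [C (x-y)], the other
   modes being dissipated strongly enough; this yields the discrete Riccati
   recursion for [1/C] whose continuous limit is the stated constant. The
   initial value [C0] is large and comes from a Lipschitz cylinder function
   [phi]. Such functions approximate Lipschitz functions of the negative Sobolev
   norm, and these approximate Borel functions in [L^1] of the two laws.
   Applying the power inequality to [phi^(1/p)] and letting [p] tend to infinity
   gives the log-Harnack inequality by Jensen's inequality. *)
Require Import Defs.
From mathcomp Require Import all_boot all_order all_algebra.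
From mathcomp Require Import all_classical all_reals all_analysis.
From mathcomp Require Import measurable_realfun zify ring lra.

Import Order.TTheory GRing.Theory Num.Theory.
Import numFieldNormedType.Exports.

Local Open Scope classical_set_scope.
Local Open Scope ring_scope.

Set Implicit Arguments.
Unset Strict Implicit.
Unset Printing Implicit Defensive.

(** * Cosine basis and Fejer means *)

Section basics.
Context {R : realType}.
Local Notation mu := (@lebesgue_measure R).
Local Notation I01 := (`[0, 1]%classic : set R).

(** The solution is given only by its weak formulation and by the Gaussian increments of [W], so the
    shift is made in finitely many Gaussian variables, where it is elementary, rather than along
    paths. In the weight [rho m n / (n pi)^2], the factor [rho] turns the pairing with the
    nonlinearity into an integral against the Fejer mean, where monotonicity gives a sign;
    [(n pi)^-2] cancels the operator in front of the drift; and since [B = (-A)^(1/2)] gives mode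
    [n] the variance [(n pi)^2], all modes receive noise of the same strength in this norm, up to
    [rho]. Mode [n] contracts at the rate [((n pi)^2 - lambda) (n pi)^2], smallest for [n = 1]: here
    [pi^2 > lambda] enters, and from here comes the constant. Shifting mode [n] costs a factor
    [1 / rho m n], close to 1 for low modes but unbounded at the top ones, so only low modes are
    shifted. The limits are nested in the order starting time, cut-off of the logarithm, number of
    modes, time step, because the constants in each error depend on the parameters fixed before. *)

Lemma bounded_integrable d (T : measurableType d)
    (m : {measure set T -> \bar R}) (D : set T) (f : T -> R) (M : R) :
  measurable D -> (m D < +oo)%E -> measurable_fun D f ->
  (forall x, D x -> `|f x| <= M) -> m.-integrable D (EFin \o f).
Proof.
move=> mD mDoo mf fM; apply: measurable_bounded_integrable => //.
exists M; split; first by rewrite num_real.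
by move=> y My x Dx; apply: le_trans (fM x Dx) (ltW My).
Qed.

Lemma mu01 : mu I01 = 1%E.
Proof. by rewrite lebesgue_measure_itv/= lte_fin ltr01 sube0. Qed.

Lemma measurable01 : measurable (I01 : set (measurableTypeR R)).
Proof. exact: measurable_itv. Qed.

Lemma bounded_integrable01 (f : R -> R) (M : R) : measurable_fun I01 f ->
  (forall x, I01 x -> `|f x| <= M) -> mu.-integrable I01 (EFin \o f).
Proof.
move=> mf fM.

refine (@bounded_integrable _ _ mu I01 f M _ _ _ _) => //.
by rewrite [X in (X < _)%E]mu01 ltry.
Qed.

Lemma Rintegral_sum d (T : measurableType d) (m : {measure set T -> \bar R})
    (D : set T) (I : Type) (s : seq I) (f : I -> T -> R) : measurable D ->
  (forall i, m.-integrable D (EFin \o f i)) ->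
  \int[m]_(x in D) (\sum_(i <- s) f i x) = \sum_(i <- s) \int[m]_(x in D) f i x /\
  m.-integrable D (EFin \o fun x => \sum_(i <- s) f i x).
Proof.
move=> mD fi; elim: s => [|i s [IH1 IH2]].
  rewrite big_nil; under eq_Rintegral do rewrite big_nil.
  rewrite Rintegral_cst// mul0r; split => //.
  by under [X in _.-integrable _ X]eq_fun do rewrite /= big_nil; exact: integrable0.
rewrite big_cons -IH1; split.
  by under eq_Rintegral do rewrite big_cons; rewrite RintegralD//.
under [X in _.-integrable _ X]eq_fun do rewrite /= big_cons EFinD.
exact: integrableD (fi i) IH2.
Qed.

Lemma continuous_cosM (a : R) : continuous (fun x : R => cos (a * x)).
Proof.
move=> x; apply: (@continuous_comp _ _ _ (fun x => a * x) cos).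
  by apply: cvgM; [exact: cvg_cst|exact: cvg_id].
exact: continuous_cos.
Qed.

Lemma eigen0 : @eigen R 0 = fun=> 1. Proof. by []. Qed.

Lemma eigenS n : @eigen R n.+1 = fun x => Num.sqrt 2 * cos (n.+1%:R * pi * x).
Proof. by []. Qed.

Lemma continuous_eigen n : continuous (@eigen R n).
Proof.
case: n => [|n]; first by rewrite eigen0 => x; exact: cvg_cst.
rewrite eigenS => x; apply: cvgM; [exact: cvg_cst|exact: continuous_cosM].
Qed.

Lemma eigen_bound n x : `|@eigen R n x| <= 2.
Proof.
case: n => [|n]; first by rewrite eigen0 normr1; lra.
rewrite eigenS normrM ger0_norm ?sqrtr_ge0//.
have h : Num.sqrt 2 <= (2:R).
  by rewrite -[leRHS]ger0_norm// -sqrtr_sqr ler_sqrt//; lra.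
have := cos_max (n.+1%:R * pi * x); have := sqrtr_ge0 (2:R); nra.
Qed.

Lemma measurable_eigen n D : measurable_fun D (@eigen R n).
Proof.
apply: measurable_funTS; apply: continuous_measurable_fun.
exact: continuous_eigen.
Qed.

Definition bfun (v : R -> R) :=
  measurable_fun I01 v /\ forall x, I01 x -> `|v x| <= 1.

Lemma bfun_integrable (v g : R -> R) (M : R) : bfun v -> measurable_fun I01 g ->
  (forall x, I01 x -> `|g x| <= M) ->
  mu.-integrable I01 (EFin \o fun x => v x * g x).
Proof.
move=> [mv v1] mg gM; apply: (@bounded_integrable01 _ M).
  exact: measurable_funM.
move=> x x01; rewrite normrM.
have := v1 x x01; have := gM x x01; have := normr_ge0 (v x); have := normr_ge0 (g x); nra.
Qed.

Lemma coef_sum v (s : seq nat) (c : nat -> R) : bfun v ->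
  \int[mu]_(x in I01) (v x * (\sum_(n <- s) c n * eigen n x)) =
  \sum_(n <- s) c n * coef v n.
Proof.
move=> bv; under eq_Rintegral do rewrite mulr_sumr.
have h i : mu.-integrable I01 (EFin \o (fun x => v x * eigen i x)).
  apply: bfun_integrable => //; first exact: measurable_eigen.
  by move=> x _; exact: eigen_bound.
have h' i : mu.-integrable I01 (EFin \o (fun x => v x * (c i * eigen i x))).
  have := integrableZl measurable01 (c i) (h i).
  by apply: eq_integrable => // x _; rewrite /= -EFinM mulrCA.
have [-> _] := Rintegral_sum s measurable01 h'.
apply: eq_bigr => n _; rewrite /coef /inner -RintegralZl//.
by apply: eq_Rintegral => x _; rewrite mulrCA.
Qed.

End basics.
Section ortho.
Context {R : realType}.
Local Notation mu := (@lebesgue_measure R).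
Local Notation I01 := (`[0, 1]%classic : set R).

Lemma is_derive_linM (a x : R) : is_derive x 1 (fun x : R => a * x) a.
Proof.
have := is_deriveZ a (is_derive_id x (1 : R)).
by rewrite [X in is_derive _ _ _ X]/GRing.scale/= mulr1.
Qed.

Lemma is_derive_sinM (c a x : R) :
  is_derive x 1 (fun x : R => c * sin (a * x)) (c * a * cos (a * x)).
Proof.
have h := is_derive1_comp (f := sin) (is_derive_sin (a * x)) (is_derive_linM a x).
have := is_deriveZ c h.
by rewrite [X in is_derive _ _ _ X]/GRing.scale/= (mulrC (cos _)) mulrA.
Qed.

Lemma is_derive_cosM (c a x : R) :
  is_derive x 1 (fun x : R => c * cos (a * x)) (- (c * a * sin (a * x))).
Proof.
have h := is_derive1_comp (f := cos) (is_derive_cos (a * x)) (is_derive_linM a x).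
have := is_deriveZ c h.
by rewrite [X in is_derive _ _ _ X]/GRing.scale/= (mulrC (- sin _)) mulrA mulrN.
Qed.

Lemma is_derive_continuous (F : R -> R) (x df : R) :
  is_derive x 1 F df -> {for x, continuous F}.
Proof.
by case=> dF _; apply: differentiable_continuous; exact/derivable1_diffP.
Qed.

Lemma derivable_oo_LRcontinuousT (F f : R -> R) (a b : R) :
  (forall x : R, is_derive x 1 F (f x)) -> derivable_oo_LRcontinuous F a b.
Proof.
move=> dF; split.
- by move=> x _; case: (dF x).
- exact: cvg_at_right_filter (is_derive_continuous (dF a)).
- exact: cvg_at_left_filter (is_derive_continuous (dF b)).
Qed.

Lemma sin_natpi j : sin (j%:R * pi) = 0 :> R.
Proof.
elim: j => [|j IH]; first by rewrite mul0r sin0.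
by rewrite -addn1 natrD mulrDl mul1r sinDpi IH oppr0.
Qed.

Lemma integral_cos (j : nat) :
  \int[mu]_(x in I01) cos (j%:R * pi * x) = (j == 0%N)%:R.
Proof.
case: j => [|j].
  under eq_Rintegral do rewrite mul0r mul0r cos0.
  rewrite Rintegral_cst; last exact: measurable01.
  by rewrite [X in fine X]mu01 mul1r.
set a : R := j.+1%:R * pi.
have a0 : a != 0 by rewrite mulf_neq0 ?pnatr_eq0 ?gt_eqF ?pi_gt0.
have dF (x : R) : is_derive x 1 (fun x : R => a^-1 * sin (a * x)) (cos (a * x)).
  by have := is_derive_sinM a^-1 a x; rewrite mulVf// mul1r.
rewrite /Rintegral (@continuous_FTC2 _ _ (fun x => a^-1 * sin (a * x))) //=.
- by rewrite mulr0 sin0 mulr1 /a sin_natpi !mulr0 subrr.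
- by apply: continuous_subspaceT; exact: continuous_cosM.
- exact: derivable_oo_LRcontinuousT dF.
- by move=> x _; rewrite derive1E; case: (dF x).
Qed.

Lemma cos_prod (a b : R) : cos a * cos b = 2^-1 * (cos (a - b) + cos (a + b)).
Proof. by rewrite cosB cosD; lra. Qed.

Lemma bounded_cosM (a : R) : mu.-integrable I01 (EFin \o fun x => cos (a * x)).
Proof.
apply: (@bounded_integrable01 _ _ 1); last by move=> x _; exact: cos_max.
by apply: measurable_funTS; apply: continuous_measurable_fun; exact: continuous_cosM.
Qed.

Lemma integral_cosB (k n : nat) :
  \int[mu]_(x in I01) cos ((k%:R - n%:R) * pi * x) = (k == n)%:R.
Proof.
wlog kn : k n / (k <= n)%N.
  move=> W; case/orP: (leq_total k n) => [|nk]; first exact: W.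
  rewrite eq_sym -W//; apply: eq_Rintegral => x _.
  by rewrite -[in LHS]opprB !mulNr cosN.
have -> : (k == n) = (n - k == 0)%N by apply/eqP/eqP; lia.
rewrite -integral_cos; apply: eq_Rintegral => x _.
by rewrite -[in LHS]opprB !mulNr cosN natrB.
Qed.

Lemma coef_eigen k n : coef (@eigen R k) n = (k == n)%:R.
Proof.
rewrite /coef /inner.
case: k n => [|k] [|n].
- rewrite -(integral_cos 0); apply: eq_Rintegral => x _.
  by rewrite !eigen0 mul0r mul0r cos0 mul1r.
- rewrite eigen0 eigenS.
  under eq_Rintegral do rewrite mul1r.
  rewrite RintegralZl; [|exact: measurable01|exact: bounded_cosM].
  by rewrite integral_cos mulr0.
- rewrite eigen0 eigenS.
  under eq_Rintegral do rewrite mulr1.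
  rewrite RintegralZl; [|exact: measurable01|exact: bounded_cosM].
  by rewrite integral_cos mulr0.
rewrite !eigenS.
transitivity (\int[mu]_(x in I01) (cos ((k.+1%:R - n.+1%:R) * pi * x) +
    cos ((k.+1 + n.+1)%:R * pi * x))).
  apply: eq_Rintegral => x _.
  rewrite mulrACA -expr2 sqr_sqrtr// cos_prod mulrA divff// mul1r.
  by congr (cos _ + cos _); rewrite ?natrD; ring.
rewrite RintegralD; [|exact: measurable01|exact: bounded_cosM|exact: bounded_cosM].
by rewrite integral_cosB integral_cos addr0.
Qed.
End ortho.

(** * Fejer means and positivity of their kernel *)

Section fejer.
Context {R : realType}.
Local Notation mu := (@lebesgue_measure R).
Local Notation I01 := (`[0, 1]%classic : set R).

(* Truncated subtraction: [rho m n = 0] for [n > m]. *)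
Definition rho (m n : nat) : R := (m.+1 - n)%:R / m.+1%:R.

Definition fejer (m : nat) (a : nat -> R) (x : R) : R :=
  \sum_(0 <= n < m.+1) rho m n * a n * eigen n x.

Definition fejer_kernel (m : nat) (x y : R) : R :=
  \sum_(0 <= n < m.+1) rho m n * eigen n x * eigen n y.

Lemma rho_ge0 m n : 0 <= rho m n.
Proof. by rewrite /rho divr_ge0. Qed.

Lemma rho_le1 m n : rho m n <= 1.
Proof. by rewrite /rho ler_pdivrMr ?ltr0n// mul1r ler_nat leq_subr. Qed.

Lemma rho_gt0 m n : (n <= m)%N -> 0 < rho m n.
Proof. by move=> nm; rewrite /rho divr_gt0// ltr0n; lia. Qed.

Lemma rho0 m : rho m 0 = 1.
Proof. by rewrite /rho subn0 divff// pnatr_eq0. Qed.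

Lemma rhoE m n : (n <= m.+1)%N -> rho m n = 1 - n%:R / m.+1%:R.
Proof. by move=> nm; rewrite /rho natrB// mulrBl divff// pnatr_eq0. Qed.

(** The left side is the squared modulus of [\sum exp(i n a)], in which the frequencies [n] and [-n]
    occur [m + 1 - n] times each. Its nonnegativity is that of the Fejer kernel. *)
Lemma fejer_square m (a : R) :
  (\sum_(0 <= n < m.+1) cos (n%:R * a)) ^+ 2 +
  (\sum_(0 <= n < m.+1) sin (n%:R * a)) ^+ 2 =
  2 * (\sum_(0 <= n < m.+1) (m.+1 - n)%:R * cos (n%:R * a)) - m.+1%:R.
Proof.
elim: m => [|m IH].
  by rewrite !big_nat1 mul0r cos0 sin0 subn0; ring.
rewrite [X in X ^+ 2 + _]big_nat_recr//= [X in _ + X ^+ 2]big_nat_recr//= !sqrrD addrACA.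
set c := \sum_(0 <= n < m.+1) cos _; set s := \sum_(0 <= n < m.+1) sin _.
have -> : c ^+ 2 + c * cos (m.+1%:R * a) *+ 2 + (s ^+ 2 + s * sin (m.+1%:R * a) *+ 2) =
   c ^+ 2 + s ^+ 2 + 2 * (c * cos (m.+1%:R * a) + s * sin (m.+1%:R * a)) by ring.
rewrite cos2Dsin2 IH.
have -> : c * cos (m.+1%:R * a) + s * sin (m.+1%:R * a) =
    \sum_(1 <= n < m.+2) cos (n%:R * a).
  rewrite /c /s !mulr_suml -big_split/= big_nat_rev/= big_add1/=.
  apply: eq_big_nat => i /andP[_ im].
  rewrite add0n -cosB -cosN opprB -mulrBl -natrB; last lia.
  by congr (cos (_%:R * _)); lia.
have -> : \sum_(0 <= n < m.+2) (m.+2 - n)%:R * cos (n%:R * a) =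
    \sum_(0 <= n < m.+2) (m.+1 - n)%:R * cos (n%:R * a) +
    \sum_(0 <= n < m.+2) cos (n%:R * a).
  rewrite -big_split/=; apply: eq_big_nat => i /andP[_ im].
  by rewrite subSn; [rewrite -natr1; ring|lia].
have -> : \sum_(0 <= n < m.+2) (m.+1 - n)%:R * cos (n%:R * a) =
    \sum_(0 <= n < m.+1) (m.+1 - n)%:R * cos (n%:R * a).
  by rewrite big_nat_recr//= subnn mul0r addr0.
have -> : \sum_(0 <= n < m.+2) cos (n%:R * a) =
    1 + \sum_(1 <= n < m.+2) cos (n%:R * a).
  by rewrite big_nat_recl//= mul0r cos0 big_add1.
by rewrite -!natr1; ring.
Qed.

(** The product formula for cosines writes the kernel as half the sum of two classical Fejer
    kernels, one at [x - y] and one at the reflected argument [x + y]. *)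
Lemma fejer_kernel_ge0 m x y : 0 <= fejer_kernel m x y.
Proof.
pose c a : R := \sum_(0 <= n < m.+1) (m.+1 - n)%:R * cos (n%:R * a).
have c0 a : m.+1%:R <= 2 * c a.
  by rewrite -subr_ge0 -fejer_square addr_ge0// sqr_ge0.
suff -> : fejer_kernel m x y =
    (c (pi * (x - y)) + c (pi * (x + y)) - m.+1%:R) / m.+1%:R.
  rewrite divr_ge0//; have := c0 (pi * (x - y)); have := c0 (pi * (x + y)); lra.
rewrite /fejer_kernel /c -big_split/= mulrBl mulr_suml divff ?pnatr_eq0//.
rewrite big_nat_recl//= [X in _ = X - _]big_nat_recl//= rho0 !mul0r cos0 !mulr1 subn0.
rewrite mulrDl divff ?pnatr_eq0// addrAC addrK; congr (_ + _).
apply: eq_big_nat => i _; rewrite !eigenS /rho.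
have -> : i.+1%:R * (pi * (x - y)) = i.+1%:R * pi * x - i.+1%:R * pi * y by ring.
have -> : i.+1%:R * (pi * (x + y)) = i.+1%:R * pi * x + i.+1%:R * pi * y by ring.
rewrite -mulrDr (_ : cos _ + cos _ = 2 * (cos (i.+1%:R * pi * x) * cos (i.+1%:R * pi * y))); last first.
  by rewrite cos_prod mulrA divff ?mul1r.
rewrite -[X in _ = _ * (X * _) * _](@sqr_sqrtr _ 2)//; ring.
Qed.

Lemma fejer_kernelE m v x : bfun v ->
  fejer m (coef v) x = \int[mu]_(y in I01) (v y * fejer_kernel m x y).
Proof.
move=> bv; rewrite /fejer_kernel.
by rewrite (coef_sum _ (fun n => rho m n * eigen n x) bv); apply: eq_bigr => n _; ring.
Qed.

Lemma measurable_fejer m a D : measurable_fun D (fejer m a).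
Proof.
apply: measurable_sum => n; apply: measurable_funM => //; exact: measurable_eigen.
Qed.

Lemma fejer_bound m a x : `|fejer m a x| <= \sum_(0 <= n < m.+1) 2 * `|a n|.
Proof.
apply: le_trans (ler_norm_sum _ _ _) _; apply: ler_sum => n _.
rewrite normrM normrM (ger0_norm (rho_ge0 m n)).
have := rho_le1 m n; have := rho_ge0 m n; have := eigen_bound n x.
have := normr_ge0 (a n); have := normr_ge0 (eigen n x); move=> h1 h2 h3 h4 h5.
have : rho m n * `|a n| <= `|a n| by nra.
move=> h6; have := mulr_ge0 h4 h2; nra.
Qed.

Lemma fejer_kernel_integrable m v x : bfun v ->
  mu.-integrable I01 (EFin \o fun y => v y * fejer_kernel m x y).
Proof.
move=> bv; apply: bfun_integrable => //; last by move=> y _; exact: fejer_bound.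
exact: measurable_fejer.
Qed.

Lemma bfun1 : bfun (fun=> 1 : R).
Proof. by split=> [|x _]; [exact: measurable_cst|rewrite normr1]. Qed.

Lemma fejer_kernel_eigen m j x :
  \int[mu]_(y in I01) (eigen j y * fejer_kernel m x y) = rho m j * eigen j x.
Proof.
transitivity (\sum_(0 <= n < m.+1) (rho m n * eigen n x) * (j == n)%:R).
  (* Halving brings [eigen j], bounded by 2, under the bound 1 required by [bfun]. *)
  transitivity (2 * \int[mu]_(y in I01) ((2^-1 * eigen j y) * fejer_kernel m x y)).
    rewrite -RintegralZl.
    - by apply: eq_Rintegral => y _; lra.
    - exact: measurable01.
    - apply: fejer_kernel_integrable; split.
        by apply: measurable_funM => //; exact: measurable_eigen.
      by move=> y _; rewrite normrM ger0_norm//; have := eigen_bound j y; lra.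
  rewrite /fejer_kernel.
  rewrite (coef_sum _ (fun n => rho m n * eigen n x)); last first.
    split; first by apply: measurable_funM => //; exact: measurable_eigen.
    by move=> y _; rewrite normrM ger0_norm//; have := eigen_bound j y; lra.
  rewrite mulr_sumr; apply: eq_bigr => n _; rewrite mulrCA; congr (_ * _).
  rewrite -coef_eigen /coef /inner -RintegralZl; last 2 first.
  - exact: measurable01.
  - apply: (@bounded_integrable01 _ _ 2).
      apply: measurable_funM; last exact: measurable_eigen.
      by apply: measurable_funM => //; exact: measurable_eigen.
    move=> y _; rewrite !normrM (ger0_norm (_ : 0 <= 2^-1))//.
    have := eigen_bound j y; have := eigen_bound n y.
    by have := normr_ge0 (eigen j y); have := normr_ge0 (eigen n y); nra.
  by apply: eq_Rintegral => y _; lra.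
have [jm|jm] := leqP j m.
  rewrite (bigD1_seq j) ?mem_index_iota ?iota_uniq//.
  rewrite eqxx mulr1.
  by rewrite big1 /= ?addr0// => n /negPf; rewrite eq_sym => ->; rewrite mulr0.
rewrite /rho (_ : (m.+1 - j)%N = 0%N); last lia.
rewrite !mul0r big_nat_cond big1// => n /andP[/andP[_ nm] _].
by rewrite (_ : (j == n) = false) ?mulr0//; apply/eqP; lia.
Qed.

Lemma fejer_kernel1 m x : \int[mu]_(y in I01) fejer_kernel m x y = 1.
Proof.
rewrite -[RHS](rho0 m) -[RHS]mulr1 -(fejer_kernel_eigen m 0 x).
by apply: eq_Rintegral => y _; rewrite eigen0 mul1r.
Qed.

(** The kernel is a probability density, so the mean averages [v]. This is why Fejer means replace
    sharp truncation: the truncated solution stays within the barriers. *)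
Lemma fejer_le1 m v x : bfun v -> `|fejer m (coef v) x| <= 1.
Proof.
move=> bv; rewrite fejer_kernelE//.
apply: le_trans (le_normr_Rintegral _ _) _.
- exact: measurable01.
- exact: fejer_kernel_integrable.
rewrite -[leRHS](fejer_kernel1 m x); apply: le_Rintegral.
- exact: measurable01.
- by apply: integrable_norm => //; exact: fejer_kernel_integrable.
- have := fejer_kernel_integrable m x bfun1.
  by apply: eq_integrable => [|y _]; [exact: measurable01|rewrite /= mul1r].
move=> y y01; rewrite normrM (ger0_norm (fejer_kernel_ge0 _ _ _)).
by have := bv.2 y y01; have := fejer_kernel_ge0 m x y; nra.
Qed.
End fejer.

(** * Uniform approximation by Fejer means *)

Section fejer_approximation.
Context {R : realType}.
Local Notation mu := (@lebesgue_measure R).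
Local Notation I01 := (`[0, 1]%classic : set R).

(* Korovkin's argument: the Fejer operator integrates
   [y |-> (cos (pi y) - cos (pi x))^2] at [x] to at most [1 / (m + 1)]. *)
Lemma fejer_kernel_cos m x : (0 < m)%N ->
  \int[mu]_(y in I01) ((cos (pi * y) - cos (pi * x)) ^+ 2 * fejer_kernel m x y)
  <= m.+1%:R^-1.
Proof.
move=> m0.
have h2 : Num.sqrt 2 * Num.sqrt 2 = 2 :> R by rewrite -expr2 sqr_sqrtr.
have eC j y : Num.sqrt 2 * eigen j.+1 y = 2 * cos (j.+1%:R * pi * y) :> R.
  by rewrite eigenS mulrA h2.
have ie j (c : R) :
    mu.-integrable I01 (EFin \o fun y => c * (eigen j y * fejer_kernel m x y)).
  apply: (@bounded_integrable01 _ _ (`|c| * (2 * \sum_(0 <= n < m.+1) 2 * `|@eigen R n x|))).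
    apply: measurable_funM => //; apply: measurable_funM; first exact: measurable_eigen.
    exact: measurable_fejer.
  move=> y _; rewrite !normrM ler_wpM2l// ler_pM//; first exact: eigen_bound.
  exact: fejer_bound.
pose c := cos (pi * x) : R.
pose s := Num.sqrt 2 : R.
have E y : (cos (pi * y) - cos (pi * x)) ^+ 2 * fejer_kernel m x y =
  (2^-1 + c ^+ 2) * (eigen 0 y * fejer_kernel m x y) +
  (- (c * s)) * (eigen 1 y * fejer_kernel m x y) +
  (s / 4) * (eigen 2 y * fejer_kernel m x y).
  have e1 := eC 0%N y; have e2 := eC 1%N y; rewrite -/s !mul1r in e1 e2.
  have e3 : cos (2 * pi * y) = 2 * cos (pi * y) ^+ 2 - 1.
    by rewrite -mulrA mulr_natl cos_mulr2n; ring.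
  rewrite e3 in e2; rewrite eigen0 -/c.
  transitivity ((2^-1 + c ^+ 2 - c * (s * eigen 1 y) + 4^-1 * (s * eigen 2 y)) *
    fejer_kernel m x y); last by field.
  by rewrite e1 e2; field.
under eq_Rintegral do rewrite E.
have mI := @measurable01 R.
have Z j (a : R) : \int[mu]_(y in I01) (a * (eigen j y * fejer_kernel m x y)) =
    a * (rho m j * eigen j x).
  rewrite -fejer_kernel_eigen RintegralZl//.
  by have := ie j 1; apply: eq_integrable => // y _; rewrite /= mul1r.
rewrite RintegralD; [|exact: mI| |exact: ie]; last first.
  have := integrableD mI (ie 0%N (2^-1 + c ^+ 2)) (ie 1%N (- (c * s))).
  by apply: eq_integrable.
rewrite RintegralD; [|exact: mI|exact: ie|exact: ie].
rewrite !Z rho0 !rhoE// [eigen 0 x]/eigen/=.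
have e1 := eC 0%N x; have e2 := eC 1%N x; rewrite -/s !mul1r -/c in e1 e2.
have e3 : cos (2 * pi * x) = 2 * c ^+ 2 - 1.
  by rewrite -mulrA mulr_natl cos_mulr2n /c; ring.
rewrite e3 in e2.
set r := m.+1%:R^-1; rewrite -/c.
have -> : (2^-1 + c ^+ 2) * (1 * 1) + - (c * s) * ((1 - 1 * r) * eigen 1 x) +
    s / 4 * ((1 - 2 * r) * eigen 2 x) =
  (2^-1 + c ^+ 2) - c * (1 - r) * (s * eigen 1 x) +
    4^-1 * (1 - 2 * r) * (s * eigen 2 x) by field.
by rewrite e1 e2 le_eqVlt; apply/orP; left; apply/eqP; field.
Qed.

(** Averaging the hypothesis against the probability kernel leaves [eps], and the quadratic term is
    controlled by [fejer_kernel_cos]. Any modulus of continuity can be put in this form, since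
    [cos (pi y)] separates the points of [0,1]. *)
Lemma fejer_approx m v x (eps C : R) : (0 < m)%N -> bfun v -> 0 <= C ->
  I01 x ->
  (forall y, I01 y -> `|v y - v x| <= eps + C * (cos (pi * y) - cos (pi * x)) ^+ 2) ->
  `|fejer m (coef v) x - v x| <= eps + C / m.+1%:R.
Proof.
move=> m0 bv C0 x01 vC; have mI := @measurable01 R; rewrite fejer_kernelE//.
have k1 : mu.-integrable I01 (EFin \o fejer_kernel m x).
  have := fejer_kernel_integrable m x bfun1.
  by apply: eq_integrable => // y _; rewrite /= mul1r.
have kv : mu.-integrable I01 (EFin \o fun y => v x * fejer_kernel m x y).
  apply: fejer_kernel_integrable; split; first exact: measurable_cst.
  by move=> _ _; exact: bv.2.
have ek : mu.-integrable I01 (EFin \o fun y => eps * fejer_kernel m x y).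
  exact: integrableZl k1.
have qk : mu.-integrable I01 (EFin \o fun y =>
    (cos (pi * y) - cos (pi * x)) ^+ 2 * fejer_kernel m x y).
  have q4 : bfun (fun y => 4^-1 * (cos (pi * y) - cos (pi * x)) ^+ 2).
    split; last first.
      move=> y _; rewrite ger0_norm; last by apply: mulr_ge0 => //; exact: sqr_ge0.
      have := cos_le1 (pi * y); have := cos_geN1 (pi * y).
      by have := cos_le1 (pi * x); have := cos_geN1 (pi * x); nra.
    apply: measurable_funM => //; apply: measurable_funX.
    apply: measurable_funB => //; apply: measurable_funTS.
    by apply: continuous_measurable_fun; exact: continuous_cosM.
  have := integrableZl mI 4 (fejer_kernel_integrable m x q4).
  by apply: eq_integrable => // y _; rewrite /= -EFinM; congr EFin; field.
have Cqk : mu.-integrable I01 (EFin \o fun y =>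
    C * ((cos (pi * y) - cos (pi * x)) ^+ 2 * fejer_kernel m x y)).
  exact: integrableZl qk.
have -> : v x = \int[mu]_(y in I01) (v x * fejer_kernel m x y).
  by rewrite RintegralZl// fejer_kernel1 mulr1.
rewrite -RintegralB//; last exact: fejer_kernel_integrable.
have vk : mu.-integrable I01 (EFin \o fun y =>
    v y * fejer_kernel m x y - v x * fejer_kernel m x y).
  exact: integrableB (fejer_kernel_integrable m x bv) kv.
apply: le_trans (le_normr_Rintegral mI vk) _.
apply: (@le_trans _ _ (\int[mu]_(y in I01) (eps * fejer_kernel m x y +
    C * ((cos (pi * y) - cos (pi * x)) ^+ 2 * fejer_kernel m x y)))).
  apply: le_Rintegral => //; first exact: integrable_norm.
    exact: integrableD ek Cqk.
  move=> y y01; rewrite -mulrBl normrM (ger0_norm (fejer_kernel_ge0 _ _ _)).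
  by rewrite mulrA -mulrDl ler_wpM2r ?fejer_kernel_ge0//; exact: vC.
rewrite RintegralD// !RintegralZl// fejer_kernel1 mulr1 lerD2l.
by rewrite ler_wpM2l// fejer_kernel_cos.
Qed.

(** By the product formula the difference is [2 sin s sin d] up to sign, with [s] and [d] the half
    sum and half difference of the angles; [d <= s <= pi - d] gives
    [sin s >= sin d >= sin (pi eta / 2)]. *)
Lemma cos_gap (eta x y : R) : 0 < eta -> I01 x -> I01 y -> eta <= `|y - x| ->
  2 * sin (pi * eta / 2) ^+ 2 <= `|cos (pi * y) - cos (pi * x)|.
Proof.
wlog xy : x y / x <= y.
  move=> W eta0 x01 y01 h; case/orP: (le_total x y) => xy; first exact: W.
  by rewrite distrC; apply: W => //; rewrite distrC.
move=> eta0; rewrite /= !in_itv/= => /andP[x0 x1] /andP[y0 y1].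
rewrite ger0_norm ?subr_ge0// => hd.
have p0 := @pi_gt0 R.
pose s := pi * (x + y) / 2; pose d := pi * (y - x) / 2.
have -> : cos (pi * y) - cos (pi * x) = - (2 * (sin s * sin d)).
  have -> : pi * y = s + d by rewrite /s /d; field.
  have -> : pi * x = s - d by rewrite /s /d; field.
  by rewrite cosD cosB; ring.
have se0 : 0 < sin (pi * eta / 2).
  by apply: sin_gt0_pi; apply/andP; split; [rewrite divr_gt0// mulr_gt0//|nra].
have mono a b : 0 <= a -> a <= b -> b <= pi / 2 -> sin a <= sin b.
  move=> a0 ab b2; rewrite le_eqVlt; have [->|nab] := eqVneq a b; first by rewrite eqxx.
  by rewrite ltr_sin ?in_itv/= ?lt_neqAle ?nab ?ab ?orbT//; apply/andP; split; lra.
have d1 : sin (pi * eta / 2) <= sin d.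
  by apply: mono; rewrite /d; [rewrite divr_ge0// mulr_ge0// ltW|nra|nra].
have d2 : sin d <= sin s.
  have [s2|s2] := leP s (pi / 2); first by apply: mono => //; rewrite /d /s; nra.
  have -> : sin s = sin (pi - s) by rewrite sinB sinpi cospi; ring.
  by apply: mono; rewrite /d /s in s2 *; nra.
rewrite normrN ger0_norm; nra.
Qed.

(* Uniform in every family of functions with a common modulus of continuity. *)
Lemma fejer_uniform (eps eta : R) : 0 < eps -> 0 < eta -> exists m0 : nat,
  forall m v, (m0 <= m)%N -> bfun v ->
    (forall x y, I01 x -> I01 y -> `|y - x| < eta -> `|v y - v x| <= eps) ->
    forall x, I01 x -> `|fejer m (coef v) x - v x| <= 2 * eps.
Proof.
move=> e0 eta0.
pose eta' := Num.min eta 1.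
have eta'0 : 0 < eta' by rewrite lt_min eta0 ltr01.
pose g := 2 * sin (pi * eta' / 2) ^+ 2 : R.
have p0 := @pi_gt0 R.
have g0 : 0 < g.
  rewrite mulr_gt0// exprn_gt0//; apply: sin_gt0_pi; apply/andP; split.
    by rewrite divr_gt0// mulr_gt0.
  have : eta' <= 1 by rewrite ge_min lexx orbT.
  nra.
(* At distance at least [eta'] the quadratic term is then at least 2, which dominates the
   oscillation of any function with values in [-1,1]. *)
pose C := 2 / g ^+ 2.
have C0 : 0 <= C by rewrite divr_ge0// sqr_ge0.
exists (Num.truncn (C / eps)).+1 => m v mm bv vm x x01.
apply: le_trans (_ : eps + C / m.+1%:R <= _).
  apply: fejer_approx => //; first exact: leq_trans mm.
  move=> y y01; have [h|h] := ltP `|y - x| eta'.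
    apply: le_trans (vm x y x01 y01 _) _; last by rewrite lerDl; apply: mulr_ge0 => //; exact: sqr_ge0.
    by apply: lt_le_trans h _; rewrite ge_min lexx.
  have := cos_gap eta'0 x01 y01 h; rewrite -/g => gc.
  have c2 : g ^+ 2 <= (cos (pi * y) - cos (pi * x)) ^+ 2.
    by rewrite -[leRHS]real_normK ?num_real// ler_pXn2r ?nnegrE// ltW.
  have : 2 <= C * (cos (pi * y) - cos (pi * x)) ^+ 2.
    by rewrite /C mulrAC ler_pdivlMr ?exprn_gt0// ler_wpM2l.
  have := ler_normB (v y) (v x); have := bv.2 y y01; have := bv.2 x x01; lra.
rewrite (_ : 2 * eps = eps + eps); last ring.
rewrite lerD2l ler_pdivrMr ?ltr0n// mulrC -ler_pdivrMr//.
by apply: le_trans (ltW (truncnS_gt _)) _; rewrite ler_nat; exact: leqW.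
Qed.
End fejer_approximation.

(** * Fourier transforms and Gaussian laws *)

Section fourier.
Context {R : realType}.
Local Notation I01 := (`[0, 1]%classic : set R).

Lemma Rintegral_bounded_cvg d (T : measurableType d) (m : {measure set T -> \bar R})
    (f_ : nat -> T -> R) (f : T -> R) (M : R) :
  (m setT < +oo)%E -> (forall n, measurable_fun setT (f_ n)) ->
  (forall n x, `|f_ n x| <= M) -> (forall x, f_ n x @[n --> \oo] --> f x) ->
  measurable_fun setT f /\
  (\int[m]_x f_ n x) @[n --> \oo] --> \int[m]_x f x.
Proof.
move=> moo mf_ f_M f_f.
have mf : measurable_fun setT f.
  by apply: (@measurable_fun_cvg _ _ _ _ f_ f) => // x _; exact: f_f.
split => //.
have fM x : `|f x| <= M.
  have h : (fun n => `|f_ n x|) @ \oo --> `|f x| by apply: cvg_norm; exact: f_f.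
  rewrite -(cvg_lim (@Rhausdorff R) h).
  by apply: limr_le; [apply/cvg_ex; exists (Num.norm (f x))|apply: nearW => n].
have intf : m.-integrable setT (EFin \o f).
  exact: (@bounded_integrable _ _ _ m setT f M).
have [] // := @dominated_convergence _ _ _ m setT measurableT
  (fun n => EFin \o f_ n) (EFin \o f) (EFin \o cst M).
- by move=> n; exact/measurable_EFinP.
- exact/measurable_EFinP.
- by apply: aeW => x _; apply: cvg_EFin; [exact: nearW|exact: f_f].
- by apply: (@bounded_integrable _ _ _ m setT (cst M) `|M|).
- by apply: aeW => x n _ /=; rewrite lee_fin.
move=> _ _ h; apply: fine_cvg; rewrite fineK; first exact: h.
exact: integrable_fin_num.
Qed.

Lemma clamp_lip (l h a b : R) :
  `|Num.max l (Num.min h a) - Num.max l (Num.min h b)| <= `|a - b|.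
Proof.
have lipmax (c x y : R) : `|Num.max c x - Num.max c y| <= `|x - y|.
  have h1 := ler_norm (x - y); have h2 := ler_norm (y - x).
  rewrite distrC in h2; rewrite ler_norml.
  by case: (leP c x); case: (leP c y) => ? ?; apply/andP; split; lra.
apply: le_trans (lipmax _ _ _) _.
have h1 := ler_norm (a - b); have h2 := ler_norm (b - a).
rewrite distrC in h2; rewrite ler_norml.
by case: (leP h a); case: (leP h b) => ? ?; apply/andP; split; lra.
Qed.

Lemma cvg_eq_lim (u v : nat -> R) (a b : R) : (forall n, u n = v n) ->
  u @ \oo --> a -> v @ \oo --> b -> a = b.
Proof.
move=> uv ua vb; rewrite -(cvg_lim (@Rhausdorff R) ua) -(cvg_lim (@Rhausdorff R) vb).
by rewrite (funext uv).
Qed.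

(** [cos (n t)] is a polynomial in [cos t], by the three-term recursion of the Chebyshev
    polynomials, and [acos (cos t)] has the same cosine as [t]. *)
Lemma cos_fold n (t : R) : cos (n%:R * acos (cos t)) = cos (n%:R * t).
Proof.
have step k (a : R) : cos (k.+2%:R * a) = 2 * cos a * cos (k.+1%:R * a) - cos (k%:R * a).
  have -> : k.+2%:R * a = k.+1%:R * a + a by rewrite -[k.+2%:R]natr1; ring.
  have -> : k%:R * a = k.+1%:R * a - a by rewrite -natr1; ring.
  by rewrite cosD cosB; ring.
have e : cos (acos (cos t)) = cos t by rewrite acosK// in_itv/= cos_geN1 cos_le1.
suff [] : cos (n%:R * acos (cos t)) = cos (n%:R * t) /\
  cos (n.+1%:R * acos (cos t)) = cos (n.+1%:R * t) by [].
elim: n => [|n [IH1 IH2]]; first by rewrite !mul0r cos0 !mul1r.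
by split => //; rewrite !step IH1 IH2 e.
Qed.

(** The even periodic folding of the line onto [0,1]. It turns a Fejer mean into a trigonometric
    polynomial of [t], so that approximation on [0,1] serves on the whole line. *)
Definition fold (t : R) : R := acos (cos t) / pi.

Lemma fold01 t : I01 (fold t).
Proof.
have c1 : -1 <= cos t <= 1 by rewrite cos_geN1 cos_le1.
rewrite /= in_itv/= /fold divr_ge0 ?acos_ge0 ?pi_ge0//=.
by rewrite ler_pdivrMr ?pi_gt0// mul1r acos_lepi.
Qed.

Lemma eigen_fold n t : eigen n (fold t) =
  (if n == 0%N then 1 else Num.sqrt 2) * cos (n%:R * t).
Proof.
case: n => [|n]; first by rewrite eigen0 mul0r cos0 mulr1.
by rewrite eigenS /fold -cos_fold -mulrA (mulrC pi) divfK// gt_eqF// pi_gt0.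
Qed.

Lemma fold_id t : `|t| <= pi -> fold t = `|t| / pi.
Proof. by move=> h; rewrite /fold -cos_norm cosK// in_itv/= normr_ge0. Qed.

Section uniqueness.
Context d (T : measurableType d) (m : {measure set T -> \bar R}).
Hypothesis moo : (m setT < +oo)%E.
Variables (A A' Y Y' : T -> R) (M : R).
Hypotheses (mA : measurable_fun setT A) (mA' : measurable_fun setT A').
Hypotheses (mY : measurable_fun setT Y) (mY' : measurable_fun setT Y').
Hypotheses (YM : forall x, `|Y x| <= M) (YM' : forall x, `|Y' x| <= M).
Hypothesis AA' : forall c s,
  \int[m]_x (Y x * cos (c * A x + s)) = \int[m]_x (Y' x * cos (c * A' x + s)).

Let mcos (B : T -> R) c s : measurable_fun setT B ->
  measurable_fun setT (fun x => cos (c * B x + s)).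
Proof.
move=> mB; apply: (measurableT_comp (f := cos)).
  apply: continuous_measurable_fun; exact: continuous_cos.
by apply: measurable_funD => //; exact: measurable_funM.
Qed.

Let integral_fejer (B Z : T -> R) (a : nat -> R) j c s : measurable_fun setT B ->
  measurable_fun setT Z -> (forall x, `|Z x| <= M) ->
  \int[m]_x (Z x * fejer j a (fold (c * B x + s))) =
  \sum_(0 <= n < j.+1) rho j n * a n * (if n == 0%N then 1 else Num.sqrt 2) *
     \int[m]_x (Z x * cos (n%:R * c * B x + n%:R * s)) /\
  measurable_fun setT (fun x => fejer j a (fold (c * B x + s))).
Proof.
move=> mB mZ ZM.
pose w n := rho j n * a n * (if n == 0%N then 1 else Num.sqrt 2).
have E x : fejer j a (fold (c * B x + s)) =
    \sum_(0 <= n < j.+1) w n * cos (n%:R * c * B x + n%:R * s).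
  by apply: eq_bigr => n _; rewrite eigen_fold /w -!mulrA mulrDr mulrA.
have int1 n : m.-integrable setT (EFin \o fun x => Z x * cos (n%:R * c * B x + n%:R * s)).
  apply: (@bounded_integrable _ _ _ m setT _ M) => //.
    by apply: measurable_funM => //; exact: mcos.
  move=> x _; rewrite normrM; have := cos_max (n%:R * c * B x + n%:R * s).
  by have := ZM x; have := normr_ge0 (Z x); nra.
have int2 n : m.-integrable setT (EFin \o fun x => w n * (Z x * cos (n%:R * c * B x + n%:R * s))).
  exact: integrableZl (int1 n).
split; last first.
  rewrite (funext E); apply: measurable_sum => n.
  by apply: measurable_funM => //; exact: mcos.
under eq_Rintegral do rewrite E mulr_sumr.
transitivity (\int[m]_x \sum_(0 <= n < j.+1) w n * (Z x * cos (n%:R * c * B x + n%:R * s))).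
  by apply: eq_Rintegral => x _; apply: eq_bigr => n _; rewrite mulrCA.
have [-> _] := Rintegral_sum (index_iota 0 j.+1) measurableT int2.
by apply: eq_bigr => n _; rewrite RintegralZl.
Qed.

(** The Fejer means of [v] converge to [v] uniformly, and for each of them the two integrals agree
    term by term, all frequencies of the folded polynomial being multiples of [c]. *)
Let integral_fold (v : R -> R) c s : bfun v ->
  (forall eps : R, 0 < eps -> exists2 eta : R, 0 < eta & forall x y, I01 x -> I01 y ->
     `|y - x| < eta -> `|v y - v x| <= eps) ->
  \int[m]_x (Y x * v (fold (c * A x + s))) =
  \int[m]_x (Y' x * v (fold (c * A' x + s))) /\
  measurable_fun setT (fun x => Y x * v (fold (c * A x + s))) /\
  measurable_fun setT (fun x => Y' x * v (fold (c * A' x + s))).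
Proof.
move=> bv cv.
have key (B Z : T -> R) : measurable_fun setT B ->
    measurable_fun setT Z -> (forall x, `|Z x| <= M) ->
    measurable_fun setT (fun x => Z x * v (fold (c * B x + s))) /\
    (\int[m]_x (Z x * fejer j (coef v) (fold (c * B x + s)))) @[j --> \oo] -->
    \int[m]_x (Z x * v (fold (c * B x + s))).
  move=> mB mZ ZM; apply: (@Rintegral_bounded_cvg _ _ m
    (fun j x => Z x * fejer j (coef v) (fold (c * B x + s))) _ M) => //.
  - by move=> j; apply: measurable_funM => //; case: (@integral_fejer B Z (coef v) j c s).
  - move=> j x; rewrite normrM; have := @fejer_le1 _ j v (fold (c * B x + s)) bv.
    by have := ZM x; have := normr_ge0 (Z x); nra.
  - move=> x; apply: cvgM; first exact: cvg_cst.
    apply/cvgrPdist_le => /= e e0.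
    have e20 : 0 < e / 2 by rewrite divr_gt0.
    have [eta eta0 veta] := cv _ e20.
    have [m0 hm0] := fejer_uniform e20 eta0.
    exists m0 => // j /= m0j; rewrite distrC.
    by have := hm0 j v m0j bv veta _ (fold01 (c * B x + s)); rewrite [2 * _]mulrC divfK.
have [mv cvg1] := key A Y mA mY YM; have [mv' cvg2] := key A' Y' mA' mY' YM'.
split => //; apply: (cvg_eq_lim _ cvg1 cvg2) => j.
have [-> _] := @integral_fejer A Y (coef v) j c s mA mY YM.
have [-> _] := @integral_fejer A' Y' (coef v) j c s mA' mY' YM'.
by apply: eq_bigr => n _; rewrite AA'.
Qed.

Let integral_itv (p r : R) : 0 < r ->
  \int[m]_x (Y x * \1_(`[p - r, p + r]%classic) (A x)) =
  \int[m]_x (Y' x * \1_(`[p - r, p + r]%classic) (A' x)).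
Proof.
move=> r0.
(* A plateau of height 1 on [k x <= r] followed by a linear descent. With frequency [pi / k] the
   folded argument is [|A - p| / k] as soon as [k >= |A - p|], so [v k] becomes a cut-off of slope
   [k] in [|A - p|] and tends to the indicator of the interval. *)
pose v (k : nat) (x : R) : R := Num.max 0 (Num.min 1 (1 - k%:R * (k%:R * x - r))).
have v01 k x : 0 <= v k x <= 1.
  by rewrite /v le_max lexx/= ge_max ler01 ge_min lexx.
have vlip k x y : `|v k y - v k x| <= k%:R ^+ 2 * `|y - x|.
  rewrite /v (le_trans (_ : _ <= `|(1 - k%:R * (k%:R * y - r)) - (1 - k%:R * (k%:R * x - r))|))//.
    exact: clamp_lip.
  rewrite (_ : _ - _ = - (k%:R ^+ 2 * (y - x))); last ring.
  by rewrite normrN normrM (ger0_norm (sqr_ge0 _)).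
have vc k (eps : R) : 0 < eps -> exists2 eta : R, 0 < eta & forall x y, I01 x -> I01 y ->
    `|y - x| < eta -> `|v k y - v k x| <= eps.
  move=> e0; exists (eps / (k%:R ^+ 2 + 1)).
    by rewrite divr_gt0// ltr_pwDr// sqr_ge0.
  move=> x y _ _; rewrite ltr_pdivlMr ?ltr_pwDr ?sqr_ge0// => h.
  by apply: le_trans (vlip k x y) _; have := normr_ge0 (y - x); nra.
have bv k : bfun (v k).
  split; last by move=> x _; have /andP[? ?] := v01 k x; rewrite ger0_norm.
  apply: measurable_maxr => //; apply: measurable_minr => //.
  by apply: measurable_funB => //; apply: measurable_funM => //; apply: measurable_funB => //;
    exact: measurable_funM.
have key (B Z : T -> R) : measurable_fun setT B ->
    (forall k, measurable_fun setT (fun x => Z x * v k (fold (pi / k%:R * B x + (- (pi / k%:R * p)))))) ->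
    (forall x, `|Z x| <= M) ->
    (\int[m]_x (Z x * v k (fold (pi / k%:R * B x + (- (pi / k%:R * p)))))) @[k --> \oo] -->
    \int[m]_x (Z x * \1_(`[p - r, p + r]%classic) (B x)).
  move=> mB mv ZM; apply: (@Rintegral_bounded_cvg _ _ m
    (fun k x => Z x * v k (fold (pi / k%:R * B x + (- (pi / k%:R * p))))) _ M _ _ _ _).2 => //.
  - move=> k x; rewrite normrM.
    have /andP[] := v01 k (fold (pi / k%:R * B x + (- (pi / k%:R * p)))).
    set t := v k _ => t0 t1; rewrite (ger0_norm t0).
    by have := ZM x; have := normr_ge0 (Z x); nra.
  - move=> x; apply: cvgM; first exact: cvg_cst.
    apply: cvg_near_cst.
    pose a : R := `|B x - p|.
    have vE : \forall k \near \oo, v k (fold (pi / k%:R * B x + (- (pi / k%:R * p)))) =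
        Num.max 0 (Num.min 1 (1 - k%:R * (a - r))).
      near=> k.
      have k0 : 0 < k%:R :> R by rewrite ltr0n; near: k; exact: nbhs_infty_gt.
      have ak : a <= k%:R by near: k; exact: nbhs_infty_ger.
      have -> : pi / k%:R * B x + - (pi / k%:R * p) = pi / k%:R * (B x - p) by ring.
      have E : `|pi / k%:R * (B x - p)| = pi / k%:R * a.
        by rewrite normrM ger0_norm// divr_ge0 ?pi_ge0.
      rewrite fold_id E; last by rewrite mulrAC ler_pdivrMr// ler_wpM2l// pi_ge0.
      rewrite /v; congr (Num.max _ (Num.min _ (_ - _ * (_ - _)))).
      have k1 : k%:R != 0 :> R by rewrite gt_eqF.
      have p1 : pi != 0 :> R by rewrite gt_eqF ?pi_gt0.
      have gen (x1 y1 z1 : R) : x1 != 0 -> y1 != 0 -> x1 * (y1 / x1 * z1 / y1) = z1.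
        by move=> x0 y0; field; rewrite x0 y0.
      exact: gen.
    have [ar|ra] := leP a r.
      near=> k; rewrite (near vE k)//.
      rewrite (_ : \1_ _ _ = 1); last first.
        by rewrite indicE mem_set//= in_itv/= -ler_distl.
      have : 0 <= k%:R * (r - a) by rewrite mulr_ge0// subr_ge0.
      move=> h; rewrite min_l ?max_r//; nra.
    near=> k; rewrite (near vE k)//.
    rewrite (_ : \1_ _ _ = 0); last first.
      rewrite indicE memNset//= in_itv/= -ler_distl.
      by apply/negP; rewrite -ltNge.
    have : (a - r)^-1 <= k%:R by near: k; exact: nbhs_infty_ger.
    rewrite -[X in X <= _]mulr1 ler_pdivrMl ?subr_gt0// => h.
    by rewrite max_l// ge_min; apply/orP; right; rewrite mulrC subr_le0.
have h k := @integral_fold (v k) (pi / k%:R) (- (pi / k%:R * p)) (bv k) (vc k).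
have c1 := key A Y mA (fun k => (h k).2.1) YM.
have c2 := key A' Y' mA' (fun k => (h k).2.2) YM'.
by apply: (cvg_eq_lim _ c1 c2) => k; exact: (h k).1.
Unshelve. all: by end_near. Qed.

(** The half-line is an increasing union of the intervals treated in [integral_itv]. This is a
    uniqueness theorem for characteristic functions in which the phase [s] takes the place of the
    sine; the weights [Y] and [Y'] allow a joint law to be identified one coordinate at a time. *)
Lemma cos_integral_unique x :
  \int[m]_w (Y w * \1_(`[x, +oo[%classic) (A w)) =
  \int[m]_w (Y' w * \1_(`[x, +oo[%classic) (A' w)).
Proof.
pose D (k : nat) : set R := `[(x + k.+1%:R) - k.+1%:R, (x + k.+1%:R) + k.+1%:R]%classic.
have key (B Z : T -> R) : measurable_fun setT B -> measurable_fun setT Z ->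
    (forall x, `|Z x| <= M) ->
    (\int[m]_w (Z w * \1_(D k) (B w))) @[k --> \oo] -->
    \int[m]_w (Z w * \1_(`[x, +oo[%classic) (B w)).
  move=> mB mZ ZM; apply: (@Rintegral_bounded_cvg _ _ m
    (fun k w => Z w * \1_(D k) (B w)) _ M _ _ _ _).2 => //.
  - move=> k; apply: measurable_funM => //.
    by apply: (measurableT_comp _ mB); apply: measurable_indic; exact: measurable_itv.
  - by move=> k w; rewrite normrM indicE; case: (_ \in _); rewrite ?normr1 ?normr0 ?mulr1 ?mulr0//;
      apply: le_trans (normr_ge0 _) (ZM w).
  - move=> w; apply: cvgM; first exact: cvg_cst.
    apply: cvg_near_cst; near=> k.
    have hk : B w - x <= k%:R by near: k; exact: nbhs_infty_ger.
    rewrite !indicE; congr (_%:R); congr nat_of_bool.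
    apply/idP/idP; rewrite !inE /D /= !in_itv/= andbT addrK; first by case/andP.
    move=> xB.
    by rewrite xB/=; have : (k%:R : R) <= k.+1%:R; [rewrite ler_nat|lra].
have c1 := key A Y mA mY YM; have c2 := key A' Y' mA' mY' YM'.
by apply: (cvg_eq_lim _ c1 c2) => k; exact: integral_itv.
Unshelve. all: by end_near. Qed.
End uniqueness.
End fourier.

(** * Independence through cosine transforms *)

Section independence.
Context {R : realType} d (Omega : measurableType d) (P : probability Omega R).

Definition indep d1 (T1 : measurableType d1) d2 (T2 : measurableType d2)
    (A : Omega -> T1) (B : Omega -> T2) : Prop :=
  forall C D, measurable C -> measurable D ->
    P (A @^-1` C `&` B @^-1` D) = (P (A @^-1` C) * P (B @^-1` D))%E.

Lemma P_fin (A : set Omega) : measurable A -> (P A)%E \is a fin_num.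
Proof. by move=> mA; rewrite fin_num_measure. Qed.

Lemma Rintegral_indic (A : set Omega) : measurable A ->
  \int[P]_w \1_A w = fine (P A).
Proof. by move=> mA; rewrite /Rintegral integral_indic// setIT. Qed.

Lemma bounded_integrableP (f : Omega -> R) (M : R) : measurable_fun setT f ->
  (forall w, `|f w| <= M) -> P.-integrable setT (EFin \o f).
Proof.
move=> mf fM; apply: (@bounded_integrable _ _ _ P setT f M) => //.
exact: le_lt_trans (probability_le1 P measurableT) (ltry 1).
Qed.

Section joint_law.
Context d1 (T1 : measurableType d1) d2 (T2 : measurableType d2).
Variables (Z : Omega -> T1) (U : Omega -> T2).
Hypotheses (mZ : measurable_fun setT Z) (mU : measurable_fun setT U).
Hypothesis ZU : indep Z U.

(** Independence makes the law of the pair the product of the two laws, and Fubini's theorem applies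
    to the bounded [f]; this freezes [Z] while [U] is integrated out. *)
Lemma indep_Rintegral (f : T1 * T2 -> R) (M : R) : measurable_fun setT f ->
  (forall x, `|f x| <= M) ->
  \int[P]_w f (Z w, U w) = \int[P]_w (\int[P]_w' f (Z w, U w')).
Proof.
move=> mf fM.
have mZU : measurable_fun setT (fun w => (Z w, U w)) by exact: measurable_fun_pair.
pose rZ : {mfun Omega >-> T1} := mfun_Sub (mem_set mZ).
pose rU : {mfun Omega >-> T2} := mfun_Sub (mem_set mU).
pose rZU : {mfun Omega >-> (T1 * T2)%type} := mfun_Sub (mem_set mZU).
pose lZ := distribution P rZ; pose lU := distribution P rU.
pose lZU := distribution P rZU.
have prodE X : measurable X -> (lZ \x lU)%E X = lZU X.
  by apply: product_measure_unique => A B mA mB; rewrite -ZU.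
have imf : (lZ \x lU)%E.-integrable setT (EFin \o f).
  apply: (@bounded_integrable _ _ _ (lZ \x lU)%E setT f M) => //.
  refine (eq_ind_r (fun x => (x < +oo)%E) _ (prodE setT measurableT)).
  exact: le_lt_trans (probability_le1 lZU measurableT) (ltry 1).
have mEf : measurable_fun setT (EFin \o f) by exact/measurable_EFinP.
have inner_fin z : (\int[P]_w' (f (z, U w'))%:E \is a fin_num)%E.
  apply: integrable_fin_num => //; apply: (@bounded_integrableP (fun w => f (z, U w)) M) => //.
  by apply: measurableT_comp => //; exact: measurable_fun_pair.
have innerE z : (\int[lU]_u (f (z, u))%:E)%E = (\int[P]_w' (f (z, U w'))%:E)%E.
  rewrite integral_pushforward//.
    by apply/measurable_EFinP; apply: measurableT_comp => //; exact: measurable_fun_pair.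
  apply: (@bounded_integrableP (fun w => f (z, U w)) M) => //.
  by apply: measurableT_comp => //; exact: measurable_fun_pair.
have iF := integrable_fubini_F imf; have := integral12_prod_meas1 imf.
rewrite /fubini_F /= in iF *.
rewrite (eq_measure_integral lZU); last by move=> X mX _; exact: prodE.
have mF := measurable_int _ iF.
have iFZ : P.-integrable setT ((fun z => \int[lU]_u (f (z, u))%:E)%E \o Z).
  apply/integrableP; split; first exact: measurableT_comp.
  have /integrableP[_] := iF.
  by rewrite ge0_integral_pushforward//; exact: measurableT_comp.
have iZU : P.-integrable setT ((EFin \o f) \o rZU).
  apply: (@bounded_integrableP (fun w => f (Z w, U w)) M) => //.
  exact: measurableT_comp.
rewrite (integral_pushforward _ _ iFZ)// (integral_pushforward _ _ iZU)//.
move=> E; rewrite /Rintegral -[X in fine X = _]E; congr fine.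
apply: eq_integral => w _ /=; rewrite innerE fineK//.
Qed.

End joint_law.

Lemma indicM (A B : set Omega) w : \1_A w * \1_B w = \1_(A `&` B) w :> R.
Proof. by rewrite indicI. Qed.

Lemma measurable_indicT (A : set Omega) : measurable A ->
  measurable_fun setT (\1_A : Omega -> R).
Proof. exact: measurable_indic. Qed.

Lemma preimage_measurable d1 (T1 : measurableType d1) (A : Omega -> T1) C :
  measurable_fun setT A -> measurable C -> measurable (A @^-1` C).
Proof. by move=> mA mC; rewrite -[X in measurable X]setTI; exact: mA. Qed.

Lemma measurable_cosD (U : Omega -> R) c s : measurable_fun setT U ->
  measurable_fun setT (fun w => cos (c * U w + s)).
Proof.
move=> mU; apply: (measurableT_comp (f := cos)).
  apply: continuous_measurable_fun; exact: continuous_cos.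
by apply: measurable_funD => //; exact: measurable_funM.
Qed.

Lemma integrable_cosD (U : Omega -> R) c s : measurable_fun setT U ->
  P.-integrable setT (EFin \o fun w => cos (c * U w + s)).
Proof.
move=> mU; apply: (@bounded_integrableP _ 1); first exact: measurable_cosD.
by move=> w; exact: cos_max.
Qed.

Lemma indic_le1 (A : set Omega) w : `|\1_A w : R| <= 1.
Proof. by rewrite indicE; case: (_ \in _); rewrite ?normr1 ?normr0. Qed.

Lemma integrable_indicT (A : set Omega) : measurable A ->
  P.-integrable setT (EFin \o (\1_A : Omega -> R)).
Proof.
move=> mA; apply: (@bounded_integrableP _ 1); first exact: measurable_indicT.
exact: indic_le1.
Qed.

Lemma indep_cos d1 (T1 : measurableType d1) (Z : Omega -> T1) (U : Omega -> R) C c s :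
  measurable_fun setT Z -> measurable_fun setT U -> indep Z U -> measurable C ->
  \int[P]_w (\1_(Z @^-1` C) w * cos (c * U w + s)) =
  fine (P (Z @^-1` C)) * \int[P]_w cos (c * U w + s).
Proof.
move=> mZ mU ZU mC.
pose f (x : T1 * R) : R := \1_C x.1 * cos (c * x.2 + s).
have mf : measurable_fun setT f.
  apply: measurable_funM.
    have m1 : measurable_fun setT (\1_C : T1 -> R) by exact: measurable_indic.
    exact: (measurableT_comp m1 measurable_fst).
  apply: (measurableT_comp (f := cos)).
    apply: continuous_measurable_fun; exact: continuous_cos.
  by apply: measurable_funD => //; exact: measurable_funM.
have f1 x : `|f x| <= 1.
  rewrite normrM -[leRHS]mulr1 ler_pM// ?cos_max//.
  by rewrite indicE; case: (_ \in _); rewrite ?normr1 ?normr0.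
have := indep_Rintegral mZ mU ZU mf f1; rewrite /f /= => E.
rewrite -[LHS]/(\int[P]_w (\1_C (Z w) * cos (c * U w + s))) E.
transitivity (\int[P]_w (\1_(Z @^-1` C) w * \int[P]_w' cos (c * U w' + s))).
  apply: eq_Rintegral => w _; rewrite RintegralZl//; exact: integrable_cosD.
rewrite RintegralZr//; last first.
  apply: (@bounded_integrableP _ 1); last by move=> w; exact: indic_le1.
  by apply: measurable_indicT; exact: preimage_measurable.
by rewrite Rintegral_indic//; exact: preimage_measurable.
Qed.

Lemma halfline_unique (m1 m2 : {measure set (R) -> \bar R}) :
  (forall x : R, m1 `[x, +oo[%classic = m2 `[x, +oo[%classic) ->
  (forall x : R, m1 `[x, +oo[%classic < +oo)%E ->
  forall D, measurable D -> m1 D = m2 D.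
Proof.
move=> m12 m1oo; refine (@measure_unique _ R (R) (@RGenCInfty.G R)
  (fun n => `[- n%:R, +oo[%classic) _ _ _ _ m1 m2 _ _).
- exact: RGenCInfty.measurableE.
- move=> _ _ [x ->] [y ->]; exists (Num.max x y).
  by apply/seteqP; split => z /=; rewrite !in_itv/= !andbT ge_max => /andP.
- by move=> n; exists (- n%:R).
- apply/seteqP; split => // x _; exists (Num.truncn `|x|).+1 => //=.
  rewrite in_itv/= andbT lerNl; apply: le_trans (ltW (truncnS_gt _)).
  by rewrite -normrN ler_norm.
- by move=> _ [x ->].
- by move=> n.
Qed.

Lemma halfline_scale (G : set Omega) (V : Omega -> R) (k : R) :
  measurable G -> measurable_fun setT V -> 0 <= k ->
  (forall x : R, P (G `&` V @^-1` `[x, +oo[%classic) =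
     (k%:E * P (V @^-1` `[x, +oo[%classic))%E) ->
  forall D, measurable D -> P (G `&` V @^-1` D) = (k%:E * P (V @^-1` D))%E.
Proof.
move=> mG mV k0 h D mD.
pose rV : {mfun Omega >-> R} := mfun_Sub (mem_set mV).
rewrite setIC.
apply: (@halfline_unique (pushforward (mrestr P mG) rV)
  (mscale (NngNum k0) (distribution P rV))) => // x.
  by rewrite -[RHS]/(k%:E * P (V @^-1` _))%E -h setIC.
apply: le_lt_trans (ltry 1); apply: probability_le1.
by apply: measurableI => //; apply: preimage_measurable => //; exact: measurable_itv.
Qed.

Section triple.
Context d1 (T1 : measurableType d1).
Variables (Z : Omega -> T1) (U B : Omega -> R).
Hypotheses (mZ : measurable_fun setT Z) (mU : measurable_fun setT U)
  (mB : measurable_fun setT B).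
Hypothesis H : forall C, measurable C -> forall c s b s',
  \int[P]_w (\1_(Z @^-1` C) w * cos (b * B w + s') * cos (c * U w + s)) =
  fine (P (Z @^-1` C)) * (\int[P]_w cos (b * B w + s')) *
    \int[P]_w cos (c * U w + s).

(** Two applications of [cos_integral_unique]: first in [U], weighted by the indicator of [C] times
    the cosine of [B], then in [B], weighted by the indicator obtained. *)
Let half C x y : measurable C ->
  P (Z @^-1` C `&` U @^-1` `[x, +oo[%classic `&` B @^-1` `[y, +oo[%classic) =
  (P (Z @^-1` C) * P (U @^-1` `[x, +oo[%classic) * P (B @^-1` `[y, +oo[%classic))%E.
Proof.
move=> mC.
have mh (V : Omega -> R) x' : measurable_fun setT V -> measurable (V @^-1` `[x', +oo[%classic).
  by move=> mV; apply: preimage_measurable => //; exact: measurable_itv.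
have mZC := preimage_measurable mZ mC.
have step1 b s' :
    \int[P]_w (\1_(Z @^-1` C) w * cos (b * B w + s') * \1_(`[x, +oo[%classic) (U w)) =
    fine (P (Z @^-1` C)) * (\int[P]_w cos (b * B w + s')) *
      fine (P (U @^-1` `[x, +oo[%classic)).
  pose k : R := fine (P (Z @^-1` C)) * \int[P]_w cos (b * B w + s').
  rewrite -(Rintegral_indic (mh U x mU)) -/k.
  have -> : k * \int[P]_w \1_(U @^-1` `[x, +oo[%classic) w =
      \int[P]_w (k * \1_(`[x, +oo[%classic) (U w)).
    rewrite RintegralZl//; exact: (integrable_indicT (mh U x mU)).
  apply: (@cos_integral_unique _ _ _ P _ U U _ (cst k) (Num.max 1 `|k|)) => //.
  - exact: le_lt_trans (probability_le1 P measurableT) (ltry 1).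
  - apply: measurable_funM; first exact: measurable_indicT.
    exact: measurable_cosD.
  - move=> w; rewrite le_max; apply/orP; left.
    by rewrite normrM -[leRHS]mulr1 ler_pM// ?cos_max// indic_le1.
  - by move=> w; rewrite le_max lexx orbT.
  - by move=> c s; rewrite H// RintegralZl//; exact: integrable_cosD.
have step2 :
    \int[P]_w (\1_(Z @^-1` C `&` U @^-1` `[x, +oo[%classic) w * \1_(`[y, +oo[%classic) (B w)) =
    fine (P (Z @^-1` C)) * fine (P (U @^-1` `[x, +oo[%classic)) *
      fine (P (B @^-1` `[y, +oo[%classic)).
  pose k : R := fine (P (Z @^-1` C)) * fine (P (U @^-1` `[x, +oo[%classic)).
  rewrite -(Rintegral_indic (mh B y mB)) -/k.
  have -> : k * \int[P]_w \1_(B @^-1` `[y, +oo[%classic) w =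
      \int[P]_w (k * \1_(`[y, +oo[%classic) (B w)).
    rewrite RintegralZl//; exact: (integrable_indicT (mh B y mB)).
  apply: (@cos_integral_unique _ _ _ P _ B B _ (cst k) (Num.max 1 `|k|)) => //.
  - exact: le_lt_trans (probability_le1 P measurableT) (ltry 1).
  - by apply: measurable_indicT; apply: measurableI => //; exact: mh.
  - by move=> w; rewrite le_max indic_le1.
  - by move=> w; rewrite le_max lexx orbT.
  - move=> b s'; rewrite RintegralZl//; last exact: integrable_cosD.
    rewrite /k mulrAC -step1; apply: eq_Rintegral => w _.
    by rewrite -indicM mulrAC.
have mA : measurable (Z @^-1` C `&` U @^-1` `[x, +oo[%classic `&` B @^-1` `[y, +oo[%classic).
  by apply: measurableI; [apply: measurableI => //|]; exact: mh.
rewrite -[LHS]fineK ?P_fin// -Rintegral_indic//.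
transitivity (\int[P]_w (\1_(Z @^-1` C `&` U @^-1` `[x, +oo[%classic) w *
    \1_(`[y, +oo[%classic) (B w)))%:E.
  by congr EFin; apply: eq_Rintegral => w _; rewrite indicI.
by rewrite step2 !EFinM !fineK ?P_fin//; exact: mh.
Qed.

Lemma triple_indep C D D' : measurable C -> measurable D -> measurable D' ->
  P (Z @^-1` C `&` U @^-1` D `&` B @^-1` D') =
  (P (Z @^-1` C) * P (U @^-1` D) * P (B @^-1` D'))%E.
Proof.
move=> mC mD mD'.
have mZC := preimage_measurable mZ mC.
have mh (V : Omega -> R) x' : measurable_fun setT V -> measurable (V @^-1` `[x', +oo[%classic).
  by move=> mV; apply: preimage_measurable => //; exact: measurable_itv.
have half1 x : P (Z @^-1` C `&` U @^-1` `[x, +oo[%classic `&` B @^-1` D') =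
    (P (Z @^-1` C) * P (U @^-1` `[x, +oo[%classic) * P (B @^-1` D'))%E.
  pose k := (fine (P (Z @^-1` C)) * fine (P (U @^-1` `[x, +oo[%classic)))%R.
  have kE : k%:E = (P (Z @^-1` C) * P (U @^-1` `[x, +oo[%classic))%E.
    by rewrite EFinM !fineK ?P_fin//; exact: mh.
  rewrite -kE; apply: halfline_scale => //.
  - by apply: measurableI => //; exact: mh.
  - by rewrite mulr_ge0 ?fine_ge0.
  - by move=> y; rewrite kE half.
have mBD : measurable (B @^-1` D') by exact: preimage_measurable.
pose k := (fine (P (Z @^-1` C)) * fine (P (B @^-1` D')))%R.
have kE : k%:E = (P (Z @^-1` C) * P (B @^-1` D'))%E.
  by rewrite EFinM !fineK ?P_fin.
rewrite setIAC muleAC -kE; apply: halfline_scale => //.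
- exact: measurableI.
- by rewrite mulr_ge0 ?fine_ge0.
- by move=> x; rewrite kE setIAC half1 muleAC.
Qed.

(** Rectangles form a generating class stable under intersection, and on them [triple_indep] gives
    the factorization. *)
Lemma indep_pair : indep (fun w => (Z w, U w)) B /\ indep Z U.
Proof.
have PT (V : Omega -> R) : P (V @^-1` setT) = 1%E.
  by rewrite preimage_setT probability_setT.
have ZU : indep Z U.
  move=> C D mC mD; have := triple_indep mC mD measurableT.
  by rewrite PT mule1 preimage_setT setIT.
split => // X D' mX mD'.
have mZU : measurable_fun setT (fun w => (Z w, U w)) by exact: measurable_fun_pair.
pose rZU : {mfun Omega >-> (T1 * R)%type} := mfun_Sub (mem_set mZU).
have Pnn A : (0 <= fine (P A))%R by exact: fine_ge0.
have mBD : measurable (B @^-1` D') by exact: preimage_measurable.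
rewrite muleC -[X in _ = (X * _)%E](fineK (P_fin mBD)).
refine (@measure_unique _ R (T1 * R)%type
  [set A `*` B | A in measurable & B in measurable] (fun=> setT)
  (measurable_prod_measurableType _ _) _ _ _
  (pushforward (mrestr P mBD) rZU)
  (mscale (NngNum (Pnn (B @^-1` D'))) (distribution P rZU)) _ _ X mX) => //.
- move=> _ _ [A mA [A' mA' <-]] [E mE [E' mE' <-]].
  exists (A `&` E); first exact: measurableI.
  by exists (A' `&` E'); [exact: measurableI|rewrite setXI].
- by move=> _; exists setT => //; exists setT => //; rewrite setXTT.
- by apply/seteqP; split => // x _; exists 0%N.
- move=> _ [A mA [A' mA' <-]].
  rewrite -[LHS]/(P (Z @^-1` A `&` U @^-1` A' `&` B @^-1` D')).
  rewrite -[RHS]/((fine (P (B @^-1` D')))%:E * P (Z @^-1` A `&` U @^-1` A'))%E.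
  by rewrite triple_indep// fineK ?P_fin// ZU// muleC.
- move=> _; apply: le_lt_trans (ltry 1); apply: probability_le1.
  by apply: measurableI => //; exact: preimage_measurable.
Unshelve. exact: mZU.
Qed.
End triple.

End independence.

(** * One-dimensional Gaussian means and their Harnack inequality *)

Section gauss.
Context {R : realType}.
Local Notation mu := (@lebesgue_measure R).

Lemma integrableRZl d (T : measurableType d) (m : {measure set T -> \bar R})
    (D : set T) (k : R) (f : T -> R) : measurable D ->
  m.-integrable D (EFin \o f) -> m.-integrable D (EFin \o fun x => k * f x).
Proof.
move=> mD fi; have := @integrableZl _ _ _ m D mD k _ fi.
by apply: eq_integrable.
Qed.

(** The Radon-Nikodym derivative of the normal law is identified with [normal_pdf] almost everywhere
    by comparing integrals over measurable sets. *)
Lemma integral_normal_prob (s : R) (f : R -> \bar R) :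
  measurable_fun setT f -> (normal_prob 0 s).-integrable setT f ->
  (\int[normal_prob 0 s]_x f x = \int[mu]_x (f x * (normal_pdf 0 s x)%:E))%E.
Proof.
move=> mf intf.
rewrite -(Radon_Nikodym_change_of_variables (normal_prob_dominates 0 s))//=.
apply: ae_eq_integral => //.
- apply: emeasurable_funM => //; apply: (measurable_int mu).
  by apply: Radon_Nikodym_integrable; exact: normal_prob_dominates.
- apply: emeasurable_funM => //=; apply/measurableT_comp => //=.
  exact: measurable_normal_pdf.
- apply: ae_eqe_mul2l => /=.
  rewrite Radon_NikodymE//=; first exact: normal_prob_dominates.
  move=> abmu.
  case: cid => /= h [h1 h2 h3].
  apply: integral_ae_eq => //=.
  + by apply/measurableT_comp =>//; exact: measurable_normal_pdf.
  + by move=> E E01 mE; rewrite -h3.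
Qed.

Definition gmean (s : R) (g : R -> R) : R :=
  \int[mu]_a (g a * normal_pdf 0 s a).

Lemma normal_pdf_integrable (s : R) (g : R -> R) (M : R) :
  measurable_fun setT g -> (forall a, `|g a| <= M) ->
  mu.-integrable setT (EFin \o fun a => g a * normal_pdf 0 s a).
Proof.
move=> mg gM.
have h : mu.-integrable setT (EFin \o fun a => M * normal_pdf 0 s a).
  apply: integrableRZl => //; exact: integrable_normal_pdf.
apply: le_integrable h => //.
  apply/measurable_EFinP; apply: measurable_funM => //; exact: measurable_normal_pdf.
move=> a _ /=; rewrite lee_fin !normrM ler_wpM2r//.
by apply: le_trans (gM a) (ler_norm _).
Qed.

Lemma gmean_law d (Omega : measurableType d) (P : probability Omega R)
    (X : Omega -> R) (s : R) (g : R -> R) (M : R) :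
  measurable_fun setT X -> (forall D, measurable D -> P (X @^-1` D) = normal_prob 0 s D) ->
  measurable_fun setT g -> (forall a, `|g a| <= M) ->
  \int[P]_w g (X w) = gmean s g.
Proof.
move=> mX XN mg gM.
pose X' : Omega -> measurableTypeR R := X.
have mX' : measurable_fun setT X' by exact: mX.
pose rX : {mfun Omega >-> (measurableTypeR R)} := mfun_Sub (mem_set mX').
have mEg : measurable_fun (setT : set (measurableTypeR R)) (EFin \o g) by exact/measurable_EFinP.
have ig : (normal_prob 0 s).-integrable setT (EFin \o g).
  apply: (@bounded_integrable _ _ _ (normal_prob 0 s) setT g M) => //.
  exact: le_lt_trans (probability_le1 (normal_prob 0 s) measurableT) (ltry 1).
have igX : P.-integrable (rX @^-1` setT) ((EFin \o g) \o rX).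
  apply: (@bounded_integrableP _ _ _ _ (fun w => g (X w)) M) => //.
  exact: measurableT_comp.
have := integral_normal_prob mEg ig.
have := integral_pushforward mX' mEg igX measurableT.
rewrite /gmean /Rintegral /= => E1 E2; congr fine.
rewrite preimage_setT in E1; rewrite -E1.
transitivity (\int[normal_prob 0 s]_x (g x)%:E)%E; last by rewrite E2.
by apply: eq_measure_integral => D mD _; exact: XN.
Qed.

Lemma gmean_ge0 (s : R) (g : R -> R) : (forall a, 0 <= g a) -> 0 <= gmean s g.
Proof.
by move=> g0; apply: Rintegral_ge0 => a _; rewrite mulr_ge0 ?normal_pdf_ge0.
Qed.

Lemma gmean1 s : gmean s (fun=> 1) = 1.
Proof.
rewrite /gmean /Rintegral; under eq_integral do rewrite mul1r.
by rewrite integral_normal_pdf.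
Qed.

Lemma gmeanZ (s k : R) (g : R -> R) (M : R) : measurable_fun setT g -> (forall a, `|g a| <= M) ->
  gmean s (fun a => k * g a) = k * gmean s g.
Proof.
move=> mg gM; rewrite /gmean -RintegralZl//; last exact: normal_pdf_integrable gM.
by apply: eq_Rintegral => a _; rewrite mulrA.
Qed.

Lemma le_gmean (s : R) (g1 g2 : R -> R) (M : R) : measurable_fun setT g1 -> measurable_fun setT g2 ->
  (forall a, `|g1 a| <= M) -> (forall a, `|g2 a| <= M) ->
  (forall a, g1 a <= g2 a) -> gmean s g1 <= gmean s g2.
Proof.
move=> m1 m2 h1 h2 h; apply: le_Rintegral => //.
- exact: normal_pdf_integrable h1.
- exact: normal_pdf_integrable h2.
- by move=> a _; rewrite ler_wpM2r ?normal_pdf_ge0.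
Qed.

Lemma gmeanB (s : R) (g1 g2 : R -> R) (M : R) : measurable_fun setT g1 -> measurable_fun setT g2 ->
  (forall a, `|g1 a| <= M) -> (forall a, `|g2 a| <= M) ->
  gmean s (fun a => g1 a - g2 a) = gmean s g1 - gmean s g2.
Proof.
move=> m1 m2 h1 h2; rewrite /gmean -RintegralB//.
- by apply: eq_Rintegral => a _; rewrite mulrBl.
- exact: normal_pdf_integrable h1.
- exact: normal_pdf_integrable h2.
Qed.

Lemma integral_translate (G : R -> R) (h : R) : continuous G ->
  (forall x, 0 <= G x) ->
  (\int[mu]_x (G x)%:E = \int[mu]_x (G (x + h))%:E)%E.
Proof.
move=> cG G0.
pose F (x : R) := x + h.
have dF (x : R) : is_derive x 1 F 1.
  have := is_deriveD (is_derive_id x (1 : R)) (is_derive_cst h x (1 : R)).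
  by rewrite addr0.
have F'E : F^`()%classic = cst 1.
  by apply/funext => x; rewrite derive1E; case: (dF x).
rewrite (@increasing_ge0_integration_by_substitutionT _ F)//.
- by apply: eq_integral => x _; rewrite F'E /= mulr1.
- by move=> x y xy; rewrite /F ltrD2r.
- by rewrite F'E => x; exact: cvg_cst.
- by rewrite F'E; exact: is_cvg_cst.
- by rewrite F'E; exact: is_cvg_cst.
- exact: cvg_addrr_Ny.
- exact: cvg_addrr.
Qed.

Lemma normal_pdf_shift (s k a : R) : s != 0 ->
  normal_pdf 0 s (a + k) =
  normal_pdf 0 s a * expR (- (a * k / s ^+ 2) - k ^+ 2 / (2 * s ^+ 2)).
Proof.
move=> s0; rewrite /normal_pdf (negbTE s0) -[LHS]/(normal_peak s * normal_fun 0 s (a + k)).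
rewrite -[X in _ = X * _]/(normal_peak s * normal_fun 0 s a) -[RHS]mulrA.
congr (_ * _); rewrite /normal_fun -expRD.
by congr expR; rewrite !subr0 -mulr_natr; field.
Qed.

Lemma powR_inv (y r : R) : 0 <= y -> y^-1 `^ r = (y `^ r)^-1.
Proof.
by move=> y0; rewrite -powR_inv1// -powRrM mulrC powRrM powR_inv1// powR_ge0.
Qed.

Lemma powR_root (p y : R) : p != 0 -> 0 <= y -> (y `^ p^-1) `^ p = y.
Proof. by move=> p0 y0; rewrite -powRrM mulVf// powRr1. Qed.

Lemma powR_rootV (p y : R) : p != 0 -> 0 <= y -> (y `^ p) `^ p^-1 = y.
Proof. by move=> p0 y0; rewrite -powRrM mulfV// powRr1. Qed.

(** Young's inequality for the normalised quantities [x / U] and [y^q / V]. With [U] and [V] the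
    integrals of [x] and [y^q], the bracket integrates to [1/p + 1/q = 1], which is Hoelder's
    inequality. *)
Lemma young_scaled (p q x y U V : R) : 0 <= x -> 0 <= y -> 0 < U -> 0 < V ->
  0 < p -> 0 < q -> p^-1 + q^-1 = 1 ->
  x `^ p^-1 * y <= U `^ p^-1 * V `^ q^-1 * (x / U / p + y `^ q / V / q).
Proof.
move=> x0 y0 U0 V0 p0 q0 pq.
have [U0' V0'] := (ltW U0, ltW V0).
have Ui : 0 <= U^-1 by rewrite invr_ge0.
have Vi : 0 <= (V `^ q^-1)^-1 by rewrite invr_ge0 powR_ge0.
have Up : 0 < U `^ p^-1 by exact: powR_gt0.
have Vq : 0 < V `^ q^-1 by exact: powR_gt0.
have pn0 : p != 0 by rewrite gt_eqF.
have qn0 : q != 0 by rewrite gt_eqF.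
have xU : 0 <= x / U by exact: mulr_ge0.
have yV : 0 <= y / V `^ q^-1 by exact: mulr_ge0.
have := conjugate_powR (powR_ge0 (x / U) p^-1) yV p0 q0 pq.
rewrite (powR_root pn0 xU) (powRM _ y0 Vi) (powRM _ x0 Ui).
rewrite (powR_inv q (ltW Vq)) (powR_inv p^-1 U0') (powR_root qn0 V0').
move=> Y; rewrite -ler_pdivrMl ?mulr_gt0//; apply: le_trans Y.
by rewrite invfM le_eqVlt; apply/orP; left; apply/eqP; ring.
Qed.

Lemma le_powR_root (p x y z : R) : 0 < p -> 0 <= x -> 0 <= y ->
  x `^ p <= y * expR z -> x <= y `^ p^-1 * expR (z / p).
Proof.
move=> p0 x0 y0 xy; have pn0 : p != 0 by rewrite gt_eqF.
have pi0 : 0 <= p^-1 by rewrite invr_ge0 ltW.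
have e0 := expR_ge0 z.
have := ge0_ler_powR pi0 (_ : _ \in Num.nneg) (_ : _ \in Num.nneg) xy.
rewrite !nnegrE powR_ge0 (mulr_ge0 y0 e0) => /(_ isT isT).
by rewrite (powR_rootV pn0 x0) (powRM _ y0 e0) -expRM.
Qed.

Lemma integral_normal_pdf_shift (s k : R) : s != 0 ->
  (\int[mu]_a (normal_pdf 0 s (a + k))%:E = 1)%E.
Proof.
move=> s0; rewrite -(@integral_translate (normal_pdf 0 s)).
- exact: integral_normal_pdf.
- exact: continuous_normal_pdf.
- exact: normal_pdf_ge0.
Qed.

Lemma normal_pdf_shift_integrable (s k : R) : s != 0 ->
  mu.-integrable setT (EFin \o fun a : R => normal_pdf 0 s (a + k)).
Proof.
move=> s0; apply/integrableP; split.
  apply/measurable_EFinP; apply: measurableT_comp; last exact: measurable_funD.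
  exact: measurable_normal_pdf.
under eq_integral do rewrite /= ger0_norm ?normal_pdf_ge0//.
by rewrite integral_normal_pdf_shift// ltry.
Qed.

(** The pointwise bound is integrated over the line: translation by [h] does not change the integral
    on the left, and the shifted density on the right has mass 1. *)
Lemma gmean_le_shift (s h k M A B : R) (g1 g2 : R -> R) : 0 < s ->
  continuous g1 -> measurable_fun setT g2 ->
  (forall a, 0 <= g1 a <= M) -> (forall a, 0 < g2 a <= M) ->
  (forall a, g1 (a + h) * normal_pdf 0 s (a + h) <=
     A * (g2 a * normal_pdf 0 s a) + B * normal_pdf 0 s (a + k)) ->
  gmean s g1 <= A * gmean s g2 + B.
Proof.
move=> s0 cg1 mg2 g1M g2M.
have sn0 : s != 0 by rewrite gt_eqF.
have transg : gmean s g1 = \int[mu]_a (g1 (a + h) * normal_pdf 0 s (a + h)).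
  rewrite /gmean /Rintegral.
  rewrite (@integral_translate (fun a => g1 a * normal_pdf 0 s a) h)//.
  - move=> x; apply: cvgM; [exact: cg1|exact: continuous_normal_pdf].
  - by move=> x; rewrite mulr_ge0 ?normal_pdf_ge0//; case/andP: (g1M x).
have mg1 : measurable_fun setT g1 by exact: continuous_measurable_fun.
clear cg1.
have g2n a : `|g2 a| <= M.
  by have /andP[g20 g2m] := g2M a; rewrite (ger0_norm (ltW g20)); exact: g2m.
have i0 := normal_pdf_integrable s mg2 g2n.
have i1 := integrableRZl A measurableT i0.
have j0 := normal_pdf_shift_integrable k sn0.
have i2 := integrableRZl B measurableT j0.
have i3 : mu.-integrable setT (EFin \o fun a => A * (g2 a * normal_pdf 0 s a) +
    B * normal_pdf 0 s (a + k)).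
  by have := integrableD measurableT i1 i2; apply: eq_integrable.
have -> : A * gmean s g2 + B = \int[mu]_a (A * (g2 a * normal_pdf 0 s a) +
    B * normal_pdf 0 s (a + k)).
  rewrite (RintegralD measurableT i1 i2) (RintegralZl _ measurableT i0).
  rewrite (RintegralZl _ measurableT j0).
  by rewrite [X in B * X]/Rintegral (integral_normal_pdf_shift k sn0) mulr1.
rewrite transg => ptw; apply: le_Rintegral; [exact: measurableT| |exact: i3|by move=> a _; exact: ptw].
  have mh : measurable_fun setT (fun a : R => a + h) by exact: measurable_funD.
  apply: (le_integrable _ _ _ i3); first exact: measurableT.
    apply/measurable_EFinP; apply: measurable_funM.
      exact: (measurableT_comp mg1 mh).
    by apply: (measurableT_comp _ mh); exact: measurable_normal_pdf.
  move=> a _ /=; have /andP[g10 _] := g1M (a + h).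
  rewrite lee_fin (ger0_norm (mulr_ge0 g10 (normal_pdf_ge0 0 s (a + h)))).
  by apply: le_trans (ptw a) (ler_norm _).
Qed.

(* Shifting the argument of [g1] by [h] costs the density of [N(-h, s^2)] with
   respect to [N(0, s^2)], whose conjugate moment is explicit; Hoelder's
   inequality then compares the two Gaussian means. *)
Lemma gauss_harnack (s p h Gam M : R) (g1 g2 : R -> R) : 0 < s -> 1 < p ->
  continuous g1 -> measurable_fun setT g2 ->
  (forall a, 0 <= g1 a <= M) -> (forall a, 0 < g2 a <= M) -> 0 < gmean s g2 ->
  (forall a, g1 (a + h) `^ p <= g2 a * expR Gam) ->
  gmean s g1 `^ p <= gmean s g2 * expR (Gam + p / (2 * (p - 1)) * h ^+ 2 / s ^+ 2).
Proof.
move=> s0 p1 cg1 mg2 g1M g2M U0 g12.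
have p0 : 0 < p by lra.
have sn0 : s != 0 by rewrite gt_eqF.
pose q := p / (p - 1).
have q0 : 0 < q by rewrite divr_gt0// subr_gt0.
have pq : p^-1 + q^-1 = 1.
  by rewrite /q invf_div; field; rewrite gt_eqF.
pose U := gmean s g2; rewrite -/U in U0 *.
(* [e 1] is the moment of order [q] of the density ratio [r], namely
   [exp (q (q - 1) h^2 / (2 s^2))]; the argument [x] gives its powers. *)
pose e (x : R) := expR (2^-1 * q * (q - 1) * h ^+ 2 / s ^+ 2 * x).
pose r a := expR (- (a * h / s ^+ 2) - h ^+ 2 / (2 * s ^+ 2)).
have rq a : r a `^ q * normal_pdf 0 s a = e 1 * normal_pdf 0 s (a + q * h).
  rewrite normal_pdf_shift// [in RHS]mulrCA [RHS]mulrC; congr (_ * _).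
  rewrite /r /e -expRM -expRD; congr expR; field.
  by rewrite sn0.
pose K := expR (Gam / p) * U `^ p^-1 * e q^-1.
have K0 : 0 <= K by rewrite !mulr_ge0 ?expR_ge0 ?powR_ge0.
have ptw a : g1 (a + h) * normal_pdf 0 s (a + h) <=
    K * ((U^-1 / p) * (g2 a * normal_pdf 0 s a) + q^-1 * normal_pdf 0 s (a + q * h)).
  have /andP[g20 _] := g2M a; have /andP[g10 _] := g1M (a + h).
  have b1 := le_powR_root p0 g10 (ltW g20) (g12 a).
  have e10 : 0 < e 1 by exact: expR_gt0.
  have r0 : 0 < r a by exact: expR_gt0.
  have Y := young_scaled (ltW g20) (ltW r0) U0 e10 p0 q0 pq.
  have e1q : e 1 `^ q^-1 = e q^-1 by rewrite /e -expRM mulr1.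
  rewrite e1q in Y.
  have n0 := normal_pdf_ge0 0 s a.
  rewrite (normal_pdf_shift h a sn0) -/(r a).
  apply: (@le_trans _ _ (g2 a `^ p^-1 * expR (Gam / p) * (normal_pdf 0 s a * r a))).
    exact: (ler_wpM2r (mulr_ge0 n0 (ltW r0)) b1).
  have -> : normal_pdf 0 s (a + q * h) = r a `^ q * normal_pdf 0 s a / e 1.
    by rewrite rq [e 1 * _]mulrC mulfK// gt_eqF.
  have eG := expR_ge0 (Gam / p).
  have Y3 := ler_wpM2l (mulr_ge0 eG n0) Y.
  rewrite /K.
  have -> : g2 a `^ p^-1 * expR (Gam / p) * (normal_pdf 0 s a * r a) =
     expR (Gam / p) * normal_pdf 0 s a * (g2 a `^ p^-1 * r a) by ring.
  apply: (le_trans Y3).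
  by rewrite le_eqVlt; apply/orP; left; apply/eqP; ring.
have GK : gmean s g1 <= K.
  have -> : K = K * (U^-1 / p) * gmean s g2 + K * q^-1.
    by rewrite -/U -mulrA (mulrAC U^-1) mulVf ?gt_eqF// mul1r -mulrDr pq mulr1.
  apply: (@gmean_le_shift s h (q * h) M) => // a.
  by rewrite -(mulrA K (U^-1 / p)) -(mulrA K q^-1) -mulrDr; exact: ptw.
have G0 : 0 <= gmean s g1 by apply: gmean_ge0 => a; case/andP: (g1M a).
have := ge0_ler_powR (ltW p0) (_ : _ \in Num.nneg) (_ : _ \in Num.nneg) GK.
rewrite !nnegrE G0 K0 => /(_ isT isT) /le_trans; apply.
rewrite /K !powRM ?mulr_ge0 ?expR_ge0 ?powR_ge0//.
rewrite -powRrM mulVf ?gt_eqF// powRr1 ?(ltW U0)// -!expRM divfK ?gt_eqF//.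
rewrite mulrAC -expRD mulrC le_eqVlt; apply/orP; left; apply/eqP.
congr (_ * expR (_ + _)); rewrite /q; field.
by rewrite sn0 !gt_eqF// subr_gt0.
Qed.
End gauss.

(** * Euler steps of the projected Galerkin system *)

Lemma cvg_seq_sum {R : realType} (r : seq nat) (f : nat -> nat -> R) (l : nat -> R) :
  (forall n, n \in r -> (fun k => f k n) @ \oo --> l n) ->
  (fun k => \sum_(n <- r) f k n) @ \oo --> \sum_(n <- r) l n.
Proof.
elim: r => [|a r IH] h.
  rewrite big_nil; under eq_fun do rewrite big_nil; exact: cvg_cst.
rewrite big_cons; under eq_fun do rewrite big_cons.
apply: cvgD; first by apply: h; rewrite mem_head.
by apply: IH => n nr; apply: h; rewrite in_cons nr orbT.
Qed.

Section quadratic_form.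
Context {R : realType}.
Variables (m : nat) (w : nat -> R).
Hypothesis w0 : forall n, (1 <= n <= m)%N -> 0 < w n.
Implicit Types x y z v : nat -> R.

Definition ip x y : R := \sum_(1 <= n < m.+1) w n * (x n * y n).
Definition nrm2 x : R := ip x x.

Lemma ipC x y : ip x y = ip y x.
Proof. by apply: eq_bigr => n _; rewrite [x n * _]mulrC. Qed.

Lemma ipDl x y z : ip (x + y) z = ip x z + ip y z.
Proof. by rewrite /ip -big_split/=; apply: eq_bigr => n _; rewrite !fctE; ring. Qed.

Lemma ipZl (a : R) x z : ip (fun n => a * x n) z = a * ip x z.
Proof. by rewrite /ip mulr_sumr; apply: eq_bigr => n _; ring. Qed.

Lemma ipNl x z : ip (- x) z = - ip x z.
Proof. by rewrite /ip -sumrN; apply: eq_bigr => n _; rewrite !fctE; ring. Qed.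

Lemma ipDr x y z : ip x (y + z) = ip x y + ip x z.
Proof. by rewrite ipC ipDl !(ipC x). Qed.

Lemma ipZr (a : R) x z : ip x (fun n => a * z n) = a * ip x z.
Proof. by rewrite ipC ipZl ipC. Qed.

Lemma ipNr x z : ip x (- z) = - ip x z.
Proof. by rewrite ipC ipNl ipC. Qed.

Lemma eq_ip x x' y y' : (forall n, (1 <= n <= m)%N -> x n = x' n) ->
  (forall n, (1 <= n <= m)%N -> y n = y' n) -> ip x y = ip x' y'.
Proof.
move=> xx yy; rewrite /ip big_nat_cond [RHS]big_nat_cond; apply: eq_bigr => n.
by rewrite andbT ltnS => nm; rewrite xx// yy.
Qed.

Lemma nrm2_ge0 x : 0 <= nrm2 x.
Proof.
rewrite /nrm2 /ip big_nat_cond; apply: sumr_ge0 => n.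
by rewrite andbT ltnS => nm; rewrite mulr_ge0 ?(ltW (w0 nm))// -expr2 sqr_ge0.
Qed.

Lemma nrm2D x y : nrm2 (x + y) = nrm2 x + 2 * ip x y + nrm2 y.
Proof. by rewrite /nrm2 ipDl !ipDr (ipC y x); ring. Qed.

Lemma nrm2B x y : nrm2 (x - y) = nrm2 x - 2 * ip x y + nrm2 y.
Proof. by rewrite nrm2D ipNr /nrm2 ipNl ipNr; ring. Qed.

Lemma nrm2Z (a : R) x : nrm2 (fun n => a * x n) = a ^+ 2 * nrm2 x.
Proof. by rewrite /nrm2 ipZl ipZr; ring. Qed.

Lemma nrm2BC x y : nrm2 (x - y) = nrm2 (y - x).
Proof. by rewrite !nrm2B (ipC x); ring. Qed.

Lemma ip_le x y : 2 * ip x y <= nrm2 x + nrm2 y.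
Proof. by have := nrm2_ge0 (x - y); rewrite nrm2B; lra. Qed.

Lemma nrm2D_le x y : nrm2 (x + y) <= 2 * nrm2 x + 2 * nrm2 y.
Proof. by rewrite nrm2D; have := ip_le x y; lra. Qed.

Lemma coord_le x n : (1 <= n <= m)%N -> w n * x n ^+ 2 <= nrm2 x.
Proof.
move=> nm; have nm' : n \in index_iota 1 m.+1 by rewrite mem_index_iota ltnS.
rewrite /nrm2 /ip (bigD1_seq n nm') ?iota_uniq//= -expr2 lerDl.
rewrite big_nat_cond; apply: sumr_ge0 => i.
by rewrite ltnS => /andP[im _]; rewrite mulr_ge0 ?(ltW (w0 im))// -expr2 sqr_ge0.
Qed.

Definition dist2 x y : R := Num.sqrt (nrm2 (x - y)).

Lemma dist2_ge0 x y : 0 <= dist2 x y. Proof. exact: sqrtr_ge0. Qed.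

Lemma coord_dist x y n : (1 <= n <= m)%N ->
  `|x n - y n| <= (Num.sqrt (w n))^-1 * dist2 x y.
Proof.
move=> nm; have wn := w0 nm.
rewrite -[X in X <= _]mul1r -(mulVf (_ : Num.sqrt (w n) != 0)); last first.
  by rewrite gt_eqF// sqrtr_gt0.
rewrite -mulrA ler_pM2l ?invr_gt0 ?sqrtr_gt0//.
rewrite -sqrtr_sqr -sqrtrM ?(ltW wn)// ler_sqrt ?nrm2_ge0//.
by have := coord_le (x - y) nm; rewrite !fctE.
Qed.

Lemma nrm2_sum_le x (B : R) : (forall n, (1 <= n <= m)%N -> `|x n| <= B) ->
  nrm2 x <= (\sum_(1 <= n < m.+1) w n) * B ^+ 2.
Proof.
move=> xB; rewrite /nrm2 /ip mulr_suml big_nat_cond [leRHS]big_nat_cond.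
apply: ler_sum => n; rewrite andbT ltnS => nm; rewrite ler_wpM2l ?(ltW (w0 nm))//.
rewrite -expr2 -[leLHS]real_normK ?num_real// ler_pXn2r ?nnegrE//; first exact: xB.
by apply: le_trans (normr_ge0 _) (xB _ nm).
Qed.

Section projection.
Variable C : set (nat -> R).
Hypothesis C_ext : forall x y, (forall n, (1 <= n <= m)%N -> x n = y n) -> C x -> C y.
Hypothesis C_convex : forall x y (s : R), 0 <= s <= 1 -> C x -> C y ->
  C (fun n => x n + s * (y n - x n)).
Hypothesis C_closed : forall (u : nat -> nat -> R) x, (forall k, C (u k)) ->
  (forall n, (1 <= n <= m)%N -> (fun k => u k n) @ \oo --> x n) -> C x.
Hypothesis C_ne : C !=set0.

Lemma parallelogram (a x y : nat -> R) : nrm2 (x - y) =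
  2 * nrm2 (a - x) + 2 * nrm2 (a - y) -
  4 * nrm2 (a - (fun n => x n + 2^-1 * (y n - x n))).
Proof.
rewrite /nrm2 /ip !mulr_sumr -sumrN -!big_split/=; apply: eq_bigr => n _.
by rewrite !fctE; field.
Qed.

(** A minimising sequence is Cauchy by the parallelogram law at the midpoint, which convexity keeps
    in [C]; its coordinates 1 to [m] converge because the weights are positive. *)
Lemma projection_exists (a : nat -> R) : exists p, C p /\
  forall v, C v -> nrm2 (a - p) <= nrm2 (a - v).
Proof.
pose E := [set nrm2 (a - v) | v in C].
have Elb : lbound E 0 by move=> _ [v _ <-]; exact: nrm2_ge0.
have Ehlb : has_inf E.
  by split; [case: C_ne => v Cv; exists (nrm2 (a - v)); exists v|exists 0].
pose dd := inf E.
have dle v : C v -> dd <= nrm2 (a - v) by move=> Cv; apply: ge_inf => //; [exists 0|exists v].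
have /choice[u hu] : forall k : nat, exists v, C v /\ nrm2 (a - v) < dd + k.+1%:R^-1.
  move=> k; have k0 : 0 < k.+1%:R^-1 :> R by rewrite invr_gt0.
  by have [_ [v Cv <-] h] := inf_adherent k0 Ehlb; exists v.
have dist_u k l : nrm2 (u k - u l) <= 2 * k.+1%:R^-1 + 2 * l.+1%:R^-1.
  rewrite (parallelogram a).
  have h01 : 0 <= (2 : R)^-1 <= 1 by apply/andP; split; lra.
  move: (dle _ (C_convex h01 (hu k).1 (hu l).1)) (hu k).2 (hu l).2.
  set A1 := nrm2 (a - u k); set A2 := nrm2 (a - u l); set A3 := nrm2 _.
  set k1 := k.+1%:R^-1; set l1 := l.+1%:R^-1; lra.
have cvg_u n : (1 <= n <= m)%N -> cvgn (fun k => u k n).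
  move=> nm; apply/cauchy_cvgP/cauchy_exP => e e0.
  have wn := w0 nm.
  pose N := (Num.truncn (4 / (w n * e ^+ 2))).+1.
  have hN k : (N <= k)%N -> 4 / (w n * e ^+ 2) < k.+1%:R.
    move=> Nk; apply: lt_le_trans (truncnS_gt _) _.
    by rewrite ler_nat; exact: leqW.
  have p0 : 0 < w n * e ^+ 2 by rewrite mulr_gt0// exprn_gt0.
  exists (u N n), N => // l /= Nl; rewrite /ball/=.
  have hk := hN N (leqnn N); have hl := hN l Nl.
  rewrite ltr_pdivrMr// -ltr_pdivrMl ?ltr0n// mulrC in hk.
  rewrite ltr_pdivrMr// -ltr_pdivrMl ?ltr0n// mulrC in hl.
  have h2 : 2 * N.+1%:R^-1 + 2 * l.+1%:R^-1 < w n * e ^+ 2.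
    move: hk hl; set k1 := N.+1%:R^-1; set l1 := l.+1%:R^-1; lra.
  have := le_lt_trans (le_trans (coord_le (u N - u l) nm) (dist_u N l)) h2.
  rewrite !fctE ltr_pM2l// => h.
  by rewrite -(@ltr_pXn2r _ 2) ?nnegrE ?(ltW e0)// real_normK ?num_real.
pose p n : R := limn (fun k => u k n).
have Cp : C p by apply: (C_closed (fun k => (hu k).1)) => n nm; exact: cvg_u.
exists p; split => // v Cv.
apply: le_trans (dle v Cv).
have cN : (fun k => nrm2 (a - u k)) @ \oo --> nrm2 (a - p).
  apply: cvg_seq_sum => n; rewrite mem_index_iota ltnS => nm.
  have cn : (fun k => (a - u k) n) @ \oo --> (a - p) n.
    by rewrite !fctE; apply: cvgB; [exact: cvg_cst|exact: cvg_u].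
  by apply: cvgM; [exact: cvg_cst|exact: cvgM].
have cd : (fun k : nat => dd + k.+1%:R^-1) @ \oo --> dd.
  by rewrite -[X in _ --> X]addr0; apply: cvgD; [exact: cvg_cst|exact: cvg_harmonic].
rewrite -(cvg_lim (@Rhausdorff R) cN) -(cvg_lim (@Rhausdorff R) cd).
apply: ler_lim; [by apply/cvg_ex; eexists; exact: cN|by apply/cvg_ex; eexists; exact: cd|].
by apply: nearW => k; exact: ltW (hu k).2.
Qed.

(** Only the coordinates 1 to [m] of the chosen point are determined; [nrm2] does not see the
    others. *)
Definition proj (a : nat -> R) : nat -> R := sval (cid (projection_exists a)).

Lemma proj_in a : C (proj a).
Proof. by rewrite /proj; case: cid => p []. Qed.

Lemma proj_ip (a v : nat -> R) : C v -> ip (a - proj a) (v - proj a) <= 0.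
Proof.
move=> Cv; rewrite /proj; case: cid => p /= [Cp pmin].
set e := ip _ _; rewrite leNgt; apply/negP => e0.
pose N := nrm2 (v - p).
have N0 : 0 <= N by exact: nrm2_ge0.
(* This step satisfies [s <= 1] and [s N <= e], so moving from [p] towards [v] by the fraction [s]
   would change the squared distance by [s^2 N - 2 s e < 0]. *)
pose s := e / (N + e).
have Ne : 0 < N + e by lra.
have s0 : 0 < s by exact: divr_gt0.
have s1 : s <= 1 by rewrite ler_pdivrMr// mul1r; lra.
have sN : s * N <= e.
  by rewrite /s mulrAC ler_pdivrMr// ler_wpM2l//; lra.
have s01 : 0 <= s <= 1 by rewrite (ltW s0).
have := pmin _ (C_convex s01 Cp Cv).
have -> : nrm2 (a - (fun n => p n + s * (v n - p n))) =
    nrm2 (a - p) - 2 * s * e + s ^+ 2 * N.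
  rewrite /N /e /nrm2 /ip !mulr_sumr -sumrN -!big_split/=; apply: eq_bigr => n _.
  by rewrite !fctE; ring.
nra.
Qed.

(** Adding the variational inequalities at [a] and at [b] bounds the squared distance of the
    projections by the inner product of [a - b] with their difference. *)
Lemma proj_nonexp (a b : nat -> R) : nrm2 (proj a - proj b) <= nrm2 (a - b).
Proof.
have h1 := @proj_ip a _ (proj_in b); have h2 := @proj_ip b _ (proj_in a).
have h3 := ip_le (a - b) (proj a - proj b).
have E : ip (a - proj a) (proj b - proj a) + ip (b - proj b) (proj a - proj b) =
    nrm2 (proj a - proj b) - ip (a - b) (proj a - proj b).
  rewrite /nrm2 /ip -sumrN -!big_split/=; apply: eq_bigr => n _; rewrite !fctE; ring.
lra.
Qed.
End projection.
End quadratic_form.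

(** * Galerkin drift, regularized logarithm and admissible states *)

Section drift.
Context {R : realType}.
Local Notation mu := (@lebesgue_measure R).
Local Notation I01 := (`[0, 1]%classic : set R).

Definition nu (n : nat) : R := n%:R * pi.

Lemma nu_ge0 n : 0 <= nu n.
Proof. by apply: mulr_ge0; [exact: ler0n|exact: pi_ge0]. Qed.

Lemma nu_gt0 n : (0 < n)%N -> 0 < nu n.
Proof. by move=> n0; rewrite mulr_gt0 ?ltr0n// pi_gt0. Qed.

Lemma nu_le n m : (n <= m)%N -> nu n <= nu m.
Proof. by move=> nm; rewrite ler_wpM2r ?pi_ge0// ler_nat. Qed.

(** [nu^-2] is the weight of the norm of order -1 and cancels the outer operator of the drift; what
    is left, [rho], is the multiplier of the Fejer mean. *)
Definition wt (m n : nat) : R := rho m n / nu n ^+ 2.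

Lemma wt_gt0 m n : (1 <= n <= m)%N -> 0 < wt m n.
Proof.
by move=> /andP[n1 nm]; rewrite divr_gt0 ?rho_gt0// exprn_gt0// nu_gt0.
Qed.

(** Coordinate 0 carries the conserved mass and takes no part in the dynamics. *)
Definition ext (c : R) (X : nat -> R) (n : nat) : R := if n is 0%N then c else X n.

Lemma coefS_bounded (g : R -> R) (G : R) n : measurable_fun I01 g ->
  (forall x, I01 x -> `|g x| <= G) -> `|coef g n| <= 2 * G.
Proof.
move=> mg gG.
have G0 : 0 <= G by apply: le_trans (gG 0 _); rewrite //= in_itv/= lexx ler01.
have mge : measurable_fun I01 (fun x => g x * eigen n x).
  by apply: measurable_funM => //; exact: measurable_eigen.
have bd x : I01 x -> `|g x * eigen n x| <= 2 * G.
  by move=> Ix; rewrite normrM mulrC ler_pM// ?eigen_bound// gG.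
have ig : mu.-integrable I01 (EFin \o (fun x => g x * eigen n x)).
  exact: bounded_integrable01 mge bd.
have i1 : mu.-integrable I01 (EFin \o (fun=> 2 * G)).
  by apply: (@bounded_integrable01 _ _ `|2 * G|); [exact: measurable_cst|].
rewrite /coef /inner; apply: le_trans (le_normr_Rintegral measurable01 ig) _.
have -> : 2 * G = \int[mu]_(x in I01) (2 * G).
  rewrite (Rintegral_cst _ measurable01) -[X in (fine X)]/(mu I01) mu01 /=; ring.
apply: (@le_Rintegral _ _ _ mu I01 _ _ measurable01 _ i1); last exact: bd.
exact: (integrable_norm ig).
Qed.

Lemma coef_sum_bounded (v : R -> R) (s : seq nat) (c : nat -> R) (G : R) :
  measurable_fun I01 v -> (forall x, I01 x -> `|v x| <= G) ->
  \int[mu]_(x in I01) (v x * (\sum_(n <- s) c n * eigen n x)) =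
  \sum_(n <- s) c n * coef v n.
Proof.
move=> mv vG.
pose G1 := `|G| + 1.
have G10 : 0 < G1 by rewrite ltr_wpDl.
pose v1 x := G1^-1 * v x.
have b1 : bfun v1.
  split; first exact: measurable_funM.
  move=> x Ix; rewrite /v1 normrM gtr0_norm ?invr_gt0// ler_pdivrMl// mulr1.
  by apply: le_trans (vG _ Ix) _; rewrite (le_trans (ler_norm _))// /G1 lerDl.
have int1 (g : R -> R) (B : R) : measurable_fun I01 g -> (forall x, I01 x -> `|g x| <= B) ->
    \int[mu]_(x in I01) (v x * g x) = G1 * \int[mu]_(x in I01) (v1 x * g x).
  move=> mg gB; rewrite -RintegralZl//; last exact: (bfun_integrable b1 mg gB).
  by apply: eq_Rintegral => x _; rewrite /v1 !mulrA divff ?mul1r// gt_eqF.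
have mS : measurable_fun I01 (fun x => \sum_(n <- s) c n * eigen n x).
  apply: measurable_sum => n; apply: measurable_funM => //.
  exact: measurable_eigen.
rewrite (int1 _ (\sum_(n <- s) `|c n| * 2) mS).
  rewrite coef_sum// mulr_sumr; apply: eq_bigr => n _.
  rewrite [coef v n](int1 _ 2 (@measurable_eigen R n I01)) /coef /inner; first ring.
  by move=> x _; exact: eigen_bound.
move=> x _; apply: le_trans (ler_norm_sum _ _ _) _.
by apply: ler_sum => n _; rewrite normrM ler_wpM2l// eigen_bound.
Qed.

Section beta.
Variable a : R.
Hypothesis a01 : 0 < a < 1.

Definition clamp (v : R) : R := Num.max (-1) (Num.min 1 v).

Lemma clamp_bound v : -1 <= clamp v <= 1.
Proof. by rewrite /clamp le_max lexx/= ge_max ge_min lexx/= andbT; lra. Qed.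

Lemma clamp_norm v : `|clamp v| <= 1.
Proof. by rewrite ler_norml; exact: clamp_bound. Qed.

Lemma clamp_id v : `|v| <= 1 -> clamp v = v.
Proof.
rewrite ler_norml => /andP[v1 v2]; rewrite /clamp.
by rewrite min_r// max_r.
Qed.

Lemma clamp_le u v : u <= v -> clamp u <= clamp v.
Proof.
move=> uv; rewrite /clamp ge_max le_max lexx/= le_max; apply/orP; right.
by rewrite le_min ge_min lexx/= ge_min uv orbT.
Qed.

(** The logarithm of the free energy at [a * clamp v]. As [a < 1], it is bounded and Lipschitz; it
    stays nonincreasing, and its modulus stays below that of the logarithm while [a] tends to 1. *)
Definition beta (v : R) : R := ln (1 - a * clamp v) - ln (1 + a * clamp v).

Let pos v : 0 < 1 - a * clamp v /\ 0 < 1 + a * clamp v.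
Proof. by have := clamp_bound v; move: a01 => /andP[? ?] /andP[? ?]; split; nra. Qed.

Lemma beta_le u v : u <= v -> beta v <= beta u.
Proof.
move=> /clamp_le uv; rewrite /beta.
have [u1 u2] := pos u; have [v1 v2] := pos v.
have a0 : 0 < a by case/andP: a01.
have := ler_wpM2l (ltW a0) uv => h.
apply: lerB; rewrite ler_ln ?posrE//; lra.
Qed.

Lemma ln_lip (e x y : R) : 0 < e -> e <= x -> e <= y -> `|ln x - ln y| <= `|x - y| / e.
Proof.
move=> e0; wlog yx : x y / y <= x.
  move=> W ex ey; case: (leP y x) => h; first exact: W.
  by rewrite distrC (distrC x); apply: W => //; exact: ltW.
move=> ex ey; have x0 : 0 < x by lra. have y0 : 0 < y by lra.
rewrite !ger0_norm ?subr_ge0// ?ler_ln//.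
have -> : ln x - ln y = ln (1 + (x / y - 1)).
  by rewrite addrCA subrr addr0 ln_div.
have h : -1 < x / y - 1 by have := divr_gt0 x0 y0; lra.
apply: le_trans (le_ln1Dx h) _.
rewrite -[X in _ - X](divff (_ : y != 0)) ?gt_eqF// -mulrBl.
by rewrite ler_wpM2l ?subr_ge0// lef_pV2.
Qed.

(** Also a bound for [beta] itself, because [beta 0 = 0] and the clamped argument has modulus at
    most 1. *)
Definition beta_lip : R := 2 / (1 - a).

Lemma beta_lip_gt0 : 0 < beta_lip.
Proof. by rewrite divr_gt0//; move: a01 => /andP[? ?]; lra. Qed.

Lemma betaL u v : `|beta u - beta v| <= beta_lip * `|u - v|.
Proof.
move: (a01) => /andP[a0 a1].
have cl := clamp_lip (-1) 1 u v; rewrite -/(clamp u) -/(clamp v) in cl.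
have e0 : 0 < 1 - a by lra.
have /andP[u1 u2] := clamp_bound u; have /andP[v1 v2] := clamp_bound v.
have h1 := @ln_lip (1 - a) (1 - a * clamp u) (1 - a * clamp v) e0.
have h2 := @ln_lip (1 - a) (1 + a * clamp u) (1 + a * clamp v) e0.
have {h1} h1 := h1 ltac:(nra) ltac:(nra).
have {h2} h2 := h2 ltac:(nra) ltac:(nra).
have E1 : `|1 - a * clamp u - (1 - a * clamp v)| <= `|u - v|.
  have -> : 1 - a * clamp u - (1 - a * clamp v) = - (a * (clamp u - clamp v)) by ring.
  rewrite normrN normrM gtr0_norm//; apply: le_trans cl.
  by rewrite ler_piMl// ltW.
have E2 : `|1 + a * clamp u - (1 + a * clamp v)| <= `|u - v|.
  have -> : 1 + a * clamp u - (1 + a * clamp v) = a * (clamp u - clamp v) by ring.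
  rewrite normrM gtr0_norm//; apply: le_trans cl.
  by rewrite ler_piMl// ltW.
have -> : beta u - beta v = (ln (1 - a * clamp u) - ln (1 - a * clamp v)) -
   (ln (1 + a * clamp u) - ln (1 + a * clamp v)) by rewrite /beta; ring.
apply: le_trans (ler_normB _ _) _.
have -> : beta_lip * `|u - v| = `|u - v| / (1 - a) + `|u - v| / (1 - a).
  by rewrite /beta_lip; field; rewrite gt_eqF.
apply: lerD; [apply: le_trans h1 _|apply: le_trans h2 _];
  by rewrite ler_wpM2r// invr_ge0 ltW.
Qed.

Lemma beta_clamp v : beta (clamp v) = beta v.
Proof. by rewrite /beta [in clamp (clamp v)]clamp_id// clamp_norm. Qed.

Lemma beta0 : beta 0 = 0.
Proof. by rewrite /beta clamp_id ?normr0// mulr0 subr0 addr0 subrr. Qed.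

Lemma beta_bounded v : `|beta v| <= beta_lip.
Proof.
rewrite -beta_clamp; have := betaL (clamp v) 0; rewrite beta0 !subr0 => h.
by apply: le_trans h _; rewrite ler_piMr ?clamp_norm// ltW// beta_lip_gt0.
Qed.

Lemma continuous_beta : continuous beta.
Proof.
move=> x; apply/(@cvgrPdist_le _ _ _ _ (nbhs_filter x)) => e e0.
have d0 : 0 < e / beta_lip by rewrite divr_gt0// beta_lip_gt0.
near=> y; apply: le_trans (betaL _ _) _.
rewrite -ler_pdivlMl ?beta_lip_gt0// mulrC; near: y.
by apply: cvgr_dist_le => //; exact: cvg_id.
Unshelve. all: by end_near. Qed.

(** Both logarithms move away from 0 as [a] increases to 1, so the unregularized logarithm is the
    majorant for dominated convergence. *)
Lemma beta_log (v : R) : -1 < v < 1 -> `|beta v| <= `|ln ((1 - v) / (1 + v))|.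
Proof.
move=> /andP[v1 v2]; move: (a01) => /andP[a0 a1].
rewrite /beta clamp_id; last by rewrite ler_norml; apply/andP; split; lra.
rewrite ln_div ?posrE; [|lra|lra].
have l (x y : R) : 0 < x -> x <= y -> ln x <= ln y.
  by move=> x0 xy; rewrite ler_ln ?posrE//; lra.
case: (leP 0 v) => v0.
  have h1 := l (1 - v) (1 - a * v) ltac:(lra) ltac:(nra).
  have h2 := l (1 + a * v) (1 + v) ltac:(nra) ltac:(nra).
  have h3 := l (1 - a * v) (1 + a * v) ltac:(nra) ltac:(nra).
  by rewrite !ler0_norm; lra.
have h1 := l (1 + v) (1 + a * v) ltac:(lra) ltac:(nra).
have h2 := l (1 - a * v) (1 - v) ltac:(nra) ltac:(nra).
have h3 := l (1 + a * v) (1 - a * v) ltac:(nra) ltac:(nra).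
by rewrite !ger0_norm; lra.
Qed.

Lemma measurable_beta D (g : R -> R) : measurable_fun D g -> measurable_fun D (beta \o g).
Proof.
move=> mg; apply: measurableT_comp => //.
exact: continuous_measurable_fun continuous_beta.
Qed.
End beta.

Section state.
Variables (c : R) (m : nat).
Hypothesis c1 : `|c| < 1.

Definition field (X : nat -> R) (x : R) : R := fejer m (ext c X) x.

Lemma fieldE X x : field X x = c + \sum_(1 <= n < m.+1) rho m n * X n * eigen n x.
Proof.
rewrite /field /fejer big_ltn// rho0 eigen0 !mul1r mulr1; congr (_ + _).
by rewrite big_nat_cond [RHS]big_nat_cond; apply: eq_bigr => -[].
Qed.

Lemma field_diff X Y x : field X x - field Y x =
  \sum_(1 <= n < m.+1) rho m n * (X n - Y n) * eigen n x.
Proof.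
rewrite !fieldE opprD addrACA subrr add0r -sumrB; apply: eq_bigr => n _; ring.
Qed.

Definition admissible : set (nat -> R) := [set X | forall x, I01 x -> `|field X x| <= 1].

Lemma admissible_ext X Y : (forall n, (1 <= n <= m)%N -> X n = Y n) ->
  admissible X -> admissible Y.
Proof.
move=> XY AX x Ix; suff <- : field X x = field Y x by exact: AX.
apply/eqP; rewrite -subr_eq0 field_diff big_nat_cond big1// => n.
by rewrite andbT ltnS => nm; rewrite XY// subrr mulr0 mul0r.
Qed.

Lemma admissible_convex X Y (s : R) : 0 <= s <= 1 -> admissible X -> admissible Y ->
  admissible (fun n => X n + s * (Y n - X n)).
Proof.
move=> /andP[s0 s1] AX AY x Ix.
have -> : field (fun n => X n + s * (Y n - X n)) x =
    (1 - s) * field X x + s * field Y x.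
  have -> : (1 - s) * field X x + s * field Y x =
     field X x + s * (field Y x - field X x) by ring.
  rewrite field_diff !fieldE -addrA; congr (_ + _).
  by rewrite mulr_sumr -big_split/=; apply: eq_bigr => n _; ring.
move: (AX x Ix) (AY x Ix); rewrite !ler_norml => /andP[? ?] /andP[? ?].
by apply/andP; split; nra.
Qed.

Lemma admissible_closed (u : nat -> nat -> R) X : (forall k, admissible (u k)) ->
  (forall n, (1 <= n <= m)%N -> (fun k => u k n) @ \oo --> X n) -> admissible X.
Proof.
move=> Au uX x Ix.
have h : (fun k => field (u k) x) @ \oo --> field X x.
  rewrite fieldE; under eq_fun do rewrite fieldE.
  apply: cvgD; first exact: cvg_cst.
  apply: cvg_seq_sum => n; rewrite mem_index_iota ltnS => nm.
  by apply: cvgM; [apply: cvgM; [exact: cvg_cst|exact: uX]|exact: cvg_cst].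
rewrite ler_norml; apply/andP; split.
  apply: (closed_cvg (fun y : R => -1 <= y)) h; first exact: closed_ge.
  by apply: nearW => k; move: (Au k x Ix); rewrite ler_norml => /andP[].
apply: (closed_cvg (fun y : R => y <= 1)) h; first exact: closed_le.
by apply: nearW => k; move: (Au k x Ix); rewrite ler_norml => /andP[].
Qed.

Lemma admissible0 : admissible (fun=> 0).
Proof.
move=> x _; rewrite fieldE big1 ?addr0 ?ltW// => n _.
by rewrite mulr0 mul0r.
Qed.

Lemma measurable_field X D : measurable_fun D (field X).
Proof. exact: measurable_fejer. Qed.

Definition pr := proj (@wt_gt0 m) admissible_convex admissible_closed
  (ex_intro _ _ admissible0).

Section drift_map.
Variables (a lam : R).
Hypothesis a01 : 0 < a < 1.

(** Mode [n] of [-1/2 A (A X + lam X + beta (field X))]. Only the nonlinearity sees the Fejer mean;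
    the linear terms act on the modes themselves, which keeps their contraction rates exact. *)
Definition drift (X : nat -> R) (n : nat) : R :=
  2^-1 * nu n ^+ 2 * ((lam - nu n ^+ 2) * X n + coef (beta a \o field X) n).

Lemma beta_field_diff X Y (n : nat) :
  coef (beta a \o field X) n - coef (beta a \o field Y) n =
  coef (fun x => beta a (field X x) - beta a (field Y x)) n.
Proof.
have mb Z : measurable_fun I01 (beta a \o field Z).
  by apply: measurable_beta => //; exact: measurable_field.
have ib Z : mu.-integrable I01 (EFin \o (fun x => (beta a \o field Z) x * eigen n x)).
  apply: (@bounded_integrable01 _ _ (beta_lip a * 2)).
    by apply: measurable_funM => //; exact: measurable_eigen.
  by move=> x _; rewrite normrM ler_pM// ?eigen_bound//; exact: beta_bounded.
have h := RintegralB measurable01 (ib X) (ib Y).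
transitivity (\int[mu]_(x in I01) ((beta a \o field X) x * eigen n x -
   (beta a \o field Y) x * eigen n x)); first by rewrite h.
by rewrite /coef /inner; apply: eq_Rintegral => x _ /=; ring.
Qed.

(** The weight [rho / nu^2] against the factor [nu^2] of the drift makes the nonlinear contribution
    the integral of the difference of the [beta] terms times the difference of the Fejer means,
    nonpositive because [beta] is nonincreasing. *)
Lemma drift_dissipative X Y : 2 * ip m (wt m) (drift X - drift Y) (X - Y) <=
  - \sum_(1 <= n < m.+1) rho m n * (nu n ^+ 2 - lam) * (X n - Y n) ^+ 2.
Proof.
pose g x := beta a (field X x) - beta a (field Y x).
have mg : measurable_fun I01 g.
  by apply: measurable_funB; apply: measurable_beta => //; exact: measurable_field.
have gG x : I01 x -> `|g x| <= beta_lip a + beta_lip a.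
  by move=> _; apply: le_trans (ler_normB _ _) _; apply: lerD; exact: beta_bounded.
have E : \int[mu]_(x in I01) (g x * (field X x - field Y x)) =
    \sum_(1 <= n < m.+1) rho m n * (X n - Y n) * coef g n.
  rewrite -(coef_sum_bounded _ _ mg gG).
  by apply: eq_Rintegral => x _; rewrite field_diff.
have S0 : \sum_(1 <= n < m.+1) rho m n * (X n - Y n) * coef g n <= 0.
  have ig : mu.-integrable I01 (EFin \o (fun x => g x * (field X x - field Y x))).
    apply: (@bounded_integrable01 _ _ ((beta_lip a + beta_lip a) *
       (\sum_(1 <= n < m.+1) `|rho m n * (X n - Y n)| * 2))).
      by apply: measurable_funM => //; apply: measurable_funB; exact: measurable_field.
    move=> x Ix; rewrite normrM ler_pM ?gG// field_diff.
    apply: le_trans (ler_norm_sum _ _ _) _.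
    by apply: ler_sum => n _; rewrite normrM ler_wpM2l// eigen_bound.
  have i0 : mu.-integrable I01 (EFin \o (fun=> 0)).
    by apply: (@bounded_integrable01 _ _ 0) => [|x _]; [exact: measurable_cst|rewrite normr0].
  have z0 : \int[mu]_(x in I01) (0 : R) = 0 by rewrite (Rintegral_cst _ measurable01) mul0r.
  rewrite -E -[leRHS]z0; apply: (@le_Rintegral _ _ _ mu I01 _ _ measurable01 ig i0) => x _.
  rewrite /g; case: (leP (field X x) (field Y x)) => h.
    by have := beta_le a01 h => h'; apply: mulr_ge0_le0; lra.
  by have := beta_le a01 (ltW h) => h'; apply: mulr_le0_ge0; lra.
rewrite -[leLHS]subr0; apply: le_trans (lerB (lexx _) S0) _.
rewrite -subr_le0 opprK /ip mulr_sumr -sumrB -big_split/= big_nat_cond big1 ?lexx// => n.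
rewrite andbT => /andP[n1 _].
rewrite !fctE /drift -beta_field_diff.
have nn : nu n != 0 by rewrite gt_eqF// nu_gt0.
by rewrite /wt; field.
Qed.

(** All norms on [m] coordinates are comparable. The constant depends on [m] and [a], which is
    harmless because it only restricts the size of the time step. *)
Lemma drift_lipschitz : exists2 L : R, 0 <= L & forall X Y,
  nrm2 m (wt m) (drift X - drift Y) <= L * nrm2 m (wt m) (X - Y).
Proof.
pose q n := (Num.sqrt (wt m n))^-1.
have q0 n : 0 <= q n by rewrite invr_ge0 sqrtr_ge0.
pose Q := \sum_(1 <= n < m.+1) q n.
have Q0 : 0 <= Q by apply: sumr_ge0 => n _.
have qQ n : (1 <= n <= m)%N -> q n <= Q.
  move=> nm; have nm' : n \in index_iota 1 m.+1 by rewrite mem_index_iota ltnS.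
  rewrite /Q (bigD1_seq n nm') ?iota_uniq//= lerDl.
  by apply: sumr_ge0.
pose B := 2^-1 * nu m ^+ 2 * ((nu m ^+ 2 + `|lam|) * Q + 2 * (beta_lip a * (2 * Q))).
have L0 := beta_lip_gt0 a01.
have B0 : 0 <= B.
  have h1 : 0 <= nu m ^+ 2 by exact: sqr_ge0.
  have h2 : 0 <= `|lam| by exact: normr_ge0.
  have h3 := ltW L0.
  have h4 : 0 <= beta_lip a * (2 * Q) by apply: mulr_ge0 => //; exact: mulr_ge0.
  apply: mulr_ge0; first exact: mulr_ge0.
  by apply: addr_ge0; apply: mulr_ge0 => //; exact: addr_ge0.
pose W := \sum_(1 <= n < m.+1) wt m n.
have W0 : 0 <= W.
  rewrite /W big_nat_cond; apply: sumr_ge0 => n; rewrite andbT ltnS => nm.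
  exact: ltW (wt_gt0 nm).
exists (W * B ^+ 2); first by rewrite mulr_ge0// sqr_ge0.
move=> X Y.
have D0 := dist2_ge0 m (wt m) X Y.
have cd n : (1 <= n <= m)%N -> `|X n - Y n| <= q n * dist2 m (wt m) X Y.
  by move=> nm; exact: (coord_dist (@wt_gt0 m)).
have fd x : `|field X x - field Y x| <= 2 * Q * dist2 m (wt m) X Y.
  rewrite field_diff; apply: le_trans (ler_norm_sum _ _ _) _.
  rewrite /Q mulr_sumr mulr_suml big_nat_cond [leRHS]big_nat_cond.
  apply: ler_sum => n; rewrite andbT ltnS => nm.
  have h1 : 0 <= rho m n :> R := rho_ge0 m n; have h2 : rho m n <= 1 :> R := rho_le1 m n.
  rewrite normrM [X in X * _]normrM (ger0_norm h1).
  have h3 := eigen_bound n x.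
  have h4 := cd n nm.
  have -> : 2 * q n * dist2 m (wt m) X Y = 1 * (q n * dist2 m (wt m) X Y) * 2 by ring.
  by apply: ler_pM => //; [exact: mulr_ge0|apply: ler_pM].
have key n : (1 <= n <= m)%N -> `|(drift X - drift Y) n| <= B * dist2 m (wt m) X Y.
  move=> nm; have /andP[n1 nm1] := nm.
  have -> : (drift X - drift Y) n = 2^-1 * nu n ^+ 2 * ((lam - nu n ^+ 2) * (X n - Y n) +
     (coef (beta a \o field X) n - coef (beta a \o field Y) n)).
    by rewrite !fctE /drift; ring.
  rewrite beta_field_diff.
  have hc : `|coef (fun x => beta a (field X x) - beta a (field Y x)) n| <=
      2 * (beta_lip a * (2 * Q * dist2 m (wt m) X Y)).
    apply: coefS_bounded.
      by apply: measurable_funB; apply: measurable_beta => //; exact: measurable_field.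
    move=> x _; apply: le_trans (betaL a01 _ _) _.
    by rewrite ler_wpM2l ?(ltW L0)//; exact: fd.
  have hn : nu n ^+ 2 <= nu m ^+ 2 by rewrite ler_pXn2r ?nnegrE ?nu_ge0// nu_le.
  have n20 : 0 <= nu n ^+ 2 by exact: sqr_ge0.
  have -> : B * dist2 m (wt m) X Y = 2^-1 * nu m ^+ 2 *
     ((nu m ^+ 2 + `|lam|) * (Q * dist2 m (wt m) X Y) +
      2 * (beta_lip a * (2 * Q * dist2 m (wt m) X Y))) by rewrite /B; ring.
  rewrite normrM ger0_norm; last exact: mulr_ge0.
  apply: ler_pM => //; first exact: mulr_ge0.
    by rewrite ler_wpM2l.
  apply: le_trans (ler_normD _ _) _; apply: lerD => //.
  rewrite normrM; apply: ler_pM => //.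
    apply: le_trans (ler_normB _ _) _; rewrite addrC (ger0_norm n20).
    by rewrite lerD2r.
  apply: le_trans (cd n nm) _.
  by rewrite ler_wpM2r// qQ.
apply: le_trans (nrm2_sum_le (@wt_gt0 m) key) _.
rewrite -/W exprMn mulrA /dist2 sqr_sqrtr; first exact: lexx.
exact: nrm2_ge0 (@wt_gt0 m) _.
Qed.

End drift_map.
End state.
End drift.

(** * Harnack inequality for the Euler chain *)

Section chain.
Context {R : realType}.
Local Notation mu := (@lebesgue_measure R).
Variables (m : nat) (w s : nat -> R).
Hypothesis w0 : forall n, (1 <= n <= m)%N -> 0 < w n.
Hypothesis s0 : forall n, (1 <= n)%N -> 0 < s n.
Local Notation nrm2 := (nrm2 m w).
Local Notation dist2 := (dist2 m w).
Implicit Types (x y z h : nat -> R) (f g : (nat -> R) -> R).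

Definition upd x (i : nat) (e : R) : nat -> R := fun n => x n + (n == i)%:R * e.

Definition smooth i f x : R := gmean (s i) (fun e => f (upd x i e)).

Fixpoint noise k f : (nat -> R) -> R :=
  if k is k'.+1 then noise k' (smooth k f) else f.

(** A class preserved by [smooth], [noise] and [step] when [lo > 0]. The Lipschitz bound makes such
    an [f] depend on the coordinates 1 to [m] alone, because [dist2] ignores the others. *)
Definition good (lo hi : R) f := (forall x, lo <= f x <= hi) /\
  exists2 L : R, 0 <= L & forall x y, `|f x - f y| <= L * dist2 x y.

Lemma dist2_mono x y x' y' : nrm2 (x - y) <= nrm2 (x' - y') -> dist2 x y <= dist2 x' y'.
Proof. by move=> h; rewrite /dist2 ler_wsqrtr. Qed.

Lemma dist2_upd x i (e1 e2 : R) :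
  dist2 (upd x i e1) (upd x i e2) <= Num.sqrt (\sum_(1 <= n < m.+1) w n) * `|e1 - e2|.
Proof.
have W0 : 0 <= \sum_(1 <= n < m.+1) w n.
  rewrite big_nat_cond; apply: sumr_ge0 => n; rewrite andbT ltnS => nm.
  exact: ltW (w0 nm).
have -> : `|e1 - e2| = Num.sqrt (`|e1 - e2| ^+ 2) by rewrite sqrtr_sqr normr_id.
rewrite -sqrtrM// /dist2; apply: ler_wsqrtr.
apply: nrm2_sum_le => // n _; rewrite /upd !fctE.
have -> : x n + (n == i)%:R * e1 - (x n + (n == i)%:R * e2) = (n == i)%:R * (e1 - e2) by ring.
by case: eqP => _; rewrite ?mul1r ?mul0r ?normr0.
Qed.

Lemma upd_sub x y i (e1 e2 : R) :
  upd x i e1 - upd y i e2 = upd (x - y) i (e1 - e2).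
Proof. by apply/funext => n; rewrite /upd !fctE; ring. Qed.

Lemma upd0 x i : upd x i 0 = x.
Proof. by apply/funext => n; rewrite /upd mulr0 addr0. Qed.

Lemma good_continuous lo hi f x i : good lo hi f -> continuous (fun e => f (upd x i e)).
Proof.
move=> [_ [L L0 fL]] e; apply/(@cvgrPdist_le _ _ _ _ (nbhs_filter e)) => eps eps0.
pose A := L * Num.sqrt (\sum_(1 <= n < m.+1) w n) + 1.
have A0 : 0 < A by rewrite ltr_wpDl// mulr_ge0// sqrtr_ge0.
near=> y; apply: le_trans (fL _ _) _.
apply: (@le_trans _ _ (A * `|e - y|)).
  apply: le_trans (ler_wpM2l L0 (dist2_upd _ _ _ _)) _.
  by rewrite mulrA ler_wpM2r// /A lerDl.
rewrite -ler_pdivlMl// mulrC; near: y.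
by apply: cvgr_dist_le; [exact: cvg_id|exact: divr_gt0].
Unshelve. all: by end_near. Qed.

Lemma good_measurable lo hi f x i : good lo hi f ->
  measurable_fun setT (fun e => f (upd x i e)).
Proof. by move=> gf; apply: continuous_measurable_fun; exact: good_continuous gf. Qed.

Lemma good_norm lo hi f : 0 < lo -> good lo hi f -> forall x, `|f x| <= hi.
Proof.
move=> lo0 [fb _] x; have /andP[f1 f2] := fb x.
by rewrite ger0_norm//; apply: le_trans (ltW lo0) f1.
Qed.

Lemma gmean_cst (t k : R) : gmean t (fun=> k) = k.
Proof.
have h := @gmeanZ R t k (fun=> 1) 1 (@measurable_cst _ _ _ _ _ _).
transitivity (gmean t (fun=> k * 1)); first by rewrite mulr1.
by rewrite h ?gmean1 ?mulr1// => a; rewrite normr1.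
Qed.

Lemma gmean_dist (t M D : R) (g1 g2 : R -> R) : measurable_fun setT g1 ->
  measurable_fun setT g2 -> (forall e, `|g1 e| <= M) -> (forall e, `|g2 e| <= M) ->
  (forall e, `|g1 e - g2 e| <= D) -> `|gmean t g1 - gmean t g2| <= D.
Proof.
move=> m1 m2 b1 b2 d12.
rewrite -(gmeanB _ m1 m2 b1 b2) ler_norml; apply/andP; split.
  rewrite -[leLHS](gmean_cst t).
  apply: (@le_gmean _ t _ _ (`|D| + (M + M))).
  - exact: measurable_cst.
  - exact: measurable_funB.
  - by move=> _; rewrite normrN lerDl addr_ge0// (le_trans _ (b1 0)).
  - move=> e; apply: le_trans (d12 e) _; rewrite (le_trans (ler_norm _))// lerDl.
    by rewrite addr_ge0// (le_trans _ (b1 0)).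
  - by move=> e; move: (d12 e); rewrite ler_norml => /andP[].
rewrite -[leRHS](gmean_cst t).
apply: (@le_gmean _ t _ _ (`|D| + (M + M))).
- exact: measurable_funB.
- exact: measurable_cst.
- move=> e; apply: le_trans (d12 e) _; rewrite (le_trans (ler_norm _))// lerDl.
  by rewrite addr_ge0// (le_trans _ (b1 0)).
- by move=> _; rewrite lerDl addr_ge0// (le_trans _ (b1 0)).
- by move=> e; move: (d12 e); rewrite ler_norml => /andP[].
Qed.

Lemma smooth_good lo hi f i : 0 < lo -> good lo hi f -> good lo hi (smooth i f).
Proof.
move=> lo0 gf; have [fb [L L0 fL]] := gf; have fn := good_norm lo0 gf.
have mf x : measurable_fun setT (fun e => f (upd x i e)) by exact: good_measurable gf.
have lohi : lo <= hi by have /andP[] := fb (fun=> 0); exact: le_trans.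
split; last exists L => // x y.
  move=> x; apply/andP; split; rewrite /smooth.
    rewrite -[leLHS](gmean_cst (s i)); apply: (@le_gmean _ _ _ _ hi) => //.
    - by move=> _; rewrite gtr0_norm.
    - by move=> e; have /andP[] := fb (upd x i e).
  rewrite -[leRHS](gmean_cst (s i)); apply: (@le_gmean _ _ _ _ hi) => //.
  - by move=> _; rewrite gtr0_norm// (lt_le_trans lo0).
  - by move=> e; have /andP[] := fb (upd x i e).
rewrite /smooth; apply: gmean_dist (mf x) (mf y) (fun e => fn _) (fun e => fn _) _ => e.
apply: le_trans (fL _ _) _; rewrite ler_wpM2l//.
by apply: dist2_mono; rewrite upd_sub subrr upd0.
Qed.

Lemma noise_good lo hi f k : 0 < lo -> good lo hi f -> good lo hi (noise k f).
Proof. by move=> lo0; elim: k f => [//|k IH] f gf; apply: IH; exact: smooth_good. Qed.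

Variable p : R.
Hypothesis p1 : 1 < p.
Let cp : R := p / (2 * (p - 1)).

(** The kick of [y] is shifted by [e] while that of [x] is not, so the difference of the two points
    ends up lowered by [e] in coordinate [i]; [gauss_harnack] gives the price of the shift. *)
Lemma smooth_harnack lo hi f g (Gam : (nat -> R) -> R) i (e : R) x y :
  (1 <= i)%N -> 0 < lo -> good lo hi f -> good lo hi g ->
  (forall x y, f y `^ p <= g x * expR (Gam (x - y))) ->
  smooth i f y `^ p <= smooth i g x * expR (Gam (upd (x - y) i (- e)) + cp * e ^+ 2 / s i ^+ 2).
Proof.
move=> i1 lo0 gf gg H; apply: (@gauss_harnack R (s i) p e _ hi) => //.
- exact: s0.
- exact: good_continuous gf.
- exact: good_measurable gg.
- by move=> a; have /andP[h1 h2] := gf.1 (upd y i a); rewrite h2 (le_trans (ltW lo0)).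
- by move=> a; have /andP[h1 h2] := gg.1 (upd x i a); rewrite h2 (lt_le_trans lo0).
- by have /andP[h1 h2] := (smooth_good i lo0 gg).1 x; exact: lt_le_trans h1.
- move=> a; apply: le_trans (H (upd x i a) _) _.
  by rewrite upd_sub opprD addNKr.
Qed.

Definition trunc k h : nat -> R := fun n => if (1 <= n <= k)%N then h n else 0.

(** The kicks are averaged one at a time, so the shifts [h i] can be chosen separately and their
    costs add up. *)
Lemma noise_harnack lo hi f g (Gam : (nat -> R) -> R) k h x y :
  0 < lo -> good lo hi f -> good lo hi g ->
  (forall x y, f y `^ p <= g x * expR (Gam (x - y))) ->
  noise k f y `^ p <= noise k g x *
    expR (Gam (x - y - trunc k h) + \sum_(1 <= i < k.+1) cp * h i ^+ 2 / s i ^+ 2).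
Proof.
move=> lo0; elim: k f g Gam x y => [|k IH] f g Gam x y gf gg H.
  rewrite /= big_geq// addr0; apply: le_trans (H x y) _.
  suff -> : x - y - trunc 0 h = x - y by [].
  by apply/funext => n; rewrite /trunc !fctE; case: n => [|n]; rewrite subr0.
have := IH _ _ (fun z => Gam (upd z k.+1 (- h k.+1)) + cp * h k.+1 ^+ 2 / s k.+1 ^+ 2)
  x y (smooth_good k.+1 lo0 gf) (smooth_good k.+1 lo0 gg)
  (fun x y => @smooth_harnack lo hi f g Gam k.+1 (h k.+1) x y isT lo0 gf gg H).
rewrite /=; congr (_ <= _ * expR _).
suff -> : upd (x - y - trunc k h) k.+1 (- h k.+1) = x - y - trunc k.+1 h.
  by rewrite [in RHS]big_nat_recr//=; ring.
apply/funext => n; rewrite /upd /trunc !fctE; case: eqP => [->|/eqP nk].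
  by rewrite !ltnn/= leqnn subr0 mul1r.
by rewrite mul0r addr0 [(n <= k.+1)%N]leq_eqVlt (negbTE nk)/= ltnS.
Qed.

Section steps.
Variables (pj b : (nat -> R) -> nat -> R) (tau L rate r C0 q : R) (j : nat) (kap : nat -> R).
Hypothesis pjL : forall x y, nrm2 (pj x - pj y) <= nrm2 (x - y).
Hypothesis L0 : 0 <= L.
Hypothesis bL : forall x y, nrm2 (b x - b y) <= L * nrm2 (x - y).
Hypothesis bD : forall x y, 2 * ip m w (b x - b y) (x - y) <=
  - \sum_(1 <= n < m.+1) w n * kap n * (x n - y n) ^+ 2.
Hypothesis tau0 : 0 < tau.
Hypothesis q0 : 0 < q.
Hypothesis sw : forall n, (1 <= n <= j)%N -> q * tau <= w n * s n ^+ 2.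
Hypothesis jm : (j <= m)%N.
Hypotheses (r0 : 0 < r) (C00 : 0 < C0).
(** A shift by [tau * C * g * (x - y)] lowers the exponent at the rate [2 C^2 g] and costs at most
    [C^2 g^2 cp / q]; the best choice is [g = q / cp], with net gain [C^2 g]. *)
Let gam := q / cp.
Hypothesis kap_low : forall n, (1 <= n <= m)%N -> rate <= kap n.
Hypothesis kap_high : forall n, (j < n <= m)%N -> rate + C0 * gam <= kap n.
(** Constant of the terms of order [tau^2] in one step; by [tau_small] they are absorbed by the gap
    between [rate] and [r]. *)
Let KK := 2 * L + 2 * C0 ^+ 2 * gam ^+ 2.
Hypothesis tau_small : KK * tau * (1 + tau * (r + gam * C0)) <= rate - r.

Definition move (x : nat -> R) : nat -> R := fun n => x n + tau * b x n.

Definition step f x : R := noise m (f \o pj) (move x).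

Let cp0 : 0 < cp. Proof.
have p0 : 0 < p by exact: lt_trans ltr01 p1.
by rewrite /cp divr_gt0// mulr_gt0// subr_gt0.
Qed.
Let gam0 : 0 < gam. Proof. by rewrite /gam; exact: divr_gt0. Qed.

Lemma move_lip x y : nrm2 (move x - move y) <= (2 + 2 * (tau ^+ 2 * L)) * nrm2 (x - y).
Proof.
have -> : move x - move y = (x - y) + (fun n => tau * (b x - b y) n).
  by apply/funext => n; rewrite /move !fctE; ring.
apply: le_trans (nrm2D_le w0 _ _) _; rewrite nrm2Z.
have h := ler_wpM2l (sqr_ge0 tau) (bL x y).
move: h; set A := nrm2 (b x - b y); set B := nrm2 (x - y); lra.
Qed.

Lemma step_good lo hi f : 0 < lo -> good lo hi f -> good lo hi (step f).
Proof.
move=> lo0 gf.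
have gfp : good lo hi (f \o pj).
  have [fb [M M0 fM]] := gf; split => [x|]; first exact: fb.
  exists M => // x y; apply: le_trans (fM _ _) _; rewrite ler_wpM2l//.
  exact: dist2_mono.
have [nb [M M0 fM]] := noise_good m lo0 gfp; split => [x|]; first exact: nb.
have E0 : 0 <= 2 + 2 * (tau ^+ 2 * L) by rewrite addr_ge0// mulr_ge0// mulr_ge0// sqr_ge0.
exists (M * Num.sqrt (2 + 2 * (tau ^+ 2 * L))); first by rewrite mulr_ge0// sqrtr_ge0.
move=> x y; apply: le_trans (fM _ _) _; rewrite -mulrA; apply: ler_wpM2l => //.
by rewrite /dist2 -sqrtrM//; apply: ler_wsqrtr; exact: move_lip.
Qed.

(* The shift is along [tau * C * gam] times the first [j] coordinates of
   [x - y], the others being contracted strongly enough by the drift. *)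
Lemma step_contract (C : R) x y h : 0 < C -> C <= C0 ->
  h = (fun n => tau * (C * gam) * (x n - y n)) ->
  C * nrm2 (move x - move y - trunc j h) +
    \sum_(1 <= i < j.+1) cp * h i ^+ 2 / s i ^+ 2 <=
  C * (1 - tau * (rate + gam * C) + tau ^+ 2 * KK) * nrm2 (x - y).
Proof.
move=> CC0 CC hE.
pose z := x - y.
pose Nj := \sum_(1 <= n < j.+1) w n * z n ^+ 2.
have zE n : z n = x n - y n by [].
have pjz : \sum_(1 <= n < m.+1) w n * (trunc j z n * z n) = Nj.
  rewrite /Nj (@big_cat_nat _ _ _ j.+1)//=.
  rewrite [X in _ + X]big_nat_cond [X in _ + X]big1 ?addr0; last first.
    by move=> n; rewrite andbT /trunc => /andP[jn _]; rewrite [(n <= j)%N]leqNgt jn andbF mul0r mulr0.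
  rewrite big_nat_cond [RHS]big_nat_cond; apply: eq_bigr => n.
  by rewrite andbT ltnS /trunc => ->; rewrite expr2.
have pjz2 : nrm2 (trunc j z) = Nj.
  rewrite -pjz /nrm2 /ip; apply: eq_bigr => n _.
  by rewrite /trunc; case: ifP => // _; rewrite !mul0r.
have Nj0 : 0 <= Nj by rewrite -pjz2; exact: nrm2_ge0.
have NjN : Nj <= nrm2 z.
  rewrite -pjz /nrm2 /ip big_nat_cond [leRHS]big_nat_cond; apply: ler_sum => n.
  rewrite andbT ltnS => nm; rewrite ler_wpM2l ?(ltW (w0 nm))// /trunc.
  by case: ifP => // _; rewrite mul0r -expr2 sqr_ge0.
have cost : \sum_(1 <= i < j.+1) cp * h i ^+ 2 / s i ^+ 2 <= tau * C ^+ 2 * gam * Nj.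
  rewrite /Nj mulr_sumr big_nat_cond [leRHS]big_nat_cond; apply: ler_sum => n.
  rewrite andbT ltnS => nj; have /andP[n1 nj1] := nj.
  have sn : 0 < s n ^+ 2 by rewrite exprn_gt0// s0.
  rewrite ler_pdivrMr//.
  have -> : cp * h n ^+ 2 = tau * C ^+ 2 * gam * z n ^+ 2 * (q * tau).
    by rewrite hE /gam zE; field; rewrite gt_eqF.
  have -> : tau * C ^+ 2 * gam * (w n * z n ^+ 2) * s n ^+ 2 =
    tau * C ^+ 2 * gam * z n ^+ 2 * (w n * s n ^+ 2) by ring.
  apply: ler_wpM2l; last exact: sw.
  apply: mulr_ge0; last exact: sqr_ge0.
  by apply: mulr_ge0 (ltW gam0); apply: mulr_ge0 (ltW tau0) _; exact: sqr_ge0.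
have E : nrm2 (move x - move y - trunc j h) = nrm2 z + tau * (2 * ip m w (b x - b y) z)
    - 2 * tau * (C * gam) * Nj
    + tau ^+ 2 * nrm2 ((b x - b y) - (fun n => C * gam * trunc j z n)).
  rewrite -pjz /nrm2 /ip !mulr_sumr -!big_split/= -sumrN -!big_split/=; apply: eq_bigr => n _.
  rewrite /move /trunc /z !fctE; case: ifP => _; rewrite ?hE; ring.
have quad : nrm2 ((b x - b y) - (fun n => C * gam * trunc j z n)) <= KK * nrm2 z.
  rewrite nrm2BC -nrm2BC.
  apply: le_trans (nrm2D_le w0 _ _) _.
  have -> : nrm2 (- (fun n => C * gam * trunc j z n)) = (C * gam) ^+ 2 * Nj.
    by rewrite -pjz2 -nrm2Z /nrm2 ipNl ipNr opprK.
  have h1 := bL x y; rewrite -/z in h1.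
  have h2 : (C * gam) ^+ 2 * Nj <= (C0 * gam) ^+ 2 * nrm2 z.
    apply: ler_pM => //; first exact: sqr_ge0.
    have c1 : 0 <= C * gam := mulr_ge0 (ltW CC0) (ltW gam0).
    have c2 : C * gam <= C0 * gam := ler_wpM2r (ltW gam0) CC.
    by rewrite ler_pXn2r// nnegrE// (le_trans c1).
  have -> : KK * nrm2 z = 2 * (L * nrm2 z) + 2 * ((C0 * gam) ^+ 2 * nrm2 z) by rewrite /KK; ring.
  by apply: lerD; rewrite ler_wpM2l.
(* The first [j] modes receive the extra [C * gam] from the shift; the other modes have at least
   [C0 * gam] of additional dissipation, enough because [C <= C0]. *)
have diss : (rate + C * gam) * nrm2 z <=
    \sum_(1 <= n < m.+1) w n * kap n * (x n - y n) ^+ 2 + C * gam * Nj.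
  rewrite -pjz /nrm2 /ip !mulr_sumr -big_split/= big_nat_cond [leRHS]big_nat_cond.
  apply: ler_sum => n; rewrite andbT ltnS => nm.
  have -> : (rate + C * gam) * (w n * (z n * z n)) = w n * z n ^+ 2 * (rate + C * gam) by ring.
  have -> : w n * kap n * (x n - y n) ^+ 2 + C * gam * (w n * (trunc j z n * z n)) =
    w n * z n ^+ 2 * (kap n + C * gam * (n <= j)%N%:R).
    rewrite /trunc; have /andP[-> _] := nm; rewrite /= zE; case: (n <= j)%N; rewrite /=; ring.
  apply: ler_wpM2l; first by rewrite mulr_ge0 ?sqr_ge0// ltW// w0.
  case: (leqP n j) => nj; first by rewrite mulr1 lerD2r kap_low.
  rewrite mulr0 addr0; apply: le_trans (kap_high _); last by rewrite nj; case/andP: nm.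
  by rewrite lerD2l ler_wpM2r ?(ltW gam0).
have bd := bD x y; rewrite -/z in bd.
rewrite E.
have t2 : 0 <= tau ^+ 2 by exact: sqr_ge0.
have h1 := ler_wpM2l (ltW tau0) bd.
have h2 := ler_wpM2l (ltW tau0) diss.
have h3 := ler_wpM2l t2 quad.
set N := nrm2 z in h2 h3 Nj0 NjN *.
set I := ip m w _ _ in h1 *.
set S := \sum_(1 <= n < m.+1) _ in h1 h2.
set Qd := nrm2 _ in h3 *.
rewrite -/z -/N.
apply: (@le_trans _ _ (C * (N + tau * (2 * I) - 2 * tau * (C * gam) * Nj + tau ^+ 2 * Qd) +
  tau * C ^+ 2 * gam * Nj)); first by rewrite lerD2l.
have -> : C * (N + tau * (2 * I) - 2 * tau * (C * gam) * Nj + tau ^+ 2 * Qd) +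
  tau * C ^+ 2 * gam * Nj =
  C * (N + tau * (2 * I) - tau * (C * gam * Nj) + tau ^+ 2 * Qd) by ring.
rewrite -[leRHS]mulrA; apply: (ler_wpM2l (ltW CC0)).
lra.
Qed.

(** Euler recursion for [D' = r D + gam], where [D = 1/C] linearizes the Riccati equation
    [C' = - r C - gam C^2]. As [D] increases, [C] stays below [C0]. *)
Fixpoint inv_rate (k : nat) : R :=
  if k is k'.+1 then (1 + r * tau) * inv_rate k' + gam * tau else C0^-1.

Lemma inv_rate_ge k : C0^-1 <= inv_rate k.
Proof.
have C00' : 0 < C0^-1 by rewrite invr_gt0.
elim: k => //= k IH; apply: le_trans (IH) _.
have := mulr_gt0 gam0 tau0; have := mulr_gt0 r0 tau0.
have : 0 < inv_rate k by apply: lt_le_trans C00' IH.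
nra.
Qed.

(** Comparison with the same recursion started from 0. The bound is free of the initial value
    [C0^-1], so [C0] may be as large as the inequality at time 0 requires. *)
Lemma inv_rate_low k : gam * (((1 + r * tau) ^+ k - 1) / r) <= inv_rate k.
Proof.
elim: k => [|k IH] /=; first by rewrite expr0 subrr mul0r mulr0 invr_ge0 ltW.
have h : 0 <= 1 + r * tau by have := mulr_gt0 r0 tau0; lra.
apply: le_trans (lerD (ler_wpM2l h IH) (lexx (gam * tau))).
rewrite le_eqVlt; apply/orP; left; apply/eqP.
by rewrite exprS; field; rewrite gt_eqF.
Qed.

Lemma step_harnack lo hi f g (eps : R) k x y : 0 < lo -> good lo hi f -> good lo hi g ->
  (forall x y, f y `^ p <= g x * expR (eps + C0 * nrm2 (x - y))) ->
  iter k step f y `^ p <= iter k step g x * expR (eps + (inv_rate k)^-1 * nrm2 (x - y)).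
Proof.
move=> lo0 gf gg H0.
have C00' : 0 < C0^-1 by rewrite invr_gt0.
elim: k x y => [|k IH] x y; first by rewrite /= invrK; exact: H0.
have gfk : good lo hi (iter k step f) by elim: (k) => //= k' ?; exact: step_good.
have ggk : good lo hi (iter k step g) by elim: (k) => //= k' ?; exact: step_good.
set D := inv_rate k in IH.
have DC : C0^-1 <= D by exact: inv_rate_ge.
have D0 : 0 < D by exact: lt_le_trans DC.
pose C := D^-1.
have CC0 : 0 < C by rewrite invr_gt0.
have CC : C <= C0 by rewrite -[C0]invrK lef_pV2 ?posrE.
have gp f' : good lo hi f' -> good lo hi (f' \o pj).
  move=> [fb [M M0 fM]]; split => [?|]; first exact: fb.
  by exists M => // x' y'; apply: le_trans (fM _ _) _; rewrite ler_wpM2l//; exact: dist2_mono.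
(* [noise_harnack] is applied to all [m] kicks; the shift is 0 beyond mode [j], where the drift
   alone contracts. *)
pose h n := if (n <= j)%N then tau * (C * gam) * (x n - y n) else 0.
have := @noise_harnack lo hi _ _ (fun z => eps + C * nrm2 z) m h (move x) (move y) lo0
  (gp _ gfk) (gp _ ggk).
move=> /(_ _)/le_trans; apply.
  move=> x' y'; apply: le_trans (IH (pj x') (pj y')) _.
  have g0 := le_trans (ltW lo0) (andP (ggk.1 (pj x'))).1.
  by apply: ler_wpM2l => //; rewrite ler_expR lerD2l ler_wpM2l ?(ltW CC0).
have g0 := le_trans (ltW lo0) (andP ((step_good lo0 ggk).1 x)).1.
rewrite [iter _.+1 _ g]/=; apply: ler_wpM2l => //; rewrite ler_expR -addrA lerD2l.
pose h' n := tau * (C * gam) * (x n - y n).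
have := @step_contract _ x y h' CC0 CC erefl.
have -> : trunc m h = trunc j h'.
  apply/funext => n; rewrite /trunc /h /h'; case: (leqP n j) => nj.
    by rewrite (leq_trans nj jm).
  by rewrite andbF; case: ifP.
have -> : \sum_(1 <= i < m.+1) cp * h i ^+ 2 / s i ^+ 2 =
    \sum_(1 <= i < j.+1) cp * h' i ^+ 2 / s i ^+ 2.
  rewrite (@big_cat_nat _ _ _ j.+1)//=.
  rewrite [X in _ + X]big_nat_cond [X in _ + X]big1 ?addr0; last first.
    by move=> n; rewrite andbT /h => /andP[jn _]; rewrite leqNgt jn expr0n/= mulr0 mul0r.
  rewrite big_nat_cond [RHS]big_nat_cond; apply: eq_bigr => n.
  by rewrite andbT ltnS /h => /andP[_ ->].
move=> hh; apply: le_trans hh _.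
apply: ler_wpM2r; first exact: nrm2_ge0.
have Dn : 0 < (1 + r * tau) * D + gam * tau.
  have := mulr_gt0 gam0 tau0; have := mulr_gt0 r0 tau0; nra.
rewrite /= -/D -[leRHS]div1r ler_pdivlMr//.
have -> : (1 + r * tau) * D + gam * tau = D * (1 + tau * (r + gam * C)).
  by rewrite /C; field; rewrite gt_eqF.
have -> : C * (1 - tau * (rate + gam * C) + tau ^+ 2 * KK) * (D * (1 + tau * (r + gam * C))) =
   (1 - tau * (rate + gam * C) + tau ^+ 2 * KK) * (1 + tau * (r + gam * C)).
  by rewrite /C; field; rewrite gt_eqF.
set Y := r + gam * C.
have Y0 : 0 < Y by rewrite /Y addr_gt0//; exact: mulr_gt0.
have YC : Y <= r + gam * C0 by rewrite lerD2l ler_wpM2l ?(ltW gam0).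
have K0 : 0 <= KK.
  rewrite /KK; apply: addr_ge0; first exact: mulr_ge0.
  by apply: mulr_ge0 (sqr_ge0 _); apply: mulr_ge0 (sqr_ge0 _).
have h1 : KK * tau * (1 + tau * Y) <= rate - r.
  apply: le_trans tau_small; apply: ler_wpM2l; first exact: mulr_ge0 (ltW tau0).
  by rewrite lerD2l ler_wpM2l ?(ltW tau0).
have E : rate + gam * C = Y + (rate - r) by rewrite /Y; ring.
rewrite E.
have rr : 0 <= rate - r.
  apply: le_trans h1; apply: mulr_ge0; first exact: mulr_ge0 (ltW tau0).
  by rewrite addr_ge0// mulr_ge0// ltW.
move: h1 rr; set dl := rate - r => h1 rr.
(* The contraction factor of the step times the growth factor of [1/C] has to be at most 1.
   Expanded, it is 1 plus a term that [tau_small] makes nonpositive, minus a nonnegative term. *)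
have -> : (1 - tau * (Y + dl) + tau ^+ 2 * KK) * (1 + tau * Y) =
  1 + tau * (KK * tau * (1 + tau * Y) - dl) - tau ^+ 2 * (Y * (Y + dl)) by ring.
have h2 : tau * (KK * tau * (1 + tau * Y) - dl) <= 0 by apply: mulr_ge0_le0 (ltW tau0) _; lra.
have h3 : 0 <= tau ^+ 2 * (Y * (Y + dl)).
  apply: mulr_ge0; first exact: sqr_ge0.
  by apply: mulr_ge0 (ltW Y0) _; apply: addr_ge0 => //; exact: ltW.
lra.
Qed.

End steps.
End chain.

(** * Gaussian noise *)

Section noise_law.
Context {R : realType} d (Omega : measurableType d) (P : probability Omega R).
Variables (m : nat) (w s : nat -> R).
Hypothesis w0 : forall n, (1 <= n <= m)%N -> 0 < w n.

Definition coord_measurable d1 (T : measurableType d1) (X : T -> nat -> R) :=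
  forall n, measurable_fun setT (fun z => X z n).

(* A Lipschitz function is the supremum of countably many cones with vertices
   at rational points. *)
Lemma lip_comp_measurable (L : R) (f : (nat -> R) -> R) d1 (T : measurableType d1)
    (X : T -> nat -> R) : 0 <= L -> (forall x y, `|f x - f y| <= L * dist2 m w x y) ->
  coord_measurable X -> measurable_fun setT (f \o X).
Proof.
move=> L0 fL mX.
pose pt (k : nat) : nat -> R :=
  if unpickle k is Some sq then fun n => ratr (nth 0%R (sq : seq rat) n) else fun=> 0.
pose cone k z := f (pt k) - L * dist2 m w (X z) (pt k).
have mcone k : measurable_fun setT (cone k).
  apply: measurable_funB; first exact: measurable_cst.
  apply: measurable_funM; first exact: measurable_cst.
  have ms : measurable_fun setT (@Num.sqrt R).
    by apply: continuous_measurable_fun => x; exact: sqrt_continuous.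
  apply: (measurableT_comp ms).
  apply: measurable_sum => n; apply: measurable_funM; first exact: measurable_cst.
  have h : measurable_fun setT (fun z => X z n - pt k n).
    by apply: measurable_funB; [exact: mX|exact: measurable_cst].
  exact: measurable_funM.
have cle k z : cone k z <= f (X z).
  by have := fL (pt k) (X z); rewrite ler_norml /cone /dist2 nrm2BC => /andP[]; lra.
have ubd z : has_ubound (range (cone^~ z)) by exists (f (X z)) => _ [k _ <-].
have -> : f \o X = fun z => sups (cone^~ z) 0; last exact: measurable_fun_sups.
apply/funext => z; transitivity (sup (range (cone^~ z))); last first.
  by congr (sup _); apply/seteqP; split => [_ [k _ <-]|_ [k _ <-]]; exists k.
apply/eqP; rewrite eq_le; apply/andP; split; last first.
  by apply: ge_sup; [exists (cone 0%N z); exists 0%N|move=> _ [k _ <-]].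
apply/ler_addgt0Pr => e e0.
pose A := 2 * L * Num.sqrt (\sum_(1 <= n < m.+1) w n) + 1.
have A0 : 0 < A by rewrite ltr_wpDl// mulr_ge0 ?sqrtr_ge0// mulr_ge0.
have eA : 0 < e / A by exact: divr_gt0.
have /choice[q hq] : forall n, exists q : rat, `|X z n - ratr q| <= e / A.
  move=> n; have [q] : exists q : rat, ratr q \in `]X z n - e / A, X z n + e / A[.
    by apply: rat_in_itvoo; lra.
  by rewrite in_itv/= => /andP[h1 h2]; exists q; rewrite ler_norml; apply/andP; split; lra.
pose k := pickle (mkseq q m.+1).
have W0 : 0 <= \sum_(1 <= n < m.+1) w n.
  rewrite big_nat_cond; apply: sumr_ge0 => n; rewrite andbT ltnS => nm.
  exact: ltW (w0 nm).
have dk : dist2 m w (X z) (pt k) <= Num.sqrt (\sum_(1 <= n < m.+1) w n) * (e / A).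
  have -> : e / A = Num.sqrt ((e / A) ^+ 2) by rewrite sqrtr_sqr gtr0_norm.
  rewrite -sqrtrM//; apply: ler_wsqrtr; apply: nrm2_sum_le => // n nm.
  rewrite /pt /k pickleK !fctE nth_mkseq//.
  by rewrite ltnS; case/andP: nm.
apply: (@le_trans _ _ (cone k z + e)); last first.
  by rewrite lerD2r; apply: ub_le_sup => //; exists k.
have h1 : f (X z) <= f (pt k) + L * dist2 m w (X z) (pt k).
  by have := fL (X z) (pt k); rewrite ler_norml => /andP[]; lra.
rewrite /cone; apply: le_trans h1 _.
have h2 := ler_wpM2l L0 dk.
suff : 2 * L * Num.sqrt (\sum_(1 <= n < m.+1) w n) * (e / A) <= e.
  by move: h2; set S := Num.sqrt _; set D := dist2 _ _ _ _; lra.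
rewrite mulrA ler_pdivrMr// [leRHS]mulrC ler_wpM2r ?(ltW e0)//.
by rewrite /A lerDl.
Qed.

Lemma good_comp_measurable lo hi f d1 (T : measurableType d1) (X : T -> nat -> R) :
  good m w lo hi f -> coord_measurable X -> measurable_fun setT (f \o X).
Proof. by move=> [_ [L L0 fL]]; exact: lip_comp_measurable fL. Qed.

Lemma upd_coord_measurable d1 (T : measurableType d1) (X : T -> nat -> R) (U : T -> R) i :
  coord_measurable X -> measurable_fun setT U ->
  coord_measurable (fun z => upd (X z) i (U z)).
Proof.
move=> mX mU n; apply: measurable_funD; first exact: mX.
by apply: measurable_funM => //; exact: measurable_cst.
Qed.

Variable xi : nat -> Omega -> R.
Hypothesis mxi : forall l, measurable_fun setT (xi l).
Hypothesis law_xi : forall l, (1 <= l)%N ->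
  forall D, measurable D -> P (xi l @^-1` D) = normal_prob 0 (s l) D.

Definition comb (i : nat) (a : nat -> R) (o : Omega) : R :=
  \sum_(i <= l < m.+1) a l * xi l o.

Lemma measurable_comb i a : measurable_fun setT (comb i a).
Proof. by apply: measurable_sum => l; apply: measurable_funM. Qed.

(** Stands for the characteristic function of a centred Gaussian law as a function of its variance.
    Besides [comb_cos] only the product rule is required of it, so its explicit value is never
    computed. *)
Variable chi : R -> R.
Hypothesis chiD : forall a b, 0 <= a -> 0 <= b -> chi (a + b) = chi a * chi b.
Hypothesis comb_cos : forall a t, \int[P]_o cos (comb 1 a o + t) =
  cos t * chi (\sum_(1 <= l < m.+1) (a l * s l) ^+ 2).

Let comb_cos_from i a t : (1 <= i)%N -> \int[P]_o cos (comb i a o + t) =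
  cos t * chi (\sum_(i <= l < m.+1) (a l * s l) ^+ 2).
Proof.
move=> i1; case: (leqP i m.+1) => im; last first.
  have E0 : comb 1 (fun=> 0) = comb i a.
    by apply/funext => o; rewrite /comb [RHS]big_geq ?(ltnW im)// big1// => l _; rewrite mul0r.
  rewrite -E0 comb_cos [in RHS]big_geq ?(ltnW im)//.
  by rewrite big1// => l _; rewrite mul0r expr0n.
pose a' l := if (l < i)%N then 0 else a l.
have E o : comb 1 a' o = comb i a o.
  rewrite /comb (@big_cat_nat _ _ _ i)//= big_nat_cond big1 ?add0r.
    rewrite big_nat_cond [RHS]big_nat_cond; apply: eq_bigr => l.
    by rewrite andbT /a' => /andP[il _]; rewrite ltnNge il.
  by move=> l; rewrite andbT /a' => /andP[_ ->]; rewrite mul0r.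
under eq_Rintegral do rewrite -E.
rewrite comb_cos; congr (_ * chi _).
rewrite (@big_cat_nat _ _ _ i)//= big_nat_cond big1 ?add0r.
  rewrite big_nat_cond [RHS]big_nat_cond; apply: eq_bigr => l.
  by rewrite andbT /a' => /andP[il _]; rewrite ltnNge il.
by move=> l; rewrite andbT /a' => /andP[_ ->]; rewrite mul0r expr0n.
Qed.

Let tail_var i a := \sum_(i <= l < m.+1) (a l * s l) ^+ 2.

Let tail_var_ge0 i a : 0 <= tail_var i a.
Proof. by apply: sumr_ge0 => l _; exact: sqr_ge0. Qed.

(** By the product formula for cosines, the joint transform of [comb i.+2 a] and [xi i.+1] is a half
    sum of transforms of two combinations starting at [i.+1], both independent of [Z]; the product
    rule of [chi] then factorizes it. *)
Lemma indep_noise_step d1 (T : measurableType d1) (Z : Omega -> T) i :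
  (i < m)%N -> measurable_fun setT Z -> (forall a, indep P Z (comb i.+1 a)) ->
  (forall a, indep P (fun o => (Z o, xi i.+1 o)) (comb i.+2 a)) /\ indep P Z (xi i.+1).
Proof.
move=> im mZ iZ.
suff H a : indep P (fun o => (Z o, xi i.+1 o)) (comb i.+2 a) /\ indep P Z (xi i.+1).
  by split => [a|]; [exact: (H a).1|exact: (H (fun=> 0)).2].
apply: indep_pair => //; first exact: measurable_comb.
move=> C mC c t b t'.
pose ap (e : R) l := if l == i.+1 then e * c else b * a l.
have apE e o : comb i.+1 (ap e) o = b * comb i.+2 a o + e * (c * xi i.+1 o).
  rewrite /comb big_ltn ?ltnS// /ap eqxx addrC mulrA; congr (_ + _).
  rewrite mulr_sumr big_nat_cond [RHS]big_nat_cond; apply: eq_bigr => l.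
  rewrite andbT => /andP[il _]; rewrite mulrA.
  by case: eqP => // E; rewrite E ltnn in il.
have vE e : e ^+ 2 = 1 -> tail_var i.+1 (ap e) = tail_var i.+2 (fun l => b * a l) +
    (c * s i.+1) ^+ 2.
  move=> e2; rewrite /tail_var big_ltn ?ltnS// /ap eqxx addrC; congr (_ + _).
    rewrite big_nat_cond [RHS]big_nat_cond; apply: eq_bigr => l.
    rewrite andbT => /andP[il _].
    by case: eqP => // E; rewrite E ltnn in il.
  by rewrite !exprMn e2 mul1r.
have c2 x y : cos x * cos y = 2^-1 * (cos (x - y) + cos (x + y)) :> R by exact: cos_prod.
have E o : cos (b * comb i.+2 a o + t') * cos (c * xi i.+1 o + t) =
    2^-1 * (cos (1 * comb i.+1 (ap (-1)) o + (t' - t)) + cos (1 * comb i.+1 (ap 1) o + (t' + t))).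
  rewrite c2 !apE !mul1r mulN1r; congr (_ * (cos _ + cos _)); ring.
pose Q := \1_(Z @^-1` C) : Omega -> R.
have mQ : measurable (Z @^-1` C) by exact: preimage_measurable.
have iQ e t0 : P.-integrable setT (EFin \o fun o => Q o * cos (1 * comb i.+1 (ap e) o + t0)).
  apply: (@bounded_integrableP _ _ _ _ _ 1).
    apply: measurable_funM; first exact: measurable_indicT.
    by apply: measurable_cosD; exact: measurable_comb.
  by move=> o; rewrite normrM mulr_ile1// ?indic_le1// ler_norml cos_geN1 cos_le1.
transitivity (2^-1 * (\int[P]_o (Q o * cos (1 * comb i.+1 (ap (-1)) o + (t' - t))) +
   \int[P]_o (Q o * cos (1 * comb i.+1 (ap 1) o + (t' + t))))).
  rewrite -RintegralD// -RintegralZl//; last first.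
    have := integrableD measurableT (iQ (-1) (t' - t)) (iQ 1 (t' + t)).
    by apply: eq_integrable => // o _; rewrite /= EFinD.
  by apply: eq_Rintegral => o _; rewrite -mulrA E -/Q; ring.
rewrite !(indep_cos _ _ mZ (measurable_comb _ _) (iZ _) mC).
under eq_Rintegral do rewrite mul1r.
under [X in _ + _ * X]eq_Rintegral do rewrite mul1r.
rewrite !comb_cos_from// -!/(tail_var _ _) !vE ?expr1n ?sqrrN ?expr1n//.
have -> : \int[P]_o cos (b * comb i.+2 a o + t') =
   cos t' * chi (tail_var i.+2 (fun l => b * a l)).
  rewrite -comb_cos_from//; apply: eq_Rintegral => o _; congr (cos (_ + _)).
  by rewrite /comb mulr_sumr; apply: eq_bigr => l _; rewrite mulrA.
have -> : \int[P]_o cos (c * xi i.+1 o + t) = cos t * chi ((c * s i.+1) ^+ 2).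
  pose al l := if l == i.+1 then c else 0.
  have := comb_cos_from al t (isT : (1 <= i.+1)%N).
  rewrite big_ltn ?ltnS// [X in _ + X]big_nat_cond [X in _ + X]big1 ?addr0.
    rewrite /al eqxx => <-; apply: eq_Rintegral => o _; congr (cos (_ + _)).
    rewrite /comb big_ltn ?ltnS// eqxx [X in _ + X]big_nat_cond [X in _ + X]big1 ?addr0//.
    move=> l; rewrite andbT => /andP[il _].
    by case: eqP => [E0|]; [rewrite E0 ltnn in il|rewrite mul0r].
  move=> l; rewrite andbT => /andP[il _]; rewrite /al.
  by case: eqP => [E0|]; [rewrite E0 ltnn in il|rewrite mul0r expr0n].
rewrite (chiD (tail_var_ge0 _ _) (sqr_ge0 _)).
have -> : cos (t' - t) = cos t' * cos t + sin t' * sin t by rewrite cosB.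
by rewrite cosD; field.
Qed.

Fixpoint kick (i : nat) (x : nat -> R) (o : Omega) : nat -> R :=
  if i is i'.+1 then upd (kick i' x o) i (xi i o) else x.

(** [noise] averages over the highest mode first, so the kicks are added in increasing order and the
    last one is integrated out with the earlier ones frozen. *)
Lemma noise_expectation d0 (T0 : measurableType d0) (Z0 : Omega -> T0)
    (X : T0 -> nat -> R) lo hi f :
  measurable_fun setT Z0 -> coord_measurable X -> (forall a, indep P Z0 (comb 1 a)) ->
  0 < lo -> good m w lo hi f ->
  \int[P]_o f (kick m (X (Z0 o)) o) = \int[P]_o noise s m f (X (Z0 o)).
Proof.
move=> mZ0 mX iZ0 lo0.
(* The induction carries a random element [Z1] that determines the state after the kicks made so far
   and is independent of all combinations of the later ones. *)
suff [_ H] : (exists d1 (T1 : measurableType d1) (Z1 : Omega -> T1) (X1 : T1 -> nat -> R),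
    [/\ measurable_fun setT Z1, coord_measurable X1, (forall a, indep P Z1 (comb m.+1 a)) &
      forall o, X1 (Z1 o) = kick m (X (Z0 o)) o]) /\
    forall f, good m w lo hi f ->
      \int[P]_o f (kick m (X (Z0 o)) o) = \int[P]_o noise s m f (X (Z0 o)) by exact: H.
have : (m <= m)%N by [].
move: {1 3 4 6 7}m => i; elim: i => [|i IH] im.
  by split => [|//]; exists d0, T0, Z0, X.
have [[d1 [T1 [Z1 [X1 [mZ1 mX1 iZ1 XE]]]]] {}IH] := IH (ltnW im).
have [i1 i2] := indep_noise_step im mZ1 iZ1.
have mZ2 : measurable_fun setT (fun o => (Z1 o, xi i.+1 o)) by exact/measurable_fun_pair.
pose X2 (z : T1 * R) := upd (X1 z.1) i.+1 z.2.
have mX2 : coord_measurable X2.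
  apply: (@upd_coord_measurable _ _ (fun z : T1 * R => X1 z.1)) => [n|].
    by apply: (measurableT_comp (mX1 n)); exact: measurable_fst.
  exact: measurable_snd.
split.
  exists _, _, (fun o => (Z1 o, xi i.+1 o)), X2; split => // o.
  by rewrite /X2 /= XE.
move=> {}f gf.
have fn := good_norm lo0 gf.
transitivity (\int[P]_o (smooth s i.+1 f) (kick i (X (Z0 o)) o)); last first.
  by rewrite IH//; exact: smooth_good.
transitivity (\int[P]_o (f \o X2) (Z1 o, xi i.+1 o)).
  by apply: eq_Rintegral => o _; rewrite /X2 /= XE.
have mf : measurable_fun setT (f \o X2) by exact: good_comp_measurable gf mX2.
rewrite (indep_Rintegral mZ1 (mxi i.+1) i2 mf (fun x => fn (X2 x))).
apply: eq_Rintegral => o _; rewrite /X2 /= XE.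
apply: gmean_law => //; first exact: law_xi.
exact: good_measurable gf.
Qed.

End noise_law.

(** * Wiener increments as Gaussian kicks *)

Section wiener_noise.
Context {R : realType} d (Omega : measurableType d) (P : probability Omega R).
Local Notation mu := (@lebesgue_measure R).
Local Notation I01 := (`[0, 1]%classic : set R).
Variables (F : R -> set (set Omega)) (W : (R -> R) -> R -> Omega -> R).
Hypotheses (hF : filtration F) (hW : cylindrical_wiener P F W).

Lemma L2_bounded (h : R -> R) (B : R) : measurable_fun I01 h ->
  (forall x, I01 x -> `|h x| <= B) -> L2 h.
Proof.
move=> mh hB; split => //.
apply: (@bounded_integrable01 _ (fun x => h x ^+ 2) (B ^+ 2)); first exact: measurable_funX.
move=> x Ix; rewrite normrX lerXn2r ?nnegrE//; last exact: hB.
exact: le_trans (normr_ge0 _) (hB x Ix).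
Qed.

Definition esum (c : nat -> R) (r : seq nat) (x : R) : R := \sum_(l <- r) c l * eigen l x.

Lemma esum_bounded c r x : `|esum c r x| <= \sum_(l <- r) `|c l| * 2.
Proof.
apply: le_trans (ler_norm_sum _ _ _) _.
by apply: ler_sum => l _; rewrite normrM ler_wpM2l// eigen_bound.
Qed.

Lemma measurable_esum c r D : measurable_fun D (esum c r).
Proof.
by apply: measurable_sum => l; apply: measurable_funM => //; exact: measurable_eigen.
Qed.

Lemma L2_esum c r : L2 (esum c r).
Proof.
apply: (@L2_bounded _ (\sum_(l <- r) `|c l| * 2)); first exact: measurable_esum.
by move=> x _; exact: esum_bounded.
Qed.

Lemma inner_esum c r : uniq r -> inner (esum c r) (esum c r) = \sum_(l <- r) c l ^+ 2.
Proof.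
move=> ur; rewrite /inner.
rewrite (@coef_sum_bounded _ (esum c r) r c (\sum_(l <- r) `|c l| * 2)).
- rewrite big_seq [RHS]big_seq; apply: eq_bigr => l lr; rewrite expr2; congr (_ * _).
  transitivity (\sum_(k <- r) c k * coef (@eigen R l) k); last first.
    rewrite (bigD1_seq l)//= coef_eigen eqxx mulr1 big1 ?addr0// => k kl.
    by rewrite coef_eigen eq_sym (negbTE kl) mulr0.
  rewrite -(@coef_sum_bounded _ (eigen l) r c 2); last 2 first.
  + exact: measurable_eigen.
  + by move=> x _; exact: eigen_bound.
  by rewrite /coef /inner; apply: eq_Rintegral => x _; rewrite mulrC.
- exact: measurable_esum.
- by move=> x _; exact: esum_bounded.
Qed.

Definition incr h (t t' : R) (o : Omega) : R := W h t' o - W h t o.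

(** With [F t] as the sigma-algebra of the sample space, the general rules for measurable functions
    apply to adaptedness. *)
Definition Fmeasurable (t : R) (X : Omega -> R) :=
  measurable_fun (setT : set (g_sigma_algebraType (F t))) X.

Lemma FmeasurableP t (X : Omega -> R) : 0 <= t ->
  Fmeasurable t X <-> forall D, measurable D -> F t (X @^-1` D).
Proof.
move=> t0; have sF := (hF.1 t t0).1; split => [mX D mD|mX _ D mD].
  have := mX measurableT D mD; rewrite setTI.
  by rewrite /measurable/= sigma_algebra_id.
by rewrite setTI /measurable/= sigma_algebra_id//; exact: mX.
Qed.

Lemma Fmeasurable_measurable t X : 0 <= t -> Fmeasurable t X -> measurable_fun setT X.
Proof.
move=> t0 /(FmeasurableP _ t0) mX _ D mD; rewrite setTI.
by apply: (hF.1 t t0).2; exact: mX.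
Qed.

Lemma Fmeasurable_le s t X : 0 <= s -> s <= t -> Fmeasurable s X -> Fmeasurable t X.
Proof.
move=> s0 st; have t0 := le_trans s0 st.
move=> /(FmeasurableP _ s0) mX; apply/(FmeasurableP _ t0) => D mD.
exact: hF.2 s0 st _ (mX _ mD).
Qed.

Lemma Fmeasurable_incr h s t : L2 h -> 0 <= s -> s <= t -> Fmeasurable t (incr h s t).
Proof.
move=> hh s0 st; have t0 := le_trans s0 st; have [W1 _ _ _] := hW.
apply: measurable_funB; first by apply/(FmeasurableP _ t0); exact: W1.
by apply: Fmeasurable_le st _ => //; apply/(FmeasurableP _ s0); exact: W1.
Qed.

Lemma measurable_incr h s t : L2 h -> 0 <= s -> s <= t -> measurable_fun setT (incr h s t).
Proof.
move=> hh s0 st; exact: Fmeasurable_measurable (le_trans s0 st) (Fmeasurable_incr hh s0 st).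
Qed.

Lemma incr_linear (k : R) g h s t : L2 g -> L2 h -> 0 <= s -> s <= t ->
  {ae P, forall o, incr (fun x => k * g x + h x) s t o = k * incr g s t o + incr h s t o}.
Proof.
move=> lg lh s0 st; have [_ _ W3 _] := hW.
apply: filterS2 (W3 k g h lg lh s s0) (W3 k g h lg lh t (le_trans s0 st)) => o e1 e2.
by rewrite /incr e1 e2; ring.
Qed.

Lemma incr_esum c r s t : 0 <= s -> s <= t ->
  {ae P, forall o, incr (esum c r) s t o = \sum_(l <- r) c l * incr (eigen l) s t o}.
Proof.
move=> s0 st; elim: r => [|l r IH].
  have l0 := L2_esum c [::].
  apply: filterS (incr_linear (-1) l0 l0 s0 st) => o; rewrite big_nil.
  have -> : (fun x => -1 * esum c [::] x + esum c [::] x) = esum c [::].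
    by apply/funext => x; rewrite /esum big_nil mulr0 addr0.
  lra.
have le : L2 (@eigen R l).
  by apply: (@L2_bounded _ 2) => [|x _]; [exact: measurable_eigen|exact: eigen_bound].
apply: filterS2 IH (incr_linear (c l) le (L2_esum c r) s0 st) => o IH E.
rewrite big_cons -IH -E; congr (incr _ _ _ _).
by apply/funext => x; rewrite /esum big_cons.
Qed.

Lemma ae_Rintegral (f g : Omega -> R) : measurable_fun setT f -> measurable_fun setT g ->
  {ae P, forall o, f o = g o} -> \int[P]_o f o = \int[P]_o g o.
Proof.
move=> mf mg fg; rewrite /Rintegral; congr fine.
apply: ae_eq_integral => //; try exact/measurable_EFinP.
by apply: filterS fg => o -> _.
Qed.

Lemma ae_prob (G : set Omega) (U V : Omega -> R) D : measurable G ->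
  measurable_fun setT U -> measurable_fun setT V -> measurable D ->
  {ae P, forall o, U o = V o} -> P (G `&` U @^-1` D) = P (G `&` V @^-1` D).
Proof.
move=> mG mU mV mD UV.
have mI X : measurable_fun setT X -> measurable (G `&` X @^-1` D).
  by move=> mX; apply: measurableI => //; exact: preimage_measurable.
rewrite -(fineK (P_fin P (mI _ mU))) -(fineK (P_fin P (mI _ mV))); congr EFin.
rewrite -(Rintegral_indic P (mI _ mU)) -(Rintegral_indic P (mI _ mV)); apply: ae_Rintegral; try exact: measurable_indicT (mI _ _).
by apply: filterS UV => o UV'; rewrite !indicE; congr (nat_of_bool _)%:R;
  apply/idP/idP; rewrite !inE /preimage/= UV'.
Qed.

Lemma incr_law h s t D : L2 h -> 0 <= s -> s < t -> measurable D ->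
  P (incr h s t @^-1` D) = gauss ((t - s) * inner h h) D.
Proof. by move=> lh s0 st mD; have [_ _ _ W4] := hW; have [] := W4 h lh s t s0 st D mD. Qed.

Lemma incr_indep h s t G D : L2 h -> 0 <= s -> s < t -> measurable D -> F s G ->
  P (G `&` incr h s t @^-1` D) = (P G * P (incr h s t @^-1` D))%E.
Proof.
by move=> lh s0 st mD FG; have [_ _ _ W4] := hW; have [_] := W4 h lh s t s0 st D mD; exact.
Qed.

Let e0 : R -> R := esum (fun=> 1) [:: 0%N].

Let inner_e0 : inner e0 e0 = 1.
Proof. by rewrite /e0 inner_esum// big_seq1 expr1n. Qed.

(** The case [v = 0] is separate because the law is then the Dirac mass at 0. *)
Definition gauss_char (v : R) : R := if v == 0 then 1 else gmean (Num.sqrt v) (@cos R).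

Let measurable_cos : measurable_fun setT (@cos R).
Proof. by apply: continuous_measurable_fun; exact: continuous_cos. Qed.

Let measurable_sin : measurable_fun setT (@sin R).
Proof. by apply: continuous_measurable_fun; exact: continuous_sin. Qed.

Let cos_bound (a : R) : `|cos a| <= 1. Proof. by rewrite ler_norml cos_geN1 cos_le1. Qed.
Let sin_bound (a : R) : `|sin a| <= 1. Proof. by rewrite ler_norml sin_geN1 sin_le1. Qed.

Lemma gauss_pos_law (v : R) (X : Omega -> R) : 0 < v ->
  (forall D, measurable D -> P (X @^-1` D) = gauss v D) ->
  forall D, measurable D -> P (X @^-1` D) = normal_prob 0 (Num.sqrt v) D.
Proof. by move=> v0 XD D mD; rewrite XD// /gauss gt_eqF. Qed.

(* By symmetry of the increments of W. *)
Lemma gmean_sin (v : R) : 0 < v -> gmean (Num.sqrt v) (@sin R) = 0.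
Proof.
move=> v0.
pose f0 : R -> R := esum (fun=> -1) [:: 0%N].
have lf : L2 f0 by exact: L2_esum.
have le : L2 e0 by exact: L2_esum.
have law g : L2 g -> inner g g = 1 ->
    forall D, measurable D -> P (incr g 0 v @^-1` D) = normal_prob 0 (Num.sqrt v) D.
  move=> lg ig; apply: gauss_pos_law => // D mD.
  by have := incr_law lg (lexx 0) v0 mD; rewrite subr0 ig mulr1.
have me g : L2 g -> measurable_fun setT (incr g 0 v).
  by move=> lg; apply: measurable_incr => //; exact: ltW.
have if0 : inner f0 f0 = 1 by rewrite /f0 inner_esum// big_seq1 sqrrN expr1n.
have h1 := gmean_law (me _ le) (law _ le inner_e0) measurable_sin sin_bound.
have h2 := gmean_law (me _ lf) (law _ lf if0) measurable_sin sin_bound.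
suff : \int[P]_o sin (incr f0 0 v o) = - \int[P]_o sin (incr e0 0 v o).
  by rewrite h1 h2; lra.
transitivity (\int[P]_o (-1 * sin (incr e0 0 v o))); last first.
  rewrite RintegralZl ?mulN1r//.
  apply: (@bounded_integrableP _ _ _ _ _ 1); last by move=> o; exact: sin_bound.
  exact: measurableT_comp (me _ le).
apply: ae_Rintegral.
- exact: measurableT_comp (me _ lf).
- apply: measurable_funM; first exact: measurable_cst.
  exact: measurableT_comp (me _ le).
have h0 := incr_esum (fun=> -1) [:: 0%N] (lexx 0) (ltW v0).
have h0' := incr_esum (fun=> 1) [:: 0%N] (lexx 0) (ltW v0).
apply: filterS2 h0 h0' => o; rewrite !big_seq1 -/e0 -/f0 => -> ->.
by rewrite mul1r !mulN1r sinN.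
Qed.

Lemma gauss_cos (v t : R) (X : Omega -> R) : 0 <= v -> measurable_fun setT X ->
  (forall D, measurable D -> P (X @^-1` D) = gauss v D) ->
  \int[P]_o cos (X o + t) = cos t * gauss_char v.
Proof.
move=> v0 mX XD; rewrite /gauss_char; case: eqP => [vE|/eqP vn].
  rewrite mulr1.
  have X0 : {ae P, forall o, X o = 0}.
    have m1 : measurable (~` (X @^-1` [set 0])).
      by apply: measurableC; exact: preimage_measurable.
    exists (~` (X @^-1` [set 0])); split => //.
    rewrite probability_setC; last exact: preimage_measurable.
    rewrite XD// /gauss vE eqxx diracE mem_set// -EFinB subrr//.
  transitivity (\int[P]_o cos t); last first.
    by rewrite (Rintegral_cst _ measurableT) -[X in fine X]/(P setT) probability_setT mulr1.
  apply: ae_Rintegral; last by apply: filterS X0 => o ->; rewrite add0r.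
    apply: (measurableT_comp measurable_cos); apply: measurable_funD => //.
  exact: measurable_cst.
have vp : 0 < v by rewrite lt_neqAle eq_sym vn.
have mct : measurable_fun setT (fun a : R => cos (a + t)).
  by apply: (measurableT_comp measurable_cos); apply: measurable_funD => //; exact: measurable_cst.
rewrite (gmean_law mX (gauss_pos_law vp XD) mct (fun a => cos_bound _)).
transitivity (gmean (Num.sqrt v) (fun a => cos t * cos a - sin t * sin a)).
  by congr gmean; apply/funext => a; rewrite cosD; ring.
have mc : measurable_fun setT (fun a : R => cos t * cos a) by exact: measurable_funM.
have ms : measurable_fun setT (fun a : R => sin t * sin a) by exact: measurable_funM.
rewrite (gmeanB _ mc ms (M := 1)); last 2 first.
- by move=> a; rewrite normrM mulr_ile1.
- by move=> a; rewrite normrM mulr_ile1.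
rewrite (gmeanZ _ _ measurable_cos cos_bound) (gmeanZ _ _ measurable_sin sin_bound).
by rewrite gmean_sin// mulr0 subr0.
Qed.

(** The increment of one coordinate of [W] over [[0, a + b]] is the sum of independent increments
    over [[0, a]] and [[a, a + b]], which factorizes its transform; no Gaussian integral has to be
    evaluated. *)
Lemma gauss_charD a b : 0 <= a -> 0 <= b -> gauss_char (a + b) = gauss_char a * gauss_char b.
Proof.
move=> a0 b0.
have [->|an] := eqVneq a 0; first by rewrite add0r {2}/gauss_char eqxx mul1r.
have [->|bn] := eqVneq b 0; first by rewrite addr0 {3}/gauss_char eqxx mulr1.
have ap : 0 < a by rewrite lt_neqAle eq_sym an.
have bp : 0 < b by rewrite lt_neqAle eq_sym bn.
have le : L2 e0 by exact: L2_esum.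
have aab : a < a + b by rewrite ltrDl.
have law s t : 0 <= s -> s < t ->
    forall D, measurable D -> P (incr e0 s t @^-1` D) = gauss (t - s) D.
  by move=> s0 st D mD; have := incr_law le s0 st mD; rewrite inner_e0 mulr1.
have law1 := law 0 a (lexx 0) ap; rewrite subr0 in law1.
have law2 := law a (a + b) a0 aab; rewrite addrAC subrr add0r in law2.
have law3 := law 0 (a + b) (lexx 0) (addr_gt0 ap bp); rewrite subr0 in law3.
have m1 := measurable_incr le (lexx 0) a0.
have m2 := measurable_incr le a0 (ltW aab).
have m3 := measurable_incr le (lexx 0) (addr_ge0 a0 b0).
have h3 := gauss_cos 0 (addr_ge0 a0 b0) m3 law3.
rewrite cos0 mul1r in h3; rewrite -h3.
have i12 : indep P (incr e0 0 a) (incr e0 a (a + b)).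
  move=> C D mC mD; apply: incr_indep => //.
  exact: ((FmeasurableP _ a0).1 (Fmeasurable_incr le (lexx 0) a0)).
transitivity (\int[P]_o (fun z : R * R => cos (z.2 + z.1)) (incr e0 0 a o, incr e0 a (a + b) o)).
  by apply: eq_Rintegral => o _; rewrite /incr /=; congr cos; ring.
have mf : measurable_fun setT (fun z : R * R => cos (z.2 + z.1)).
  apply: (measurableT_comp measurable_cos); apply: measurable_funD.
    exact: measurable_snd.
  exact: measurable_fst.
rewrite (indep_Rintegral m1 m2 i12 mf (fun z => cos_bound _)) /=.
under eq_Rintegral do rewrite (gauss_cos _ b0 m2 law2) mulrC.
have h1 := gauss_cos 0 a0 m1 law1; rewrite cos0 mul1r in h1.
under eq_Rintegral do rewrite mulrC.
rewrite RintegralZr//.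
  rewrite -h1; congr (_ * _); by apply: eq_Rintegral => o _; rewrite addr0.
apply: (@bounded_integrableP _ _ _ _ _ 1); last by move=> o; exact: cos_bound.
exact: measurableT_comp m1.
Qed.

(** This is [B e_n] for [B = (-A)^(1/2)], so the increments of [W (mode n)] are the stochastic
    forcing of mode [n]. *)
Definition mode (n : nat) : R -> R := esum (@nu R) [:: n].

Lemma wiener_noise (m : nat) (w : nat -> R) (t t' lo hi : R) (X : Omega -> nat -> R) f :
  (forall n, (1 <= n <= m)%N -> 0 < w n) -> 0 <= t -> t < t' ->
  (forall n, Fmeasurable t (fun o => X o n)) -> 0 < lo -> good m w lo hi f ->
  \int[P]_o f (kick (fun n => incr (mode n) t t') m (X o) o) =
  \int[P]_o noise (fun n => Num.sqrt (t' - t) * nu n) m f (X o).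
Proof.
move=> w0 t0 tt' mX lo0 gf.
have tau0 : 0 < t' - t by rewrite subr_gt0.
have mxi l : measurable_fun setT (incr (mode l) t t').
  by apply: measurable_incr (ltW tt') => //; exact: L2_esum.
have combE a : {ae P, forall o, comb m (fun n => incr (mode n) t t') 1 a o =
    incr (esum (fun l => a l * nu l) (index_iota 1 m.+1)) t t' o}.
  have h : {ae P, forall o, forall l, incr (mode l) t t' o = nu l * incr (eigen l) t t' o}.
    apply: ae_foralln => l.
    by apply: filterS (incr_esum (@nu R) [:: l] t0 (ltW tt')) => o; rewrite big_seq1.
  apply: filterS2 h (incr_esum (fun l => a l * nu l) (index_iota 1 m.+1) t0 (ltW tt')) => o h ->.
  by rewrite /comb; apply: eq_bigr => l _; rewrite h mulrA.
have lE a : L2 (esum (fun l => a l * nu l) (index_iota 1 m.+1)) by exact: L2_esum.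
have mE a := measurable_incr (lE a) t0 (ltW tt').
have mC a : measurable_fun setT (comb m (fun n => incr (mode n) t t') 1 a).
  exact: measurable_comb.
have law l : (1 <= l)%N -> forall D, measurable D ->
    P (incr (mode l) t t' @^-1` D) = normal_prob 0 (Num.sqrt (t' - t) * nu l) D.
  move=> l1 D mD; rewrite (incr_law (L2_esum _ _) t0 tt' mD).
  rewrite /mode inner_esum// big_seq1 /gauss gt_eqF; last first.
    by rewrite mulr_gt0// exprn_gt0// nu_gt0.
  by rewrite (sqrtrM _ (ltW tau0)) sqrtr_sqr (ger0_norm (nu_ge0 l)).
have cc a s : \int[P]_o cos (comb m (fun n => incr (mode n) t t') 1 a o + s) =
    cos s * gauss_char (\sum_(1 <= l < m.+1) (a l * (Num.sqrt (t' - t) * nu l)) ^+ 2).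
  have mc (U : Omega -> R) : measurable_fun setT U -> measurable_fun setT (fun o : Omega => cos (U o + s)).
    move=> mU; apply: (measurableT_comp measurable_cos); apply: measurable_funD => //.
  transitivity (\int[P]_o cos (incr (esum (fun l => a l * nu l) (index_iota 1 m.+1)) t t' o + s)).
    apply: ae_Rintegral; [exact: mc|exact: mc|].
    by apply: filterS (combE a) => o ->.
  apply: gauss_cos => //; first by apply: sumr_ge0 => l _; exact: sqr_ge0.
  move=> D mD; rewrite (incr_law (lE a) t0 tt' mD) (inner_esum _ (iota_uniq _ _)) mulr_sumr.
  congr gauss; apply: eq_bigr => l _.
  by rewrite !exprMn (sqr_sqrtr (ltW tau0)); ring.
(* The past enters through the identity map into the sample space equipped with [F t]; independence
   of this map from an increment is independence of the increment from [F t]. *)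
have mid : measurable_fun setT (idfun : Omega -> g_sigma_algebraType (F t)).
  move=> _ D mD; rewrite setTI preimage_id.
  by move: mD; rewrite /measurable/= (sigma_algebra_id (hF.1 t t0).1); exact: (hF.1 t t0).2.
have iid a : indep P (idfun : Omega -> g_sigma_algebraType (F t))
    (comb m (fun n => incr (mode n) t t') 1 a).
  move=> C D mC' mD.
  have FC : F t C by move: mC'; rewrite /measurable/= (sigma_algebra_id (hF.1 t t0).1).
  have mC0 : @measurable d Omega C by exact: (hF.1 t t0).2.
  rewrite preimage_id (ae_prob mC0 (mC a) (mE a) mD (combE a)).
  rewrite (incr_indep (lE a) t0 tt' mD FC); congr (_ * _)%E.
  by have := ae_prob measurableT (mC a) (mE a) mD (combE a); rewrite !setTI.
exact: (@noise_expectation R d Omega P m w _ w0 _ mxi law _ gauss_charD cc _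
  (g_sigma_algebraType (F t)) idfun X lo hi f
  mid mX iid lo0 gf).
Qed.

End wiener_noise.

(** * Pathwise error of the chain *)

Section rectangle.
Context {R : realType}.
Local Notation mu := (@lebesgue_measure R).
Local Notation I01 := (`[0, 1]%classic : set R).

Definition rect (a b : R) : set (R * R) := `[a, b] `*` I01.

Lemma within_compact_unif (K : set (R * R)) (f : R * R -> R) (eps : R) : compact K ->
  {within K, continuous f} -> 0 < eps ->
  exists2 eta : R, 0 < eta & forall z z', K z -> K z' -> `|z.1 - z'.1| < eta ->
    `|z.2 - z'.2| < eta -> `|f z - f z'| <= eps.
Proof.
move=> /compact_near_coveringP/near_covering_withinP cK /subspace_continuousP cf e0.
pose Q (eta : R) (z : R * R) := forall z', K z' -> `|z.1 - z'.1| < eta ->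
    `|z.2 - z'.2| < eta -> `|f z - f z'| <= eps.
have H : forall x, K x -> \forall z \near x & eta \near (0 : R)^'+, K z -> Q eta z.
  move=> x Kx.
  have e2 : 0 < eps / 2 by exact: divr_gt0.
  have := @cvgr_dist_lt _ _ _ _ (within_filter _ (nbhs_filter x)) _ _ (cf x Kx) _ e2.
  move=> /nbhs_ballP[r /= r0 hr].
  have r2 : 0 < r / 2 by exact: divr_gt0.
  exists (ball x (r / 2), [set eta | eta < r / 2]).
    split; first exact: nbhsx_ballx.
    exact: nbhs_right_lt.
  move=> [z eta] /= [[b1 b2] etar] Kz z' Kz' h1 h2.
  have bz : `|f x - f z| < eps / 2.
    by apply: hr => //; split; apply: lt_trans (_ : _ < r / 2) _ => //; lra.
  have bz' : `|f x - f z'| < eps / 2.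
    rewrite /ball/= in b1 b2.
    apply: hr => //; split; rewrite /ball/=.
      have -> : x.1 - z'.1 = (x.1 - z.1) + (z.1 - z'.1) by ring.
      by apply: le_lt_trans (ler_normD _ _) _; move: b1 h1 etar; set A := `|_|; set B := `|_|; lra.
    have -> : x.2 - z'.2 = (x.2 - z.2) + (z.2 - z'.2) by ring.
    by apply: le_lt_trans (ler_normD _ _) _; move: b2 h2 etar; set A := `|_|; set B := `|_|; lra.
  have -> : f z - f z' = (f x - f z') - (f x - f z) by ring.
  by apply: le_trans (ler_normB _ _) _; move: bz bz'; set A := `|_|; set B := `|_|; lra.
have [eta eta0 hQ] : exists2 eta : R, 0 < eta & K `<=` Q eta.
  have h := cK _ _ _ _ H.
  have [e /= e0' he] := h.
  exists (e / 2); first exact: divr_gt0.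
  apply: he => /=; last exact: divr_gt0.
  by rewrite sub0r normrN gtr0_norm ?divr_gt0//; lra.
by exists eta => // z z' Kz; exact: hQ.
Qed.

(** Clamping the argument extends [g] to a continuous function on the line. *)
Lemma uniform_measurable (a b : R) (g : R -> R) : a <= b ->
  (forall eps : R, 0 < eps -> exists2 eta : R, 0 < eta & forall s s', a <= s <= b ->
     a <= s' <= b -> `|s - s'| < eta -> `|g s - g s'| <= eps) ->
  measurable_fun (`[a, b]%classic : set R) g.
Proof.
move=> ab gu.
pose cl (s : R) := Num.max a (Num.min b s).
have clab s : a <= cl s <= b.
  by rewrite /cl le_max lexx/= ge_max ab/= ge_min lexx.
apply: (@eq_measurable_fun _ _ _ _ _ (g \o cl)) => [s|].
  rewrite inE/= in_itv/= => /andP[s1 s2]; congr g; rewrite /cl min_r// max_r//.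
apply: measurable_funTS; apply: continuous_measurable_fun => s.
apply/(@cvgrPdist_le _ _ _ _ (nbhs_filter s)) => eps e0.
have [eta eta0 h] := gu eps e0.
near=> s'; apply: h => //; apply: le_lt_trans (clamp_lip _ _ _ _) _.
by near: s'; apply: cvgr_dist_lt => //; exact: cvg_id.
Unshelve. all: by end_near. Qed.

Section bounded_field.
Variables (u : R -> R -> R) (a b : R).
Hypothesis ab : a <= b.
Hypothesis cu : {within rect a b, continuous (fun z => u z.1 z.2)}.
Hypothesis u1 : forall s x, a <= s <= b -> I01 x -> `|u s x| <= 1.

Lemma compact_rect : compact (rect a b).
Proof. by apply: compact_setX; exact: segment_compact. Qed.

Lemma field_unif (eps : R) : 0 < eps -> exists2 eta : R, 0 < eta &
  forall s s' x x', a <= s <= b -> a <= s' <= b -> I01 x -> I01 x' ->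
  `|s - s'| < eta -> `|x - x'| < eta -> `|u s x - u s' x'| <= eps.
Proof.
move=> e0; have [eta eta0 h] := within_compact_unif compact_rect cu e0.
exists eta => // s s' x x' hs hs' hx hx' h1 h2.
by apply: (h (s, x) (s', x')).
Qed.

Lemma field_bfun s : a <= s <= b -> bfun (u s).
Proof.
move=> hs; split; last by move=> x; exact: u1.
apply: uniform_measurable => // eps e0; have [eta eta0 h] := field_unif e0.
exists eta => // x x' hx hx' xx'; apply: h => //.
by rewrite subrr normr0.
Qed.

Lemma coef_dist (v v' : R -> R) (eps : R) n : bfun v -> bfun v' ->
  (forall x, I01 x -> `|v x - v' x| <= eps) -> `|coef v n - coef v' n| <= 2 * eps.
Proof.
move=> bv bv' h.
have ei (f : R -> R) : bfun f -> mu.-integrable I01 (EFin \o (fun x => f x * eigen n x)).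
  move=> bf.
  exact: (bfun_integrable bf (@measurable_eigen R n I01) (fun x _ => eigen_bound n x)).
have -> : coef v n - coef v' n = coef (fun x => v x - v' x) n.
  rewrite /coef /inner; have e := RintegralB measurable01 (ei _ bv) (ei _ bv').
  transitivity (\int[mu]_(x in I01) (v x * eigen n x - v' x * eigen n x)); first by rewrite e.
  by apply: eq_Rintegral => x _; ring.
by apply: coefS_bounded => //; apply: measurable_funB; [exact: bv.1|exact: bv'.1].
Qed.

Lemma measurable_coef n : measurable_fun (`[a, b]%classic : set R) (fun s => coef (u s) n).
Proof.
apply: uniform_measurable => // eps e0.
have e2 : 0 < eps / 2 by exact: divr_gt0.
have [eta eta0 h] := field_unif e2.
exists eta => // s s' hs hs' ss'.
have -> : eps = 2 * (eps / 2) by field.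
apply: coef_dist; [exact: field_bfun|exact: field_bfun|].
by move=> x hx; apply: h => //; rewrite subrr normr0.
Qed.

Lemma field_fejer (eps : R) : 0 < eps -> exists m0, forall m s x, (m0 <= m)%N ->
  a <= s <= b -> I01 x -> `|fejer m (coef (u s)) x - u s x| <= eps.
Proof.
move=> e0; have e2 : 0 < eps / 2 by exact: divr_gt0.
have [eta eta0 h] := field_unif e2.
have [m0 hm] := fejer_uniform e2 eta0.
exists m0 => m s x m0m hs hx.
have -> : eps = 2 * (eps / 2) by field.
apply: (hm m (u s)) => //; first exact: field_bfun.
by move=> y y' hy hy' yy'; apply: h => //; rewrite ?subrr ?normr0// distrC.
Qed.

Lemma measurable_rect a' b' : measurable (rect a' b').
Proof. by apply: measurableX; exact: measurable_itv. Qed.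

(** Each Fejer mean is a finite sum of products of a function of time and a function of space, hence
    measurable for the product sigma-algebra, and these means converge pointwise on the
    rectangle. *)
Lemma measurable_field2 : measurable_fun (rect a b) (fun z => u z.1 z.2).
Proof.
apply: (@measurable_fun_cvg _ _ _ _ (fun m z => fejer m (coef (u z.1)) z.2)).
  move=> m; apply: measurable_sum => n; apply: measurable_funM.
    apply: measurable_funM; first exact: measurable_cst.
    have := measurable_coef n.
    move=> mc; apply: (measurable_comp _ _ mc); first exact: measurable_itv.
    - by move=> _ [z [hz _] <-].
    - by apply: measurable_funTS; exact: measurable_fst.
  have me := @measurable_eigen R n setT.
  by apply: measurable_funTS; apply: (measurableT_comp me); exact: measurable_snd.
move=> [s x] [/=]; rewrite in_itv/= => hs hx.
apply/cvgrPdist_le => eps e0; have [m0 h] := field_fejer e0.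
by exists m0 => // m /= m0m; rewrite distrC; exact: h.
Qed.

End bounded_field.

Lemma fubini_rect (a b : R) (f : R * R -> \bar R) :
  (mu \x mu)%E.-integrable (rect a b) f ->
  (\int[mu]_(s in `[a, b]) \int[mu]_(x in I01) f (s, x) =
   \int[(mu \x mu)%E]_(z in rect a b) f z)%E.
Proof.
have mr : measurable (rect a b : set (measurableTypeR R * measurableTypeR R)).
  exact: measurable_rect.
rewrite (integrable_mkcond _ mr) => fi.
rewrite [RHS]integral_mkcond -(integral12_prod_meas1 fi) integral_mkcond.
apply: eq_integral => s _; rewrite /fubini_F patchE; case: ifPn => hs.
  rewrite [LHS]integral_mkcond; apply: eq_integral => x _; rewrite !patchE.
  have -> : ((s, x) \in rect a b) = (x \in I01) => //.
  apply/idP/idP => [/set_mem[_ hx]|/set_mem hx]; first exact: mem_set.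
  by apply: mem_set; split => //; exact: (set_mem hs).
rewrite integral0_eq// => x _; rewrite patchE ifF//.
by apply/negbTE; apply: contra hs => /set_mem[hs _]; exact: mem_set.
Qed.

End rectangle.

(** * Error of one Euler step against the solution *)

Section step_error.
Context {R : realType}.
Local Notation mu := (@lebesgue_measure R).
Local Notation I01 := (`[0, 1]%classic : set R).
Local Notation plane := (measurableTypeR R * measurableTypeR R)%type.

Lemma coef_esum (c : nat -> R) r n : uniq r -> n \in r -> coef (esum c r) n = c n.
Proof.
move=> ur nr; transitivity (\sum_(k <- r) c k * coef (@eigen R n) k); last first.
  rewrite (bigD1_seq n)//= coef_eigen eqxx mulr1 big1 ?addr0// => k kn.
  by rewrite coef_eigen eq_sym (negbTE kn) mulr0.
rewrite -(@coef_sum_bounded _ (eigen n) r c 2 (@measurable_eigen R n I01) (fun x _ => eigen_bound n x)).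
by rewrite /coef /inner; apply: eq_Rintegral => x _; rewrite mulrC.
Qed.

(** Cutting [f] at [k] changes it on a null set only and makes the inequality hold everywhere. *)
Lemma Rintegral_ae_le (eta : {measure set plane -> \bar R}) (D : set plane) (f : plane -> R)
    (M k : R) : measurable D -> (eta D < +oo)%E -> measurable_fun D f ->
  (forall z, D z -> `|f z| <= M) -> {ae eta, forall z, D z -> f z <= k} ->
  \int[eta]_(z in D) f z <= k * fine (eta D).
Proof.
move=> mD Doo mf fM fk.
have mk : measurable_fun D (fun=> k : R) by exact: measurable_cst.
have mg : measurable_fun D (fun z => Num.min (f z) k) by exact: measurable_minr.
have ik : eta.-integrable D (EFin \o fun=> k) by exact: (bounded_integrable (M := `|k|) mD).
have ig : eta.-integrable D (EFin \o fun z => Num.min (f z) k).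
  apply: (bounded_integrable (M := M + `|k|) mD) => // z Dz.
  by have := fM z Dz; case: (leP (f z) k) => _ h; rewrite ?(le_trans h) ?lerDl ?lerDr// (le_trans _ h).
have -> : \int[eta]_(z in D) f z = \int[eta]_(z in D) Num.min (f z) k.
  rewrite /Rintegral; congr fine; apply: ae_eq_integral => //; try exact/measurable_EFinP.
  by apply: filterS fk => z h Dz; rewrite min_l// h.
rewrite -(Rintegral_cst _ mD); apply: le_Rintegral => // z _.
by rewrite ge_min lexx orbT.
Qed.

Lemma measurable_snd_fun (D : set plane) (f : R -> R) : measurable_fun setT f ->
  measurable_fun D (fun z : plane => f z.2).
Proof.
by move=> mf; apply: measurable_funTS; apply: (measurableT_comp mf); exact: measurable_snd.
Qed.

Variables (c : R) (m : nat) (a lam : R) (c1 : `|c| < 1).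
Hypothesis a01 : 0 < a < 1.
Hypothesis lam_pi : lam <= pi ^+ 2.
Local Notation N := (nrm2 m (wt m)).

Variables (u : R -> R -> R) (A B : R) (bt : R * R -> R).
Hypothesis AB : A <= B.
Hypothesis cu : {within rect A B, continuous (fun z => u z.1 z.2)}.
Hypothesis u1 : forall s x, A <= s <= B -> I01 x -> `|u s x| <= 1.
Hypothesis umass : coef (u B) 0 = c.
Hypothesis ibt : (mu \x mu)%E.-integrable (rect A B) (EFin \o bt).
Variables etap etam : {measure set plane -> \bar R}.
Hypothesis etap_fin : (etap (rect A B) < +oo)%E.
Hypothesis etam_fin : (etam (rect A B) < +oo)%E.
Hypothesis contactp : {ae etap, forall z, rect A B z -> u z.1 z.2 = 1}.
Hypothesis contactm : {ae etam, forall z, rect A B z -> u z.1 z.2 = -1}.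
(** The noise increment of the step, common to the solution and to the chain, so that it cancels in
    their difference. *)
Variable xi : nat -> R.
Hypothesis modal : forall n, (1 <= n <= m)%N ->
  coef (u B) n - coef (u A) n = 2^-1 * nu n ^+ 2 *
    ((lam - nu n ^+ 2) * \int[mu]_(s in `[A, B]) coef (u s) n +
     \int[(mu \x mu)%E]_(z in rect A B) (bt z * eigen n z.2) +
     \int[etam]_(z in rect A B) eigen n z.2 - \int[etap]_(z in rect A B) eigen n z.2) + xi n.
Variables X X' : nat -> R.
Hypothesis X_adm : admissible c m X.
Hypothesis XX' : forall n, (1 <= n <= m)%N ->
  X' n = pr m c1 (fun k => X k + (B - A) * drift c m a lam X k + xi k) n.
Variables (om eps Dl : R).
Hypothesis om_mod : forall s s' x, A <= s <= B -> A <= s' <= B -> I01 x ->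
  `|u s x - u s' x| <= om.
Hypothesis eps_fejer : forall x, I01 x -> `|fejer m (coef (u B)) x - u B x| <= eps.
Hypothesis Dl_incr : forall n, (1 <= n <= m)%N -> `|X' n - X n| <= Dl.

Let tau := B - A.
Let U := coef (u B).
Let z := U - X'.
Let Z (x : R) := field c m U x - field c m X' x.
Let rc : measurable (rect A B : set plane). Proof. exact: measurable_rect. Qed.
Let hA : A <= A <= B. Proof. by rewrite lexx AB. Qed.
Let hB : A <= B <= B. Proof. by rewrite lexx AB. Qed.
Let tau0 : 0 <= tau. Proof. by rewrite subr_ge0. Qed.
Let bU : bfun (u B). Proof. exact: field_bfun cu u1 _ hB. Qed.

Let fieldU x : field c m U x = fejer m U x.
Proof.
rewrite /field /fejer; apply: eq_bigr => n _; congr (_ * _ * _).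
by case: n => [|//]; rewrite /= /U umass.
Qed.

Let X'_adm : admissible c m X'.
Proof.
apply: (@admissible_ext _ _ _ (pr m c1 (fun k => X k + (B - A) * drift c m a lam X k + xi k))).
  by move=> n /XX' ->.
exact: proj_in.
Qed.

Let U_adm : admissible c m U.
Proof. by move=> x Ix; rewrite fieldU; exact: fejer_le1. Qed.

Let ZE x : Z x = esum (fun n => rho m n * z n) (index_iota 1 m.+1) x.
Proof. by rewrite /Z field_diff /esum /z. Qed.

Let Z_bound x : I01 x -> `|Z x| <= 2.
Proof.
move=> Ix; apply: le_trans (ler_normB _ _) _.
by have := lerD (U_adm Ix) (X'_adm Ix); rewrite -[leRHS]/(1 + 1 : R).
Qed.

Let mZ D : measurable_fun D Z.
Proof. by apply: measurable_funB; exact: measurable_field. Qed.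

Let rz_bound n : (1 <= n <= m)%N -> `|rho m n * z n| <= 4.
Proof.
move=> nm; have nr : n \in index_iota 1 m.+1 by rewrite mem_index_iota ltnS.
rewrite -(@coef_esum (fun n => rho m n * z n) _ _ (iota_uniq _ _) nr).
have -> : (4 : R) = 2 * 2 by ring.
apply: coefS_bounded; first exact: measurable_esum.
by move=> x Ix; rewrite -ZE; exact: Z_bound.
Qed.

(** Error of replacing solution and chain at another time of the step by their values at its end:
    Fejer error, oscillation of [u], and increment of the chain. *)
Let kap : R := eps + om + (\sum_(1 <= n < m.+1) 2) * Dl.

Let ZU s x : A <= s <= B -> I01 x ->
  `|Z x - (u s x - field c m X x)| <= kap.
Proof.
move=> hs Ix; rewrite /Z fieldU.
have -> : fejer m U x - field c m X' x - (u s x - field c m X x) =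
  (fejer m U x - u B x) + (u B x - u s x) - (field c m X' x - field c m X x) by ring.
apply: le_trans (ler_normB _ _) _; apply: lerD.
  by apply: le_trans (ler_normD _ _) _; apply: lerD; [exact: eps_fejer|exact: om_mod].
rewrite field_diff; apply: le_trans (ler_norm_sum _ _ _) _.
rewrite mulr_suml big_nat_cond [leRHS]big_nat_cond; apply: ler_sum => n.
rewrite andbT ltnS => nm; rewrite normrM [2 * Dl]mulrC; apply: ler_pM => //.
  rewrite normrM (ger0_norm (rho_ge0 m n)); apply: le_trans (Dl_incr nm).
  by apply: ler_piMl => //; exact: rho_le1.
exact: eigen_bound.
Qed.

Let kapB x s : A <= s <= B -> I01 x -> `|fejer m U x - u s x| <= kap.
Proof.
move=> hs Ix.
have Dl0 : 0 <= (\sum_(1 <= n < m.+1) (2 : R)) * Dl.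
  rewrite mulr_suml big_nat_cond; apply: sumr_ge0 => n; rewrite andbT ltnS => nm.
  by apply: mulr_ge0 => //; apply: le_trans (Dl_incr nm); exact: normr_ge0.
have -> : fejer m U x - u s x = (fejer m U x - u B x) + (u B x - u s x) by ring.
apply: le_trans (ler_normD _ _) _; rewrite /kap.
by have := eps_fejer Ix; have := om_mod hB hs Ix; move: Dl0; rewrite -/U; lra.
Qed.

Let S1 := \sum_(1 <= n < m.+1) rho m n * z n *
  ((lam - nu n ^+ 2) * (\int[mu]_(s in `[A, B]) coef (u s) n - tau * X n)).
Let S2 := \sum_(1 <= n < m.+1) rho m n * z n *
  (\int[(mu \x mu)%E]_(z in rect A B) (bt z * eigen n z.2) -
   tau * coef (beta a \o field c m X) n).
Let S3 := \sum_(1 <= n < m.+1) rho m n * z n *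
  (\int[etam]_(z in rect A B) eigen n z.2 - \int[etap]_(z in rect A B) eigen n z.2).

(** The squares are expanded around the final difference [z], so the square of the increment has a
    favourable sign. As [U] is admissible, the variational inequality of the projection removes the
    correction [Y - p], and the common noise cancels. *)
Let energy : N (U - X') - N (coef (u A) - X) <= S1 + S2 + S3.
Proof.
pose Y k := X k + (B - A) * drift c m a lam X k + xi k.
pose p := pr m c1 Y.
have key : ip m (wt m) (Y - p) (U - p) <= 0 by rewrite /p /pr; exact: proj_ip.
pose E n := U n - coef (u A) n - (B - A) * drift c m a lam X n - xi n.
have h1 : N (U - X') - N (coef (u A) - X) <= 2 * ip m (wt m) (E + (Y - p)) z.
  have -> : N (coef (u A) - X) = N (z - (E + (Y - p))).
    apply: eq_ip => n nm; rewrite /z !fctE XX'// -/p /E /Y -/Y; ring.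
  by rewrite -/z (@nrm2B R m (wt m) z (E + (Y - p))) [ip m (wt m) z _]ipC; have := nrm2_ge0 (@wt_gt0 R m) (E + (Y - p)); lra.
apply: le_trans h1 _; rewrite ipDl.
have -> : ip m (wt m) (Y - p) z = ip m (wt m) (Y - p) (U - p).
  by apply: eq_ip => // n nm; rewrite /z !fctE XX'.
have -> : S1 + S2 + S3 = 2 * ip m (wt m) E z; last by lra.
rewrite /S1 /S2 /S3 /ip mulr_sumr -!big_split/= big_nat_cond [RHS]big_nat_cond.
apply: eq_bigr => n; rewrite andbT ltnS => nm.
have nn : nu n != 0 :> R by rewrite gt_eqF// nu_gt0//; case/andP: nm.
rewrite /E modal// -/tau /drift /wt.
by field.
Qed.

Let G := 4 * \sum_(1 <= n < m.+1) (nu n ^+ 2 - lam).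

Let lam_nu n : (1 <= n)%N -> 0 <= nu n ^+ 2 - lam.
Proof.
move=> n1; rewrite subr_ge0; apply: le_trans lam_pi _.
have p0 : 0 <= (pi : R) := pi_ge0 R.
rewrite ler_pXn2r ?nnegrE ?nu_ge0//.
by rewrite /nu; apply: ler_peMl => //; rewrite ler1n.
Qed.

(** Up to the variation within the step, the linear part in mode [n] is
    [- tau rho (nu^2 - lam) z^2], nonpositive because [lam <= pi^2]. *)
Let S1_le : S1 <= G * (2 * om + Dl) * tau.
Proof.
rewrite /S1 /G mulr_sumr !mulr_suml big_nat_cond [leRHS]big_nat_cond.
apply: ler_sum => n; rewrite andbT ltnS => nm; have /andP[n1 _] := nm.
set I := \int[mu]_(s in `[A, B]) coef (u s) n.
have mI : (mu `[A, B]%classic < +oo)%E by rewrite lebesgue_measure_itv/=; case: ifP => _; rewrite ltry.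
have mAB : measurable (`[A, B]%classic : set (measurableTypeR R)) by exact: measurable_itv.
have muAB : fine (mu `[A, B]%classic) = tau.
  rewrite lebesgue_measure_itv/= lte_fin; case: ltP => // BA.
  by rewrite /tau; have -> : A = B; [apply/eqP; rewrite eq_le AB BA|rewrite subrr].
have ic : mu.-integrable `[A, B] (EFin \o fun s => coef (u s) n).
  apply: (@bounded_integrable _ _ _ _ _ _ 2) => //.
    exact: (measurable_coef AB cu u1).
  move=> s; rewrite /= in_itv/= => hs; rewrite -[leRHS]mulr1.
  have bs := field_bfun cu u1 hs.
  by apply: coefS_bounded; [exact: bs.1|exact: bs.2].
have ik (k : R) : mu.-integrable `[A, B] (EFin \o fun=> k).
  by apply: (@bounded_integrable _ _ _ _ _ _ `|k|) => //; exact: measurable_cst.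
have hI : `|I - tau * U n| <= 2 * om * tau.
  have E1 : I - tau * U n = \int[mu]_(s in `[A, B]) (coef (u s) n - U n).
    by rewrite RintegralB// Rintegral_cst// muAB [tau * _]mulrC.
  have i1 : mu.-integrable `[A, B] (EFin \o fun s => coef (u s) n - U n).
    by have := integrableB mAB ic (ik (U n)); apply: eq_integrable.
  rewrite E1; apply: le_trans (le_normr_Rintegral mAB i1) _.
  rewrite -muAB -(Rintegral_cst _ mAB).
  apply: (@le_Rintegral _ _ _ mu _ _ _ mAB (integrable_norm i1) (ik _)) => s.
  rewrite /= in_itv/= => hs; apply: coef_dist; [exact: field_bfun cu u1 _ hs|exact: bU|].
  by move=> x Ix; exact: om_mod.
have E2 : rho m n * z n * ((lam - nu n ^+ 2) * (I - tau * X n)) =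
   - (rho m n * z n ^+ 2 * ((nu n ^+ 2 - lam) * tau)) -
   rho m n * z n * ((nu n ^+ 2 - lam) * ((I - tau * U n) + tau * (X' n - X n))).
  by rewrite /z !fctE; ring.
have g0 : 0 <= rho m n * z n ^+ 2 * ((nu n ^+ 2 - lam) * tau).
  apply: mulr_ge0; first by apply: mulr_ge0; [exact: rho_ge0|exact: sqr_ge0].
  by apply: mulr_ge0 => //; exact: lam_nu.
have g1 : `|rho m n * z n * ((nu n ^+ 2 - lam) * ((I - tau * U n) + tau * (X' n - X n)))| <=
    4 * (nu n ^+ 2 - lam) * (2 * om + Dl) * tau.
  have -> : 4 * (nu n ^+ 2 - lam) * (2 * om + Dl) * tau =
    4 * ((nu n ^+ 2 - lam) * ((2 * om + Dl) * tau)) by ring.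
  rewrite normrM; apply: ler_pM => //; first exact: rz_bound.
  rewrite normrM (ger0_norm (lam_nu n1)); apply: ler_wpM2l; first exact: lam_nu.
  apply: le_trans (ler_normD _ _) _.
  have -> : (2 * om + Dl) * tau = 2 * om * tau + Dl * tau by ring.
  apply: lerD => //.
  by rewrite normrM (ger0_norm tau0) mulrC; apply: ler_wpM2r => //; exact: Dl_incr.
rewrite E2; move: g1; rewrite ler_norml => /andP[g1 _]; lra.
Qed.

Let Zr_bound n : forall w : plane, rect A B w -> `|eigen n w.2 : R| <= 2.
Proof. by move=> w _; exact: eigen_bound. Qed.

Let mE n : measurable_fun (rect A B : set plane) (fun w : plane => eigen n w.2 : R).
Proof. by apply: measurable_snd_fun; exact: measurable_eigen. Qed.

Let eta_sum (eta : {measure set plane -> \bar R}) : (eta (rect A B) < +oo)%E ->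
  \sum_(1 <= n < m.+1) rho m n * z n * \int[eta]_(w in rect A B) eigen n w.2 =
  \int[eta]_(w in rect A B) Z w.2.
Proof.
move=> fin.
have ie n : eta.-integrable (rect A B) (EFin \o fun w => eigen n w.2).
  exact: (bounded_integrable rc fin (mE n) (Zr_bound n)).
have ie' n : eta.-integrable (rect A B) (EFin \o fun w => rho m n * z n * eigen n w.2).
  exact: integrableRZl.
transitivity (\int[eta]_(w in rect A B) \sum_(n <- index_iota 1 m.+1) rho m n * z n * eigen n w.2).
  have [-> _] := Rintegral_sum (index_iota 1 m.+1) rc ie'.
  by apply: eq_bigr => n _; rewrite RintegralZl.
by apply: eq_Rintegral => w _; rewrite ZE.
Qed.

(** Where [u = 1] the Fejer mean of the solution is at least [1 - kap] while that of the chain is at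
    most 1, so [Z >= - kap] where [etap] charges; symmetrically [Z <= kap] for [etam]. *)
Let S3_le : S3 <= kap * (fine (etap (rect A B)) + fine (etam (rect A B))).
Proof.
have -> : S3 = \int[etam]_(w in rect A B) Z w.2 - \int[etap]_(w in rect A B) Z w.2.
  rewrite /S3 -(eta_sum etam_fin) -(eta_sum etap_fin) -sumrB.
  by apply: eq_bigr => n _; ring.
have mZ2 : measurable_fun (rect A B : set plane) (fun w : plane => Z w.2).
  by apply: measurable_snd_fun; exact: mZ.
have Zb (w : plane) : rect A B w -> `|Z w.2| <= 2 by move=> [_ h]; exact: Z_bound.
have ip : \int[etam]_(w in rect A B) Z w.2 <= kap * fine (etam (rect A B)).
  apply: (Rintegral_ae_le rc etam_fin mZ2 Zb).
  apply: (@filterS _ _ (ae_filter_ringOfSetsType etam) _ _ _ contactm) => w h hw; have := h hw; case: hw => /=; rewrite in_itv/= => hs Ix uE.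
  have := X'_adm Ix; rewrite ler_norml /Z fieldU => /andP[h1 _].
  by have := kapB hs Ix; rewrite uE ler_norml => /andP[_]; lra.
have im : \int[etap]_(w in rect A B) (- Z w.2) <= kap * fine (etap (rect A B)).
  apply: (@Rintegral_ae_le _ _ _ 2 _ rc etap_fin).
  - by apply: (measurableT_comp (@oppr_measurable R setT)).
  - by move=> w hw; rewrite normrN; exact: Zb.
  apply: (@filterS _ _ (ae_filter_ringOfSetsType etap) _ _ _ contactp) => w h hw; have := h hw; case: hw => /=; rewrite in_itv/= => hs Ix uE.
  have := X'_adm Ix; rewrite ler_norml /Z fieldU => /andP[_ h1].
  by have := kapB hs Ix; rewrite uE ler_norml => /andP[]; lra.
have E : \int[etap]_(w in rect A B) (- Z w.2) = - \int[etap]_(w in rect A B) Z w.2.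
  rewrite -mulN1r -RintegralZl//.
    by apply: eq_Rintegral => w _; rewrite mulN1r.
  exact: (bounded_integrable rc etap_fin mZ2 Zb).
by rewrite E in im; rewrite mulrDr; lra.
Qed.

Let H1 (w : plane) := `|bt w - beta a (u w.1 w.2)|.
Let H2 (w : plane) := `|bt w| + beta_lip a.

Let murect : ((mu \x mu)%E (rect A B) < +oo)%E.
Proof.
rewrite /rect product_measure1E; [|exact: measurable_itv|exact: measurable_itv].
rewrite -[X in (_ * X)%E]/(mu I01) mu01 mule1 -[X in (X < _)%E]/(mu `[A, B]%classic).
by rewrite lebesgue_measure_itv/=; case: ifP => _; rewrite ltry.
Qed.

Let mu2 : measurable_fun (rect A B : set plane) (fun w : plane => u w.1 w.2).
Proof. exact: (measurable_field2 AB cu u1). Qed.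

Let ibu : (mu \x mu)%E.-integrable (rect A B) (EFin \o fun w => beta a (u w.1 w.2)).
Proof.
have mb : measurable_fun setT (beta a).
  by apply: continuous_measurable_fun; exact: continuous_beta.
apply: (bounded_integrable (M := beta_lip a) rc murect); first exact: (measurableT_comp mb mu2).
by move=> w _; exact: beta_bounded.
Qed.

Let ibb : (mu \x mu)%E.-integrable (rect A B) (EFin \o fun w => bt w - beta a (u w.1 w.2)).
Proof. exact: (integrableB rc ibt ibu). Qed.

Let iH1 : (mu \x mu)%E.-integrable (rect A B) (EFin \o H1).
Proof. exact: (integrable_norm ibb). Qed.

Let iH2 : (mu \x mu)%E.-integrable (rect A B) (EFin \o H2).
Proof.
have ik : (mu \x mu)%E.-integrable (rect A B) (EFin \o fun=> beta_lip a).
  exact: (@bounded_integrable R _ plane (mu \x mu)%E (rect A B) (fun=> beta_lip a)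
    `|beta_lip a| rc murect (@measurable_cst _ _ _ _ _ _) (fun _ _ => lexx _)).
by have := integrableD rc (integrable_norm ibt) ik; apply: eq_integrable.
Qed.

Let ibtM (g : plane -> R) (M : R) : measurable_fun (rect A B : set plane) g ->
  (forall w, rect A B w -> `|g w| <= M) ->
  (mu \x mu)%E.-integrable (rect A B) (EFin \o fun w => bt w * g w).
Proof.
move=> mg gM.
have iM : (mu \x mu)%E.-integrable (rect A B) (EFin \o fun w => M * `|bt w|).
  exact: (integrableRZl M rc (integrable_norm ibt)).
have mbt : measurable_fun (rect A B : set plane) bt.
  by apply/measurable_EFinP; case/integrableP: ibt.
apply: (le_integrable rc _ _ iM).
  by apply/measurable_EFinP; exact: measurable_funM.
move=> w hw; rewrite /= lee_fin normrM mulrC.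
by apply: le_trans (ler_norm _); apply: ler_wpM2r => //; exact: gM.
Qed.

Let v := beta a \o field c m X.

Let mv D : measurable_fun D v.
Proof. by apply: measurable_beta => //; exact: measurable_field. Qed.

Let vb x : `|v x| <= beta_lip a. Proof. exact: beta_bounded. Qed.

Let ivZ : (mu \x mu)%E.-integrable (rect A B) (EFin \o fun w => v w.2 * Z w.2).
Proof.
apply: (bounded_integrable (M := beta_lip a * 2) rc murect).
  by apply: (measurable_snd_fun (f := fun x => v x * Z x)); apply: measurable_funM.
move=> w [_ h]; rewrite normrM; apply: ler_pM => //; exact: Z_bound.
Qed.

Let vZ : \sum_(1 <= n < m.+1) rho m n * z n * (tau * coef v n) =
  \int[(mu \x mu)%E]_(w in rect A B) (v w.2 * Z w.2).
Proof.
rewrite [RHS]/Rintegral -(fubini_rect ivZ).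
have mAB : measurable (`[A, B]%classic : set (measurableTypeR R)) by exact: measurable_itv.
have e1 : (\int[mu]_(x in I01) (v x * Z x)%:E)%E = (\int[mu]_(x in I01) (v x * Z x))%:E.
  rewrite /Rintegral fineK//; apply: integrable_fin_num; first exact: measurable01.
  apply: (@bounded_integrable01 _ (fun x => v x * Z x) (beta_lip a * 2)).
    by apply: measurable_funM.
  by move=> x h; rewrite normrM; apply: ler_pM => //; exact: Z_bound.
have -> : (\int[mu]_(s in `[A, B]) \int[mu]_(x in I01) (EFin \o (fun w : plane => v w.2 * Z w.2)%R) (s, x) =
    \int[mu]_(s in `[A, B]) (\int[mu]_(x in I01) (v x * Z x)%R)%:E)%E.
  by apply: eq_integral => s _; exact: e1.
rewrite integral_cst//= fineM//; last first.
  by rewrite lebesgue_measure_itv/=; case: ifP => _; rewrite ?fin_numB.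
have -> : fine (mu `[A, B]%classic) = tau.
  rewrite lebesgue_measure_itv/= lte_fin; case: ltP => // BA.
  by rewrite /tau; have -> : A = B; [apply/eqP; rewrite eq_le AB BA|rewrite subrr].
rewrite /= -[X in _ = X * _](_ : \sum_(1 <= n < m.+1) rho m n * z n * coef v n = _).
  by rewrite mulr_suml; apply: eq_bigr => n _; ring.
rewrite -(@coef_sum_bounded _ v _ _ (beta_lip a) (@mv I01) (fun x _ => vb x)).
by apply: eq_Rintegral => x _; rewrite ZE.
Qed.

Let S2E : S2 = \int[(mu \x mu)%E]_(w in rect A B) ((bt w - v w.2) * Z w.2).
Proof.
have iZ : (mu \x mu)%E.-integrable (rect A B) (EFin \o fun w => bt w * Z w.2).
  apply: (@ibtM (fun w : plane => Z w.2) 2); first by apply: measurable_snd_fun; exact: mZ.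
  by move=> w [_ h]; exact: Z_bound.
have ie n : (mu \x mu)%E.-integrable (rect A B) (EFin \o fun w => bt w * eigen n w.2).
  exact: ibtM (mE n) (@Zr_bound n).
have ie' n : (mu \x mu)%E.-integrable (rect A B)
    (EFin \o fun w => rho m n * z n * (bt w * eigen n w.2)).
  exact: (integrableRZl _ rc (ie n)).
transitivity (\int[(mu \x mu)%E]_(w in rect A B) (bt w * Z w.2) -
  \int[(mu \x mu)%E]_(w in rect A B) (v w.2 * Z w.2)); last first.
  rewrite -(RintegralB rc iZ ivZ); apply: eq_Rintegral => w _.
  by move: (bt w) (v w.2) (Z w.2) => p q r; ring.
rewrite -vZ /S2.
have -> : \int[(mu \x mu)%E]_(w in rect A B) (bt w * Z w.2) =
    \sum_(1 <= n < m.+1) rho m n * z n *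
      \int[(mu \x mu)%E]_(w in rect A B) (bt w * eigen n w.2).
  transitivity (\int[(mu \x mu)%E]_(w in rect A B)
      \sum_(n <- index_iota 1 m.+1) rho m n * z n * (bt w * eigen n w.2)).
    apply: eq_Rintegral => w _; rewrite ZE /esum mulr_sumr; apply: eq_bigr => n _; ring.
  have [-> _] := Rintegral_sum (index_iota 1 m.+1) rc ie'.
  by apply: eq_bigr => n _; rewrite (RintegralZl _ rc (ie n)).
by rewrite -sumrB; apply: eq_bigr => n _; rewrite mulrBr.
Qed.

Let kap0 : 0 <= kap.
Proof.
have I0 : I01 0 by rewrite /= in_itv/= lexx ler01.
exact: le_trans (normr_ge0 _) (kapB hA I0).
Qed.

Let S2_le : S2 <= 2 * \int[(mu \x mu)%E]_(w in rect A B) H1 w +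
  kap * \int[(mu \x mu)%E]_(w in rect A B) H2 w.
Proof.
have i1 : (mu \x mu)%E.-integrable (rect A B) (EFin \o fun w => 2 * H1 w).
  exact: (integrableRZl _ rc iH1).
have i2 : (mu \x mu)%E.-integrable (rect A B) (EFin \o fun w => kap * H2 w).
  exact: (integrableRZl _ rc iH2).
rewrite S2E -(RintegralZl _ rc iH1) -(RintegralZl _ rc iH2) -(RintegralD rc i1 i2).
apply: (le_Rintegral rc).
- have iZ : (mu \x mu)%E.-integrable (rect A B) (EFin \o fun w => bt w * Z w.2).
    apply: (@ibtM (fun w : plane => Z w.2) 2); first by apply: measurable_snd_fun; exact: mZ.
    by move=> w [_ h]; exact: Z_bound.
  have := integrableB rc iZ ivZ; apply: eq_integrable => // w _ /=.
  by rewrite -EFinD; congr EFin; move: (bt w) (v w.2) (Z w.2) => p q r; ring.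
- exact: (integrableD rc i1 i2).
move=> [s x] []; rewrite /= in_itv/= => hs Ix.
have hZ := ZU hs Ix; set E := Z x - _ in hZ.
have -> : Z x = (u s x - field c m X x) + E by rewrite /E; ring.
rewrite /H1 /H2 /= /v /=.
set f := field c m X x; set b := bt (s, x).
have uf : `|u s x - f| <= 2.
  apply: le_trans (ler_normB _ _) _.
  by have := lerD (u1 hs Ix) (X_adm Ix); rewrite -[leRHS]/(1 + 1 : R).
(* Three parts: the error of regularizing the logarithm, a product that is nonpositive by
   monotonicity of [beta], and the error of freezing time within the step. *)
have -> : (b - beta a f) * (u s x - f + E) = (b - beta a (u s x)) * (u s x - f) +
  (beta a (u s x) - beta a f) * (u s x - f) + (b - beta a f) * E by ring.
have mono : (beta a (u s x) - beta a f) * (u s x - f) <= 0.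
  case: (leP (u s x) f) => h.
    by have := beta_le a01 h => h'; apply: mulr_ge0_le0; lra.
  by have := beta_le a01 (ltW h) => h'; apply: mulr_le0_ge0; lra.
have t1 : (b - beta a (u s x)) * (u s x - f) <= 2 * `|b - beta a (u s x)|.
  by apply: le_trans (ler_norm _) _; rewrite normrM mulrC; apply: ler_wpM2r.
have t2 : (b - beta a f) * E <= kap * (`|b| + beta_lip a).
  apply: le_trans (ler_norm _) _; rewrite normrM mulrC; apply: ler_pM => //.
  by apply: le_trans (ler_normB _ _) _; rewrite lerD2l; exact: beta_bounded.
by move: mono t1 t2; lra.
Qed.

Lemma step_error : N (coef (u B) - X') - N (coef (u A) - X) <=
  2 * \int[(mu \x mu)%E]_(w in rect A B) `|bt w - beta a (u w.1 w.2)| +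
  (eps + om + (\sum_(1 <= n < m.+1) 2) * Dl) *
    (\int[(mu \x mu)%E]_(w in rect A B) (`|bt w| + beta_lip a) +
     (fine (etap (rect A B)) + fine (etam (rect A B)))) +
  4 * (\sum_(1 <= n < m.+1) (nu n ^+ 2 - lam)) * (2 * om + Dl) * (B - A).
Proof.
apply: le_trans energy _.
have h1 := S1_le; have h2 := S2_le; have h3 := S3_le.
rewrite [(eps + _ + _) * _]mulrDr -/kap -/tau -/G.
by rewrite -/H1 -/H2 in h2 *; lra.
Qed.

End step_error.

Lemma dist_segment {R : realDomainType} (a b s s' : R) : a <= s <= b -> a <= s' <= b ->
  `|s - s'| <= b - a.
Proof.
move=> /andP[s1 s2] /andP[s3 s4]; rewrite ler_norml; apply/andP; split; lra.
Qed.

Lemma lerD_three {R : realDomainType} (p1 p2 p3 r1 r2 r3 s1 s2 s3 : R) :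
  p1 + p2 <= p3 -> r1 + r2 <= r3 -> s1 + s2 <= s3 ->
  (2 * p1 + r1 + s1) + (2 * p2 + r2 + s2) <= 2 * p3 + r3 + s3.
Proof. lra. Qed.

(** * Accumulated error along the time grid *)

Section path_error.
Context {R : realType}.
Local Notation mu := (@lebesgue_measure R).
Local Notation I01 := (`[0, 1]%classic : set R).
Local Notation plane := (measurableTypeR R * measurableTypeR R)%type.

Variables (del T : R) (K : nat).
Hypothesis delT : del < T.
Hypothesis K0 : (0 < K)%N.

Definition grid_step : R := (T - del) / K%:R.
Definition grid (k : nat) : R := del + k%:R * grid_step.

Lemma grid_step_gt0 : 0 < grid_step.
Proof. by rewrite divr_gt0 ?subr_gt0// ltr0n. Qed.

Lemma grid0 : grid 0 = del. Proof. by rewrite /grid mul0r addr0. Qed.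

Lemma gridK : grid K = T.
Proof. by rewrite /grid /grid_step; field; rewrite pnatr_eq0 -lt0n. Qed.

Lemma gridS k : grid k.+1 - grid k = grid_step.
Proof. by rewrite /grid -natr1; ring. Qed.

Lemma grid_le j k : (j <= k)%N -> grid j <= grid k.
Proof. by move=> jk; rewrite lerD2l ler_wpM2r ?(ltW grid_step_gt0)// ler_nat. Qed.

Lemma grid_lt j k : (j < k)%N -> grid j < grid k.
Proof. by move=> jk; rewrite ltrD2l ltr_pM2r ?grid_step_gt0// ltr_nat. Qed.

Lemma grid_in k : (k <= K)%N -> del <= grid k <= T.
Proof. by move=> kK; have := grid_le (leq0n k); have := grid_le kK; rewrite grid0 gridK => -> ->. Qed.

Section overlap.
Variable g : R -> R -> R.
Hypothesis g0 : forall a b, del <= a -> a <= b -> b <= T -> 0 <= g a b.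
Hypothesis gD : forall a b b' d, del <= a -> a <= b -> b < b' -> b' <= d -> d <= T ->
  g a b + g b' d <= g a d.

(* The closed grid cells overlap at their end points, hence the factor 2. *)
Lemma overlap_sum : \sum_(k < K) g (grid k) (grid k.+1) <= 2 * g del T.
Proof.
have g1 k : (k <= K)%N -> 0 <= g del (grid k).
  by move=> /grid_in/andP[h1 h2]; exact: g0.
(* Superadditivity requires a gap between the two intervals, so the cell that starts at [grid j.+1]
   is joined to [[del, grid j]]; the bound therefore keeps the last two grid points. *)
have H j : (j <= K)%N -> \sum_(k < j) g (grid k) (grid k.+1) <=
    g del (grid j) + g del (grid j.-1).
  elim: j => [|j IH] jK; first by rewrite big_ord0; apply: addr_ge0; exact: g1.
  rewrite big_ord_recr/=; case: j IH jK => [|j] IH jK.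
    by rewrite big_ord0 add0r grid0 lerDl -{2}grid0; exact: g1.
  have h1 := IH (ltnW jK).
  have /andP[h2 h3] := grid_in (ltnW (ltnW jK)).
  have /andP[h4 h5] := grid_in jK.
  have := @gD del (grid j) (grid j.+1) (grid j.+2) (lexx _) h2 (grid_lt (ltnSn j))
    (grid_le (leqnSn j.+1)) h5.
  by move: h1 => /=; lra.
apply: le_trans (H K (leqnn K)) _; rewrite gridK.
have /andP[h2 h3] := grid_in (leq_pred K).
have pK : grid K.-1 < T by rewrite -[X in _ < X]gridK; apply: grid_lt; rewrite prednK.
have := @gD del _ T T (lexx _) h2 pK (lexx T) (lexx T).
have := g0 (ltW delT) (lexx T) (lexx T).
set A := g del T; set B := g T T; set C := g del _; lra.
Qed.
End overlap.

Lemma rect_superadditive (eta : {measure set plane -> \bar R}) (h : plane -> R) a b b' d :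
  (forall z, 0 <= h z) -> eta.-integrable (rect a d) (EFin \o h) ->
  a <= b -> b < b' -> b' <= d ->
  \int[eta]_(z in rect a b) h z + \int[eta]_(z in rect b' d) h z <=
  \int[eta]_(z in rect a d) h z.
Proof.
move=> h0 ih ab bb' b'd.
have mr x y : measurable (rect x y : set plane) by exact: measurable_rect.
have sub x y : a <= x -> y <= d -> rect x y `<=` rect a d.
  move=> ax yd z [/=]; rewrite !in_itv/= => /andP[z1 z2] z3; split => //=.
  by rewrite in_itv/= (le_trans ax z1) (le_trans z2 yd).
have s1 : rect a b `<=` rect a d by apply: sub => //; lra.
have s2 : rect b' d `<=` rect a d by apply: sub => //; lra.
have sU : rect a b `|` rect b' d `<=` rect a d by move=> z [/s1|/s2].
have mU : measurable (rect a b `|` rect b' d : set plane) by exact: measurableU.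
have iU := integrableS (mr a d) mU sU ih.
rewrite -(Rintegral_setU (mr _ _) (mr _ _) iU); last first.
  apply/disj_setPS => z [[/=]]; rewrite !in_itv/= => /andP[_ z1] _ [/=].
  by rewrite in_itv/= => /andP[z2 _] _; lra.
have f1 := integrable_fin_num mU iU; have f2 := integrable_fin_num (mr a d) ih.
rewrite /Rintegral; apply: (fine_le f1 f2).
apply: ge0_subset_integral => //; first by have := measurable_int _ ih.
by move=> z _; rewrite lee_fin.
Qed.

Variables (c : R) (m : nat) (a lam : R) (c1 : `|c| < 1).
Hypothesis a01 : 0 < a < 1.
Hypothesis lam_pi : lam <= pi ^+ 2.
Local Notation N := (nrm2 m (wt m)).

Variables (u : R -> R -> R) (bt : R * R -> R).
Hypothesis cu : {within rect del T, continuous (fun z => u z.1 z.2)}.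
Hypothesis u1 : forall s x, del <= s <= T -> I01 x -> `|u s x| <= 1.
Hypothesis umass : forall k, (k < K)%N -> coef (u (grid k.+1)) 0 = c.
Hypothesis ibt : (mu \x mu)%E.-integrable (rect del T) (EFin \o bt).
Variables etap etam : {measure set plane -> \bar R}.
Hypothesis etap_fin : (etap (rect del T) < +oo)%E.
Hypothesis etam_fin : (etam (rect del T) < +oo)%E.
Hypothesis contactp : {ae etap, forall z, rect del T z -> u z.1 z.2 = 1}.
Hypothesis contactm : {ae etam, forall z, rect del T z -> u z.1 z.2 = -1}.
Variable xi : nat -> nat -> R.
Hypothesis modal : forall k n, (k < K)%N -> (1 <= n <= m)%N ->
  coef (u (grid k.+1)) n - coef (u (grid k)) n = 2^-1 * nu n ^+ 2 *
    ((lam - nu n ^+ 2) * \int[mu]_(s in `[grid k, grid k.+1]) coef (u s) n +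
     \int[(mu \x mu)%E]_(z in rect (grid k) (grid k.+1)) (bt z * eigen n z.2) +
     \int[etam]_(z in rect (grid k) (grid k.+1)) eigen n z.2 -
     \int[etap]_(z in rect (grid k) (grid k.+1)) eigen n z.2) + xi k n.
Variables X : nat -> nat -> R.
Hypothesis X_adm : forall k, admissible c m (X k).
Hypothesis XS : forall k n, (1 <= n <= m)%N ->
  X k.+1 n = pr m c1 (fun n => X k n + grid_step * drift c m a lam (X k) n + xi k n) n.
Variables (om eps Dl : R).
Hypothesis om_mod : forall s s' x, del <= s <= T -> del <= s' <= T -> I01 x ->
  `|s - s'| <= grid_step -> `|u s x - u s' x| <= om.
Hypothesis eps_fejer : forall s x, del <= s <= T -> I01 x ->
  `|fejer m (coef (u s)) x - u s x| <= eps.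
Hypothesis Dl_incr : forall k n, (k < K)%N -> (1 <= n <= m)%N -> `|X k.+1 n - X k n| <= Dl.

(** The left sides of [step_error] telescope. Its right side is a superadditive function of the
    interval, so the sum is at most twice the value on the whole interval, whatever the number of
    steps. *)
Lemma path_error : (0 < m)%N -> N (coef (u T) - X K) <= N (coef (u del) - X 0) + 2 * (
  2 * \int[(mu \x mu)%E]_(w in rect del T) `|bt w - beta a (u w.1 w.2)| +
  (eps + om + (\sum_(1 <= n < m.+1) 2) * Dl) *
    (\int[(mu \x mu)%E]_(w in rect del T) (`|bt w| + beta_lip a) +
     (fine (etap (rect del T)) + fine (etam (rect del T)))) +
  4 * (\sum_(1 <= n < m.+1) (nu n ^+ 2 - lam)) * (2 * om + Dl) * (T - del)).
Proof.
move=> m0.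
pose g A B := 2 * \int[(mu \x mu)%E]_(w in rect A B) `|bt w - beta a (u w.1 w.2)| +
  (eps + om + (\sum_(1 <= n < m.+1) 2) * Dl) *
    (\int[(mu \x mu)%E]_(w in rect A B) (`|bt w| + beta_lip a) +
     (fine (etap (rect A B)) + fine (etam (rect A B)))) +
  4 * (\sum_(1 <= n < m.+1) (nu n ^+ 2 - lam)) * (2 * om + Dl) * (B - A).
rewrite -[X in _ <= _ + 2 * X]/(g del T).
have mr x y : measurable (rect x y : set plane) by exact: measurable_rect.
have sub x y : del <= x -> y <= T -> rect x y `<=` rect del T.
  move=> ax yd z [/=]; rewrite !in_itv/= => /andP[z1 z2] z3; split => //=.
  by rewrite in_itv/= (le_trans ax z1) (le_trans z2 yd).
have hdel : del <= del <= T by rewrite lexx ltW.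
have I0 : I01 0 by rewrite /= in_itv/= lexx ler01.
have om0 : 0 <= om.
  apply: le_trans (om_mod hdel hdel I0 _); first exact: normr_ge0.
  by rewrite subrr normr0; exact: ltW grid_step_gt0.
have eps0 : 0 <= eps by apply: le_trans (eps_fejer hdel I0); exact: normr_ge0.
have Dl0 : 0 <= Dl by apply: le_trans (@Dl_incr 0 1 K0 _); [exact: normr_ge0|rewrite m0].
have kap0 : 0 <= eps + om + (\sum_(1 <= n < m.+1) 2) * Dl.
  apply: addr_ge0; first exact: addr_ge0.
  by apply: mulr_ge0 => //; apply: sumr_ge0.
have L0 := beta_lip_gt0 a01.
have nu_lam : 0 <= \sum_(1 <= n < m.+1) (nu n ^+ 2 - lam).
  rewrite big_nat_cond; apply: sumr_ge0 => n /andP[/andP[n1 _] _].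
  rewrite subr_ge0; apply: le_trans lam_pi _.
  rewrite ler_pXn2r ?nnegrE ?nu_ge0 ?pi_ge0// /nu.
  by apply: ler_peMl; [exact: pi_ge0|rewrite ler1n].
have coefT : 0 <= 4 * (\sum_(1 <= n < m.+1) (nu n ^+ 2 - lam)) * (2 * om + Dl).
  apply: mulr_ge0; first exact: mulr_ge0.
  by apply: addr_ge0 => //; exact: mulr_ge0.
have murect : ((mu \x mu)%E (rect del T) < +oo)%E.
  rewrite /rect product_measure1E; [|exact: measurable_itv|exact: measurable_itv].
  rewrite -[X in (_ * X)%E]/(mu I01) mu01 mule1 -[X in (X < _)%E]/(mu `[del, T]%classic).
  by rewrite lebesgue_measure_itv/=; case: ifP => _; rewrite ltry.
have iH1 : (mu \x mu)%E.-integrable (rect del T) (EFin \o fun w => `|bt w - beta a (u w.1 w.2)|).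
  have mb : measurable_fun setT (beta a).
    by apply: continuous_measurable_fun; exact: continuous_beta.
  have ibu : (mu \x mu)%E.-integrable (rect del T) (EFin \o fun w => beta a (u w.1 w.2)).
    apply: (bounded_integrable (M := beta_lip a) (mr _ _) murect).
      exact: (measurableT_comp mb (measurable_field2 (ltW delT) cu u1)).
    by move=> w _; exact: beta_bounded.
  exact: (integrable_norm (integrableB (mr _ _) ibt ibu)).
have iH2 : (mu \x mu)%E.-integrable (rect del T) (EFin \o fun w => `|bt w| + beta_lip a).
  have ik : (mu \x mu)%E.-integrable (rect del T) (EFin \o fun=> beta_lip a).
    exact: (@bounded_integrable R _ plane (mu \x mu)%E _ (fun=> beta_lip a)
      `|beta_lip a| (mr _ _) murect (@measurable_cst _ _ _ _ _ _) (fun _ _ => lexx _)).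
  by have := integrableD (mr _ _) (integrable_norm ibt) ik; apply: eq_integrable.
have etaE (eta : {measure set plane -> \bar R}) A B : fine (eta (rect A B)) =
    \int[eta]_(w in rect A B) 1 by rewrite (Rintegral_cst _ (mr _ _)) mul1r.
have ieta (eta : {measure set plane -> \bar R}) : (eta (rect del T) < +oo)%E ->
    eta.-integrable (rect del T) (EFin \o fun=> 1).
  move=> fin; exact: (@bounded_integrable R _ plane eta _ (fun=> 1) `|1| (mr _ _) fin
    (@measurable_cst _ _ _ _ _ _) (fun _ _ => lexx _)).
have restr (eta : {measure set plane -> \bar R}) h A B :
    eta.-integrable (rect del T) (EFin \o h) -> del <= A -> B <= T ->
    eta.-integrable (rect A B) (EFin \o h).
  by move=> ih dA BT; apply: integrableS ih => //; exact: sub.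
have key k : (k < K)%N -> N (coef (u (grid k.+1)) - X k.+1) -
    N (coef (u (grid k)) - X k) <= g (grid k) (grid k.+1).
  move=> kK; have /andP[A0 _] := grid_in (ltnW kK); have /andP[_ B1] := grid_in kK.
  have AB : grid k <= grid k.+1 by exact: grid_le.
  have hin s : grid k <= s <= grid k.+1 -> del <= s <= T.
    by move=> /andP[s1 s2]; rewrite (le_trans A0 s1) (le_trans s2 B1).
  apply: (@step_error R c m a lam c1 a01 lam_pi u (grid k) (grid k.+1) bt AB _ _ _ _ etap etam
    _ _ _ _ (xi k)).
  - exact: continuous_subspaceW (sub _ _ A0 B1) cu.
  - by move=> s x /hin; exact: u1.
  - exact: umass.
  - exact: restr.
  - by apply: le_lt_trans etap_fin; apply: le_measure; rewrite ?inE; [exact: mr|exact: mr|exact: sub].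
  - by apply: le_lt_trans etam_fin; apply: le_measure; rewrite ?inE; [exact: mr|exact: mr|exact: sub].
  - by apply: (@filterS _ _ (ae_filter_ringOfSetsType etap) _ _ _ contactp) => w h /(sub _ _ A0 B1); exact: h.
  - by apply: (@filterS _ _ (ae_filter_ringOfSetsType etam) _ _ _ contactm) => w h /(sub _ _ A0 B1); exact: h.
  - by move=> n nm; exact: modal.
  - exact: X_adm.
  - by move=> n nm; rewrite gridS; exact: XS.
  - move=> s s' x hs hs' Ix; apply: om_mod => //; try exact: hin.
    by rewrite -(gridS k); exact: dist_segment hs hs'.
  - by move=> x Ix; apply: eps_fejer => //; apply: hin; rewrite AB lexx.
  - by move=> n nm; exact: Dl_incr.
have tele : \sum_(k < K) (N (coef (u (grid k.+1)) - X k.+1) - N (coef (u (grid k)) - X k)) =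
    N (coef (u T) - X K) - N (coef (u del) - X 0).
  have := @telescope_sumr _ 0 K (fun k => N (coef (u (grid k)) - X k)) (leq0n K).
  by rewrite gridK grid0 => <-; rewrite big_mkord.
rewrite -lerBlDl -tele.
apply: (@le_trans _ _ (\sum_(k < K) g (grid k) (grid k.+1))).
  by apply: ler_sum => k _; exact: key.
apply: overlap_sum => [A B dA AB BT|A b b' B dA Ab bb' bB BT].
  rewrite /g !etaE; apply: addr_ge0; last first.
    by apply: mulr_ge0 => //; rewrite subr_ge0.
  apply: addr_ge0.
    by apply: mulr_ge0 => //; apply: Rintegral_ge0 => w _; exact: normr_ge0.
  apply: mulr_ge0 => //; apply: addr_ge0; last by apply: addr_ge0; apply: Rintegral_ge0 => w _.
  by apply: Rintegral_ge0 => w _; apply: addr_ge0 (ltW L0).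
rewrite /g !etaE.
have q1 := rect_superadditive (fun z => normr_ge0 _) (restr _ _ _ _ iH1 dA BT) Ab bb' bB.
have q2 := rect_superadditive (fun z => addr_ge0 (normr_ge0 _) (ltW L0)) (restr _ _ _ _ iH2 dA BT) Ab bb' bB.
have q3 := rect_superadditive (fun z => ler01) (restr _ _ _ _ (ieta _ etap_fin) dA BT) Ab bb' bB.
have q4 := rect_superadditive (fun z => ler01) (restr _ _ _ _ (ieta _ etam_fin) dA BT) Ab bb' bB.
have q5 := ler_wpM2l kap0 (lerD q2 (lerD q3 q4)).
have q6 : 4 * (\sum_(1 <= n < m.+1) (nu n ^+ 2 - lam)) * (2 * om + Dl) * (b - A) +
   4 * (\sum_(1 <= n < m.+1) (nu n ^+ 2 - lam)) * (2 * om + Dl) * (B - b') <=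
   4 * (\sum_(1 <= n < m.+1) (nu n ^+ 2 - lam)) * (2 * om + Dl) * (B - A).
  rewrite -mulrDr; apply: (ler_wpM2l coefT).
  have -> : b - A + (B - b') = B - A - (b' - b) by ring.
  by rewrite gerBl subr_ge0 ltW.
apply: (lerD_three q1 _ q6).
by rewrite -mulrDr addrACA [X in _ * (_ + X)]addrACA; exact: q5.
Qed.

End path_error.

(** * Modal equations of the solution *)

Section modal_equation.
Context {R : realType}.
Local Notation mu := (@lebesgue_measure R).
Local Notation I01 := (`[0, 1]%classic : set R).
Local Notation plane := (measurableTypeR R * measurableTypeR R)%type.

Lemma weak_derivative_C1 (G g : R -> R) : (forall x : R, is_derive x 1 G (g x)) ->
  continuous g -> weak_derivative G g.
Proof.
move=> dG cg h [hd [a [b [a0 b1 h0]]]].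
have dh (x : R) : is_derive x 1 h (derive1 h x).
  by apply: DeriveDef; [exact: (hd 0%N x)|rewrite derive1E].
have ch' : continuous (derive1 h).
  by move=> x; apply/differentiable_continuous/derivable1_diffP; exact: (hd 1%N x).
have h00 : h 0 = 0 by apply: h0; move=> /andP[]; lra.
have h10 : h 1 = 0 by apply: h0; move=> /andP[]; lra.
have G' x : derive1 G x = g x by rewrite derive1E; have := dG x => ?; exact: derive_val.
have c1 : {within `[0, 1], continuous g} by exact: continuous_subspaceT.
have c2 : {within `[0, 1], continuous (derive1 h)} by exact: continuous_subspaceT.
have := integration_by_parts ltr01 c1 (derivable_oo_LRcontinuousT 0 1 dG) (fun x _ => G' x)
  c2 (derivable_oo_LRcontinuousT 0 1 dh) (fun x _ => erefl).
rewrite h00 h10 !mulr0 subrr sub0e /inner /Rintegral => ->.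
by rewrite fineN.
Qed.

Definition eigen_scale (n : nat) : R := if n == 0%N then 1 else Num.sqrt 2.

Lemma eigenE n : @eigen R n = fun x => eigen_scale n * cos (nu n * x).
Proof.
apply/funext => x; rewrite /eigen /eigen_scale /nu.
by case: eqP => [->|_]; rewrite ?mul0r ?cos0 ?mulr1.
Qed.

Lemma graphA_eigen (k : R) n : graphA (fun x => k * eigen n x)
  (fun x => k * - nu n ^+ 2 * eigen n x).
Proof.
have LE (k' : R) : L2 (fun x => k' * eigen n x).
  apply: (@L2_bounded _ _ (`|k'| * 2)).
    by apply: measurable_funM; [exact: measurable_cst|exact: measurable_eigen].
  by move=> x _; rewrite normrM ler_wpM2l// eigen_bound.
split; [exact: LE|exact: LE|].
pose G x := - (k * eigen_scale n * nu n * sin (nu n * x)).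
have d1 (x : R) : is_derive x 1 (fun x => k * eigen n x) (G x).
  have -> : (fun x => k * @eigen R n x) = fun x => k * eigen_scale n * cos (nu n * x).
    by apply/funext => y; rewrite eigenE mulrA.
  exact: is_derive_cosM.
have GE : G = fun x => - (k * eigen_scale n * nu n) * sin (nu n * x).
  by apply/funext => x; rewrite /G mulNr.
have d2 (x : R) : is_derive x 1 G (k * - nu n ^+ 2 * eigen n x).
  rewrite GE; have := is_derive_sinM (- (k * eigen_scale n * nu n)) (nu n) x.
  by rewrite eigenE; congr is_derive; ring.
have cG : continuous G by move=> x; exact: is_derive_continuous (d2 x).
exists G; split.
- exact: continuous_subspaceT.
- exact: weak_derivative_C1.
- apply: weak_derivative_C1 => // x; apply: cvgM; first exact: cvg_cst.
  exact: continuous_eigen.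
- by rewrite /G mulr0 sin0 mulr0 oppr0.
- by rewrite /G mulr1 /nu sin_natpi mulr0 oppr0.
Qed.

Lemma adjoint_eigen n : adjoint (graph_powA 1) (@eigen R n) (mode n).
Proof.
split; [by apply: (@L2_bounded _ _ 2) => [|x _]; [exact: measurable_eigen|exact: eigen_bound]|exact: L2_esum|].
move=> g h [Lg Lh] /(_ n); rewrite -[inner h _]/(coef h n) => ->.
have -> : mode n = fun x : R => nu n * eigen n x.
  by apply/funext => x; rewrite /mode /esum big_seq1.
case: eqP => [->|/eqP n0].
  rewrite /inner; under eq_Rintegral do rewrite /nu mul0r mul0r mulr0.
  by rewrite (Rintegral_cst _ measurable01) mul0r.
rewrite -/(nu n) powRr1 ?nu_ge0// /coef /inner.
have ig : mu.-integrable I01 (EFin \o fun x => g x * eigen n x).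
  have [mg g2] := Lg.
  have i1 : mu.-integrable I01 (EFin \o fun=> 2 : R).
    by apply: (@bounded_integrable01 _ _ `|2|); [exact: measurable_cst|].
  have i2 : mu.-integrable I01 (EFin \o fun x => 2 * g x ^+ 2 + 2).
    have := integrableD measurable01 (integrableRZl 2 measurable01 g2) i1.
    by apply: eq_integrable => //; exact: measurable01.
  apply: (le_integrable measurable01 _ _ i2).
    by apply/measurable_EFinP; apply: measurable_funM => //; exact: measurable_eigen.
  move=> x _; rewrite /= lee_fin normrM.
  apply: le_trans (ler_norm _).
  have e2 := eigen_bound n x; have g0 := normr_ge0 (g x).
  apply: le_trans (ler_wpM2l g0 e2) _; rewrite -(real_normK (num_real (g x))).
  by have := sqr_ge0 (`|g x| - 1); move: `|g x| => y; nra.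
rewrite -(RintegralZl _ measurable01 ig).
by apply: eq_Rintegral => x _; ring.
Qed.

Variables (u : R -> R -> R) (A B lam : R).
Hypothesis AB : A <= B.
Hypothesis cu : {within rect A B, continuous (fun z => u z.1 z.2)}.
Hypothesis u1 : forall s x, A <= s <= B -> I01 x -> `|u s x| <= 1.
Hypothesis iflog : (mu \x mu)%E.-integrable (rect A B) (fun z => flog lam (u z.1 z.2)).

(* The logarithmic part of the free energy, with junk value where [flog] is infinite. *)
Definition log_part (z : R * R) : R := fine (flog lam (u z.1 z.2)) - lam * u z.1 z.2.

Let rc : measurable (rect A B : set plane). Proof. exact: measurable_rect. Qed.
Let mu2 : measurable_fun (rect A B : set plane) (fun w : plane => u w.1 w.2).
Proof. exact: (measurable_field2 AB cu u1). Qed.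

Lemma murect_fin : ((mu \x mu)%E (rect A B) < +oo)%E.
Proof.
rewrite /rect product_measure1E; [|exact: measurable_itv|exact: measurable_itv].
rewrite -[X in (_ * X)%E]/(mu I01) mu01 mule1 -[X in (X < _)%E]/(mu `[A, B]%classic).
by rewrite lebesgue_measure_itv/=; case: ifP => _; rewrite ltry.
Qed.

Let iu : (mu \x mu)%E.-integrable (rect A B) (EFin \o fun w => u w.1 w.2).
Proof.
apply: (bounded_integrable (M := 1) rc murect_fin mu2) => -[s x] [/=]; rewrite in_itv/=.
exact: u1.
Qed.

Lemma integrable_log_part : (mu \x mu)%E.-integrable (rect A B) (EFin \o log_part).
Proof.
have i1 : (mu \x mu)%E.-integrable (rect A B) (EFin \o fun z => fine (flog lam (u z.1 z.2))).
  apply: (le_integrable rc _ _ iflog).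
    apply/measurable_EFinP; apply: (@measurableT_comp _ _ _ _ _ _ (@fine R)) => //.
    exact: measurable_int iflog.
  by move=> z _ /=; case: (flog lam _) => [r| |]//=; rewrite normr0 leey.
have := integrableB rc i1 (integrableRZl lam rc iu).
by apply: eq_integrable.
Qed.

Let iM (f g : plane -> R) (M : R) (eta : {measure set plane -> \bar R}) :
  eta.-integrable (rect A B) (EFin \o f) ->
  measurable_fun (rect A B : set plane) g -> (forall w, rect A B w -> `|g w| <= M) ->
  eta.-integrable (rect A B) (EFin \o fun w => f w * g w).
Proof.
move=> fi mg gM.
have ifM : eta.-integrable (rect A B) (EFin \o fun w => M * `|f w|).
  exact: (integrableRZl M rc (integrable_norm fi)).
apply: (le_integrable rc _ _ ifM).
  apply/measurable_EFinP; apply: measurable_funM => //.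
  by apply/measurable_EFinP; exact: measurable_int fi.
move=> w hw; rewrite /= lee_fin normrM mulrC.
by apply: le_trans (ler_norm _); apply: ler_wpM2r => //; exact: gM.
Qed.

(** The weak formulation tested with an eigenfunction. Integrability makes [flog] finite almost
    everywhere, so it splits into [log_part] and the linear term, which joins the term of fourth
    order. *)
Lemma modal_equation (n : nat) (dW : R) (etap etam : {measure set plane -> \bar R}) :
  (etap (rect A B) < +oo)%E -> (etam (rect A B) < +oo)%E ->
  inner (u B) (eigen n) = inner (u A) (eigen n)
    - 2^-1 * \int[mu]_(s in `[A, B]) inner (u s) (fun x => nu n ^+ 4 * eigen n x)
    - 2^-1 * fine (\int[mu]_(s in `[A, B]) \int[mu]_(x in I01)
          (flog lam (u s x) * (- nu n ^+ 2 * eigen n x)%:E))%E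
    - 2^-1 * \int[etam]_(z in rect A B) (- nu n ^+ 2 * eigen n z.2)
    + 2^-1 * \int[etap]_(z in rect A B) (- nu n ^+ 2 * eigen n z.2) + dW ->
  coef (u B) n - coef (u A) n = 2^-1 * nu n ^+ 2 *
    ((lam - nu n ^+ 2) * \int[mu]_(s in `[A, B]) coef (u s) n +
     \int[(mu \x mu)%E]_(z in rect A B) (log_part z * eigen n z.2) +
     \int[etam]_(z in rect A B) eigen n z.2 - \int[etap]_(z in rect A B) eigen n z.2) + dW.
Proof.
move=> finp finm E.
have mE : measurable_fun (rect A B : set plane) (fun w : plane => eigen n w.2 : R).
  by apply: measurable_snd_fun; exact: measurable_eigen.
have ie (eta : {measure set plane -> \bar R}) : (eta (rect A B) < +oo)%E ->
    eta.-integrable (rect A B) (EFin \o fun w => eigen n w.2).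
  by move=> fin; apply: (bounded_integrable (M := 2) rc fin mE) => w _; exact: eigen_bound.
have mAB : measurable (`[A, B]%classic : set (measurableTypeR R)) by exact: measurable_itv.
have mABoo : (mu `[A, B]%classic < +oo)%E by rewrite lebesgue_measure_itv/=; case: ifP => _; rewrite ltry.
have bu s : A <= s <= B -> bfun (u s) by exact: field_bfun cu u1 s.
have ieu s : A <= s <= B -> mu.-integrable I01 (EFin \o fun x => u s x * eigen n x).
  move=> hs; exact: (bfun_integrable (bu s hs) (@measurable_eigen R n I01) (fun x _ => eigen_bound n x)).
have ic : mu.-integrable `[A, B] (EFin \o fun s => coef (u s) n).
  apply: (@bounded_integrable _ _ _ _ _ _ 2) => //; first exact: (measurable_coef AB cu u1).
  move=> s; rewrite /= in_itv/= => hs; rewrite -[leRHS]mulr1.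
  by apply: coefS_bounded; [exact: (bu s hs).1|exact: (bu s hs).2].
have e1 : \int[mu]_(s in `[A, B]) inner (u s) (fun x => nu n ^+ 4 * eigen n x) =
    nu n ^+ 4 * \int[mu]_(s in `[A, B]) coef (u s) n.
  rewrite -(RintegralZl _ mAB ic); apply: eq_Rintegral => s; rewrite inE/= in_itv/= => hs.
  rewrite /coef /inner -(RintegralZl _ measurable01 (ieu s hs)).
  by apply: eq_Rintegral => x _; ring.
have e2 (eta : {measure set plane -> \bar R}) : (eta (rect A B) < +oo)%E ->
    \int[eta]_(z in rect A B) (- nu n ^+ 2 * eigen n z.2) =
    - nu n ^+ 2 * \int[eta]_(z in rect A B) eigen n z.2.
  by move=> fin; rewrite (RintegralZl _ rc (ie _ fin)).
have iue : (mu \x mu)%E.-integrable (rect A B) (EFin \o fun w => u w.1 w.2 * eigen n w.2).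
  by apply: (iM (M := 2) iu mE) => w _; exact: eigen_bound.
have ile : (mu \x mu)%E.-integrable (rect A B) (EFin \o fun w => log_part w * eigen n w.2).
  by apply: (iM (M := 2) integrable_log_part mE) => w _; exact: eigen_bound.
have e3 : \int[(mu \x mu)%E]_(w in rect A B) (u w.1 w.2 * eigen n w.2) =
    \int[mu]_(s in `[A, B]) coef (u s) n.
  rewrite [LHS]/Rintegral -(fubini_rect iue) /Rintegral; congr fine.
  apply: eq_integral => s; rewrite inE/= in_itv/= => hs.
  have f := integrable_fin_num measurable01 (ieu s hs).
  by rewrite /coef /inner /Rintegral fineK.
pose h (w : plane) := - nu n ^+ 2 * (log_part w * eigen n w.2) +
  (- nu n ^+ 2 * lam) * (u w.1 w.2 * eigen n w.2).
have ih : (mu \x mu)%E.-integrable (rect A B) (EFin \o h).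
  have := integrableD rc (integrableRZl (- nu n ^+ 2) rc ile) (integrableRZl (- nu n ^+ 2 * lam) rc iue).
  by apply: eq_integrable.
have mfe : measurable_fun (rect A B : set plane)
    (fun w => flog lam (u w.1 w.2) * (- nu n ^+ 2 * eigen n w.2)%:E)%E.
  apply: emeasurable_funM; first exact: measurable_int iflog.
  by apply/measurable_EFinP; apply: measurable_funM => //; exact: measurable_cst.
have fh : ae_eq (mu \x mu)%E (rect A B)
    (fun w => flog lam (u w.1 w.2) * (- nu n ^+ 2 * eigen n w.2)%:E)%E (EFin \o h).
  apply: filterS (integrable_ae rc iflog) => w hw Dw; have := hw Dw.
  rewrite /h /log_part /=; case: (flog lam _) => [r| |]//= _.
  by rewrite -EFinM; congr EFin; ring.
have iff' : (mu \x mu)%E.-integrable (rect A B)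
    (fun w => flog lam (u w.1 w.2) * (- nu n ^+ 2 * eigen n w.2)%:E)%E.
  have i2 := integrableZl rc (nu n ^+ 2 * 2) (integrable_abse iflog).
  apply: (le_integrable rc mfe _ i2) => w _; rewrite abseM muleC.
  rewrite [leRHS]gee0_abs; last by apply: mule_ge0; [rewrite lee_fin mulr_ge0 ?sqr_ge0|exact: abse_ge0].
  apply: lee_wpmul2r; first exact: abse_ge0.
  rewrite /= lee_fin normrM normrN (ger0_norm (sqr_ge0 (nu n))).
  by apply: ler_wpM2l; [exact: sqr_ge0|exact: eigen_bound].
have e4 : fine (\int[mu]_(s in `[A, B]) \int[mu]_(x in I01)
          (flog lam (u s x) * (- nu n ^+ 2 * eigen n x)%:E))%E =
    - nu n ^+ 2 * \int[(mu \x mu)%E]_(w in rect A B) (log_part w * eigen n w.2) +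
    (- nu n ^+ 2 * lam) * \int[mu]_(s in `[A, B]) coef (u s) n.
  rewrite -e3 -(RintegralZl _ rc ile) -(RintegralZl _ rc iue).
  rewrite -(RintegralD rc (integrableRZl (- nu n ^+ 2) rc ile) (integrableRZl (- nu n ^+ 2 * lam) rc iue)).
  rewrite /Rintegral (fubini_rect iff'); congr fine.
  apply: ae_eq_integral fh => //; exact: measurable_int ih.
move: E; rewrite -!/(coef _ _) e1 !e2// e4.
move=> ->.
set q1 := \int[mu]_(s in `[A, B]) coef (u s) n.
set q2 := \int[(mu \x mu)%E]_(w in rect A B) (log_part w * eigen n w.2).
set q3 := \int[etam]_(w in rect A B) eigen n w.2.
set q4 := \int[etap]_(w in rect A B) eigen n w.2.
by field.
Qed.

End modal_equation.

(** * The chain as an approximation of the solution *)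

Section chain_process.
Context {R : realType} d (Omega : measurableType d) (P : probability Omega R).
Local Notation I01 := (`[0, 1]%classic : set R).
Variables (F : R -> set (set Omega)) (W : (R -> R) -> R -> Omega -> R).
Hypotheses (hF : filtration F) (hW : cylindrical_wiener P F W).
Variables (c : R) (m : nat) (a lam : R) (c1 : `|c| < 1).
Hypothesis a01 : 0 < a < 1.
Local Notation N := (nrm2 m (wt m)).
Local Notation pj := (pr m c1).
Local Notation b := (drift c m a lam).
Let w0 := @wt_gt0 R m.

Lemma lip_ext (L : R) (f : (nat -> R) -> R) x y :
  (forall x y, `|f x - f y| <= L * dist2 m (wt m) x y) ->
  (forall n, (1 <= n <= m)%N -> x n = y n) -> f x = f y.
Proof.
move=> fL xy; apply/eqP; rewrite -subr_eq0 -normr_le0; apply: le_trans (fL x y) _.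
rewrite /dist2 (_ : N (x - y) = 0) ?sqrtr0 ?mulr0//.
rewrite /nrm2 /ip big_nat_cond big1// => n; rewrite andbT ltnS => nm.
by rewrite !fctE xy// subrr !mulr0.
Qed.

Lemma trunc_id x n : (1 <= n <= m)%N -> trunc m x n = x n :> R.
Proof. by rewrite /trunc => ->. Qed.

Lemma pr_nonexp x y : N (pj x - pj y) <= N (x - y).
Proof. exact: proj_nonexp. Qed.

Lemma pr_coord_lip n : (1 <= n <= m)%N -> forall x y,
  `|pj x n - pj y n| <= (Num.sqrt (wt m n))^-1 * dist2 m (wt m) x y.
Proof.
move=> nm x y; apply: le_trans (coord_dist w0 _ _ nm) _.
apply: ler_wpM2l; first by rewrite invr_ge0 sqrtr_ge0.
exact: dist2_mono (pr_nonexp x y).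
Qed.

Lemma pr_ext x y n : (1 <= n <= m)%N -> (forall n, (1 <= n <= m)%N -> x n = y n) ->
  pj x n = pj y n.
Proof. by move=> nm; exact: (lip_ext (f := fun x => pj x n) (pr_coord_lip nm)). Qed.

Lemma pr_id x n : admissible c m x -> (1 <= n <= m)%N -> pj x n = x n.
Proof.
move=> Ax nm.
have h : ip m (wt m) (x - pj x) (x - pj x) <= 0 by apply: proj_ip.
have := le_trans (coord_le w0 (x - pj x) nm) h.
rewrite !fctE pmulr_rle0 ?w0// => h2.
by apply/eqP; rewrite eq_sym -subr_eq0 -sqrf_eq0 eq_le h2 sqr_ge0.
Qed.

Lemma kickE (xi : nat -> Omega -> R) x o k n : kick xi k x o n =
  if (1 <= n <= k)%N then x n + xi n o else x n.
Proof.
elim: k => [|k IH] /=; first by case: n.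
rewrite /upd IH; case: eqP => [->|/eqP nk]; first by rewrite ltnn leqnn mul1r.
by rewrite mul0r addr0 [(n <= k.+1)%N]leq_eqVlt (negbTE nk)/= ltnS.
Qed.

(** [rho m n * X n] is a cosine coefficient of a function bounded by 1, and
    [rho m n >= 1 / (m + 1)]. *)
Lemma admissible_bound X n : admissible c m X -> (1 <= n <= m)%N -> `|X n| <= 2 * m.+1%:R.
Proof.
move=> AX /andP[n1 nm].
have nr : n \in index_iota 0 m.+1 by rewrite mem_index_iota ltnS.
have E : rho m n * ext c X n = coef (field c m X) n.
  by rewrite -(coef_esum (fun n => rho m n * ext c X n) (iota_uniq 0 m.+1)) ?subn0//; congr coef.
have h : `|rho m n * X n| <= 2 * 1.
  have -> : X n = ext c X n by case: (n) n1.
  by rewrite E; apply: coefS_bounded => //; exact: measurable_field.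
have r0 : m.+1%:R^-1 <= rho m n :> R.
  by rewrite /rho -[leLHS]mul1r ler_wpM2r ?invr_ge0// ler1n subn_gt0 ltnS.
have m0 : 0 < m.+1%:R^-1 :> R by rewrite invr_gt0.
rewrite -[leRHS](mulrC _ 2) -ler_pdivrMl// mulrC.
have r1 : 0 <= rho m n :> R := rho_ge0 m n.
rewrite normrM (ger0_norm r1) mulr1 in h; apply: le_trans h; rewrite mulrC.
by apply: ler_wpM2r.
Qed.

Lemma drift_bounded : exists2 D : R, 0 <= D &
  forall X, admissible c m X -> N (b X) <= D.
Proof.
have [L L0 bL] := drift_lipschitz c m lam a01.
pose z : nat -> R := fun=> 0.
pose S := \sum_(1 <= n < m.+1) wt m n : R.
have S0 : 0 <= S.
  by rewrite /S big_nat_cond; apply: sumr_ge0 => n; rewrite andbT ltnS => nm; exact: ltW (w0 nm).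
exists (2 * (L * (S * (2 * m.+1%:R) ^+ 2)) + 2 * N (b z)).
  apply: addr_ge0; apply: mulr_ge0 => //; last exact: nrm2_ge0.
  by apply: mulr_ge0 => //; apply: mulr_ge0 => //; exact: sqr_ge0.
move=> X AX.
have -> : N (b X) = N ((b X - b z) + b z) by congr N; apply/funext => n; rewrite !fctE addrNK.
apply: le_trans (nrm2D_le w0 _ _) _; rewrite lerD2r ler_wpM2l//.
apply: le_trans (bL X z) _; rewrite ler_wpM2l//.
have -> : X - z = X by apply/funext => n; rewrite !fctE subr0.
by apply: (nrm2_sum_le w0) => n nm; exact: admissible_bound.
Qed.

(** An admissible state is its own projection, so nonexpansiveness bounds the increment by that of
    the unprojected step, and the drift is bounded on admissible states. *)
Lemma euler_incr : exists2 C : R, 0 <= C & forall X (xi : nat -> R) (h zeta : R),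
  admissible c m X -> 0 <= h -> (forall n, (1 <= n <= m)%N -> `|xi n| <= zeta) ->
  forall n, (1 <= n <= m)%N ->
    `|pj (fun n => X n + h * b X n + xi n) n - X n| <= C * (h + zeta).
Proof.
have [D D0 bD] := drift_bounded.
pose S := \sum_(1 <= n < m.+1) wt m n : R.
have S0 : 0 <= S.
  by rewrite /S big_nat_cond; apply: sumr_ge0 => n; rewrite andbT ltnS => nm; exact: ltW (w0 nm).
pose q n := (Num.sqrt (wt m n))^-1 : R.
have q0 n : 0 <= q n by rewrite invr_ge0 sqrtr_ge0.
pose Q := \sum_(1 <= n < m.+1) q n.
have Q0 : 0 <= Q by apply: sumr_ge0.
have E0 : 0 <= 2 * D + 2 * S by apply: addr_ge0; exact: mulr_ge0.
exists (Q * Num.sqrt (2 * D + 2 * S)); first by rewrite mulr_ge0// sqrtr_ge0.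
move=> X xi h zeta AX h0 hz n nm.
have z0 : 0 <= zeta by apply: le_trans (hz n nm); exact: normr_ge0.
pose A n := X n + h * b X n + xi n.
rewrite -[X in _ - X](pr_id AX nm).
apply: le_trans (pr_coord_lip nm A X) _; rewrite -mulrA; apply: ler_pM => //.
- exact: dist2_ge0.
- have nr : n \in index_iota 1 m.+1 by rewrite mem_index_iota ltnS.
  by rewrite /Q (bigD1_seq n nr) ?iota_uniq//= lerDl sumr_ge0.
have tz : 0 <= h + zeta by rewrite addr_ge0.
have -> : h + zeta = Num.sqrt ((h + zeta) ^+ 2) by rewrite sqrtr_sqr ger0_norm.
rewrite -sqrtrM// /dist2; apply: ler_wsqrtr.
have -> : A - X = (fun n => h * b X n) + xi.
  by apply/funext => i; rewrite /A !fctE; ring.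
apply: le_trans (nrm2D_le w0 _ _) _; rewrite nrm2Z.
have h1 : h ^+ 2 * N (b X) <= (h + zeta) ^+ 2 * D.
  apply: ler_pM => //; [exact: sqr_ge0|exact: nrm2_ge0| |exact: bD].
  by rewrite ler_pXn2r ?nnegrE// lerDl.
have h2 : N xi <= S * (h + zeta) ^+ 2.
  apply: le_trans (nrm2_sum_le w0 hz) _; apply: ler_wpM2l => //.
  by rewrite ler_pXn2r ?nnegrE// lerDr.
have -> : (2 * D + 2 * S) * (h + zeta) ^+ 2 = 2 * ((h + zeta) ^+ 2 * D) +
  2 * (S * (h + zeta) ^+ 2) by ring.
by apply: lerD; rewrite ler_wpM2l.
Qed.

Variables (del T : R) (K : nat).
Hypotheses (del0 : 0 <= del) (delT : del < T) (K0 : (0 < K)%N).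
Local Notation g := (grid del T K).
Local Notation tau := (grid_step del T K).
Variable y0 : nat -> R.
Hypothesis y0_adm : admissible c m y0.

(** The truncations set the coordinates outside 1 to [m] to 0: there the projection is an arbitrary
    choice, about which no measurability is known. *)
Fixpoint chain (k : nat) (o : Omega) : nat -> R :=
  if k is k'.+1 then
    trunc m (pj (kick (fun n => incr W (mode n) (g k') (g k'.+1)) m
      (trunc m (move b tau (chain k' o))) o))
  else trunc m y0.

Let tau0 : 0 < tau. Proof. exact: grid_step_gt0. Qed.

Let g_ge0 k : 0 <= g k.
Proof. by rewrite /grid addr_ge0// mulr_ge0// ltW. Qed.

Let g_lt k : g k < g k.+1. Proof. exact: grid_lt. Qed.

Lemma chain_admissible k o : admissible c m (chain k o).
Proof.
case: k => [|k] /=.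
  by apply: admissible_ext y0_adm => n nm; rewrite trunc_id.
apply: (@admissible_ext _ _ _ (pj (kick (fun n => incr W (mode n) (g k) (g k.+1)) m
      (trunc m (move b tau (chain k o))) o))).
  by move=> n nm; rewrite trunc_id.
exact: proj_in.
Qed.

Lemma chainS k o n : (1 <= n <= m)%N -> chain k.+1 o n =
  pj (fun n => chain k o n + tau * b (chain k o) n + incr W (mode n) (g k) (g k.+1) o) n.
Proof.
move=> nm; rewrite /= trunc_id//; apply: pr_ext => // i im.
by rewrite kickE im trunc_id.
Qed.

Lemma drift_coord_lip n : (1 <= n <= m)%N -> exists2 L : R, 0 <= L & forall x y,
  `|b x n - b y n| <= L * dist2 m (wt m) x y.
Proof.
move=> nm; have [L L0 bL] := drift_lipschitz c m lam a01.
exists ((Num.sqrt (wt m n))^-1 * Num.sqrt L).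
  by apply: mulr_ge0; [rewrite invr_ge0|]; exact: sqrtr_ge0.
move=> x y; apply: le_trans (coord_dist w0 _ _ nm) _.
rewrite -mulrA; apply: ler_wpM2l; first by rewrite invr_ge0 sqrtr_ge0.
by rewrite /dist2 -sqrtrM//; apply: ler_wsqrtr; exact: bL.
Qed.

Let Fm_cst t (k : R) : Fmeasurable F t (fun=> k).
Proof. exact: measurable_cst. Qed.

Lemma move_Fmeasurable t (X : Omega -> nat -> R) :
  (forall n, Fmeasurable F t (fun o => X o n)) ->
  forall n, Fmeasurable F t (fun o => trunc m (move b tau (X o)) n).
Proof.
move=> mX n; rewrite /trunc; case nm : (1 <= n <= m)%N; last exact: Fm_cst.
apply: measurable_funD; first exact: mX.
apply: measurable_funM; first exact: measurable_cst.
have [L L0 bL] := drift_coord_lip nm.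
exact: (@lip_comp_measurable R m (wt m) w0 L (fun x => b x n) _ (g_sigma_algebraType (F t)) X L0 bL mX).
Qed.

Lemma chain_Fmeasurable k n : Fmeasurable F (g k) (fun o => chain k o n).
Proof.
elim: k n => [|k IH] n; first exact: Fm_cst.
rewrite /= /trunc; case nm : (1 <= n <= m)%N; last exact: Fm_cst.
have mX i : Fmeasurable F (g k.+1)
    (fun o => kick (fun n => incr W (mode n) (g k) (g k.+1)) m (trunc m (move b tau (chain k o))) o i).
  have mv : Fmeasurable F (g k.+1) (fun o => trunc m (move b tau (chain k o)) i).
    exact: (Fmeasurable_le hF (g_ge0 k) (ltW (g_lt k)) (move_Fmeasurable IH i)).
  under eq_fun do rewrite kickE.
  case: (_ <= _ <= _)%N => //.
  apply: measurable_funD; first exact: mv.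
  by apply: (Fmeasurable_incr hF hW _ (g_ge0 k) (ltW (g_lt k))); exact: L2_esum.
have l0 : 0 <= (Num.sqrt (wt m n))^-1 :> R by rewrite invr_ge0 sqrtr_ge0.
exact: (@lip_comp_measurable R m (wt m) w0 _ (fun x => pj x n) _ (g_sigma_algebraType (F (g k.+1)))
  _ l0 (pr_coord_lip nm) mX).
Qed.

Lemma chain_measurable k n : measurable_fun setT (fun o => chain k o n).
Proof. exact: (Fmeasurable_measurable hF (g_ge0 k) (@chain_Fmeasurable k n)). Qed.

Local Notation stp := (step m (fun n => Num.sqrt tau * nu n) pj b tau).

(** The state at [grid k] is measurable for the past, so [wiener_noise] integrates out the kicks of
    the step that follows. The induction peels the last step of the chain, which is the innermost
    application of [step]. *)
Lemma chain_expectation lo hi f k : 0 < lo -> good m (wt m) lo hi f ->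
  \int[P]_o f (chain k o) = iter k stp f y0.
Proof.
move=> lo0; elim: k f => [|k IH] f gf.
  have [_ [L _ fL]] := gf.
  under eq_Rintegral do rewrite /= (lip_ext fL (@trunc_id y0)).
  by rewrite (Rintegral_cst _ measurableT) -[X in fine X]/(P setT) probability_setT mulr1.
have [L L0 bL] := drift_lipschitz c m lam a01.
have gs : good m (wt m) lo hi (stp f) by exact: (step_good _ w0 tau pr_nonexp L0 bL lo0 gf).
rewrite iterSr -(IH _ gs).
have gfp : good m (wt m) lo hi (f \o pj).
  have [fb [M M0 fM]] := gf; split => [x|]; first exact: fb.
  exists M => // x y; apply: le_trans (fM _ _) _; rewrite ler_wpM2l//.
  by apply: dist2_mono; exact: pr_nonexp.
transitivity (\int[P]_o (f \o pj) (kick (fun n => incr W (mode n) (g k) (g k.+1)) m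
    (trunc m (move b tau (chain k o))) o)).
  apply: eq_Rintegral => o _ /=; have [_ [M _ fM]] := gf.
  exact: (lip_ext fM (@trunc_id _)).
rewrite (wiener_noise hF hW w0 (g_ge0 k) (g_lt k) (move_Fmeasurable (@chain_Fmeasurable k)) lo0 gfp).
apply: eq_Rintegral => o _; rewrite /step gridS.
have [_ [M _ nM]] := noise_good (fun n => Num.sqrt tau * nu n) w0 m lo0 gfp.
exact: (lip_ext nM (@trunc_id _)).
Qed.

End chain_process.

(** * Convergence of the chain along a fixed path *)

Section path_limit.
Context {R : realType}.
Local Notation mu := (@lebesgue_measure R).
Local Notation I01 := (`[0, 1]%classic : set R).
Local Notation plane := (measurableTypeR R * measurableTypeR R)%type.

Lemma poweR12_sq (x : \bar R) : (0 <= x)%E -> ((x `^ 2^-1) `^ 2 = x)%E.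
Proof. by move=> x0; rewrite -poweRrM mulVf// poweRe1. Qed.

(** The square of the seminorm of order -1, kept free of the root. *)
Definition hsum (b : nat -> R) : \bar R :=
  (\sum_(1 <= n <oo) ((nu n ^+ 2)^-1 * b n ^+ 2)%:E)%E.

Lemma hsum_ge0 b : (0 <= hsum b)%E.
Proof.
apply: nneseries_ge0 => n _ _; rewrite lee_fin.
by rewrite mulr_ge0 ?invr_ge0 ?sqr_ge0.
Qed.

Lemma seminormVE b : (seminormV (-1) b = hsum b `^ 2^-1)%E.
Proof.
rewrite /seminormV /hsum; congr (_ `^ _)%E; apply: eq_eseriesr => n n1.
congr (_ * _)%:E; rewrite -/(nu n).
have h0 : 0 <= nu n :> R := nu_ge0 n.
by rewrite mulrN1 powRN -powR_mulrn.
Qed.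

Lemma hsum_partial (b : nat -> R) k :
  ((\sum_(1 <= n < k) (nu n ^+ 2)^-1 * b n ^+ 2)%R%:E <= hsum b)%E.
Proof.
rewrite /hsum -sumEFin; apply: nneseries_lim_ge => n _.
by rewrite lee_fin mulr_ge0 ?invr_ge0 ?sqr_ge0.
Qed.

Lemma nrm2_le_hsum m b : ((nrm2 m (wt m) b)%:E <= hsum b)%E.
Proof.
apply: le_trans (hsum_partial b m.+1); rewrite lee_fin /nrm2 /ip.
apply: ler_sum => n _; rewrite -expr2; apply: ler_wpM2r; first exact: sqr_ge0.
by rewrite /wt; apply: ler_piMl; [rewrite invr_ge0 sqr_ge0|exact: rho_le1].
Qed.

Lemma normV_lt b (r : R) : 0 < r -> (normV (-1) b < r%:E)%E <->
  (hsum b + (b 0%N ^+ 2)%:E < (r ^+ 2)%:E)%E.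
Proof.
move=> r0; rewrite /normV seminormVE poweR12_sq ?hsum_ge0//.
set S := (_ + _)%E.
have S0 : (0 <= S)%E by rewrite adde_ge0 ?hsum_ge0// lee_fin sqr_ge0.
have rE : (r%:E = (r ^+ 2)%:E `^ 2^-1)%E.
  by rewrite poweR_EFin -(powR_mulrn _ (ltW r0)) -powRrM mulfV// powRr1// ltW.
have mono (s : R) (x y : \bar R) : 0 <= s -> (0 <= x)%E -> (0 <= y)%E -> (x <= y)%E ->
    (x `^ s <= y `^ s)%E.
  by move=> s0 x0 y0; apply: gt0_ler_poweR; rewrite ?in_itv/= ?x0 ?y0 ?leey.
have r2 : (0 <= (r ^+ 2)%:E)%E by rewrite lee_fin sqr_ge0.
split => h; rewrite ltNge; apply/negP => h'.
  by move: h; rewrite ltNge => /negP; apply; rewrite rE; apply: mono => //; rewrite invr_ge0.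
move: h; rewrite ltNge => /negP; apply.
rewrite -(poweR12_sq S0) -(poweR12_sq r2) -rE; apply: mono => //.
  by rewrite lee_fin ltW.
exact: poweR_ge0.
Qed.

Lemma log_part_cvg lam (v : R) : flog lam v \is a fin_num ->
  (fun M : nat => beta (M.+1%:R / M.+2%:R) v) @ \oo --> fine (flog lam v) - lam * v /\
  forall M : nat, `|beta (M.+1%:R / M.+2%:R) v| <= `|fine (flog lam v) - lam * v|.
Proof.
rewrite /flog; case: leP => // v1; case: leP => // v2 _ /=.
have -> : ln ((1 - v) / (1 + v)) + lam * v - lam * v = ln ((1 - v) / (1 + v)) by ring.
have a01 (M : nat) : 0 < (M.+1%:R / M.+2%:R : R) < 1.
  by rewrite divr_gt0//= ltr_pdivrMr// mul1r ltr_nat.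
split; last by move=> M; apply: beta_log => //; rewrite v1 v2.
have ac : (fun M : nat => M.+1%:R / M.+2%:R : R) @ \oo --> (1 : R).
  have -> : (fun M : nat => M.+1%:R / M.+2%:R : R) = (fun M : nat => 1 - (M.+2%:R)^-1).
    apply/funext => M; have M0 : M.+2%:R != 0 :> R by rewrite pnatr_eq0.
    apply: (mulIf M0); rewrite mulrBl mul1r mulVf// divfK//.
    by rewrite -[M.+2%:R]natr1 addrK.
  rewrite -[X in _ --> X]subr0; apply: cvgB; first exact: cvg_cst.
  by have := @cvg_harmonic R; rewrite -(cvg_shiftS (@harmonic R)).
have cv : clamp v = v by apply: clamp_id; rewrite ler_norml !ltW.
rewrite ln_div ?posrE ?subr_gt0//; last by lra.
rewrite /beta cv.
have l1 : (fun M : nat => ln (1 - M.+1%:R / M.+2%:R * v)) @ \oo --> ln (1 - v).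
  apply: (@cvg_comp _ _ _ _ (@ln R) _ (nbhs (1 - v))).
    rewrite -[X in 1 - X]mul1r.
    by apply: cvgB; [exact: cvg_cst|apply: cvgM; [exact: ac|exact: cvg_cst]].
  by apply: continuous_ln; rewrite subr_gt0.
have l2 : (fun M : nat => ln (1 + M.+1%:R / M.+2%:R * v)) @ \oo --> ln (1 + v).
  apply: (@cvg_comp _ _ _ _ (@ln R) _ (nbhs (1 + v))).
    rewrite -[X in 1 + X]mul1r.
    by apply: cvgD; [exact: cvg_cst|apply: cvgM; [exact: ac|exact: cvg_cst]].
  by apply: continuous_ln; lra.
exact: cvgB.
Qed.

Lemma cell_unif (f : R -> R) (t e : R) : {within [set s : R | 0 <= s], continuous f} -> 0 < e ->
  exists2 eta : R, 0 < eta & forall s s', 0 <= s <= t -> 0 <= s' <= t -> `|s - s'| < eta ->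
    `|f s - f s'| <= e.
Proof.
move=> cf e0.
(* The path is viewed as a function on a rectangle that is constant in space, so that
   [within_compact_unif] applies. *)
have cf' : {within (`[0, t]%classic `*` I01 : set (R * R)), continuous (fun z => f z.1)}.
  apply/subspace_continuousP => -[s x] [/=]; rewrite in_itv/= => /andP[s0 st] _.
  move/subspace_continuousP/(_ s s0) : cf => cf.
  apply: (cvg_comp _ _ _ cf) => V [r /= r0 hr].
  exists (ball s r, setT); first by split; [exact: nbhsx_ballx|exact: filterT].
  move=> [s' x'] [/= b _] [/=]; rewrite in_itv/= => /andP[s'0 _] _.
  exact: hr.
have cK : compact (`[0, t]%classic `*` I01 : set (R * R)).
  by apply: compact_setX; exact: segment_compact.
have [eta eta0 h] := within_compact_unif cK cf' e0.
have I0 : I01 0 by rewrite /= in_itv/= lexx ler01.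
exists eta => // s s' hs hs' ss'; apply: (h (s, 0) (s', 0)) => //.
by rewrite subrr normr0.
Qed.

Lemma cvg_grid_step (del T e : R) : del < T -> 0 < e ->
  exists K0 : nat, forall K, (K0 <= K)%N -> grid_step del T K.+1 < e.
Proof.
move=> dT e0; exists (Num.truncn ((T - del) / e)) => K hK.
rewrite /grid_step ltr_pdivrMr ?ltr0n// mulrC -ltr_pdivrMr//.
by apply: lt_le_trans (truncnS_gt _) _; rewrite ler_nat.
Qed.

Context d (Omega : measurableType d).
Variables (W : (R -> R) -> R -> Omega -> R) (c lam t : R) (c1 : `|c| < 1).
Hypotheses (lam_pi : lam <= pi ^+ 2) (t0 : 0 < t).
Variable y0 : nat -> R.
Hypothesis y0_adm : forall m, admissible c m y0.

(** The comparison starts at a positive time because the reflection measures may have infinite mass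
    near time 0. *)
Definition del_seq (i : nat) : R := t / i.+2%:R.
Definition a_seq (M : nat) : R := M.+1%:R / M.+2%:R.

Lemma del_seq_gt0 i : 0 < del_seq i. Proof. by rewrite divr_gt0. Qed.

Lemma del_seq_lt i : del_seq i < t.
Proof. by rewrite /del_seq ltr_pdivrMr// ltr_pMr// ltr1n. Qed.

Lemma a_seq01 M : 0 < a_seq M < 1.
Proof. by rewrite divr_gt0//= ltr_pdivrMr// mul1r ltr_nat. Qed.

Lemma del_seq_small (e : R) : 0 < e -> exists i0 : nat, forall i, (i0 <= i)%N -> del_seq i < e.
Proof.
move=> e0; exists (Num.truncn (t / e)) => i hi.
rewrite /del_seq ltr_pdivrMr ?ltr0n// mulrC -ltr_pdivrMr//.
by apply: lt_le_trans (truncnS_gt _) _; rewrite ler_nat; exact: leqW.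
Qed.

Definition approx (i M m K : nat) : Omega -> nat -> R :=
  chain W m (a_seq M) lam c1 (del_seq i) t K.+1 y0 K.+1.

Variables (o : Omega) (u : R -> R -> R).
Variables etap etam : {measure set plane -> \bar R}.
Hypothesis u_cont : {within `]0, t] `*` I01, continuous (fun z : R * R => u z.1 z.2)}.
Hypothesis u_bound : forall s x, 0 < s <= t -> I01 x -> `|u s x| <= 1.
Hypothesis u_init : normV (-1) (coef (u s) - y0)%R
  @[s --> within (`[0, t] : set R) (nbhs 0)] --> 0%E.
Hypothesis u_flog : (mu \x mu)%E.-integrable (`[0, t] `*` I01)
  (fun z : R * R => flog lam (u z.1 z.2)).
Hypothesis eta_fin : forall delta, 0 < delta <= t ->
  (etap (rect delta t) < +oo)%E /\ (etam (rect delta t) < +oo)%E.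
Hypothesis contactp : {ae etap, forall z, 0 < z.1 -> I01 z.2 -> u z.1 z.2 = 1}.
Hypothesis contactm : {ae etam, forall z, 0 < z.1 -> I01 z.2 -> u z.1 z.2 = -1}.
Hypothesis W_cont : forall n,
  {within [set s : R | 0 <= s], continuous (fun s => W (mode n) s o)}.
Hypothesis u_modal : forall i K k n, (k < K.+1)%N ->
  let A := grid (del_seq i) t K.+1 k in let B := grid (del_seq i) t K.+1 k.+1 in
  coef (u B) n - coef (u A) n = 2^-1 * nu n ^+ 2 *
    ((lam - nu n ^+ 2) * \int[mu]_(s in `[A, B]) coef (u s) n +
     \int[(mu \x mu)%E]_(z in rect A B) (log_part u lam z * eigen n z.2) +
     \int[etam]_(z in rect A B) eigen n z.2 - \int[etap]_(z in rect A B) eigen n z.2) +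
    incr W (mode n) A B o.
Hypothesis u_mass : forall i K k, (k < K.+1)%N -> coef (u (grid (del_seq i) t K.+1 k.+1)) 0 = c.

Let del_in i s : del_seq i <= s <= t -> 0 < s <= t.
Proof. by move=> /andP[h1 h2]; rewrite h2 (lt_le_trans (del_seq_gt0 i) h1). Qed.

Let rect_sub i : rect (del_seq i) t `<=` `]0, t] `*` I01.
Proof. by move=> z [/=]; rewrite !in_itv/= => /del_in. Qed.

Let cu i : {within rect (del_seq i) t, continuous (fun z => u z.1 z.2)}.
Proof. exact: continuous_subspaceW (@rect_sub i) u_cont. Qed.

Let ub i s x : del_seq i <= s <= t -> I01 x -> `|u s x| <= 1.
Proof. by move=> /del_in; exact: u_bound. Qed.

Let mrect A B : measurable (rect A B : set plane). Proof. exact: measurable_rect. Qed.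

Let iflog i : (mu \x mu)%E.-integrable (rect (del_seq i) t) (fun z => flog lam (u z.1 z.2)).
Proof.
apply: integrableS u_flog => //; first exact: (mrect 0 t).
move=> z [h1 h2]; split => //; move: h1; rewrite /= !in_itv/= => /del_in/andP[h3 h4].
by rewrite h4 ltW.
Qed.

Let ibt i := integrable_log_part (ltW (del_seq_lt i)) (@cu i) (@ub i) (@iflog i).

Lemma initial_small (e : R) : 0 < e -> exists i0 : nat, forall i, (i0 <= i)%N -> forall m,
  nrm2 m (wt m) (coef (u (del_seq i)) - y0) <= e.
Proof.
move=> e0.
have r0 : 0 < Num.sqrt e by rewrite sqrtr_gt0.
have r0' : (0 < (Num.sqrt e)%:E)%E by rewrite lte_fin.
have hn : nbhs (0%E : \bar R) [set x | (x < (Num.sqrt e)%:E)%E].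
  by apply: open_nbhs_nbhs; split; [exact: open_ereal_lt_ereal|].
have [eta /= eta0 h] := u_init hn.
have [i0 hi0] := del_seq_small eta0.
exists i0 => i ii0 m.
have dt : (`[0, t]%classic : set R) (del_seq i).
  by rewrite /= in_itv/= !ltW ?del_seq_gt0 ?del_seq_lt.
have := h (del_seq i); rewrite /= sub0r normrN gtr0_norm ?del_seq_gt0//.
move=> /(_ (hi0 i ii0) dt)/(normV_lt _ r0).1; rewrite sqr_sqrtr ?(ltW e0)// => h2.
rewrite -lee_fin; apply: le_trans (nrm2_le_hsum _ _) _; apply: le_trans (ltW h2).
by rewrite leeDl// lee_fin sqr_ge0.
Qed.

(** Dominated convergence, with the integrable [log_part] as majorant. *)
Lemma drift_error_small i (e : R) : 0 < e -> exists M0 : nat, forall M, (M0 <= M)%N ->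
  \int[(mu \x mu)%E]_(w in rect (del_seq i) t) `|log_part u lam w - beta (a_seq M) (u w.1 w.2)| <= e.
Proof.
move=> e0.
pose f_ (M : nat) (w : plane) : \bar R := (beta (a_seq M) (u w.1 w.2))%:E.
have mb M : measurable_fun setT (beta (a_seq M)).
  by apply: continuous_measurable_fun; apply: continuous_beta; exact: a_seq01.
have mu2 : measurable_fun (rect (del_seq i) t : set plane) (fun w : plane => u w.1 w.2).
  exact: (measurable_field2 (ltW (del_seq_lt i)) (@cu i) (@ub i)).
have mf_ M : measurable_fun (rect (del_seq i) t : set plane) (f_ M).
  by apply/measurable_EFinP; exact: (measurableT_comp (mb M) mu2).
have fin := integrable_ae (mrect _ _) (@iflog i).
have fcv : {ae (mu \x mu)%E, forall w, rect (del_seq i) t w ->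
    f_ M w @[M --> \oo] --> (EFin \o log_part u lam) w}.
  apply: filterS fin => w hw Dw; apply: cvg_EFin; first by apply: nearW => ?.
  exact: (log_part_cvg (hw Dw)).1.
have fdom : {ae (mu \x mu)%E, forall w, forall M, rect (del_seq i) t w ->
    (`|f_ M w| <= `|(log_part u lam w)%:E|)%E}.
  by apply: filterS fin => w hw M Dw; rewrite lee_fin; exact: (log_part_cvg (hw Dw)).2.
have [_ h _] := dominated_convergence (mrect (del_seq i) t) mf_ (measurable_int _ (@ibt i)) fcv
  (integrable_abse (@ibt i)) fdom.
have hn : nbhs (0%E : \bar R) [set x | (x < e%:E)%E].
  by apply: open_nbhs_nbhs; split; [exact: open_ereal_lt_ereal|rewrite /= lte_fin].
have [M0 _ hM] := h _ hn.
exists M0 => M MM0; have := hM M MM0.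
rewrite /= /Rintegral => h2.
have -> : (\int[(mu \x mu)%E]_(w in rect (del_seq i) t)
    `|log_part u lam w - beta (a_seq M) (u w.1 w.2)|%:E)%E =
    (\int[(mu \x mu)%E]_(w in rect (del_seq i) t) `|f_ M w - (log_part u lam w)%:E|)%E.
  by apply: eq_integral => w _; rewrite /f_ -EFinB abse_EFin distrC.
have p0 : (0 <= \int[(mu \x mu)%E]_(w in rect (del_seq i) t) `|f_ M w - (log_part u lam w)%:E|)%E.
  by apply: integral_ge0 => w _; exact: abse_ge0.
rewrite -lee_fin fineK; first exact: ltW h2.
by rewrite ge0_fin_numE// (lt_trans h2)// ltry.
Qed.

Lemma eventually_all (Q : nat -> nat -> Prop) : (forall n, exists K0, forall K, (K0 <= K)%N -> Q n K) ->
  forall m, exists K0, forall K, (K0 <= K)%N -> forall n, (n <= m)%N -> Q n K.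
Proof.
move=> /choice[f hf] m; exists (\max_(n < m.+1) f n) => K hK n nm; apply: hf.
by apply: leq_trans hK; exact: (leq_bigmax (Ordinal (nm : (n < m.+1)%N))).
Qed.

(** Four errors are each brought below [zeta / 4]: the initial distance by [i], the regularization
    of the logarithm by [M], the Fejer error by [m], and the variation in time of solution and chain
    by [K]. The constants met at a later choice depend on the earlier ones, which dictates the
    nesting. *)
Lemma path_limit (zeta : R) : 0 < zeta -> exists i0, forall i, (i0 <= i)%N ->
  exists M0, forall M, (M0 <= M)%N -> exists m0, forall m, (m0 <= m)%N ->
  exists K0, forall K, (K0 <= K)%N ->
    nrm2 m (wt m) (coef (u t) - approx i M m K o) <= zeta.
Proof.
move=> z0.
have z4 : 0 < zeta / 4 by exact: divr_gt0.
have [i0 hi0] := initial_small z4.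
exists i0 => i ii0; have {hi0}hN := hi0 i ii0.
have z16 : 0 < zeta / 16 by exact: divr_gt0.
have [M0 hM0] := drift_error_small i z16.
exists M0 => M MM0; have {hM0}hI := hM0 M MM0.
have dt := del_seq_lt i.
have dpos : 0 < del_seq i <= t by rewrite del_seq_gt0 ltW.
have [finp finm] := eta_fin dpos.
pose Cst := \int[(mu \x mu)%E]_(w in rect (del_seq i) t)
     (`|log_part u lam w| + beta_lip (a_seq M)) +
     (fine (etap (rect (del_seq i) t)) + fine (etam (rect (del_seq i) t))).
have L0 := beta_lip_gt0 (a_seq01 M).
have Cst0 : 0 <= Cst.
  apply: addr_ge0; last by apply: addr_ge0; exact: fine_ge0.
  by apply: Rintegral_ge0 => w _; apply: addr_ge0 (ltW L0).
have C1 : 0 < 8 * (Cst + 1) by rewrite mulr_gt0// ltr_wpDl.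
pose eps := zeta / (8 * (Cst + 1)).
have eps0 : 0 < eps by exact: divr_gt0.
have [m0 hm0] := field_fejer (@cu i) (@ub i) eps0.
exists m0.+1 => m mm0.
have m1 : (0 < m)%N by apply: leq_trans mm0.
have {hm0}heps s x : del_seq i <= s <= t -> I01 x -> `|fejer m (coef (u s)) x - u s x| <= eps.
  by apply: hm0; exact: ltnW.
pose S := \sum_(1 <= n < m.+1) 2 : R.
have S0 : 0 <= S by apply: sumr_ge0.
pose G := 4 * (\sum_(1 <= n < m.+1) (nu n ^+ 2 - lam)) : R.
have E0 : 0 < 8 * ((1 + S) * Cst + 3 * (`|G| * t) + 1).
  rewrite mulr_gt0// ltr_wpDl//; apply: addr_ge0; first by apply: mulr_ge0 => //; exact: addr_ge0.
  by apply: mulr_ge0 => //; apply: mulr_ge0 => //; exact: ltW.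
pose e := zeta / (8 * ((1 + S) * Cst + 3 * (`|G| * t) + 1)).
have e0 : 0 < e by exact: divr_gt0.
have [C CC0 hC] := euler_incr m lam c1 (a_seq01 M).
have e1 : 0 < e / (2 * (C + 1)) by rewrite divr_gt0// mulr_gt0// ltr_wpDl.
have [eta eta0 hom] := field_unif (@cu i) e0.
have [K1 hK1] := cvg_grid_step dt eta0.
have [K2 hK2] := cvg_grid_step dt e1.
have incr_small n : exists K0, forall K, (K0 <= K)%N -> forall k, (k < K.+1)%N ->
   `|incr W (mode n) (grid (del_seq i) t K.+1 k) (grid (del_seq i) t K.+1 k.+1) o| <=
   e / (2 * (C + 1)).
  have [et et0 h] := cell_unif t (@W_cont n) e1.
  have [K0 hK0] := cvg_grid_step dt et0.
  exists K0 => K KK k kK.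
  have in0 j : (j <= K.+1)%N -> 0 <= grid (del_seq i) t K.+1 j <= t.
    move=> jK; have /andP[h1 h2] := grid_in dt (ltn0Sn K) jK.
    by rewrite h2 (le_trans (ltW (del_seq_gt0 i)) h1).
  apply: h; [exact: in0|exact: in0 (ltnW kK)|].
  rewrite gridS gtr0_norm ?grid_step_gt0//; exact: hK0.
have [K3 hK3] := eventually_all incr_small m.
exists (maxn K1 (maxn K2 K3)) => K; rewrite !geq_max => /and3P[KK1 KK2 KK3].
pose X k := chain W m (a_seq M) lam c1 (del_seq i) t K.+1 y0 k o.
have hX0 : nrm2 m (wt m) (coef (u (del_seq i)) - X 0%N) <= zeta / 4.
  by apply: le_trans (hN m); rewrite le_eqVlt; apply/orP; left; apply/eqP;
    apply: eq_ip => n nm; rewrite /X /= !fctE trunc_id.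
have hh0 : 0 < grid_step (del_seq i) t K.+1 by exact: grid_step_gt0.
have hDl k n : (k < K.+1)%N -> (1 <= n <= m)%N -> `|X k.+1 n - X k n| <= e.
  move=> kK nm; rewrite /X chainS//.
  apply: le_trans (hC _ _ (grid_step (del_seq i) t K.+1) (e / (2 * (C + 1))) _ (ltW hh0) _ n nm) _.
  - exact: chain_admissible.
  - by move=> n' /andP[_ n'm]; exact: hK3.
  have h1 := hK2 K KK2.
  apply: (@le_trans _ _ (C * (e / (2 * (C + 1)) + e / (2 * (C + 1))))).
    by apply: ler_wpM2l => //; rewrite lerD2r ltW.
  have -> : C * (e / (2 * (C + 1)) + e / (2 * (C + 1))) = e * (C / (C + 1)).
    by field; rewrite gt_eqF// ltr_wpDl.
  by apply: ler_piMr; [exact: ltW|rewrite ler_pdivrMr ?ltr_wpDl// mul1r lerDl].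
have cpw : {ae etap, forall z, rect (del_seq i) t z -> u z.1 z.2 = 1}.
  apply: (@filterS _ _ (ae_filter_ringOfSetsType etap) _ _ _ contactp) => z hz [/= h1 h2].
  by apply: hz => //; move: h1; rewrite in_itv/= => /del_in/andP[].
have cmw : {ae etam, forall z, rect (del_seq i) t z -> u z.1 z.2 = -1}.
  apply: (@filterS _ _ (ae_filter_ringOfSetsType etam) _ _ _ contactm) => z hz [/= h1 h2].
  by apply: hz => //; move: h1; rewrite in_itv/= => /del_in/andP[].
have hom' s s' x : del_seq i <= s <= t -> del_seq i <= s' <= t -> I01 x ->
    `|s - s'| <= grid_step (del_seq i) t K.+1 -> `|u s x - u s' x| <= e.
  move=> hs hs' Ix ss'; apply: hom => //; last by rewrite subrr normr0.
  exact: le_lt_trans ss' (hK1 K KK1).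
have key : nrm2 m (wt m) (coef (u t) - X K.+1) <= nrm2 m (wt m) (coef (u (del_seq i)) - X 0%N) + 2 * (
    2 * \int[(mu \x mu)%E]_(w in rect (del_seq i) t) `|log_part u lam w - beta (a_seq M) (u w.1 w.2)| +
    (eps + e + S * e) * Cst + G * (2 * e + e) * (t - del_seq i)).
  apply: (path_error dt (ltn0Sn K) (c1 := c1) (a_seq01 M) lam_pi (@cu i) (@ub i) (fun k => @u_mass i K k)
    (@ibt i) finp finm cpw cmw (fun k n kK _ => @u_modal i K k n kK) _ _ hom' heps hDl m1).
    by move=> k; exact: chain_admissible.
  by move=> k n nm; exact: chainS.
apply: le_trans key _.
have b1 : 2 * (eps * Cst) <= zeta / 4.
  have -> : zeta / 4 = 2 * (eps * (Cst + 1)).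
    by rewrite /eps; field; rewrite gt_eqF// ltr_wpDl.
  by rewrite ler_pM2l// ler_wpM2l ?(ltW eps0)// lerDl.
have b2 : 2 * ((e + S * e) * Cst + G * (2 * e + e) * (t - del_seq i)) <= zeta / 4.
  have -> : zeta / 4 = 2 * (e * ((1 + S) * Cst + 3 * (`|G| * t) + 1)).
    by rewrite /e; field; rewrite gt_eqF//; move: E0; rewrite pmulr_rgt0.
  rewrite ler_pM2l//.
  have g1 : G * (t - del_seq i) <= `|G| * t.
    apply: (@le_trans _ _ (`|G| * (t - del_seq i))).
      by apply: ler_wpM2r (ler_norm G); rewrite subr_ge0 ltW.
    by apply: ler_wpM2l => //; rewrite gerBl ltW// del_seq_gt0.
  have g2 := ler_wpM2l (ltW e0) g1.
  have -> : (e + S * e) * Cst + G * (2 * e + e) * (t - del_seq i) =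
    e * ((1 + S) * Cst) + 3 * (e * (G * (t - del_seq i))) by ring.
  have -> : e * ((1 + S) * Cst + 3 * (`|G| * t) + 1) =
    e * ((1 + S) * Cst) + 3 * (e * (`|G| * t)) + e by ring.
  by rewrite -addrA lerD2l; apply: ler_wpDr; [exact: ltW|rewrite ler_pM2l].
move: hX0 hI b1 b2.
set q1 := nrm2 _ _ _; set q2 := \int[_]_(_ in _) _; move=> hX0 hI b1 b2.
have -> : zeta = zeta / 4 + (4 * (zeta / 16) + zeta / 4 + zeta / 4) by field.
apply: lerD => //.
have -> : 2 * (2 * q2 + (eps + e + S * e) * Cst + G * (2 * e + e) * (t - del_seq i)) =
  4 * q2 + 2 * (eps * Cst) + 2 * ((e + S * e) * Cst + G * (2 * e + e) * (t - del_seq i)) by ring.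
by apply: lerD => //; apply: lerD => //; rewrite ler_pM2l.
Qed.
End path_limit.

(** * Almost sure properties of a weak solution *)

Section solution.
Context {R : realType} d (Omega : measurableType d) (P : probability Omega R).
Local Notation mu := (@lebesgue_measure R).
Local Notation I01 := (`[0, 1]%classic : set R).
Local Notation plane := (measurableTypeR R * measurableTypeR R)%type.
Variables (F : R -> set (set Omega)) (W : (R -> R) -> R -> Omega -> R).
Variables (c lam t : R) (c1 : `|c| < 1).
Hypotheses (lam_pi : lam <= pi ^+ 2) (t0 : 0 < t).
Variables (x : R -> R) (u : Omega -> R -> R -> R)
  (etap etam : R.-ker Omega ~> (measurableTypeR R * measurableTypeR R)%type).
Hypothesis sol : weak_solution P lam (graph_powA 1) x F u etap etam W.
Hypothesis x_adm : forall m, admissible c m (coef x).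
Hypothesis x_mass : coef x 0%N = c.

Lemma open_quadrant : `]0%R, +oo[%classic `*` I01 =
  \bigcup_k (rect k.+1%:R^-1 k.+1%:R : set plane).
Proof.
apply/seteqP; split => [[s y] [/= hs hy]|[s y] [k _ [/= hs hy]]]; last first.
  split => //=; move: hs; rewrite !in_itv/= andbT => /andP[h _].
  by apply: lt_le_trans h; rewrite invr_gt0.
move: hs; rewrite in_itv/= andbT => s0.
exists (maxn (Num.truncn s) (Num.truncn s^-1)) => //; split => //=.
rewrite in_itv/=; apply/andP; split.
  rewrite -[leRHS]invrK lef_pV2 ?posrE ?invr_gt0//.
  apply: le_trans (ltW (truncnS_gt _)) _; rewrite ler_nat ltnS; exact: leq_maxr.
apply: le_trans (ltW (truncnS_gt _)) _; rewrite ler_nat ltnS; exact: leq_maxl.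
Qed.

(** The integrand is nonnegative because [|v| <= 1], so its vanishing integral makes it 0 almost
    everywhere; [e = 1] and [e = -1] cover the two barriers. *)
Lemma contact_ae (v : R -> R -> R) (eta : {measure set plane -> \bar R}) (e : R) :
  (forall T, 0 < T -> {within `]0, T] `*` I01, continuous (fun z : R * R => v z.1 z.2)}) ->
  (forall s y, 0 < s -> I01 y -> `|v s y| <= 1) -> `|e| = 1 ->
  (\int[eta]_(z in (`]0%R, +oo[%classic : set R) `*` I01) (1 - e * v z.1 z.2)%:E = 0)%E ->
  {ae eta, forall z, 0 < z.1 -> I01 z.2 -> v z.1 z.2 = e}.
Proof.
move=> cv vb e1 I0.
have mD : measurable (`]0%R, +oo[%classic `*` I01 : set plane).
  by apply: measurableX; exact: measurable_itv.
have mv : measurable_fun (`]0%R, +oo[%classic `*` I01 : set plane) (fun z : plane => v z.1 z.2).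
  rewrite open_quadrant; apply/measurable_fun_bigcup => [k|k]; first exact: measurable_rect.
  have k1 : k.+1%:R^-1 <= k.+1%:R :> R.
    by apply: (@le_trans _ _ 1); rewrite ?ler1n// invf_le1// ler1n.
  have k0 : 0 < k.+1%:R^-1 :> R by rewrite invr_gt0.
  apply: (measurable_field2 k1).
    apply: continuous_subspaceW (cv k.+1%:R _) => // z [/= h1 h2]; split => //=.
    by move: h1; rewrite !in_itv/= => /andP[h3 ->]; rewrite (lt_le_trans k0 h3).
  by move=> s y /andP[s1 _]; apply: vb; exact: lt_le_trans k0 s1.
have mf : measurable_fun (`]0%R, +oo[%classic `*` I01 : set plane)
    (fun z : plane => (1 - e * v z.1 z.2)%:E).
  apply/measurable_EFinP; apply: measurable_funB; first exact: measurable_cst.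
  by apply: measurable_funM => //; exact: measurable_cst.
have f0 (z : plane) : (`]0%R, +oo[%classic `*` I01) z -> 0 <= 1 - e * v z.1 z.2.
  move=> [/=]; rewrite in_itv/= andbT => h1 h2; rewrite subr_ge0.
  apply: le_trans (ler_norm _) _; rewrite normrM e1 mul1r; exact: vb.
have : (\int[eta]_(z in `]0%R, +oo[%classic `*` I01) `|(1 - e * v z.1 z.2)%:E| = 0)%E.
  rewrite -[RHS]I0; apply: eq_integral => z /set_mem hz.
  by rewrite gee0_abs// lee_fin; exact: f0.
move=> /(ae_eq_integral_abs _ mD mf).
apply: (@filterS _ _ (ae_filter_ringOfSetsType eta)) => z hz z1 z2.
have := hz (conj _ z2); rewrite /= in_itv/= andbT => /(_ z1)[] h.
have e2 : e * e = 1 by rewrite -expr2 -(real_normK (num_real e)) e1 expr1n.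
have e3 : e * v z.1 z.2 = 1 by lra.
by rewrite -[v z.1 z.2]mul1r -e2 -mulrA e3 mulr1.
Qed.

Lemma graphA_mode n : graphA (@eigen R n) (fun y => - nu n ^+ 2 * eigen n y) /\
  graphA (fun y => - nu n ^+ 2 * @eigen R n y) (fun y => nu n ^+ 4 * eigen n y).
Proof.
split.
  have := @graphA_eigen R 1 n; congr graphA; apply/funext => y; rewrite ?mul1r//.
have := @graphA_eigen R (- nu n ^+ 2) n; congr graphA; apply/funext => y; ring.
Qed.

Let modal_at (A B : R) (o : Omega) n :=
  coef (u o B) n - coef (u o A) n = 2^-1 * nu n ^+ 2 *
    ((lam - nu n ^+ 2) * \int[mu]_(s in `[A, B]) coef (u o s) n +
     \int[(mu \x mu)%E]_(z in rect A B) (log_part (u o) lam z * eigen n z.2) +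
     \int[etam o]_(z in rect A B) eigen n z.2 - \int[etap o]_(z in rect A B) eigen n z.2) +
    incr W (mode n) A B o.

Let wiener : cylindrical_wiener P F W. Proof. by case: sol => _ _ [] . Qed.

Lemma modal_ae (A B : R) n : 0 < A -> A < B -> {ae P, forall o, modal_at A B o n}.
Proof.
move=> A0 AB; have [s1 s2 _ s4 _] := sol.
have [g1 g2] := graphA_mode n.
have cA : {within I01, continuous (fun y => - nu n ^+ 2 * @eigen R n y)}.
  apply: continuous_subspaceT => y; apply: cvgM; first exact: cvg_cst.
  exact: continuous_eigen.
have AB' : 0 < A < B by rewrite A0.
have B0 : 0 < B by exact: lt_trans AB.
have := s4 _ _ _ _ g1 g2 cA (adjoint_eigen n) A B AB'.
apply: filterS3 s1 s2 => o [_ /(_ B B0)[h1 h2 _ _ h5]] heta E.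
have sub : rect A B `<=` `]0, B] `*` I01.
  move=> z [/= h h']; split => //=; move: h; rewrite !in_itv/= => /andP[h ->].
  by rewrite (lt_le_trans A0 h).
have fin eta : eta = etap \/ eta = etam -> (eta o (rect A B) < +oo)%E.
  by move=> /heta[_]; apply; rewrite A0 ltW.
apply: (modal_equation (ltW AB)) => //.
- exact: continuous_subspaceW sub h1.
- move=> s y /andP[s3 s5] /=; rewrite in_itv/= => hy; rewrite ler_norml; apply: h2 => //.
  by rewrite s5 (lt_le_trans A0 s3).
- apply: integrableS h5; [exact: (measurable_rect 0 B)|exact: measurable_rect|].
  move=> z /sub[/= h h']; split => //=; move: h; rewrite !in_itv/= => /andP[h ->].
  by rewrite ltW.
- by apply: fin; left.
- by apply: fin; right.
Qed.

(** For [n = 0] the eigenvalue vanishes and so does the noise, hence the mass is the same at all the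
    positive times considered; the continuity at time 0 in [normV (-1)], which contains the mass,
    identifies it with that of [x]. *)
Lemma mass_ae (B : R) : 0 < B -> {ae P, forall o, coef (u o B) 0 = c}.
Proof.
move=> B0; have [s1 _ _ _ _] := sol.
have d0 j : 0 < del_seq B j by exact: del_seq_gt0.
have dlt j : del_seq B j < B by exact: del_seq_lt.
have m2 : {ae P, forall o, forall j, coef (u o B) 0 = coef (u o (del_seq B j)) 0}.
  apply: ae_foralln => j; apply: filterS2 (modal_ae 0 (d0 j) (dlt j))
    (incr_esum wiener (@nu R) [:: 0%N] (ltW (d0 j)) (ltW (dlt j))) => o h1 h2.
  apply/eqP; rewrite -subr_eq0; rewrite /modal_at h2 in h1.
  rewrite h1 big_seq1 /nu mul0r expr0n/= mulr0 !mul0r addr0//.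
apply: filterS2 s1 m2 => o [u0 hT] hmass.
have [_ _ _ h4 _] := hT B B0.
have tt : (0 : R) <= 0 <= B by rewrite lexx ltW.
have ui : normV (-1) (coef (u o s) - coef x)%R
    @[s --> within (`[0, B] : set R) (nbhs 0)] --> 0%E.
  by have := h4 0 tt; rewrite u0.
apply/eqP; rewrite -subr_eq0 -normr_le0.
apply/ler_addgt0Pr => r r0; rewrite add0r.
have r0' : (0 < r%:E)%E by rewrite lte_fin.
have hn : nbhs (0%E : \bar R) [set y | (y < r%:E)%E].
  by apply: open_nbhs_nbhs; split; [exact: open_ereal_lt_ereal|].
have [eta /= eta0 h] := ui _ hn.
have [j hj] := del_seq_small B eta0.
rewrite (hmass j) -x_mass.
have dt : (`[0, B]%classic : set R) (del_seq B j) by rewrite /= in_itv/= !ltW.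
have := h (del_seq B j); rewrite /= sub0r normrN gtr0_norm//.
move=> /(_ (hj j (leqnn j)) dt)/(normV_lt _ r0).1 h6.
have : ((coef (u o (del_seq B j)) 0 - coef x 0) ^+ 2 <= r ^+ 2)%R.
  rewrite -lee_fin; apply: le_trans (ltW h6); rewrite leeDr ?hsum_ge0//.
rewrite -[X in X <= _]real_normK ?num_real// ler_pXn2r ?nnegrE// ltW//.
Qed.

(** Starting times, grids and modes form a countable family, so the exceptional sets of all modal
    and mass equations are negligible together. *)
Lemma ae_path_limit : {ae P, forall o, forall zeta, 0 < zeta -> exists i0, forall i, (i0 <= i)%N ->
  exists M0, forall M, (M0 <= M)%N -> exists m0, forall m, (m0 <= m)%N ->
  exists K0, forall K, (K0 <= K)%N ->
    nrm2 m (wt m) (coef (u o t) - approx W lam t c1 (coef x) i M m K o) <= zeta}.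
Proof.
have [s1 s2 _ _ s5] := sol.
pose g i K k := grid (del_seq t i) t K.+1 k.
have d0 i : 0 < del_seq t i by exact: del_seq_gt0.
have dlt i : del_seq t i < t by exact: del_seq_lt.
have g0 i K k : 0 < g i K k.
  apply: lt_le_trans (d0 i) _; rewrite -(grid0 (del_seq t i) t K.+1).
  exact: grid_le (dlt i) (ltn0Sn K) _ _ (leq0n k).
have glt i K k : g i K k < g i K k.+1 by exact: grid_lt (dlt i) (ltn0Sn K) _ _ (ltnSn k).
have m1 : {ae P, forall o, forall i K k n, modal_at (g i K k) (g i K k.+1) o n}.
  apply: ae_foralln => i; apply: ae_foralln => K; apply: ae_foralln => k.
  by apply: ae_foralln => n; exact: modal_ae.
have m2 : {ae P, forall o, forall i K k, coef (u o (g i K k.+1)) 0 = c}.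
  by do 3 (apply: ae_foralln => ?); exact: mass_ae.
have wc : {ae P, forall o, forall n,
    {within [set s : R | 0 <= s], continuous (fun s => W (mode n) s o)}}.
  apply: ae_foralln => n; have [_ w2 _ _] := wiener.
  by apply: filterS (w2 (mode n) (L2_esum _ _)) => o [].
apply: filterS (filterI (filterI s1 s2) (filterI (filterI s5 wc) (filterI m1 m2))).
move=> o [[[u0 hT] heta] [[[cp cm] hw] [hm hmass]]].
have [h1 h2 h3 h4 h5] := hT t t0.
have vb s y : 0 < s -> I01 y -> `|u o s y| <= 1.
  move=> s0 /=; rewrite in_itv/= => hy; rewrite ler_norml.
  by have [_ h _ _ _] := hT s s0; apply: h => //; rewrite s0 lexx.
have cv T : 0 < T -> {within `]0, T] `*` I01, continuous (fun z : R * R => u o z.1 z.2)}.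
  by move=> T0; have [] := hT T T0.
have tt : (0 : R) <= 0 <= t by rewrite lexx ltW.
have ui : normV (-1) (coef (u o s) - coef x)%R
    @[s --> within (`[0, t] : set R) (nbhs 0)] --> 0%E.
  by have := h4 0 tt; rewrite u0.
move=> zeta z0; apply: (@path_limit R d Omega W c lam t c1 lam_pi t0 (coef x) x_adm o (u o)
  (etap o) (etam o) h1 _ ui h5 _ _ _ hw _ _ zeta z0).
- by move=> s y /andP[s0 _]; exact: vb.
- move=> delta dt; split; [apply: (heta etap (or_introl erefl)).2|apply: (heta etam (or_intror erefl)).2];
  exact: dt.
- apply: (contact_ae cv vb (normr1 _)); rewrite -[RHS]cp.
  by apply: eq_integral => z _; rewrite mul1r.
- apply: (contact_ae cv vb (normrN1 _)); rewrite -[RHS]cm.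
  by apply: eq_integral => z _; rewrite mulN1r opprK.
- by move=> i K k n _; exact: hm.
by move=> i K k _; exact: hmass.
Qed.

End solution.

(** * Harnack inequality for cylinder functions *)

Section nested_limits.
Context {R : realType} d (Omega : measurableType d) (P : probability Omega R).

(** The lower limit of the sets [B n]. *)
Definition eventually_set (B : nat -> set Omega) : set Omega :=
  \bigcup_n \bigcap_(k in [set k | (n <= k)%N]) B k.

Lemma measurable_eventually_set B : (forall n, measurable (B n)) ->
  measurable (eventually_set B).
Proof.
move=> mB; apply: bigcup_measurable => n _.
by apply: bigcap_measurable => //; exists n; exact: leqnn.
Qed.

Lemma eventually_set_large B (r : R) n0 : (forall n, measurable (B n)) ->
  (r%:E < P (eventually_set B))%E -> exists2 n, (n0 <= n)%N & (r%:E < P (B n))%E.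
Proof.
move=> mB rB.
pose D n := \bigcap_(k in [set k | (n <= k)%N]) B k.
have mD n : measurable (D n) by apply: bigcap_measurable => //; exists n; exact: leqnn.
have homoD : {homo D : n m / (n <= m)%N >-> (n <= m)%O}.
  by move=> n m nm; apply/subsetPset => o h k /= mk; apply: h; exact: leq_trans nm mk.
have h := nondecreasing_cvg_mu mD (measurable_eventually_set mB) homoD.
have hn : nbhs (P (eventually_set B)) [set y | (r%:E < y)%E].
  by apply: open_nbhs_nbhs; split; [exact: open_ereal_gt_ereal|].
have [N _ hN] := h _ P _ hn.
exists (maxn N n0); first exact: leq_maxr.
apply: (lt_le_trans (hN (maxn N n0) (leq_maxl _ _))).
by apply: le_measure; rewrite ?inE//; move=> o; apply; exact: leqnn.
Qed.

Lemma ae_full (E : set Omega) (r : R) : measurable E -> {ae P, forall o, E o} -> r < 1 ->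
  (r%:E < P E)%E.
Proof.
move=> mE [N [mN N0 EN]] r1.
have c0 : P (~` E) = 0%E.
  apply/eqP; rewrite eq_le measure_ge0 andbT -N0; apply: le_measure; rewrite ?inE//.
  exact: measurableC.
have := probability_setC P mE; rewrite c0 => h.
have fE := P_fin P mE.
rewrite -(fineK fE) lte_fin; move: h; rewrite -(fineK fE) -EFinB => -[] h.
by rewrite (_ : fine (P E) = 1)//; lra.
Qed.

(** The indices in the pathwise statement depend on the path. Lower limits taken level by level,
    with continuity of [P] from below at each level, give deterministic indices that serve on an
    event of probability above [r]. *)
Lemma nested_event (G : nat -> nat -> nat -> nat -> set Omega) (r : R) :
  (forall i M m K, measurable (G i M m K)) -> r < 1 ->
  {ae P, forall o, exists i0, forall i, (i0 <= i)%N -> exists M0, forall M, (M0 <= M)%N ->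
    exists m0, forall m, (m0 <= m)%N -> exists K0, forall K, (K0 <= K)%N -> G i M m K o} ->
  forall i0, exists2 i, (i0 <= i)%N & exists M, forall m0, exists2 m, (m0 <= m)%N &
    forall K0, exists2 K, (K0 <= K)%N & (r%:E < P (G i M m K))%E.
Proof.
move=> mG r1 hG i0.
pose E3 i M m := eventually_set (G i M m).
pose E2 i M := eventually_set (E3 i M).
pose E1 i := eventually_set (E2 i).
have m3 i M m : measurable (E3 i M m) by exact: measurable_eventually_set.
have m2 i M : measurable (E2 i M) by exact: measurable_eventually_set.
have m1 i : measurable (E1 i) by exact: measurable_eventually_set.
have full : (r%:E < P (eventually_set E1))%E.
  apply: ae_full => //; first exact: measurable_eventually_set.
  apply: filterS hG => o [i1 h]; exists i1 => // i /h[M1 h2]; exists M1 => // M /h2[k1 h3].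
  by exists k1 => // m /h3[K1 h4]; exists K1 => // K /h4.
have [i ii0 hi] := eventually_set_large i0 m1 full.
exists i => //.
have [M _ hM] := eventually_set_large 0 (m2 i) hi.
exists M => m0.
have [m mm0 hm] := eventually_set_large m0 (m3 i M) hM.
exists m => // K0.
exact: (eventually_set_large K0 (mG i M m) hm).
Qed.

End nested_limits.

Section cylinder_harnack.
Context {R : realType} d (Omega : measurableType d) (P : probability Omega R).

Definition cyl_dist (j : nat) (a b : nat -> R) : R := \sum_(1 <= n < j.+1) `|a n - b n|.

Lemma cyl_dist_ge0 j a b : 0 <= cyl_dist j a b.
Proof. by apply: sumr_ge0. Qed.

Definition cyl_const (j : nat) : R := \sum_(1 <= n < j.+1) Num.sqrt 2 * nu n.

Lemma cyl_const_ge0 j : 0 <= cyl_const j.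
Proof. by apply: sumr_ge0 => n _; rewrite mulr_ge0 ?sqrtr_ge0 ?nu_ge0. Qed.

Lemma rho_half m n : (n.*2 <= m)%N -> 2^-1 <= rho m n :> R.
Proof.
move=> nm; have nm' : (n <= m.+1)%N by rewrite -addnn in nm; lia.
rewrite rhoE//; have m0 : 0 < m.+1%:R :> R by [].
have : n%:R / m.+1%:R <= 2^-1 :> R.
  rewrite ler_pdivrMr// ler_pdivlMl// -natrM ler_nat; rewrite -addnn in nm; lia.
have h := splitr (1 : R); rewrite mul1r in h; move: h; move: (n%:R / _) (2^-1) => q h1; lra.
Qed.

(** For [n <= j] and [m >= 2 j] the multiplier [rho m n] is at least 1/2, so the constant does not
    depend on [m]. *)
Lemma cyl_dist_le j m (a b : nat -> R) : (j.*2 <= m)%N ->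
  cyl_dist j a b <= cyl_const j * dist2 m (wt m) a b.
Proof.
move=> jm; rewrite /cyl_dist /cyl_const mulr_suml big_nat_cond [leRHS]big_nat_cond.
apply: ler_sum => n; rewrite andbT ltnS => /andP[n1 nj].
have n2 : (n.*2 <= m)%N by apply: leq_trans jm; rewrite leq_double.
have nm : (1 <= n <= m)%N by rewrite n1; apply: leq_trans n2; rewrite -addnn leq_addr.
apply: le_trans (coord_dist (@wt_gt0 R m) _ _ nm) _; apply: ler_wpM2r; first exact: dist2_ge0.
have n0 : 0 < nu n :> R by exact: nu_gt0.
have -> : nu n = Num.sqrt (nu n ^+ 2) :> R by rewrite sqrtr_sqr gtr0_norm.
rewrite -sqrtrM// -sqrtrV; last by rewrite ltW// wt_gt0.
apply: ler_wsqrtr; rewrite /wt invfM invrK mulrC [leRHS]mulrC.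
apply: ler_wpM2l; first exact: sqr_ge0.
rewrite -[leRHS]invrK lef_pV2 ?posrE ?invr_gt0//; first exact: rho_half.
by apply: rho_gt0; case/andP: nm.
Qed.

(** As [a >= lo], the ratio [b / a] is at most [1 + l S / lo], hence at most [exp (l S / lo)]. The
    first part supplies the Harnack inequality at time 0, the second the Lipschitz bound of the
    power. *)
Lemma powR_dist_cyl (p lo hi l S a b : R) : 1 < p -> 0 < lo -> lo <= a <= hi -> lo <= b <= hi ->
  `|a - b| <= l * S -> 0 <= l * S ->
  b `^ p <= a `^ p * expR (p * l / lo * S) /\
  `|a `^ p - b `^ p| <= hi `^ p * (p * l / lo) * S.
Proof.
move=> p1 lo0.
have p0 : 0 < p by exact: lt_trans ltr01 p1.
suff H (a' b' : R) : lo <= a' <= hi -> lo <= b' <= hi -> `|a' - b'| <= l * S -> 0 <= l * S ->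
    b' `^ p <= a' `^ p * expR (p * l / lo * S) /\
    b' `^ p - a' `^ p <= hi `^ p * (p * l / lo) * S.
  move=> ha hb ab lS; have [h1 h2] := H a b ha hb ab lS.
  have [_ h3] := H b a hb ha (eq_ind_r (fun z => z <= _) ab (distrC _ _)) lS.
  split => //; rewrite ler_norml; apply/andP; split; last exact: h3.
  by rewrite lerNl opprB.
move=> /andP[a1 a2] /andP[b1 b2] ab lS.
have a0 : 0 < a' by exact: lt_le_trans a1.
have b0 : 0 < b' by exact: lt_le_trans b1.
have h1 : b' <= a' * expR (l * S / lo).
  apply: (@le_trans _ _ (a' * (1 + l * S / lo))); last first.
    by apply: ler_wpM2l; [exact: ltW|exact: expR_ge1Dx].
  have : b' - a' <= l * S by apply: le_trans ab; rewrite distrC ler_norm.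
  have : l * S <= a' * (l * S / lo).
    by rewrite mulrCA ler_peMr// ler_pdivlMr// mul1r.
  by rewrite mulrDr mulr1; move: (l * S / lo) => q; lra.
have h2 : b' `^ p <= a' `^ p * expR (p * l / lo * S).
  apply: (@le_trans _ _ ((a' * expR (l * S / lo)) `^ p)).
    by apply: ge0_ler_powR; rewrite ?nnegrE ?mulr_ge0 ?expR_ge0// ltW.
  rewrite powRM ?expR_ge0 ?(ltW a0)// -expRM (_ : l * S / lo * p = p * l / lo * S)//.
  by ring.
split => //.
have ap : a' `^ p >= b' `^ p * (1 - p * l / lo * S).
  apply: (@le_trans _ _ (b' `^ p * expR (- (p * l / lo * S)))).
    by apply: ler_wpM2l; [exact: powR_ge0|exact: expR_ge1Dx].
  by rewrite expRN ler_pdivrMr ?expR_gt0.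
have k0 : 0 <= p * l / lo * S.
  by rewrite (_ : p * l / lo * S = p * (l * S) / lo); [apply: divr_ge0; [apply: mulr_ge0|]; try exact: ltW|ring].
have hb : b' `^ p <= hi `^ p.
  by apply: ge0_ler_powR; rewrite ?nnegrE ?(ltW p0)//; [exact: ltW|exact: le_trans (ltW b0) b2].
have := ler_wpM2r k0 hb; rewrite -!mulrA; rewrite -!mulrA in ap.
by move: (p * _) ap => q; rewrite mulrBr mulr1; move: (_ * q) (_ * q) => q1 q2; lra.
Qed.
End cylinder_harnack.

(** * Harnack inequality for the chain with the explicit rate *)

Section chain_harnack.
Context {R : realType}.
Variables (lam : R).
Hypothesis lam_pi : lam < pi ^+ 2.
Local Notation rate := ((pi ^+ 2 - lam) * pi ^+ 2).

Let pi1 : 1 <= pi ^+ 2 :> R.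
Proof.
have h : 2 <= pi :> R by exact: pi_ge2.
by rewrite -[1](expr1n _ 2) ler_pXn2r ?nnegrE//; lra.
Qed.

Lemma nu_sq n : nu n ^+ 2 = n%:R ^+ 2 * pi ^+ 2 :> R.
Proof. by rewrite /nu exprMn. Qed.

Lemma mode_rate_low n : (1 <= n)%N -> rate <= (nu n ^+ 2 - lam) * nu n ^+ 2.
Proof.
move=> n1; have h : pi ^+ 2 <= nu n ^+ 2 :> R.
  by rewrite nu_sq ler_peMl// ?sqr_ge0// expr_ge1// ler1n.
by apply: ler_pM => //; [rewrite subr_ge0 ltW|exact: sqr_ge0|exact: lerB].
Qed.

Lemma mode_rate_high (A : R) : exists j : nat, forall n, (j < n)%N ->
  A <= (nu n ^+ 2 - lam) * nu n ^+ 2.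
Proof.
exists (Num.truncn A).+1 => n jn.
have n1 : (1 <= n)%N by exact: leq_trans jn.
have An : A <= n%:R - 1.
  have := truncnS_gt A => h; apply: le_trans (ltW h) _.
  by rewrite lerBrDr natr1 ler_nat.
have n1' : 1 <= n%:R :> R by rewrite ler1n.
apply: (le_trans An); rewrite -[leLHS]mulr1; apply: ler_pM => //; first by rewrite subr_ge0.
  apply: (@le_trans _ _ (nu n ^+ 2 - pi ^+ 2)); last by rewrite lerD2l lerN2 ltW.
  rewrite nu_sq (_ : n%:R ^+ 2 * pi ^+ 2 - pi ^+ 2 = (n%:R ^+ 2 - 1) * pi ^+ 2 :> R); last by ring.
  rewrite -[leLHS]mulr1; apply: ler_pM => //; first by rewrite subr_ge0.
  by rewrite lerD2r expr2 ler_peMr// (le_trans ler01).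
rewrite nu_sq; apply: (le_trans pi1); rewrite ler_peMl// ?sqr_ge0//.
by rewrite expr_ge1// (le_trans ler01).
Qed.

Lemma rate_gt0 : 0 < rate.
Proof. by apply: mulr_gt0; [rewrite subr_gt0|exact: lt_le_trans pi1]. Qed.

(** The inequality [ln (1 + z) >= z / (1 + z)], in exponential form, raised to the power [k]; the
    hypothesis makes room for the loss [1 + r tau]. *)
Lemma exp_growth (s r tau : R) (k : nat) : 0 < r -> 0 < tau ->
  s * (1 + r * tau) <= r * (k%:R * tau) -> expR s <= (1 + r * tau) ^+ k.
Proof.
move=> r0 t0 h; have rt : 0 < r * tau by exact: mulr_gt0.
have p0 : 0 < 1 + r * tau by exact: addr_gt0.
have : expR (r * tau / (1 + r * tau)) <= 1 + r * tau.
  rewrite -[leRHS]invrK -[leLHS]invrK lef_pV2 ?posrE ?invr_gt0 ?expR_gt0// -expRN.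
  apply: le_trans (expR_ge1Dx _).
  by rewrite le_eqVlt; apply/orP; left; apply/eqP; field; rewrite gt_eqF.
move=> /(@lerXn2r _ k _ _) h2; apply: le_trans (h2 _ _); rewrite ?nnegrE ?expR_ge0// ?(ltW p0)//.
by rewrite -expRM_natl ler_expR mulrA ler_pdivlMr// mulrCA.
Qed.

Variables (c : R) (m : nat) (a : R) (c1 : `|c| < 1).
Hypothesis a01 : 0 < a < 1.
Variables (del T : R).
Hypothesis delT : del < T.
Local Notation tau K := (grid_step del T K.+1).
Local Notation stp K := (step m (fun n => Num.sqrt (tau K) * nu n) (pr m c1)
  (drift c m a lam) (tau K)).

Variables (p C0 th s : R) (j : nat).
Hypotheses (p1 : 1 < p) (C00 : 0 < C0) (th01 : 0 < th < 1) (jm : (j <= m)%N).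
Hypothesis th_rho : forall n, (1 <= n <= j)%N -> th <= rho m n.
Let cp : R := p / (2 * (p - 1)).
Hypothesis high : forall n, (j < n)%N -> rate + C0 * (th / cp) <= (nu n ^+ 2 - lam) * nu n ^+ 2.
Hypothesis s_lt : 0 < s < th * rate * (T - del).

(** The factor [th] lowers the shift strength to [q = th], below [rho m n], and the rate to
    [r = th * rate], which leaves room for the terms of order [tau^2]. It cancels in [gam / r], so
    the constant is not spoiled and only the time horizon is shortened. *)
Lemma chain_harnack (lo hi eps : R) (f g : (nat -> R) -> R) : 0 < lo ->
  good m (wt m) lo hi f -> good m (wt m) lo hi g ->
  (forall x y, f y `^ p <= g x * expR (eps + C0 * nrm2 m (wt m) (x - y))) ->
  exists K0, forall K, (K0 <= K)%N -> forall x y,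
  iter K.+1 (stp K) f y `^ p <=
    iter K.+1 (stp K) g x * expR (eps + cp * rate / (expR s - 1) * nrm2 m (wt m) (x - y)).
Proof.
move=> lo0 gf gg H0.
have [th0 th1] := andP th01; have [s0 sr] := andP s_lt.
have w0 := @wt_gt0 R m.
have [L L0 bL] := drift_lipschitz c m lam a01.
pose r := th * rate.
have r0 : 0 < r by apply: mulr_gt0 => //; exact: rate_gt0.
have p0 : 0 < p by exact: lt_trans ltr01 p1.
have cp0 : 0 < cp by rewrite /cp divr_gt0// mulr_gt0// subr_gt0.
have rr : 0 < rate - r by rewrite -[X in X - _]mul1r -mulrBl mulr_gt0 ?rate_gt0// subr_gt0.
pose KK := 2 * L + 2 * C0 ^+ 2 * (th / cp) ^+ 2.
have KK0 : 0 <= KK.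
  apply: addr_ge0; first exact: mulr_ge0.
  by apply: mulr_ge0; [apply: mulr_ge0 => //; exact: sqr_ge0|exact: sqr_ge0].
pose E := KK * (1 + (r + th / cp * C0)) + 1.
have g0 : 0 < th / cp * C0 by rewrite mulr_gt0// divr_gt0.
have E0 : 0 < E by rewrite ltr_wpDl// mulr_ge0// addr_ge0// ltW// addr_gt0.
have sdel : 0 < (r * (T - del) - s) / (s * r) by apply: divr_gt0; [rewrite subr_gt0|exact: mulr_gt0].
have [K1 hK1] := cvg_grid_step delT (ltr01 : 0 < 1 :> R).
have [K2 hK2] := cvg_grid_step delT (divr_gt0 rr E0).
have [K3 hK3] := cvg_grid_step delT sdel.
exists (maxn K1 (maxn K2 K3)) => K; rewrite !geq_max => /andP[/hK1 t1 /andP[/hK2 t2 /hK3 t3]] x y.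
have tau0 : 0 < tau K by exact: grid_step_gt0.
have growth : expR s <= (1 + r * tau K) ^+ K.+1.
  apply: exp_growth => //.
  have -> : K.+1%:R * tau K = T - del by rewrite /grid_step mulrC divfK// pnatr_eq0.
  rewrite mulrDr mulr1 mulrA -lerBrDl [_ * tau K]mulrC -ler_pdivlMr; last exact: mulr_gt0.
  exact: ltW.
have small : KK * tau K * (1 + tau K * (r + th / cp * C0)) <= rate - r.
  apply: (@le_trans _ _ (tau K * E)); last by rewrite -ler_pdivlMr// ltW.
  rewrite [KK * tau K]mulrC -[X in X <= _]mulrA; apply: ler_wpM2l; first exact: ltW.
  rewrite /E.
  have -> : KK * (1 + tau K * (r + th / cp * C0)) = KK + KK * (r + th / cp * C0) * tau K by ring.
  have -> : KK * (1 + (r + th / cp * C0)) + 1 = KK + KK * (r + th / cp * C0) + 1 by ring.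
  have e1 : 0 <= KK * (r + th / cp * C0) by apply: mulr_ge0 => //; rewrite ltW// addr_gt0.
  have := ler_wpM2l e1 (ltW t1); rewrite mulr1; move: (_ * tau K) => q1; lra.
have sw n : (1 <= n <= j)%N -> th * tau K <= wt m n * (Num.sqrt (tau K) * nu n) ^+ 2.
  move=> nj; have n0 : nu n != 0 :> R by rewrite gt_eqF// nu_gt0//; case/andP: nj.
  rewrite exprMn sqr_sqrtr ?(ltW tau0)// (_ : wt m n * _ = rho m n * tau K).
    by rewrite ler_pM2r// th_rho.
  by rewrite /wt; field.
have s0' n : (1 <= n)%N -> 0 < Num.sqrt (tau K) * nu n.
  by move=> n1; rewrite mulr_gt0 ?sqrtr_gt0 ?nu_gt0.
have bD X Y : 2 * ip m (wt m) (drift c m a lam X - drift c m a lam Y) (X - Y) <=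
    - \sum_(1 <= n < m.+1) wt m n * ((nu n ^+ 2 - lam) * nu n ^+ 2) * (X n - Y n) ^+ 2.
  apply: le_trans (drift_dissipative c m lam a01 X Y) _; rewrite lerN2 le_eqVlt.
  apply/orP; left; apply/eqP; apply: eq_big_nat => n /andP[n1 _].
  have n0 : nu n != 0 :> R by rewrite gt_eqF// nu_gt0.
  by rewrite /wt; field.
have low n : (1 <= n <= m)%N -> rate <= (nu n ^+ 2 - lam) * nu n ^+ 2.
  by case/andP => n1 _; exact: mode_rate_low.
have high' n : (j < n <= m)%N -> rate + C0 * (th / cp) <= (nu n ^+ 2 - lam) * nu n ^+ 2.
  by case/andP => n1 _; exact: high.
have step_h := step_harnack w0 s0' p1 (@pr_nonexp _ c m c1) L0 bL bD tau0 th0 sw jm r0 C00 low high' small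
  K.+1 x y lo0 gf gg H0.
have inv_low : th / cp * (((1 + r * tau K) ^+ K.+1 - 1) / r) <= inv_rate p (tau K) r C0 th K.+1.
  exact: inv_rate_low.
have gs k : good m (wt m) lo hi (iter k (stp K) g).
  by elim: k => //= k IH; exact: (step_good _ w0 (tau K) (@pr_nonexp _ c m c1) L0 bL lo0 IH).
apply: (le_trans step_h); apply: ler_wpM2l.
  by have [/(_ x)/andP[h _] _] := gs K.+1; apply: le_trans (ltW lo0) h.
rewrite ler_expR lerD2l; apply: ler_wpM2r; first exact: nrm2_ge0.
have es : 0 < expR s - 1 by rewrite subr_gt0 expR_gt1.
have low0 : 0 < th / cp * ((expR s - 1) / r) by rewrite mulr_gt0// divr_gt0.
rewrite (_ : cp * rate / (expR s - 1) = (th / cp * ((expR s - 1) / r))^-1).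
  have h : th / cp * ((expR s - 1) / r) <= inv_rate p (tau K) r C0 th K.+1.
    apply: le_trans inv_low; apply: ler_wpM2l; first exact: ltW (divr_gt0 th0 cp0).
    by apply: ler_wpM2r; [rewrite invr_ge0 ltW|exact: lerB].
  by rewrite lef_pV2 ?posrE//; exact: lt_le_trans low0 h.
have rn : rate != 0 by rewrite gt_eqF// rate_gt0.
have cpn : cp != 0 by rewrite gt_eqF.
have esn : expR s - 1 != 0 by rewrite gt_eqF.
have thn : th != 0 by rewrite gt_eqF.
rewrite /r; move: (rate) (cp) (expR s - 1) rn cpn esn => A1 A2 A3 h1 h2 h3.
by field; rewrite h1 h2 h3 thn.
Qed.

End chain_harnack.

Section expectations.
Context {R : realType} d (Omega : measurableType d) (P : probability Omega R).

Lemma Rintegral_close (A B : Omega -> R) (G : set Omega) (lo hi e zeta : R) :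
  measurable_fun setT A -> measurable_fun setT B -> measurable G ->
  0 <= lo -> 0 <= hi -> (forall o, lo <= A o <= hi) -> (forall o, lo <= B o <= hi) ->
  0 <= e -> (forall o, G o -> `|A o - B o| <= e) -> ((1 - zeta)%:E < P G)%E ->
  `|\int[P]_o A o - \int[P]_o B o| <= e + hi * zeta.
Proof.
move=> mA mB mG lo0 hi0 bA bB e0 AB PG.
have nb (X : Omega -> R) : (forall o, lo <= X o <= hi) -> forall o, `|X o| <= hi.
  by move=> bX o; case/andP: (bX o) => h1 h2; rewrite ger0_norm// (le_trans lo0).
have iA := bounded_integrableP P mA (nb _ bA).
have iB := bounded_integrableP P mB (nb _ bB).
have mAB : measurable_fun setT (fun o => A o - B o) by exact: measurable_funB.
have bAB o : `|A o - B o| <= hi.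
  by case/andP: (bA o) => a1 a2; case/andP: (bB o) => b1 b2; rewrite ler_norml; lra.
have iAB := bounded_integrableP P mAB bAB.
rewrite -(RintegralB measurableT iA iB).
apply: le_trans (le_normr_Rintegral measurableT iAB) _.
have mi : measurable_fun setT (fun o => e + hi * \1_(~` G) o : R).
  apply: measurable_funD; first exact: measurable_cst.
  by apply: measurable_funM; [exact: measurable_cst|apply: measurable_indic; exact: measurableC].
have mN : measurable_fun setT (fun o => `|A o - B o|) by exact: measurableT_comp.
have iN : P.-integrable setT (EFin \o (fun o => `|A o - B o|)).
  by apply: (bounded_integrableP (M := hi) P mN) => o; rewrite normr_id.
have mI : measurable_fun setT (\1_(~` G) : Omega -> R).
  by apply: measurable_indic; exact: measurableC.
have iI : P.-integrable setT (EFin \o (\1_(~` G) : Omega -> R)).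
  by apply: (bounded_integrableP (M := 1) P mI) => o; rewrite indicE ger0_norm ?lern1 ?leq_b1.
have iC : P.-integrable setT (EFin \o (fun _ : Omega => e)).
  by apply: (bounded_integrableP (M := e) P); [exact: measurable_cst|move=> o; rewrite ger0_norm].
have iH := integrableRZl hi measurableT iI.
have iE : P.-integrable setT (EFin \o (fun o => e + hi * \1_(~` G) o)).
  by have := integrableD measurableT iC iH; apply: eq_integrable.
apply: (@le_trans _ _ (\int[P]_o (e + hi * \1_(~` G) o))).
  apply: le_Rintegral => // o _; rewrite indicE in_setC.
  case: (boolP (o \in G)) => oG; rewrite ?mulr0 ?addr0 ?mulr1.
    by apply: AB; move: oG; rewrite inE.
  by apply: le_trans (bAB o) _; rewrite lerDr.
rewrite (RintegralD measurableT iC iH) (Rintegral_cst _ measurableT).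
rewrite -[X in fine X]/(P setT) probability_setT mulr1 lerD2l.
rewrite (RintegralZl _ measurableT iI) (Rintegral_indic P (measurableC mG)).
apply: ler_wpM2l => //; rewrite (probability_setC P mG).
move: PG; rewrite -(fineK (P_fin P mG)) lte_fin -EFinB /=; lra.
Qed.

End expectations.
Section expectation_bounds.
Context {R : realType} d (Omega : measurableType d) (P : probability Omega R).

Lemma Rintegral_between (A : Omega -> R) (lo hi : R) : measurable_fun setT A ->
  0 <= lo -> (forall o, lo <= A o <= hi) -> lo <= \int[P]_o A o <= hi.
Proof.
move=> mA lo0 bA.
have ic (k : R) : P.-integrable setT (EFin \o (fun _ : Omega => k)).
  by apply: (bounded_integrableP (M := `|k|) P); [exact: measurable_cst|move=> o].
have iA : P.-integrable setT (EFin \o A).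
  apply: (bounded_integrableP (M := hi) P mA) => o; have /andP[h1 h2] := bA o.
  by rewrite ger0_norm// (le_trans lo0).
have cst (k : R) : \int[P]_o k = k.
  by rewrite (Rintegral_cst _ measurableT) -[X in fine X]/(P setT) probability_setT mulr1.
rewrite -[X in X <= _ <= _]cst -[X in _ <= _ <= X]cst.
by apply/andP; split; apply: le_Rintegral => // o _; case/andP: (bA o).
Qed.

End expectation_bounds.
Section arithmetic.
Context {R : realType}.

(** Turns the linear exponent of a Lipschitz function at time 0 into a quadratic one, which is the
    form that the steps propagate; the added 1 keeps the coefficient positive when [A = 0]. *)
Lemma young_linear (A D e : R) : 0 < e -> A * D <= e + (A ^+ 2 / (4 * e) + 1) * D ^+ 2.
Proof.
move=> e0; have h : 0 <= (A * D - 2 * e) ^+ 2 / (4 * e).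
  by apply: divr_ge0; [exact: sqr_ge0|rewrite mulr_ge0// ltW].
have -> : (A ^+ 2 / (4 * e) + 1) * D ^+ 2 =
    (A * D - 2 * e) ^+ 2 / (4 * e) + A * D - e + D ^+ 2 by field; rewrite gt_eqF.
have := sqr_ge0 D; lra.
Qed.

Lemma rho_near1 (th : R) j : th < 1 -> exists m0, forall m, (m0 <= m)%N ->
  forall n, (1 <= n <= j)%N -> th <= rho m n.
Proof.
move=> th1; have h : 0 < 1 - th by rewrite subr_gt0.
exists (maxn j (Num.truncn (j%:R / (1 - th)))) => m; rewrite geq_max => /andP[jm tm] n /andP[_ nj].
rewrite rhoE; last by rewrite (leq_trans nj)// (leq_trans jm).
rewrite lerBrDl -lerBrDr ler_pdivrMr ?ltr0n//.
have : j%:R / (1 - th) <= m.+1%:R.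
  by apply: le_trans (ltW (truncnS_gt _)) _; rewrite ler_nat.
rewrite ler_pdivrMr// mulrC; apply: le_trans.
by rewrite ler_nat.
Qed.

(** With [q = s / (rate t) < 1], the midpoint [th] of [q] and 1 satisfies [th^2 > q]; one factor
    [th] is spent on the rate, the other on the shortened time [t - del > th t]. *)
Lemma rate_margin (rate s t del : R) : 0 < t -> 0 < rate -> 0 < s < rate * t ->
  let th := (1 + s / (rate * t)) / 2 in
  0 < th < 1 /\ (del < (1 - th) * t -> s < th * rate * (t - del)).
Proof.
move=> t0 r0 /andP[s0 st]; have rt : 0 < rate * t by exact: mulr_gt0.
set q := s / (rate * t) => th.
have q0 : 0 < q by exact: divr_gt0.
have q1 : q < 1 by rewrite /q ltr_pdivrMr// mul1r.
have sE : s = q * (rate * t) by rewrite /q divfK// gt_eqF.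
have th0 : 0 < th by rewrite /th; lra.
have th1 : th < 1 by rewrite /th; lra.
split=> [|h]; first by rewrite th0.
have h1 : th * t < t - del by move: h; rewrite mulrBl mul1r; lra.
apply: (@lt_trans _ _ (th * rate * (th * t))); last by rewrite ltr_pM2l// mulr_gt0.
have -> : th * rate * (th * t) = th ^+ 2 * (rate * t) by ring.
rewrite sE ltr_pM2r//.
have -> : th ^+ 2 = q + ((1 - q) / 2) ^+ 2 by rewrite /th; field.
by rewrite ltrDl exprn_gt0// divr_gt0// subr_gt0.
Qed.

(** As [b] and [A] are bounded below, an additive error [eta] is at most a factor [exp (eta / lo)]
    or [exp (eta / lo^p)], which joins the exponent. *)
Lemma absorb_errors (p lo eta e Q a b A B : R) : 1 < p -> 0 < lo -> 0 <= eta -> 0 <= a ->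
  lo <= b -> lo `^ p <= A -> a <= b + eta -> B <= A + eta -> b `^ p <= B * expR (e + Q) ->
  a `^ p <= A * expR (eta * (p / lo + 1 / lo `^ p) + e + Q).
Proof.
move=> p1 lo0 eta0 a0 lob loA ab BA bB.
have p0 : 0 < p by exact: lt_trans ltr01 p1.
have b0 : 0 < b by exact: lt_le_trans lob.
have lp0 : 0 < lo `^ p by exact: powR_gt0.
have A0 : 0 < A by exact: lt_le_trans loA.
have grow x y : 0 < x -> x <= y -> y + eta <= y * expR (eta / x).
  move=> x0 xy; apply: (@le_trans _ _ (y * (1 + eta / x))); last first.
    by apply: ler_wpM2l; [exact: le_trans (ltW x0) xy|exact: expR_ge1Dx].
  by rewrite mulrDr mulr1 lerD2l mulrA ler_pdivlMr// mulrC ler_wpM2r.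
have h1 : a `^ p <= b `^ p * expR (eta / lo * p).
  rewrite expRM -powRM ?expR_ge0 ?(ltW b0)//.
  apply: ge0_ler_powR; rewrite ?nnegrE ?(ltW p0)//.
    by rewrite mulr_ge0 ?expR_ge0// ltW.
  exact: le_trans ab (grow _ _ lo0 lob).
have h2 := le_trans BA (grow _ _ lp0 loA).
apply: (le_trans h1).
apply: (@le_trans _ _ (A * expR (eta / lo `^ p) * expR (e + Q) * expR (eta / lo * p))).
  apply: ler_wpM2r; first exact: expR_ge0.
  by apply: (le_trans bB); apply: ler_wpM2r; first exact: expR_ge0.
rewrite -!mulrA -!expRD le_eqVlt; apply/orP; left; apply/eqP; congr (_ * expR _).
by rewrite div1r; ring.
Qed.

End arithmetic.

(** * Passage from the chain to the solution *)

Section cylinder_harnack.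
Context {R : realType} d (Omega : measurableType d) (P : probability Omega R).
Variables (F : R -> set (set Omega)) (W : (R -> R) -> R -> Omega -> R).
Hypotheses (hF : filtration F) (hW : cylindrical_wiener P F W).
Variables (c lam t : R) (c1 : `|c| < 1).
Hypotheses (lam_pi : lam < pi ^+ 2) (t0 : 0 < t).
Local Notation rate := ((pi ^+ 2 - lam) * pi ^+ 2).
Variables (ax ay : nat -> R) (U V : Omega -> nat -> R).
Hypotheses (mU : coord_measurable U) (mV : coord_measurable V).

Definition limit_of_approx (a : nat -> R) (X : Omega -> nat -> R) :=
  {ae P, forall o, forall zeta, 0 < zeta -> exists i0, forall i, (i0 <= i)%N ->
  exists M0, forall M, (M0 <= M)%N -> exists m0, forall m, (m0 <= m)%N ->
  exists K0, forall K, (K0 <= K)%N ->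
    nrm2 m (wt m) (X o - approx W lam t c1 a i M m K o) <= zeta}.

Hypotheses (hU : limit_of_approx ax U) (hV : limit_of_approx ay V).

Let near_event zeta i M m K : set Omega :=
  [set o | nrm2 m (wt m) (U o - approx W lam t c1 ax i M m K o) <= zeta /\
           nrm2 m (wt m) (V o - approx W lam t c1 ay i M m K o) <= zeta].

Let approx_measurable a i M m K : coord_measurable (approx W lam t c1 a i M m K).
Proof.
by move=> n; exact: (chain_measurable hF hW m lam c1 (a_seq01 M) (ltW (del_seq_gt0 t0 i))
  (del_seq_lt t0 i) (ltn0Sn K) a).
Qed.

Lemma nrm2_measurable m (X Y : Omega -> nat -> R) : coord_measurable X -> coord_measurable Y ->
  measurable_fun setT (fun o => nrm2 m (wt m) (X o - Y o)).
Proof.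
move=> mX mY; rewrite /nrm2 /ip.
under eq_fun do rewrite -[\sum_(1 <= n < m.+1) _]/(\sum_(1 <= n < m.+1) _).
apply: measurable_sum => n.
have h : measurable_fun setT (fun o => (X o - Y o) n) by exact: measurable_funB.
by apply: measurable_funM => //; apply: measurable_funM.
Qed.

Let near_measurable zeta i M m K : measurable (near_event zeta i M m K).
Proof.
have h a X : coord_measurable X ->
    measurable [set o | nrm2 m (wt m) (X o - approx W lam t c1 a i M m K o) <= zeta].
  move=> mX; have := nrm2_measurable m mX (@approx_measurable a i M m K).
  move=> /(_ measurableT _ (measurable_itv `]-oo, zeta])); rewrite setTI.
  by congr (measurable _); apply/seteqP; split => o /=; rewrite in_itv.
by apply: measurableI; [exact: h mU|exact: h mV].
Qed.

Let near_likely zeta zeta0 : 0 < zeta -> 0 < zeta0 ->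
  forall i0, exists2 i, (i0 <= i)%N & exists M, forall m0, exists2 m, (m0 <= m)%N &
    forall K0, exists2 K, (K0 <= K)%N & ((1 - zeta0)%:E < P (near_event zeta i M m K))%E.
Proof.
move=> z0 z1; apply: (nested_event (G := near_event zeta)).
- exact: near_measurable.
- by rewrite gtrBl.
- apply: (@filterS2 _ _ _ _ _ _ _ hU hV) => o /(_ _ z0)[i1 h1] /(_ _ z0)[i2 h2].
  exists (maxn i1 i2) => i; rewrite geq_max => /andP[/h1[M1 g1] /h2[M2 g2]].
  exists (maxn M1 M2) => M; rewrite geq_max => /andP[/g1[k1 f1] /g2[k2 f2]].
  exists (maxn k1 k2) => m; rewrite geq_max => /andP[/f1[K1 e1] /f2[K2 e2]].
  by exists (maxn K1 K2) => K; rewrite geq_max => /andP[/e1 ? /e2 ?].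
Qed.

Variables (p l lo hi d2 : R) (phi : (nat -> R) -> R) (j0 : nat).
Hypotheses (p1 : 1 < p) (lo0 : 0 < lo) (l0 : 0 <= l).
Hypothesis phi_bd : forall a, lo <= phi a <= hi.
Hypothesis phi_lip : forall a b, `|phi a - phi b| <= l * cyl_dist j0 a b.
Hypothesis d2_bd : forall m, nrm2 m (wt m) (ax - ay) <= d2.
Let cp : R := p / (2 * (p - 1)).

Let p0 : 0 < p. Proof. exact: lt_trans ltr01 p1. Qed.
Let hi0 : 0 < hi.
Proof. by have /andP[h1 h2] := phi_bd (fun=> 0); exact: lt_le_trans lo0 (le_trans h1 h2). Qed.
Let q := fun a => phi a `^ p.
Let lq := hi `^ p * (p * l / lo).
Let lq0 : 0 <= lq.
Proof. by apply: mulr_ge0; [exact: powR_ge0|apply: divr_ge0; [apply: mulr_ge0|]; try exact: ltW]. Qed.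

Let q_harnack a b : q b <= q a * expR (p * l / lo * cyl_dist j0 a b).
Proof.
by have [] := powR_dist_cyl p1 lo0 (phi_bd a) (phi_bd b) (phi_lip a b)
  (mulr_ge0 l0 (cyl_dist_ge0 _ _ _)).
Qed.

Let q_lip a b : `|q a - q b| <= lq * cyl_dist j0 a b.
Proof.
by have [] := powR_dist_cyl p1 lo0 (phi_bd a) (phi_bd b) (phi_lip a b)
  (mulr_ge0 l0 (cyl_dist_ge0 _ _ _)).
Qed.

Let q_bd a : lo `^ p <= q a <= hi `^ p.
Proof.
have /andP[h1 h2] := phi_bd a.
by apply/andP; split; apply: ge0_ler_powR; rewrite ?nnegrE ?(ltW p0) ?(ltW lo0) ?(ltW hi0)//;
  apply: le_trans h1; exact: ltW.
Qed.

Let cyl_good m (f : (nat -> R) -> R) (L lo' hi' lo1 hi1 : R) : (j0.*2 <= m)%N -> 0 <= L ->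
  lo1 <= lo' -> hi' <= hi1 -> (forall a, lo' <= f a <= hi') ->
  (forall a b, `|f a - f b| <= L * cyl_dist j0 a b) -> good m (wt m) lo1 hi1 f.
Proof.
move=> jm L0 h1 h2 fb fL; split.
  by move=> a; have /andP[g1 g2] := fb a; rewrite (le_trans h1 g1) (le_trans g2 h2).
exists (L * cyl_const j0); first by rewrite mulr_ge0// cyl_const_ge0.
move=> a b; apply: le_trans (fL a b) _; rewrite -mulrA ler_wpM2l//.
exact: cyl_dist_le.
Qed.

(** Closeness on [G] gives one half of [eta] through the Lipschitz bound, the small complement of
    [G] the other half. [Cm] and [Hm] are bounds common to [phi] and its power, so that one event
    serves for both. *)
Let test_close (f : (nat -> R) -> R) (L lo' hi' eta : R) (Cm Hm : R) a (X : Omega -> nat -> R)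
    (G : set Omega) i M m K :
  0 <= L -> 0 <= lo' -> 0 <= hi' -> (forall a, lo' <= f a <= hi') ->
  (forall a b, `|f a - f b| <= L * cyl_dist j0 a b) ->
  (j0.*2 <= m)%N -> coord_measurable X ->
  0 < eta -> L * cyl_const j0 <= Cm -> hi' <= Hm -> 0 < Hm -> measurable G ->
  (forall o, G o -> nrm2 m (wt m) (X o - approx W lam t c1 a i M m K o) <=
    (eta / (2 * (Cm + 1))) ^+ 2) ->
  ((1 - eta / (2 * Hm))%:E < P G)%E ->
  `|\int[P]_o f (X o) - \int[P]_o f (approx W lam t c1 a i M m K o)| <= eta.
Proof.
move=> L0 lo'0 hi'0 fb fL jm mX eta0 LC hH H0 mG hG PG.
have w0 := @wt_gt0 R m.
have L1 : 0 <= L * cyl_const j0 by rewrite mulr_ge0// cyl_const_ge0.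
have Cm0 : 0 < Cm + 1 by rewrite ltr_wpDl// (le_trans L1).
have fL2 a' b' : `|f a' - f b'| <= L * cyl_const j0 * dist2 m (wt m) a' b'.
  by apply: le_trans (fL a' b') _; rewrite -mulrA ler_wpM2l//; exact: cyl_dist_le.
have z0 : 0 < eta / (2 * (Cm + 1)) by rewrite divr_gt0// mulr_gt0.
have mf1 : measurable_fun setT (fun o => f (X o)) := lip_comp_measurable w0 L1 fL2 mX.
have mf2 : measurable_fun setT (fun o => f (approx W lam t c1 a i M m K o)) :=
  lip_comp_measurable w0 L1 fL2 (@approx_measurable a i M m K).
have e0 : 0 <= eta / 2 by rewrite divr_ge0// ltW.
apply: le_trans (Rintegral_close mf1 mf2 mG lo'0 hi'0 (fun o => fb _) (fun o => fb _) e0 _ PG) _.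
  move=> o Go; apply: le_trans (fL2 _ _) _.
  have : dist2 m (wt m) (X o) (approx W lam t c1 a i M m K o) <= eta / (2 * (Cm + 1)).
    by rewrite /dist2 -[leRHS]ger0_norm ?(ltW z0)// -sqrtr_sqr ler_wsqrtr// hG.
  move=> h; apply: (@le_trans _ _ ((Cm + 1) * (eta / (2 * (Cm + 1))))).
    apply: ler_pM => //; first exact: dist2_ge0.
    by apply: (le_trans LC); rewrite lerDl.
  by rewrite le_eqVlt; apply/orP; left; apply/eqP; field; rewrite gt_eqF.
rewrite [leRHS]splitr lerD2l; apply: (@le_trans _ _ (Hm * (eta / (2 * Hm)))).
  by apply: ler_wpM2r hH; rewrite divr_ge0 ?(ltW eta0)// mulr_ge0// ltW.
by rewrite le_eqVlt; apply/orP; left; apply/eqP; field; rewrite gt_eqF.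
Qed.

Lemma cylinder_harnack (eps s : R) : 0 < eps -> 0 < s < rate * t ->
  (\int[P]_o phi (V o)) `^ p <=
    \int[P]_o (phi (U o) `^ p) * expR (eps + cp * rate / (expR s - 1) * d2).
Proof.
move=> eps0 srt.
have r0 : 0 < rate by exact: rate_gt0.
have cp0 : 0 < cp by rewrite /cp divr_gt0// mulr_gt0// subr_gt0.
have lp0 : 0 < lo `^ p by exact: powR_gt0.
have [th01 _] := rate_margin 0 t0 r0 srt.
have marg del := (rate_margin del t0 r0 srt).2.
set th := _ / 2 in th01 marg; have [th0 th1] := andP th01.
pose eta := eps / 2 / (p / lo + 1 / lo `^ p).
have den0 : 0 < p / lo + 1 / lo `^ p by rewrite addr_gt0// divr_gt0.
have eta0 : 0 < eta by rewrite divr_gt0// divr_gt0.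
pose Cm := (l + lq) * cyl_const j0; pose Hm := hi + hi `^ p.
have Cm0 : 0 <= Cm by rewrite mulr_ge0 ?addr_ge0// cyl_const_ge0.
have hp0 : 0 < hi `^ p by exact: powR_gt0.
have Hm0 : 0 < Hm by exact: addr_gt0.
have z0 : 0 < (eta / (2 * (Cm + 1))) ^+ 2.
  by rewrite exprn_gt0// divr_gt0// mulr_gt0// ltr_wpDl.
have z1 : 0 < eta / (2 * Hm) by rewrite divr_gt0// mulr_gt0.
(* [C0] must not depend on [m]: the number [j] of shifted modes is chosen from [C0], and [m] only
   afterwards. *)
pose A := p * l / lo * cyl_const j0; pose C0 := A ^+ 2 / (4 * (eps / 2)) + 1.
have C00 : 0 < C0.
  by rewrite ltr_wpDl// divr_ge0 ?sqr_ge0// mulr_ge0// divr_ge0// ltW.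
have [j high] := mode_rate_high lam_pi (rate + C0 * (th / cp)).
have del0 : 0 < (1 - th) * t by rewrite mulr_gt0// subr_gt0.
have [i0 hi0'] := del_seq_small t del0.
have [i ii [M hM]] := near_likely z0 z1 i0.
have [m1 hm1] := rho_near1 j th1.
have [m mm hm] := hM (maxn j (maxn m1 j0.*2)).
move: mm; rewrite !geq_max => /andP[jm /andP[m1m j0m]].
have s_lt : 0 < s < th * rate * (t - del_seq t i).
  by case/andP: srt => -> _ /=; apply: marg; exact: hi0'.
pose lo1 := Num.min lo (lo `^ p); pose hi1 := Num.max hi (hi `^ p).
have lo10 : 0 < lo1 by rewrite lt_min lo0.
have gphi : good m (wt m) lo1 hi1 phi.
  by apply: (cyl_good j0m l0 _ _ phi_bd phi_lip); rewrite ?ge_min ?le_max lexx.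
have gq : good m (wt m) lo1 hi1 q.
  by apply: (cyl_good j0m lq0 _ _ q_bd q_lip); rewrite ?ge_min ?le_max lexx orbT.
have H0 a b : phi b `^ p <= q a * expR (eps / 2 + C0 * nrm2 m (wt m) (a - b)).
  apply: le_trans (q_harnack a b) _; apply: ler_wpM2l; first exact: powR_ge0.
  rewrite ler_expR; apply: (@le_trans _ _ (A * dist2 m (wt m) a b)).
    rewrite /A -[leRHS]mulrA; apply: ler_wpM2l; last exact: cyl_dist_le.
    by apply: divr_ge0; [apply: mulr_ge0|]; try exact: ltW.
  have e2 : 0 < eps / 2 by rewrite divr_gt0.
  apply: le_trans (young_linear _ _ e2) _.
  by rewrite /dist2 sqr_sqrtr//; apply: nrm2_ge0; exact: (@wt_gt0 R m).
have [K0 hK0] := chain_harnack lam_pi c1 (a_seq01 M) (del_seq_lt t0 i) p1 C00 th01 jm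
  (hm1 m m1m) high s_lt lo10 gphi gq H0.
have [K KK PG] := hm K0.
have hK := hK0 K KK ax ay.
rewrite -(chain_expectation hF hW lam c1 (a_seq01 M) (ltW (del_seq_gt0 t0 i)) (del_seq_lt t0 i)
  (ltn0Sn K) ay K.+1 lo10 gphi) in hK.
rewrite -(chain_expectation hF hW lam c1 (a_seq01 M) (ltW (del_seq_gt0 t0 i)) (del_seq_lt t0 i)
  (ltn0Sn K) ax K.+1 lo10 gq) in hK.
have mG := near_measurable ((eta / (2 * (Cm + 1))) ^+ 2) i M m K.
have closeV : `|\int[P]_o phi (V o) - \int[P]_o phi (approx W lam t c1 ay i M m K o)| <= eta.
  apply: (test_close (Cm := Cm) (Hm := Hm) l0 (ltW lo0) (ltW hi0) phi_bd phi_lip j0m mV eta0 _ _ Hm0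
    mG (fun o Go => proj2 Go) PG).
    by apply: ler_wpM2r; [exact: cyl_const_ge0|rewrite lerDl].
  by rewrite lerDl ltW.
have closeU : `|\int[P]_o q (U o) - \int[P]_o q (approx W lam t c1 ax i M m K o)| <= eta.
  apply: (test_close (Cm := Cm) (Hm := Hm) lq0 (ltW lp0) (ltW hp0) q_bd q_lip j0m mU eta0 _ _ Hm0
    mG (fun o Go => proj1 Go) PG).
    by apply: ler_wpM2r; [exact: cyl_const_ge0|rewrite lerDr].
  by rewrite lerDr ltW.
have mf (f : (nat -> R) -> R) (L lo' hi' : R) (X : Omega -> nat -> R) : 0 <= L -> (forall a, lo' <= f a <= hi') ->
    (forall a b, `|f a - f b| <= L * cyl_dist j0 a b) -> coord_measurable X ->
    measurable_fun setT (fun o : Omega => f (X o)).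
  move=> L0 fb fL; apply: (good_comp_measurable (@wt_gt0 R m) (cyl_good j0m L0 _ _ fb fL)).
    exact: lexx.
  exact: lexx.
have YM := @approx_measurable ay i M m K.
have vV := Rintegral_between P (mf _ _ _ _ _ l0 phi_bd phi_lip mV) (ltW lo0) (fun o => phi_bd (V o)).
have vY := Rintegral_between P (mf _ _ _ _ _ l0 phi_bd phi_lip YM) (ltW lo0) (fun o => phi_bd _).
have vU := Rintegral_between P (mf _ _ _ _ _ lq0 q_bd q_lip mU) (ltW lp0) (fun o => q_bd (U o)).
have -> : eps + cp * rate / (expR s - 1) * d2 =
    eta * (p / lo + 1 / lo `^ p) + eps / 2 + cp * rate / (expR s - 1) * d2.
  by rewrite /eta divfK ?gt_eqF// -splitr.
case/andP: vV => vV _; case/andP: vY => vY _; case/andP: vU => vU _.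
move: closeU closeV; rewrite !ler_norml => /andP[cU _] /andP[_ cV].
apply: (absorb_errors p1 lo0 (ltW eta0) (le_trans (ltW lo0) vV) vY vU).
- by rewrite -lerBlDl; move: cV; rewrite lerBlDl [X in _ <= X]addrC -lerBlDl.
- by move: cU; rewrite lerBrDr addrC lerBlDr; apply.
apply: (le_trans hK); apply: ler_wpM2l.
  have XM := @approx_measurable ax i M m K.
  have := Rintegral_between P (mf _ _ _ _ _ lq0 q_bd q_lip XM) (ltW lp0) (fun o => q_bd _).
  by case/andP => h _; apply: le_trans (ltW lp0) h.
rewrite ler_expR lerD2l; apply: ler_wpM2l => //.
case/andP: srt => s0 _; apply: divr_ge0; first by apply: mulr_ge0; exact: ltW.
by rewrite subr_ge0 ltW// expR_gt1.
Qed.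

End cylinder_harnack.

(** * From cylinder functions to Borel functions *)

Section negative_norm.
Context {R : realType}.
Implicit Types (a b x y : nat -> R) (c : R).

Definition psum b k : R := \sum_(1 <= n < k) (nu n ^+ 2)^-1 * b n ^+ 2.

Let w0 n : 0 <= (nu n ^+ 2)^-1 :> R. Proof. by rewrite invr_ge0 sqr_ge0. Qed.
Let t0 b n : 0 <= (nu n ^+ 2)^-1 * b n ^+ 2. Proof. by rewrite mulr_ge0// sqr_ge0. Qed.

Lemma psum_ge0 b k : 0 <= psum b k. Proof. by apply: sumr_ge0 => n _. Qed.

Lemma psum_mono b k l : (k <= l)%N -> psum b k <= psum b l.
Proof.
move=> kl; elim: l kl => [|l IH]; first by rewrite leqn0 => /eqP ->.
rewrite leq_eqVlt ltnS => /orP[/eqP ->//|/IH h]; apply: le_trans h _.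
rewrite /psum; case: l {IH} => [|l]; first by rewrite !big_geq.
by rewrite [leRHS]big_nat_recr//= lerDl.
Qed.

Lemma hsum_cvg b : ((psum b k)%:E @[k --> \oo] --> hsum b)%E.
Proof.
rewrite /hsum /psum; under eq_cvg do rewrite -sumEFin.
apply: is_cvg_nneseries => n _ _; by rewrite lee_fin.
Qed.

Lemma hsum_le b (B : R) : (forall k, psum b k <= B) -> (hsum b <= B%:E)%E.
Proof.
move=> h; rewrite -(cvg_lim _ (@hsum_cvg b))//.
by apply: lime_le; [exact: cvgP (@hsum_cvg b)|apply: nearW => k; rewrite lee_fin].
Qed.

Lemma psum_le_hsum b k : ((psum b k)%:E <= hsum b)%E. Proof. exact: hsum_partial. Qed.

(** Expanding [\sum nu^-2 (B x - A y)^2 >= 0] bounds the cross term by [A B]. *)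
Lemma psum_minkowski x y k (A B : R) : 0 < A -> 0 < B -> psum x k <= A ^+ 2 ->
  psum y k <= B ^+ 2 -> psum (x + y) k <= (A + B) ^+ 2.
Proof.
move=> A0 B0 hx hy; have AB : 0 < A * B by exact: mulr_gt0.
pose I := \sum_(1 <= n < k) (nu n ^+ 2)^-1 * (x n * y n) : R.
have e1 : psum (x + y) k = psum x k + 2 * I + psum y k.
  rewrite /psum /I mulr_sumr -!big_split/=; apply: eq_bigr => n _.
  by rewrite !fctE; ring.
have e2 : 0 <= B ^+ 2 * psum x k - 2 * (A * B) * I + A ^+ 2 * psum y k.
  have <- : \sum_(1 <= n < k) (nu n ^+ 2)^-1 * (B * x n - A * y n) ^+ 2 =
      B ^+ 2 * psum x k - 2 * (A * B) * I + A ^+ 2 * psum y k.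
    rewrite /psum /I !mulr_sumr -sumrB -big_split/=; apply: eq_bigr => n _; ring.
  by apply: sumr_ge0 => n _; rewrite mulr_ge0// sqr_ge0.
have h1 := ler_wpM2l (sqr_ge0 B) hx; have h2 := ler_wpM2l (sqr_ge0 A) hy.
have h3 : 2 * (A * B) * I <= 2 * (A * B) * (A * B).
  have -> : 2 * (A * B) * (A * B) = B ^+ 2 * A ^+ 2 + A ^+ 2 * B ^+ 2 by ring.
  move: (A ^+ 2 * B ^+ 2) (B ^+ 2 * A ^+ 2) (2 * (A * B) * I) (B ^+ 2 * psum x k)
    (A ^+ 2 * psum y k) h1 h2 e2 => q1 q2 q3 q4 q5; lra.
have I1 : I <= A * B by rewrite -(ler_pM2l (_ : 0 < 2 * (A * B)))// mulr_gt0.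
rewrite e1 sqrrD -mulr_natl; lra.
Qed.

Lemma hsum_lty x y : (hsum x < +oo)%E -> (hsum y < +oo)%E -> (hsum (x + y)%R < +oo)%E.
Proof.
have up z : (hsum z < +oo)%E -> exists2 A : R, 0 < A & forall k, psum z k <= A ^+ 2.
  move=> zoo; have f : hsum z \is a fin_num by rewrite ge0_fin_numE ?hsum_ge0.
  have h0 : 0 <= fine (hsum z) by rewrite fine_ge0 ?hsum_ge0.
  exists (fine (hsum z) + 1) => [|k]; first by rewrite ltr_wpDl.
  have : psum z k <= fine (hsum z) by rewrite -lee_fin fineK// psum_le_hsum.
  move=> h; apply: le_trans h _; rewrite sqrrD1; have := sqr_ge0 (fine (hsum z)).
  by move: (fine _) h0 => q; rewrite -mulr_natl; lra.
move=> /up[A A0 hA] /up[B B0 hB].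
apply: le_lt_trans (hsum_le (B := (A + B) ^+ 2) _) (ltry _) => k.
exact: psum_minkowski.
Qed.

Lemma hsumN x : hsum (- x) = hsum x.
Proof. by apply: eq_eseriesr => n _; rewrite !fctE sqrrN. Qed.

Lemma HE a : H a <-> (hsum a < +oo)%E.
Proof.
have n0 : (0 <= normV (-1) a)%E by exact: poweR_ge0.
split=> h.
  have f : normV (-1) a \is a fin_num by rewrite ge0_fin_numE.
  have r0 : 0 < fine (normV (-1) a) + 1 by rewrite ltr_wpDl// fine_ge0.
  have : (normV (-1) a < (fine (normV (-1) a) + 1)%:E)%E.
    by rewrite EFinD fineK// lteDl// lte_fin.
  move=> /(normV_lt _ r0); apply: contraTT; rewrite -!leNgt leye_eq => /eqP ->.
  by rewrite addye ?leey.
have f : hsum a \is a fin_num by rewrite ge0_fin_numE ?hsum_ge0.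
pose r := fine (hsum a) + a 0%N ^+ 2 + 1.
have q0 : 0 <= fine (hsum a) + a 0%N ^+ 2 by rewrite addr_ge0 ?sqr_ge0// fine_ge0 ?hsum_ge0.
have r0 : 0 < r by rewrite ltr_wpDl.
apply: (@lt_trans _ _ r%:E); last exact: ltry.
apply/(normV_lt _ r0); rewrite -(fineK f) -EFinD lte_fin /r sqrrD1.
by have := sqr_ge0 (fine (hsum a) + a 0%N ^+ 2); move: (_ + _) q0 => q; rewrite -mulr_natl; lra.
Qed.

(** The distance of [Hc c] as a real number. It is meaningful there, where the series is finite;
    [fine] would send an infinite one to 0. *)
Definition hdist a b : R := Num.sqrt (fine (hsum (a - b))).

Lemma hdist_ge0 a b : 0 <= hdist a b. Proof. exact: sqrtr_ge0. Qed.

Lemma hdistC a b : hdist a b = hdist b a.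
Proof. by rewrite /hdist -hsumN; congr (Num.sqrt (fine (hsum _))); rewrite opprB. Qed.

Lemma hsum_sub c a b : Hc c a -> Hc c b -> hsum (a - b) \is a fin_num.
Proof.
move=> [/HE Ha _] [/HE Hb _]; rewrite ge0_fin_numE ?hsum_ge0//.
by apply: hsum_lty; rewrite ?hsumN.
Qed.

Lemma psum_hdist c a b k : Hc c a -> Hc c b -> psum (a - b) k <= hdist a b ^+ 2.
Proof.
move=> Ha Hb; rewrite sqr_sqrtr; last by rewrite fine_ge0 ?hsum_ge0.
by rewrite -lee_fin fineK ?psum_le_hsum//; exact: hsum_sub Ha Hb.
Qed.

Lemma hdist_le c a b (B : R) : Hc c a -> Hc c b -> 0 <= B -> (forall k, psum (a - b) k <= B ^+ 2) ->
  hdist a b <= B.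
Proof.
move=> Ha Hb B0 h; rewrite -[leRHS]ger0_norm// -sqrtr_sqr; apply: ler_wsqrtr.
rewrite -lee_fin fineK; last exact: hsum_sub Ha Hb.
exact: hsum_le.
Qed.

Lemma hdist_triangle c a b z : Hc c a -> Hc c b -> Hc c z -> hdist a z <= hdist a b + hdist b z.
Proof.
move=> Ha Hb Hz; apply/ler_addgt0Pr => e e0.
have e2 : 0 < e / 2 by rewrite divr_gt0.
have -> : hdist a b + hdist b z + e = (hdist a b + e / 2) + (hdist b z + e / 2).
  by rewrite addrACA -splitr.
have p0 x y : 0 < hdist x y + e / 2 by rewrite ltr_wpDl// hdist_ge0.
apply: (hdist_le Ha Hz); first by rewrite ltW// addr_gt0.
move=> k; have -> : a - z = (a - b) + (b - z) by apply/funext => n; rewrite !fctE; ring.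
have sq x y : Hc c x -> Hc c y -> psum (x - y) k <= (hdist x y + e / 2) ^+ 2.
  move=> Hx Hy; apply: le_trans (psum_hdist k Hx Hy) _.
  by rewrite ler_pXn2r ?nnegrE ?hdist_ge0 ?(ltW (p0 _ _))// lerDl ltW.
exact: psum_minkowski (p0 _ _) (p0 _ _) (sq _ _ Ha Hb) (sq _ _ Hb Hz).
Qed.

Lemma hdist_diag a : hdist a a = 0.
Proof.
rewrite /hdist subrr (_ : hsum 0 = 0%E) ?sqrtr0//.
by apply: eseries0 => n _ _; rewrite -[(0 : nat -> R) n]/(0 : R) expr0n mulr0.
Qed.

Lemma open_in_ball c (O : set (nat -> R)) a : open_in (Hc c) O -> O a ->
  exists2 r : R, 0 < r & forall b, Hc c b -> hdist a b < r -> O b.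
Proof.
move=> [OH Oopen] Oa; have Ha := OH _ Oa.
have [r r0 hr] := Oopen a Oa; exists r => // b Hb ab; apply: hr => //.
apply/(normV_lt _ r0); rewrite !fctE.
have [_ ->] := Hb; have [_ ->] := Ha; rewrite subrr expr0n adde0.
rewrite -(fineK (hsum_sub Hb Ha)) lte_fin.
have : hdist b a ^+ 2 < r ^+ 2 by rewrite hdistC ltr_pXn2r ?nnegrE ?hdist_ge0// ltW.
by rewrite sqr_sqrtr// fine_ge0 ?hsum_ge0.
Qed.

(** The result lies in [Hc c] for every sequence [a], so a Lipschitz function on [Hc c] composed
    with it is a Lipschitz cylinder function defined everywhere. *)
Definition ctrunc c j a : nat -> R :=
  fun n => if n is 0%N then c else if (n <= j)%N then a n else 0.

Lemma psum_ctrunc c j a k : psum (ctrunc c j a) k <= psum a j.+1.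
Proof.
have h l : psum (ctrunc c j a) (l + j.+1) = psum a j.+1.
  elim: l => [|l IH].
    rewrite add0n; apply: eq_big_nat => n /andP[n1]; rewrite ltnS => nj.
    by case: n n1 nj => // n _ nj; rewrite /ctrunc nj.
  rewrite addSn -IH /psum big_nat_recr/=; last by rewrite addnS.
  rewrite addnS /ctrunc leqNgt ltnS leq_addl /=.
  by rewrite expr0n mulr0 addr0.
by rewrite -(h k); apply: psum_mono; exact: leq_addr.
Qed.

Lemma ctrunc_Hc c j a : Hc c (ctrunc c j a).
Proof.
split=> //; apply/HE; apply: le_lt_trans (hsum_le (B := psum a j.+1) _) (ltry _) => k.
exact: psum_ctrunc.
Qed.

(** The weights [nu^-2] are at most 1, and a sum of squares is at most the square of the sum of
    moduli. *)
Lemma hdist_ctrunc_le c j a b : hdist (ctrunc c j a) (ctrunc c j b) <= cyl_dist j a b.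
Proof.
apply: hdist_le (ctrunc_Hc _ _ _) (ctrunc_Hc _ _ _) (cyl_dist_ge0 _ _ _) _ => k.
have -> : psum (ctrunc c j a - ctrunc c j b) k = psum (ctrunc 0 j (a - b)) k.
  apply: eq_bigr => n _; congr (_ * _ ^+ 2); rewrite !fctE /ctrunc.
  by case: n => [|n]; [rewrite subrr|case: ifP => _; rewrite ?subrr].
apply: le_trans (psum_ctrunc _ _ _ _) _.
have nu1 n : (1 <= n)%N -> 1 <= nu n :> R.
  move=> n1; apply: le_trans (nu_le n1); rewrite /nu mul1r.
  by apply: le_trans (pi_ge2 R); rewrite ler1n.
rewrite /cyl_dist /psum; elim: j => [|j IH]; first by rewrite !big_geq// expr0n.
rewrite !(big_nat_recr j.+1)//=; set S := \sum_(1 <= _ < _) `|_|.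
have S0 : 0 <= S by apply: sumr_ge0.
apply: (@le_trans _ _ (S ^+ 2 + `|a j.+1 - b j.+1| ^+ 2)).
  apply: lerD => //; rewrite !fctE real_normK ?num_real// ler_piMl ?sqr_ge0//.
  by rewrite invf_le1 ?exprn_gt0 ?nu_gt0// expr_ge1 ?nu1// nu_ge0.
rewrite sqrrD lerD2r lerDl; apply: mulrn_wge0; exact: mulr_ge0.
Qed.

Lemma ctrunc_cvg c a : Hc c a -> forall e : R, 0 < e -> exists j0, forall j, (j0 <= j)%N ->
  hdist (ctrunc c j a) a < e.
Proof.
move=> Ha e e0.
have fa : hsum a \is a fin_num by rewrite ge0_fin_numE ?hsum_ge0//; apply/HE; case: Ha.
have e2 : 0 < (e / 2) ^+ 2 by rewrite exprn_gt0// divr_gt0.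
have : ((fine (hsum a) - (e / 2) ^+ 2)%:E < hsum a)%E.
  by rewrite -{2}(fineK fa) lte_fin gtrBl.
move=> lt_h.
have hn : nbhs (hsum a) [set y | ((fine (hsum a) - (e / 2) ^+ 2)%:E < y)%E].
  by apply: open_nbhs_nbhs; split; [exact: open_ereal_gt_ereal|].
have [j0 _ hj0] := hsum_cvg hn.
exists j0 => j j0j; apply: (@le_lt_trans _ _ (e / 2)); last by rewrite ltr_pdivrMr// ltr_pMr// ltr1n.
apply: hdist_le (ctrunc_Hc _ _ _) Ha _ _; first by rewrite divr_ge0// ltW.
move=> k.
have split_sum : psum (ctrunc c j a - a) (k + j.+1) + psum a j.+1 = psum a (k + j.+1).
  rewrite /psum [X in X + _](big_cat_nat _ (n := j.+1))//=; last exact: leq_addl.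
  rewrite [RHS](big_cat_nat _ (n := j.+1))//=; last exact: leq_addl.
  rewrite big_nat_cond big1 ?add0r; last first.
    move=> n; rewrite andbT ltnS => /andP[n1 nj]; rewrite !fctE.
    by case: n n1 nj => // n _ nj; rewrite /ctrunc nj subrr expr0n mulr0.
  rewrite addrC; congr (_ + _); apply: eq_big_nat => n /andP[jn _].
  case: n jn => // n jn; rewrite !fctE /ctrunc leqNgt jn /= sub0r sqrrN.
  by [].
apply: le_trans (psum_mono _ (leq_addr j.+1 k)) _.
have h1 : psum a (k + j.+1) <= fine (hsum a) by rewrite -lee_fin fineK// psum_le_hsum.
have h2 : fine (hsum a) - (e / 2) ^+ 2 < psum a j.+1.
  by have := hj0 j.+1 (leq_trans j0j (leqnSn j)); rewrite /= lte_fin.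
move: split_sum h1 h2; move: (_ ^+ 2) (psum _ _) (psum _ _) (psum _ _) => q1 q2 q3 q4; lra.
Qed.

End negative_norm.

(** * Stability of the inequality under convergence in mean *)

Section closure.
Context {R : realType} d (Omega : measurableType d) (P : probability Omega R).
Implicit Types A B C : Omega -> R.

Lemma le_mul_expR_eps (X B Q : R) : 0 <= B -> (forall e, 0 < e -> X <= B * expR (e + Q)) ->
  X <= B * expR Q.
Proof.
move=> B0 h; rewrite leNgt; apply/negP => h1.
have Q0 := expR_gt0 Q.
have X0 : 0 < X by apply: le_lt_trans h1; rewrite mulr_ge0// ltW.
have B0' : 0 < B.
  rewrite lt_neqAle B0 andbT eq_sym; apply/eqP => Bz.
  by have := h 1 ltr01; rewrite Bz mul0r leNgt X0.
have BQ : 0 < B * expR Q by exact: mulr_gt0.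
pose q := X / (B * expR Q); have q1 : 1 < q by rewrite /q ltr_pdivlMr// mul1r.
have l0 : 0 < ln q by rewrite ln_gt0.
have e0 : 0 < ln q / 2 by rewrite divr_gt0.
have := h _ e0; rewrite expRD mulrCA -ler_pdivrMr// -/q => h2.
have q0 : 0 < q by exact: lt_trans ltr01 q1.
have : expR (ln q) <= expR (ln q / 2) by rewrite lnK// posrE.
by rewrite ler_expR; move: (ln q) l0 => z; lra.
Qed.

Definition bmeas A := measurable_fun setT A /\ exists M, forall o, `|A o| <= M.

Lemma bmeas_integrable A : bmeas A -> P.-integrable setT (EFin \o A).
Proof. by move=> [mA [M hM]]; exact: bounded_integrableP mA hM. Qed.

Lemma bmeas_between A (lo hi : R) : measurable_fun setT A -> (forall o, lo <= A o <= hi) -> bmeas A.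
Proof.
move=> mA bA; split=> //; exists (`|lo| + `|hi|) => o; have /andP[h1 h2] := bA o.
rewrite ler_norml; have := ler_norm hi; have := ler_norm (- lo); rewrite normrN.
by have := normr_ge0 hi; have := normr_ge0 lo; lra.
Qed.

Definition l1 A B : R := \int[P]_o `|A o - B o|.

Lemma bmeas_dist A B : bmeas A -> bmeas B -> bmeas (fun o => `|A o - B o|).
Proof.
move=> [mA [M hM]] [mB [N hN]]; split.
  by apply: measurableT_comp => //; exact: measurable_funB.
exists (M + N) => o; rewrite normr_id; apply: le_trans (ler_normB _ _) _; exact: lerD.
Qed.

Lemma l1_le A B C D E G : bmeas A -> bmeas B -> bmeas C -> bmeas D -> bmeas E -> bmeas G ->
  (forall o, `|A o - B o| <= `|C o - D o| + `|E o - G o|) -> l1 A B <= l1 C D + l1 E G.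
Proof.
move=> bA bB bC bD bE bG h.
have i1 := bmeas_integrable (bmeas_dist bA bB).
have i2 := bmeas_integrable (bmeas_dist bC bD).
have i3 := bmeas_integrable (bmeas_dist bE bG).
rewrite /l1 -(RintegralD measurableT i2 i3).
apply: le_Rintegral => //; by have := integrableD measurableT i2 i3; apply: eq_integrable.
Qed.

Lemma l1_triangle A B C : bmeas A -> bmeas B -> bmeas C -> l1 A C <= l1 A B + l1 B C.
Proof.
move=> bA bB bC; apply: l1_le => // o.
by have := ler_normD (A o - B o) (B o - C o); rewrite addrA subrK.
Qed.

Lemma l1_scale (k : R) A B C D : 0 <= k -> bmeas A -> bmeas B -> bmeas C -> bmeas D ->
  (forall o, `|A o - B o| <= k * `|C o - D o|) -> l1 A B <= k * l1 C D.
Proof.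
move=> k0 bA bB bC bD h.
have i1 := bmeas_integrable (bmeas_dist bA bB).
have i2 := bmeas_integrable (bmeas_dist bC bD).
rewrite /l1 -(RintegralZl _ measurableT i2).
by apply: le_Rintegral => //; exact: integrableRZl.
Qed.

Lemma l1_Rintegral A B : bmeas A -> bmeas B -> `|\int[P]_o A o - \int[P]_o B o| <= l1 A B.
Proof.
move=> bA bB; have iA := bmeas_integrable bA; have iB := bmeas_integrable bB.
rewrite -(RintegralB measurableT iA iB).
by apply: le_normr_Rintegral => //; have := integrableB measurableT iA iB; apply: eq_integrable.
Qed.

Lemma l1_cvg (A_ : nat -> Omega -> R) A (M e : R) : (forall n, measurable_fun setT (A_ n)) ->
  (forall n o, `|A_ n o| <= M) -> (forall o, A_ n o @[n --> \oo] --> A o) -> 0 < e ->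
  measurable_fun setT A /\ exists n0, forall n, (n0 <= n)%N -> l1 (A_ n) A <= e.
Proof.
move=> mA bA cA e0.
have Pf : (P setT < +oo)%E by exact: le_lt_trans (probability_le1 P measurableT) (ltry 1).
have [mAl _] := Rintegral_bounded_cvg Pf mA bA cA.
have bl o : `|A o| <= M.
  have h : (fun n => `|A_ n o|) @ \oo --> `|A o| by apply: cvg_norm; exact: cA.
  rewrite -(cvg_lim (@Rhausdorff R) h).
  by apply: limr_le; [exact: cvgP h|apply: nearW => n; exact: bA].
split=> //.
have mD n : measurable_fun setT (fun o => `|A_ n o - A o|).
  by apply: measurableT_comp => //; exact: measurable_funB.
have bD n o : `| `|A_ n o - A o| | <= M + M.
  by rewrite normr_id; apply: le_trans (ler_normB _ _) _; exact: lerD.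
have cD o : `|A_ n o - A o| @[n --> \oo] --> (0 : R).
  rewrite -(normr0 R) -(subrr (A o)); apply: cvg_norm; apply: cvgB; [exact: cA|exact: cvg_cst].
have [_ /cvgrPdist_le /(_ e e0)] := Rintegral_bounded_cvg Pf mD bD cD.
rewrite (Rintegral_cst _ measurableT) mul0r => -[n0 _ h]; exists n0 => n nn.
have := h n nn => /=; rewrite sub0r normrN; apply: le_trans; exact: ler_norm.
Unshelve. all: by end_near. Qed.

(** The bounds [lo] and [hi] make the power Lipschitz, so closeness in mean passes to both sides,
    and [absorb_errors] moves it into the exponent. *)
Lemma closure_harnack (p lo hi Q : R) A B : 1 < p -> 0 < lo ->
  measurable_fun setT A -> measurable_fun setT B ->
  (forall o, lo <= A o <= hi) -> (forall o, lo <= B o <= hi) ->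
  (forall eta, 0 < eta -> exists A' B', [/\ measurable_fun setT A' /\ measurable_fun setT B',
     (forall o, lo <= A' o <= hi) /\ (forall o, lo <= B' o <= hi),
     (\int[P]_o A' o) `^ p <= \int[P]_o (B' o `^ p) * expR Q & l1 A A' <= eta /\ l1 B B' <= eta]) ->
  (\int[P]_o A o) `^ p <= \int[P]_o (B o `^ p) * expR Q.
Proof.
move=> p1 lo0 mA mB bA bB h.
have p0 : 0 < p by exact: lt_trans ltr01 p1.
have lp0 : 0 < lo `^ p by exact: powR_gt0.
have pow X : measurable_fun setT X -> (forall o, lo <= X o <= hi) ->
    measurable_fun setT (fun o : Omega => X o `^ p) /\ (forall o, lo `^ p <= X o `^ p <= hi `^ p).
  move=> mX bX; split; first exact: measurableT_comp (measurable_powR p) mX.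
  move=> o; have /andP[h1 h2] := bX o.
  by apply/andP; split; apply: ge0_ler_powR; rewrite ?nnegrE ?(ltW p0) ?(ltW lo0)//;
    apply: le_trans (ltW lo0) _ => //; exact: le_trans h1 h2.
have [mBp bBp] := pow _ mB bB.
have vB := Rintegral_between P mBp (ltW lp0) bBp.
apply: le_mul_expR_eps; first by case/andP: vB => /(le_trans (ltW lp0)).
move=> e e0.
pose den := p / lo + 1 / lo `^ p.
have den0 : 0 < den by rewrite addr_gt0// divr_gt0.
pose eta := e / den; have eta0 : 0 < eta by exact: divr_gt0.
pose k := hi `^ p * (p * 1 / lo).
have k0 : 0 <= k.
  by apply: mulr_ge0; [exact: powR_ge0|rewrite divr_ge0 ?mulr1// ltW].
have z0 : 0 < Num.min eta (eta / (k + 1)) by rewrite lt_min eta0 divr_gt0// ltr_wpDl.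
have [A' [B' [[mA' mB'] [bA' bB'] hr [dA dB]]]] := h _ z0.
have vA := Rintegral_between P mA (ltW lo0) bA.
have vA' := Rintegral_between P mA' (ltW lo0) bA'.
have [mBp' bBp'] := pow _ mB' bB'.
have bm X := @bmeas_between X lo hi.
have cA : \int[P]_o A o <= \int[P]_o A' o + eta.
  have := l1_Rintegral (bm _ mA bA) (bm _ mA' bA').
  rewrite ler_norml => /andP[_ g]; rewrite -lerBlDl.
  by apply: (le_trans g); apply: (le_trans dA); rewrite ge_min lexx.
have cB : \int[P]_o (B' o `^ p) <= \int[P]_o (B o `^ p) + eta.
  have := l1_Rintegral (bmeas_between mBp' bBp') (bmeas_between mBp bBp).
  rewrite ler_norml => /andP[_ g]; rewrite -lerBlDl; apply: (le_trans g).
  apply: (@le_trans _ _ (k * l1 B B')).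
    apply: l1_scale => //; [exact: bmeas_between bBp'|exact: bmeas_between bBp|exact: bm|exact: bm|].
    move=> o; have := powR_dist_cyl p1 lo0 (bB' o) (bB o) (l := 1) (S := `|B' o - B o|).
    by rewrite !mul1r lexx normr_ge0 => /(_ isT isT)[_]; rewrite [X in _ <= _ * X]distrC.
  apply: (@le_trans _ _ (k * (eta / (k + 1)))).
    by apply: ler_wpM2l => //; apply: (le_trans dB); rewrite ge_min lexx orbT.
  rewrite mulrCA ler_piMr ?(ltW eta0)// ler_pdivrMr ?mul1r ?lerDl//.
  by rewrite ltr_wpDl.
have := absorb_errors (e := 0) (Q := Q) p1 lo0 (ltW eta0) (le_trans (ltW lo0) (proj1 (andP vA)))
  (proj1 (andP vA')) (proj1 (andP vB)) cA cB.
rewrite add0r addr0 -/den divfK ?gt_eqF//; apply; exact: hr.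
Qed.

End closure.

(** * Borel sets approximated by Lipschitz functions under two laws *)

Section borel_harnack.
Context {R : realType} d (Omega : measurableType d) (P : probability Omega R).
Variable c : R.

Definition hlip (L : R) (f : (nat -> R) -> R) := 0 <= L /\
  forall a b, Hc c a -> Hc c b -> `|f a - f b| <= L * hdist a b.

Definition hbd (lo hi : R) (f : (nat -> R) -> R) := forall a, Hc c a -> lo <= f a <= hi.

Section law.
Variable X : Omega -> nat -> R.
Hypotheses (XH : forall o, Hc c (X o)) (mX : coord_measurable X).

Let cyl_comp_measurable (l : R) (phi : (nat -> R) -> R) j : 0 <= l ->
  (forall a b, `|phi a - phi b| <= l * cyl_dist j a b) -> measurable_fun setT (fun o => phi (X o)).
Proof.
move=> l0 lip; apply: (lip_comp_measurable (@wt_gt0 R j.*2) (mulr_ge0 l0 (cyl_const_ge0 j)) _ mX).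
move=> a b; apply: le_trans (lip a b) _; rewrite -mulrA ler_wpM2l//.
exact: cyl_dist_le.
Qed.

Lemma ctrunc_lip L f j : hlip L f ->
  forall a b, `|f (ctrunc c j a) - f (ctrunc c j b)| <= L * cyl_dist j a b.
Proof.
move=> [L0 fL] a b; apply: le_trans (fL _ _ (ctrunc_Hc _ _ _) (ctrunc_Hc _ _ _)) _.
by rewrite ler_wpM2l// hdist_ctrunc_le.
Qed.

Lemma ctrunc_comp_measurable L f j : hlip L f -> measurable_fun setT (fun o => f (ctrunc c j (X o))).
Proof. by move=> fL; exact: (cyl_comp_measurable fL.1 (ctrunc_lip j fL)). Qed.

Lemma hlip_approx L lo hi f e : hlip L f -> hbd lo hi f -> 0 < e ->
  measurable_fun setT (fun o => f (X o)) /\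
  exists n0, forall n, (n0 <= n)%N -> l1 P (fun o => f (ctrunc c n (X o))) (fun o => f (X o)) <= e.
Proof.
move=> fL fb e0.
apply: (@l1_cvg _ _ _ P (fun n o => f (ctrunc c n (X o))) _ (`|lo| + `|hi|)) => //.
- by move=> n; exact: ctrunc_comp_measurable fL.
- move=> n o; have /andP[h1 h2] := fb _ (ctrunc_Hc c n (X o)).
  rewrite ler_norml; have := ler_norm hi; have := ler_norm (- lo); rewrite normrN.
  by have := normr_ge0 hi; have := normr_ge0 lo; lra.
move=> o; apply/cvgrPdist_le => z z0.
have L1 : 0 < L + 1 by rewrite ltr_wpDl// fL.1.
have [j0 hj] := ctrunc_cvg (XH o) (divr_gt0 z0 L1).
exists j0 => // n nn; rewrite distrC.
apply: le_trans (fL.2 _ _ (ctrunc_Hc _ _ _) (XH o)) _.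
apply: (@le_trans _ _ ((L + 1) * (z / (L + 1)))); last by rewrite mulrC divfK// gt_eqF.
apply: ler_pM; [exact: fL.1|exact: hdist_ge0|by rewrite lerDl|exact: ltW (hj _ nn)].
Qed.

Lemma hlip_measurable L lo hi f : hlip L f -> hbd lo hi f -> measurable_fun setT (fun o => f (X o)).
Proof. by move=> fL fb; have [] := hlip_approx fL fb ltr01. Qed.

Lemma hlip_bmeas L lo hi f : hlip L f -> hbd lo hi f -> bmeas (fun o => f (X o)).
Proof.
move=> fL fb; apply: (@bmeas_between _ _ _ _ lo hi); first exact: hlip_measurable fL fb.
by move=> o; exact: fb.
Qed.

(* For open [O] this McShane-type infimum increases to [1_O a] as [k] grows. *)
Definition cone_inf (O : set (nat -> R)) (k : nat) a : R :=
  inf [set y | exists2 b, Hc c b & y = \1_O b + k%:R * hdist a b].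

Let cone_lb O k a : lbound [set y | exists2 b, Hc c b & y = \1_O b + k%:R * hdist a b] 0.
Proof.
move=> y [b _ ->]; apply: addr_ge0; first by rewrite indicE ler0n.
by rewrite mulr_ge0// hdist_ge0.
Qed.

Let cone_has_inf O k a : Hc c a ->
  has_inf [set y | exists2 b, Hc c b & y = \1_O b + k%:R * hdist a b].
Proof.
move=> Ha; split; first by exists (\1_O a + k%:R * hdist a a); exists a.
by exists 0; exact: cone_lb.
Qed.

Lemma cone_inf_le O k a b : Hc c a -> Hc c b -> cone_inf O k a <= \1_O b + k%:R * hdist a b.
Proof.
move=> Ha Hb; apply: ge_inf; first by exists 0; exact: cone_lb.
by exists b.
Qed.

Lemma cone_inf_ge O k a y : Hc c a ->
  (forall b, Hc c b -> y <= \1_O b + k%:R * hdist a b) -> y <= cone_inf O k a.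
Proof.
move=> Ha h; apply: lb_le_inf; first by case: (cone_has_inf O k Ha).
by move=> _ [b Hb ->]; exact: h.
Qed.

Lemma cone_inf_bd O k : hbd 0 1 (cone_inf O k).
Proof.
move=> a Ha; apply/andP; split.
  by apply: cone_inf_ge => // b Hb; apply: (cone_lb (O := O) (k := k) (a := a)); exists b.
apply: le_trans (cone_inf_le O k Ha Ha) _.
by rewrite hdist_diag mulr0 addr0 indicE lern1 leq_b1.
Qed.

Lemma cone_inf_lip O k : hlip k%:R (cone_inf O k).
Proof.
split => // a b Ha Hb.
suff h x y : Hc c x -> Hc c y -> cone_inf O k x - cone_inf O k y <= k%:R * hdist x y.
  rewrite ler_norml h// andbT lerNl opprB hdistC; exact: h.
move=> Hx Hy; rewrite lerBlDl -lerBlDr; apply: cone_inf_ge => // z Hz.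
rewrite lerBlDr; apply: le_trans (cone_inf_le O k Hx Hz) _.
rewrite -addrA lerD2l -mulrDr ler_wpM2l// addrC.
exact: hdist_triangle Hx Hy Hz.
Qed.

Lemma cone_inf_cvg O a : open_in (Hc c) O -> Hc c a -> cone_inf O k a @[k --> \oo] --> (\1_O a : R).
Proof.
move=> oO Ha; apply/cvgrPdist_le => z z0.
case: (boolP (a \in O)) => aO; last first.
  near=> k; rewrite indicE (negbTE aO) sub0r normrN ger0_norm.
    apply: le_trans (cone_inf_le O k Ha Ha) _.
    by rewrite hdist_diag mulr0 addr0 indicE (negbTE aO) ltW.
  by case/andP: (cone_inf_bd O k Ha).
have [r r0 hr] := open_in_ball oO (set_mem aO).
(* Once [k r >= 1], leaving the ball of radius [r] inside [O] costs at least 1, so the infimum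
   equals 1. *)
exists (Num.truncn r^-1).+1 => // k /= hk.
have kr : 1 <= k%:R * r.
  rewrite -ler_pdivrMr// div1r; apply: le_trans (ltW (truncnS_gt _)) _; by rewrite ler_nat.
have : 1 <= cone_inf O k a.
  apply: cone_inf_ge => // b Hb; rewrite indicE; case: (boolP (b \in O)) => bO.
    by rewrite lerDl mulr_ge0// hdist_ge0.
  rewrite add0r; apply: (le_trans kr); rewrite ler_wpM2l// leNgt; apply/negP => h.
  by move: bO; rewrite notin_setE; apply; exact: hr.
have /andP[_ h1] := cone_inf_bd O k Ha => h2.
by rewrite indicE aO (_ : cone_inf O k a = 1) ?subrr ?normr0 ?ltW//; apply/eqP; rewrite eq_le h1.
Unshelve. all: by end_near. Qed.

Lemma open_approx O e : open_in (Hc c) O -> 0 < e ->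
  measurable_fun setT (fun o => \1_O (X o) : R) /\
  exists n0, forall n, (n0 <= n)%N -> l1 P (fun o => cone_inf O n (X o)) (fun o => \1_O (X o)) <= e.
Proof.
move=> oO e0; apply: (@l1_cvg _ _ _ P (fun n o => cone_inf O n (X o)) _ 1) => //.
- by move=> n; exact: hlip_measurable (cone_inf_lip O n) (cone_inf_bd O n).
- by move=> n o; have /andP[h1 h2] := cone_inf_bd O n (XH o); rewrite ger0_norm.
- by move=> o; exact: cone_inf_cvg.
Qed.

End law.

Section two_laws.
Variables U V : Omega -> nat -> R.
Hypotheses (UH : forall o, Hc c (U o)) (VH : forall o, Hc c (V o)).
Hypotheses (mU : coord_measurable U) (mV : coord_measurable V).

Definition law X := X = U \/ X = V.

Let lawH X : law X -> forall o, Hc c (X o). Proof. by case=> ->. Qed.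
Let lawM X : law X -> coord_measurable X. Proof. by case=> ->. Qed.

(** A single function has to approximate the indicator under both laws, because it appears on both
    sides of the inequality. The class is closed under complements in [Hc c] and countable unions,
    so it contains the sigma-algebra generated by the open sets without a monotone class
    argument. *)
Definition approximable (B : set (nat -> R)) :=
  (forall X, law X -> measurable_fun setT (fun o => \1_B (X o) : R)) /\
  forall e, 0 < e -> exists L f, [/\ hlip L f, hbd 0 1 f &
    forall X, law X -> l1 P (fun o => f (X o)) (fun o => \1_B (X o)) <= e].

Let ind01 (B : set (nat -> R)) a : 0 <= (\1_B a : R) <= 1.
Proof. by rewrite indicE ler0n lern1 leq_b1. Qed.

Let ind_bmeas B X : approximable B -> law X -> bmeas (fun o => \1_B (X o) : R).
Proof. by move=> [mB _] lX; exact: (bmeas_between (mB X lX) (fun o => ind01 B (X o))). Qed.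

Let f_bmeas L lo hi f X : hlip L f -> hbd lo hi f -> law X -> bmeas (fun o => f (X o)).
Proof. by move=> fL fb lX; exact: (hlip_bmeas (lawH lX) (lawM lX) fL fb). Qed.

Lemma approximable_open O : open_in (Hc c) O -> approximable O.
Proof.
move=> oO; split=> [X lX|e e0]; first by have [] := open_approx (lawH lX) (lawM lX) oO ltr01.
have [_ [n1 h1]] := open_approx UH mU oO e0.
have [_ [n2 h2]] := open_approx VH mV oO e0.
exists (maxn n1 n2)%:R, (cone_inf O (maxn n1 n2)); split; [exact: cone_inf_lip|exact: cone_inf_bd|].
by move=> X [] ->; [apply: h1; exact: leq_maxl|apply: h2; exact: leq_maxr].
Qed.

Lemma hlip_cst (k : R) : hlip 0 (fun=> k).
Proof. by split=> // a b _ _; rewrite subrr normr0 mul0r. Qed.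

Lemma approximable0 : approximable set0.
Proof.
have E a : \1_(set0 : set (nat -> R)) a = 0 :> R by rewrite indic0.
split=> [X lX|e e0]; first by under eq_fun do rewrite E; exact: measurable_cst.
exists 0, (fun=> 0); split; [exact: hlip_cst|by move=> a _; rewrite lexx ler01|move=> X lX].
rewrite /l1; under eq_Rintegral do rewrite E subrr normr0.
by rewrite (Rintegral_cst _ measurableT) mul0r ltW.
Qed.

Lemma approximableD B : approximable B -> approximable (Hc c `\` B).
Proof.
move=> aB; have [mB hB] := aB.
have E X o : law X -> \1_(Hc c `\` B) (X o) = 1 - \1_B (X o) :> R.
  move=> lX; rewrite !indicE in_setD (mem_set (lawH lX o)) /=.
  by case: (X o \in B); rewrite ?subrr ?subr0.
split=> [X lX|e e0].
  by under eq_fun do rewrite (E _ _ lX); apply: measurable_funB => //; exact: mB.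
have [L [f [fL fb hf]]] := hB e e0.
exists L, (fun a => 1 - f a); split.
- split; first exact: fL.1.
  move=> a b Ha Hb; have -> : 1 - f a - (1 - f b) = f b - f a by ring.
  by rewrite distrC; exact: fL.2.
- by move=> a Ha; have := fb a Ha; lra.
- move=> X lX; apply: le_trans (hf X lX).
  rewrite /l1 le_eqVlt; apply/orP; left; apply/eqP; apply: eq_Rintegral => o _.
  by rewrite (E _ _ lX) -normrN; congr (`|_|); ring.
Qed.

Lemma maxr_dist (a b x y : R) : `|Num.max a b - Num.max x y| <= `|a - x| + `|b - y|.
Proof.
have h1 := ler_norm (a - x); have h2 := ler_norm (b - y).
have h3 := ler_norm (x - a); have h4 := ler_norm (y - b).
rewrite distrC in h3; rewrite distrC in h4.
have n1 := normr_ge0 (a - x); have n2 := normr_ge0 (b - y).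
move: h1 h2 h3 h4 n1 n2; move: `|a - x| `|b - y| => p q h1 h2 h3 h4 n1 n2.
by rewrite ler_norml; case: (leP a b) => ab; case: (leP x y) => xy; apply/andP; split; lra.
Qed.

Lemma hlip_max L1 L2 f g : hlip L1 f -> hlip L2 g ->
  hlip (L1 + L2) (fun a => Num.max (f a) (g a)).
Proof.
move=> [p1 h1] [p2 h2]; split=> [|a b Ha Hb]; first exact: addr_ge0.
by apply: le_trans (maxr_dist _ _ _ _) _; rewrite mulrDl lerD// ?h1 ?h2.
Qed.

Lemma approximableU A B : approximable A -> approximable B -> approximable (A `|` B).
Proof.
move=> aA aB; have [mA hA] := aA; have [mB hB] := aB.
have E a : \1_(A `|` B) a = Num.max (\1_A a) (\1_B a) :> R.
  by rewrite !indicE in_setU; case: (a \in A); case: (a \in B) => /=;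
    rewrite ?maxxx ?(max_l ler01) ?(max_r ler01).
have mAB X : law X -> measurable_fun setT (fun o => \1_(A `|` B) (X o) : R).
  move=> lX; under eq_fun do rewrite E.
  exact: measurable_maxr (mA X lX) (mB X lX).
split=> // e e0.
have e2 : 0 < e / 2 by rewrite divr_gt0.
have [L1 [f [fL fb hf]]] := hA _ e2.
have [L2 [g [gL gb hg]]] := hB _ e2.
have ML := hlip_max fL gL.
have Mb : hbd 0 1 (fun a => Num.max (f a) (g a)).
  move=> a Ha; have /andP[f0 f1] := fb a Ha; have /andP[g0 g1] := gb a Ha.
  by rewrite le_max f0 ge_max f1 g1.
exists (L1 + L2), (fun a => Num.max (f a) (g a)); split => // X lX.
rewrite [leRHS]splitr; apply: le_trans (lerD (hf X lX) (hg X lX)).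
apply: l1_le; [exact: f_bmeas ML Mb lX| |exact: f_bmeas fL fb lX|exact: ind_bmeas|
  exact: f_bmeas gL gb lX|exact: ind_bmeas|].
  exact: (bmeas_between (mAB X lX) (fun o => ind01 _ (X o))).
by move=> o; rewrite E; exact: maxr_dist.
Qed.

(** The indicators of the finite unions converge in mean under both laws, by bounded convergence. *)
Lemma approximable_bigcup (B : nat -> set (nat -> R)) : (forall n, approximable (B n)) ->
  approximable (\bigcup_n B n).
Proof.
move=> aB; pose C n := \big[setU/set0]_(k < n) B k.
have aC n : approximable (C n).
  elim: n => [|n IH]; first by rewrite /C big_ord0; exact: approximable0.
  by rewrite /C big_ord_recr; exact: approximableU.
have cv a : \1_(C n) a @[n --> \oo] --> (\1_(\bigcup_n B n) a : R).
  apply/cvgrPdist_le => z z0.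
  case: (boolP (a \in \bigcup_n B n)) => h.
    have [n _ Bn] := set_mem h; exists n.+1 => // k /= nk; rewrite !indicE h.
    rewrite (_ : (a \in C k) = true) ?subrr ?normr0 ?ltW//; apply/mem_set.
    by rewrite /C -bigcup_mkord; exists n.
  apply: nearW => k; rewrite !indicE (negbTE h) (_ : (a \in C k) = false) ?subrr ?normr0 ?ltW//.
  apply/negbTE; move: h; rewrite !notin_setE => h; apply: contra_not h.
  by rewrite /C -bigcup_mkord => -[n _ Bn]; exists n.
have lim X e : law X -> 0 < e -> measurable_fun setT (fun o => \1_(\bigcup_n B n) (X o) : R) /\
    exists n0, forall n, (n0 <= n)%N ->
      l1 P (fun o => \1_(C n) (X o)) (fun o => \1_(\bigcup_n B n) (X o)) <= e.
  move=> lX e0; apply: (@l1_cvg _ _ _ P (fun n o => \1_(C n) (X o)) _ 1) => //.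
  - by move=> n; exact: (aC n).1.
  - by move=> n o; have /andP[h1 h2] := ind01 (C n) (X o); rewrite ger0_norm.
have mB X : law X -> measurable_fun setT (fun o => \1_(\bigcup_n B n) (X o) : R).
  by move=> lX; exact: (lim X 1 lX ltr01).1.
split=> // e e0.
have e2 : 0 < e / 2 by rewrite divr_gt0.
have [n1 h1] := (lim U _ (or_introl erefl) e2).2.
have [n2 h2] := (lim V _ (or_intror erefl) e2).2.
pose n := maxn n1 n2.
have [L [f [fL fb hf]]] := (aC n).2 _ e2.
exists L, f; split => // X lX; rewrite [leRHS]splitr.
apply: le_trans (l1_triangle P (f_bmeas fL fb lX) (ind_bmeas (aC n) lX) _) _.
  exact: (bmeas_between (mB X lX) (fun o => ind01 _ (X o))).
apply: lerD; first exact: hf.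
by case: lX => ->; [apply: h1; exact: leq_maxl|apply: h2; exact: leq_maxr].
Qed.

Lemma approximable_borel B : borel (Hc c) B -> approximable B.
Proof.
apply: smallest_sub; last exact: approximable_open.
split; [exact: approximable0|exact: approximableD|exact: approximable_bigcup].
Qed.

End two_laws.
End borel_harnack.

(** * From Borel sets to Borel functions *)

Section borel_functions.
Context {R : realType} d (Omega : measurableType d) (P : probability Omega R).
Variables (c : R) (U V : Omega -> nat -> R).
Hypotheses (UH : forall o, Hc c (U o)) (VH : forall o, Hc c (V o)).
Hypotheses (mU : coord_measurable U) (mV : coord_measurable V).
Local Notation law := (law U V).
Local Notation approximable := (approximable P c U V).

Let f_bmeas L lo hi (f : (nat -> R) -> R) X : hlip c L f -> hbd c lo hi f -> law X ->
  bmeas (fun o => f (X o)).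
Proof.
by move=> fL fb [] ->; [exact: (hlip_bmeas P UH mU fL fb)|exact: (hlip_bmeas P VH mV fL fb)].
Qed.

Let lawH X : law X -> forall o, Hc c (X o). Proof. by case=> ->. Qed.

(** The sum is the integer part of [y]. *)
Lemma count_levels (y : R) N : 0 <= y <= N%:R ->
  `|y - \sum_(k < N) ((k.+1%:R : R) <= y)%R%:R| <= 1.
Proof.
move=> /andP[y0 yN]; set S := fun n : nat => \sum_(k < n) ((k.+1%:R : R) <= y)%R%:R : R.
have up n : S n <= n%:R /\ S n <= y.
  elim: n => [|n [IH1 IH2]]; first by rewrite /S big_ord0.
  rewrite /S big_ord_recr -/(S n) /=; case: (leP (n.+1%:R : R) y) => h.
    by rewrite -natr1 lerD2r IH1; split=> //; apply: le_trans h; rewrite -natr1 lerD2r.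
  by rewrite addr0; split=> //; apply: le_trans IH1 _; rewrite ler_nat.
have low n : (n%:R <= S n) || (y - 1 <= S n).
  elim: n => [|n IH]; first by rewrite /S big_ord0 lexx.
  rewrite /S big_ord_recr -/(S n) /=; case: (leP (n.+1%:R : R) y) => h.
    have h' : n%:R <= S n.
      by case/orP: IH => // g; apply: le_trans g; rewrite lerBrDr natr1.
    by rewrite -natr1 lerD2r h'.
  rewrite addr0; case/orP: IH => [g|->]; last by rewrite orbT.
  by apply/orP; right; apply: le_trans g; rewrite lerBlDr natr1 ltW.
rewrite -/(S N) ger0_norm ?subr_ge0 ?(up N).2// lerBlDr.
case/orP: (low N) => h; last by rewrite -lerBlDl.
by apply: (le_trans yN); apply: (le_trans h); rewrite lerDr.
Qed.

Lemma approximable_sum (B : nat -> set (nat -> R)) N e : (forall k, approximable (B k)) -> 0 < e ->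
  exists L g, [/\ hlip c L g, hbd c 0 N%:R g &
    forall X, law X -> l1 P (fun o => g (X o)) (fun o => \sum_(k < N) \1_(B k) (X o)) <= e].
Proof.
move=> aB; elim: N e => [|N IH] e e0.
  exists 0, (fun=> 0); split; [exact: hlip_cst|by move=> a _; rewrite lexx|move=> X lX].
  rewrite /l1; under eq_Rintegral do rewrite big_ord0 subrr normr0.
  by rewrite (Rintegral_cst _ measurableT) mul0r ltW.
have e2 : 0 < e / 2 by rewrite divr_gt0.
have [L1 [g [gL gb hg]]] := IH _ e2.
have [L2 [f [fL fb hf]]] := (aB N).2 _ e2.
have sL : hlip c (L1 + L2) (fun a => g a + f a).
  split=> [|a b Ha Hb]; first by rewrite addr_ge0 ?gL.1 ?fL.1.
  have -> : g a + f a - (g b + f b) = (g a - g b) + (f a - f b) by ring.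
  by apply: le_trans (ler_normD _ _) _; rewrite mulrDl lerD ?gL.2 ?fL.2.
have sb : hbd c 0 N.+1%:R (fun a => g a + f a).
  by move=> a Ha; rewrite -natr1; have := gb a Ha; have := fb a Ha; lra.
exists (L1 + L2), (fun a => g a + f a); split=> // X lX.
rewrite [leRHS]splitr; apply: le_trans (lerD (hg X lX) (hf X lX)).
have mI k : measurable_fun setT (fun o => \1_(B k) (X o) : R) by exact: (aB k).1.
have I01 k a : 0 <= (\1_(B k) a : R) <= 1 by rewrite indicE ler0n lern1 leq_b1.
have bS n : bmeas (fun o => \sum_(k < n) \1_(B k) (X o) : R).
  apply: (@bmeas_between _ _ _ _ 0 n%:R); first exact: measurable_sum.
  move=> o; rewrite sumr_ge0/=; last by move=> k _; case/andP: (I01 k (X o)).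
  apply: (@le_trans _ _ (\sum_(k < n) 1)); last by rewrite sumr_const card_ord.
  by apply: ler_sum => k _; case/andP: (I01 k (X o)).
apply: l1_le; [exact: f_bmeas sL sb lX|exact: bS|exact: f_bmeas gL gb lX|exact: bS|
  exact: f_bmeas fL fb lX|exact: bmeas_between (mI N) (fun o => I01 _ _)|].
move=> o; rewrite big_ord_recr /=.
by apply: le_trans (ler_normD _ _); rewrite addrACA -opprD.
Qed.

Variables (lo hi : R) (phi : (nat -> R) -> R).
Hypothesis phi_bd : hbd c lo hi phi.
Hypothesis phi_borel : forall D : set R, measurable D -> borel (Hc c) (Hc c `&` phi @^-1` D).

Lemma borel_comp_measurable X : law X -> measurable_fun setT (fun o => phi (X o)).
Proof.
move=> lX _ D mD; rewrite setTI.
have [/(_ X lX) m1 _] := approximable_borel P UH VH mU mV (phi_borel mD).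
have := m1 measurableT _ (measurable_itv `]0, +oo[); rewrite setTI; congr (measurable _).
apply/seteqP; split => o /=; rewrite in_itv/= andbT indicE.
  by rewrite ltr0n lt0b => /set_mem[].
by move=> h; rewrite mem_set//; split=> //; exact: lawH.
Qed.

(** [phi] is within one step [h <= e / 2] of [lo] plus [h] times a sum of [N] indicators of level
    sets; replacing each indicator by a Lipschitz function with values in [0,1] keeps the bounds
    [lo] and [hi]. *)
Lemma borel_approx e : 0 < e -> exists L f, [/\ hlip c L f, hbd c lo hi f &
  forall X, law X -> l1 P (fun o => phi (X o)) (fun o => f (X o)) <= e].
Proof.
move=> e0.
have Hc0 := ctrunc_Hc c 0 (fun=> 0).
have lohi : lo <= hi by have /andP[h1 h2] := phi_bd Hc0; exact: le_trans h1 h2.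
pose N := (Num.truncn ((hi - lo) / (e / 2))).+1.
pose h := (hi - lo) / N%:R.
have N0 : 0 < N%:R :> R by rewrite ltr0n.
have e2 : 0 < e / 2 by rewrite divr_gt0.
have h0 : 0 <= h by rewrite divr_ge0// subr_ge0.
have he : h <= e / 2.
  by rewrite /h ler_pdivrMr// mulrC -ler_pdivrMr// ltW// truncnS_gt.
pose B k := Hc c `&` phi @^-1` `[lo + k.+1%:R * h, +oo[%classic.
have aB k : approximable (B k) by apply: (approximable_borel P UH VH mU mV); exact: phi_borel.
have z0 : 0 < e / 2 / (h + 1) by rewrite divr_gt0// ltr_wpDl.
have [L [g [gL gb hg]]] := approximable_sum N aB z0.
have fL : hlip c (h * L) (fun a => lo + h * g a).
  split=> [|a b Ha Hb]; first by rewrite mulr_ge0// gL.1.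
  have -> : lo + h * g a - (lo + h * g b) = h * (g a - g b) by ring.
  by rewrite normrM ger0_norm// -mulrA ler_wpM2l// gL.2.
have hN : h * N%:R = hi - lo by rewrite /h divfK// gt_eqF.
have fb : hbd c lo hi (fun a => lo + h * g a).
  move=> a Ha; have /andP[g0 g1] := gb a Ha.
  have := ler_wpM2l h0 g1; have := mulr_ge0 h0 g0; rewrite hN => q1 q2; lra.
exists (h * L), (fun a => lo + h * g a); split=> // X lX.
have I01 k a : 0 <= (\1_(B k) a : R) <= 1 by rewrite indicE ler0n lern1 leq_b1.
have bS : bmeas (fun o => \sum_(k < N) \1_(B k) (X o) : R).
  apply: (@bmeas_between _ _ _ _ 0 N%:R); first by apply: measurable_sum => k; exact: (aB k).1.
  move=> o; rewrite sumr_ge0/=; last by move=> k _; case/andP: (I01 k (X o)).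
  apply: (@le_trans _ _ (\sum_(k < N) 1)); last by rewrite sumr_const card_ord.
  by apply: ler_sum => k _; case/andP: (I01 k (X o)).
have bS' : bmeas (fun o => lo + h * \sum_(k < N) \1_(B k) (X o) : R).
  apply: (@bmeas_between _ _ _ _ lo (lo + h * N%:R)).
    apply: measurable_funD; first exact: measurable_cst.
    by apply: measurable_funM; [exact: measurable_cst|case: bS].
  have S0 o : 0 <= \sum_(k < N) \1_(B k) (X o) :> R.
    by apply: sumr_ge0 => k _; case/andP: (I01 k (X o)).
  have S1 o : \sum_(k < N) \1_(B k) (X o) <= N%:R :> R.
    apply: (@le_trans _ _ (\sum_(k < N) 1)); last by rewrite sumr_const card_ord.
    by apply: ler_sum => k _; case/andP: (I01 k (X o)).
  by move=> o; rewrite lerDl mulr_ge0//= lerD2l ler_wpM2l.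
have bphi : bmeas (fun o => phi (X o)).
  by apply: (bmeas_between (borel_comp_measurable lX)) => o; exact: phi_bd (lawH lX o).
have bf := f_bmeas fL fb lX; have bg := f_bmeas gL gb lX.
apply: le_trans (l1_triangle P bphi bS' bf) _; rewrite [leRHS]splitr; apply: lerD.
  have b01 : bmeas (fun _ : Omega => e / 2).
    by split; [exact: measurable_cst|exists (e / 2) => o; rewrite ger0_norm// ltW].
  rewrite /l1 -[leRHS]mulr1.
  have -> : (e / 2) * 1 = \int[P]_(_ in setT) (e / 2).
    by rewrite (Rintegral_cst _ measurableT) -[X in _ = _ * fine X]/(P setT) probability_setT.
  apply: le_Rintegral => //; [exact: bmeas_integrable (bmeas_dist bphi bS')|exact: bmeas_integrable b01|].
  move=> o _; have Ho := lawH lX o; have /andP[p1 p2] := phi_bd Ho.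
  (* If [h = 0] then [lo = hi] and [phi] is constant on [Hc c]; otherwise division by [h] is
     legitimate. *)
  case: (eqVneq h 0) => hz.
    have lh : lo = hi by apply/esym/eqP; rewrite -subr_eq0 -hN hz mul0r.
    rewrite hz mul0r addr0 (_ : phi (X o) = lo) ?subrr ?normr0 ?(ltW e2)//.
    by apply/eqP; rewrite eq_le p1 lh p2.
  have hp : 0 < h by rewrite lt_neqAle eq_sym hz.
  have yb : 0 <= (phi (X o) - lo) / h <= N%:R.
    by rewrite divr_ge0 ?subr_ge0//= ler_pdivrMr// mulrC hN lerD2r.
  have := count_levels yb => cl.
  apply: le_trans he; rewrite -[leRHS]mulr1; apply: le_trans (ler_wpM2l h0 cl).
  rewrite -[X in X * `|_|](ger0_norm h0) -normrM mulrBr mulrCA mulfV// mulr1.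
  rewrite opprD addrA le_eqVlt; apply/orP; left; apply/eqP; congr (`|_ - h * _|).
  apply: eq_bigr => k _; rewrite indicE; congr (_%:R); congr nat_of_bool.
  apply/idP/idP.
    by move=> /set_mem[_] /=; rewrite in_itv/= andbT => g1; rewrite ler_pdivlMr// lerBrDl.
  rewrite ler_pdivlMr// lerBrDl => g1; apply/mem_set; split => //=.
  by rewrite in_itv/= andbT.
apply: (@le_trans _ _ (h * l1 P (fun o => g (X o)) (fun o => \sum_(k < N) \1_(B k) (X o)))).
  apply: l1_scale => // o.
  by rewrite opprD addrACA subrr add0r -mulrBr normrM ger0_norm// distrC.
apply: (@le_trans _ _ (h * (e / 2 / (h + 1)))); first by rewrite ler_wpM2l// hg.
by rewrite mulrCA ler_piMr ?(ltW e2)// ler_pdivrMr ?mul1r ?lerDl// ltr_wpDl.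
Qed.

Variables p Q : R.
Hypotheses (p1 : 1 < p) (lo0 : 0 < lo).
Hypothesis cyl : forall (f : (nat -> R) -> R) l j, 0 <= l -> (forall a, lo <= f a <= hi) ->
  (forall a b, `|f a - f b| <= l * cyl_dist j a b) ->
  (\int[P]_o f (V o)) `^ p <= \int[P]_o (f (U o) `^ p) * expR Q.

Lemma hlip_harnack L f : hlip c L f -> hbd c lo hi f ->
  (\int[P]_o f (V o)) `^ p <= \int[P]_o (f (U o) `^ p) * expR Q.
Proof.
move=> fL fb.
have [m1 _] := hlip_approx P VH mV fL fb ltr01.
have [m2 _] := hlip_approx P UH mU fL fb ltr01.
apply: (closure_harnack p1 lo0 m1 m2 (fun o => fb _ (VH o)) (fun o => fb _ (UH o))) => eta eta0.
have [_ [n1 h1]] := hlip_approx P VH mV fL fb eta0.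
have [_ [n2 h2]] := hlip_approx P UH mU fL fb eta0.
pose n := maxn n1 n2.
exists (fun o => f (ctrunc c n (V o))), (fun o => f (ctrunc c n (U o))); split.
- by split; [exact: (ctrunc_comp_measurable mV n fL)|exact: (ctrunc_comp_measurable mU n fL)].
- by split=> o; apply: fb; exact: ctrunc_Hc.
- apply: (cyl (f := fun a => f (ctrunc c n a)) fL.1 _ (ctrunc_lip n fL)) => a.
  by apply: fb; exact: ctrunc_Hc.
- have sym A B : l1 P A B = l1 P B A by apply: eq_Rintegral => o _; rewrite distrC.
  by rewrite sym h1 ?leq_maxl// sym h2 ?leq_maxr.
Qed.

Lemma borel_harnack : (\int[P]_o phi (V o)) `^ p <= \int[P]_o (phi (U o) `^ p) * expR Q.
Proof.
have lU : law U by left.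
have lV : law V by right.
apply: (closure_harnack p1 lo0 (borel_comp_measurable lV) (borel_comp_measurable lU)
  (fun o => phi_bd (VH o)) (fun o => phi_bd (UH o))) => eta eta0.
have [L [f [fL fb hf]]] := borel_approx eta0.
exists (fun o => f (V o)), (fun o => f (U o)); split.
- by split; [exact: (f_bmeas fL fb lV).1|exact: (f_bmeas fL fb lU).1].
- by split=> o; exact: fb.
- exact: hlip_harnack fL fb.
- by split; exact: hf.
Qed.

End borel_functions.

(** * Power-Harnack and log-Harnack inequalities *)

Section states.
Context {R : realType}.
Local Notation mu := (@lebesgue_measure R).
Local Notation I01 := (`[0, 1]%classic : set R).

(** In mode [n >= 1] the norm carries the weight [1 / nu n], in mode 0 the weight 1; the factor
    [nu n + 1] covers both. *)
Lemma coord_close (a b : nat -> R) n (r : R) : 0 < r -> (normV (-1) (b - a)%R < r%:E)%E ->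
  `|b n - a n| < (nu n + 1) * r.
Proof.
move=> r0 /(normV_lt _ r0) h.
have n0 : 0 <= nu n :> R by exact: nu_ge0.
have f : hsum (b - a) \is a fin_num.
  rewrite ge0_fin_numE ?hsum_ge0//; apply: le_lt_trans (ltry (r ^+ 2)).
  by apply: le_trans (ltW h); rewrite leeDl// lee_fin sqr_ge0.
move: h; rewrite -(fineK f) lte_fin !fctE => h.
have s0 : 0 <= fine (hsum (b - a)) by rewrite fine_ge0 ?hsum_ge0.
have sq z : 0 <= z -> `|b n - a n| ^+ 2 <= z ^+ 2 * r ^+ 2 -> z <= nu n + 1 -> z != nu n + 1 ->
    `|b n - a n| < (nu n + 1) * r.
  move=> z0 h1 h2 h3; apply: (@le_lt_trans _ _ (z * r)).
    by rewrite -(ler_pXn2r (ltn0Sn 1)) ?nnegrE ?mulr_ge0 ?(ltW r0)// exprMn.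
  by rewrite ltr_pM2r// lt_neqAle h3.
case: n n0 sq => [|n] n0 sq.
  rewrite /nu mul0r add0r mul1r -(ltr_pXn2r (ltn0Sn 1)) ?nnegrE ?(ltW r0)//.
  by rewrite real_normK ?num_real//; apply: le_lt_trans h; rewrite lerDr.
apply: (sq (nu n.+1)) => //; [|by rewrite lerDl|by rewrite lt_eqF// ltrDl].
have h1 : (nu n.+1 ^+ 2)^-1 * (b n.+1 - a n.+1) ^+ 2 <= fine (hsum (b - a)).
  rewrite -lee_fin fineK//; apply: le_trans (psum_le_hsum _ n.+2).
  rewrite lee_fin /psum big_nat_recr//= lerDr; exact: psum_ge0.
have n1 : 0 < nu n.+1 ^+ 2 :> R by rewrite exprn_gt0// nu_gt0.
rewrite real_normK ?num_real// -ler_pdivrMl//; apply: (le_trans h1).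
by apply: le_trans (ltW h); rewrite lerDl sqr_ge0.
Qed.

Lemma open_coord n (D : set R) : open D -> open_in H [set a : nat -> R | H a /\ D (a n)].
Proof.
move=> oD; split=> [a []//|a [Ha Da]].
have /nbhs_ballP[e /= e0 he] : nbhs (a n) D by exact: open_nbhs_nbhs.
have k0 : 0 < nu n + 1 :> R by rewrite ltr_wpDl// nu_ge0.
exists (e / (nu n + 1)); first exact: divr_gt0.
move=> b Hb h; split=> //; apply: he; rewrite /ball/= distrC.
have := coord_close n (divr_gt0 e0 k0) h; by rewrite mulrC divfK// gt_eqF.
Qed.

Lemma borel_Hc c : borel H (Hc c : set (nat -> R)).
Proof.
have -> : Hc c = H `\` [set a : nat -> R | H a /\ (~` [set c]) (a 0%N)].
  apply/seteqP; split=> [a [Ha <-]|a [Ha h]]; first by split=> // -[_]; apply.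
  by split=> //; apply: contrapT => n; apply: h.
have [_ hD _] : sigma_algebra (H : set (nat -> R)) (borel H) by exact: smallest_sigma_algebra.
apply: hD; apply: sub_sigma_algebra; apply: open_coord.
rewrite openC; exact: closed_eq.
Qed.

(** Clamping changes [x] on a null set only, so its coefficients are those of a function bounded by
    1 everywhere, to which [fejer_le1] applies. *)
Lemma K_admissible c (x : R -> R) m (c1 : `|c| < 1) : K x -> coef x 0 = c ->
  admissible c m (coef x).
Proof.
move=> [[mx _] bx] xc y Iy.
pose v := fun s => clamp (x s).
have bv : bfun v.
  split; last by move=> s _; exact: clamp_norm.
  apply: measurable_maxr; first exact: measurable_cst.
  by apply: measurable_minr => //; exact: measurable_cst.
have vx n : coef v n = coef x n.
  rewrite /coef /inner /Rintegral; congr fine; apply: ae_eq_integral => //.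
  - by apply/measurable_EFinP; apply: measurable_funM; [case: bv|exact: measurable_eigen].
  - by apply/measurable_EFinP; apply: measurable_funM => //; exact: measurable_eigen.
  - apply: (@filterS _ _ (ae_filter_ringOfSetsType mu) _ _ _ bx) => s hs Is; rewrite /v clamp_id// ler_norml; exact: hs.
have := fejer_le1 m y bv; congr (`|_| <= _).
rewrite /field /fejer; apply: eq_bigr => n _; congr (_ * _ * _).
by rewrite vx; case: n.
Qed.

Context d (Omega : measurableType d) (P : probability Omega R).

Lemma complete_measurable (f g : Omega -> R) : measure_is_complete P ->
  measurable_fun setT f -> {ae P, forall o, g o = f o} -> measurable_fun setT g.
Proof.
move=> hP mf fg _ D mD; rewrite setTI.
have nN : P.-negligible [set o | g o <> f o] by exact: fg.
have mN : measurable [set o | g o <> f o] by exact: hP.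
have nS : measurable ([set o | g o <> f o] `&` g @^-1` D).
  apply: hP; apply: negligibleS nN; exact: subIsetl.
have -> : g @^-1` D = (f @^-1` D `\` [set o | g o <> f o]) `|`
    ([set o | g o <> f o] `&` g @^-1` D).
  apply/seteqP; split=> o /=.
    by move=> gD; case: (pselect (g o = f o)) => [e|n]; [left; rewrite -e; split=> //; apply|right].
  by case=> [[fD /contrapT ->]|[]].
apply: measurableU => //; apply: measurableD => //.
by rewrite -[X in measurable X]setTI; exact: mf.
Qed.

Variables (F : R -> set (set Omega)) (c t : R) (u : Omega -> R -> R -> R).
Hypotheses (hF : filtration F) (uF : adapted_H F u) (t0 : 0 < t).
Hypothesis uH : {ae P, forall o, Hc c (coef (u o t))}.

(** The solution at time [t] lies in [Hc c] only almost surely. On the exceptional event, measurable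
    because [Hc c] is a Borel set of [H], it is replaced by a fixed element. *)
Lemma state_version : exists U : Omega -> nat -> R, [/\ forall o, Hc c (U o), coord_measurable U &
  {ae P, forall o, coef (u o t) = U o}].
Proof.
pose k := ctrunc c 0 (fun=> 0).
pose E := [set o | Hc c (coef (u o t))].
have [hF1 _] := hF; have [_ Fm] := hF1 t (ltW t0).
have mB D : borel H D -> measurable [set o | D (coef (u o t))].
  by move=> bD; apply: Fm; exact: uF (ltW t0) _ bD.
have mE : measurable E by apply: mB; exact: borel_Hc.
pose U o := if pselect (E o) then coef (u o t) else k.
exists U; split.
- by move=> o; rewrite /U; case: (pselect (E o)) => h //=; exact: ctrunc_Hc.
- move=> n; apply: (measurability _ (RGenOInfty.measurableE R)) => _ [_ [r ->] <-].
  rewrite setTI; set B := [set a : nat -> R | H a /\ `]r, +oo[%classic (a n)].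
  have mBn : measurable [set o | B (coef (u o t))].
    by apply: mB; apply: sub_sigma_algebra; apply: open_coord; exact: interval_open.
  have -> : (fun o => U o n) @^-1` `]r, +oo[%classic =
      (E `&` [set o | B (coef (u o t))]) `|` (~` E `&` [set o | `]r, +oo[%classic (k n)]).
    apply/seteqP; split=> o /=; rewrite /U; case: (pselect (E o)) => h //=.
    + by move=> g; left; split=> //; split=> //; case: h.
    + by move=> g; right.
    + by case=> [[_ []]|[]].
    + by case=> [[]|[]].
  apply: measurableU; first exact: measurableI.
  apply: measurableI; first exact: measurableC.
  case: (pselect (`]r, +oo[%classic (k n))) => h.
    by rewrite (_ : [set _ | _] = setT)//; apply/seteqP; split.
  by rewrite (_ : [set _ | _] = set0)//; apply/seteqP; split.
- by apply: filterS uH => o h; rewrite /U; case: (pselect (E o)).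
Qed.

End states.

(** * Removal of the positive lower bound and the logarithmic limit *)

Section harnack_limits.
Context {R : realType} d (Omega : measurableType d) (P : probability Omega R).

Lemma approach_rate (k S e : R) : 0 <= k -> 0 < S -> 0 < e ->
  exists2 s, 0 < s < S & k / (expR s - 1) <= k / (expR S - 1) + e.
Proof.
move=> k0 S0 e0; set E := expR S - 1.
have E0 : 0 < E by rewrite subr_gt0 expR_gt1.
have k1 : 0 < k + 1 by rewrite ltr_wpDl.
(* Chosen so that [k / (q E) = k / E + e k / (k + 1)]; the added 1 covers [k = 0]. *)
pose q := (1 + e * E / (k + 1))^-1.
have eE : 0 < e * E / (k + 1) by rewrite divr_gt0// mulr_gt0.
have q0 : 0 < q by rewrite invr_gt0 addr_gt0.
have q1 : q < 1 by rewrite invf_lt1 ?addr_gt0// ltrDl.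
have qE : 0 < q * E by exact: mulr_gt0.
exists (ln (1 + q * E)).
  apply/andP; split; first by rewrite ln_gt0// ltrDl.
  rewrite -[X in _ < X]expRK ltr_ln ?posrE ?expR_gt0 ?addr_gt0//.
  by rewrite -ltrBrDl -/E gtr_pMl.
rewrite lnK ?posrE ?addr_gt0// [1 + _]addrC addrK invfM invrK.
have -> : k * ((1 + e * E / (k + 1)) / E) = k / E + k / (k + 1) * e.
  by field; rewrite !gt_eqF.
by rewrite lerD2l ler_piMl ?(ltW e0)// ler_pdivrMr// mul1r lerDl.
Qed.

Variables (c : R) (U V : Omega -> nat -> R).
Hypotheses (UH : forall o, Hc c (U o)) (VH : forall o, Hc c (V o)).
Hypotheses (mU : coord_measurable U) (mV : coord_measurable V).

Definition borel_fun (phi : (nat -> R) -> R) :=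
  forall D : set R, measurable D -> borel (Hc c) (Hc c `&` phi @^-1` D).

Lemma borel_fun_comp (g : R -> R) phi : measurable_fun setT g -> borel_fun phi ->
  borel_fun (g \o phi).
Proof.
move=> mg bphi D mD; rewrite comp_preimage; apply: bphi.
by rewrite -[X in measurable X]setTI; exact: mg.
Qed.

Let borel_comp (X : Omega -> nat -> R) phi : law U V X -> borel_fun phi ->
  measurable_fun setT (fun o => phi (X o)).
Proof. by move=> lX bphi; exact: (borel_comp_measurable P UH VH mU mV bphi lX). Qed.

Let lU : law U V U. Proof. by left. Qed.
Let lV : law U V V. Proof. by right. Qed.

(** The exponent for the power [p] depends on [p] only through [p / (p - 1)], which tends to 1 as
    [p] grows; the limit [K0] is the constant of the logarithmic inequality. *)
Variable K0 : R.
Hypothesis K00 : 0 <= K0.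
Hypothesis base : forall (p lo hi : R) (phi : (nat -> R) -> R), 1 < p -> 0 < lo ->
  hbd c lo hi phi -> borel_fun phi ->
  (\int[P]_o phi (V o)) `^ p <= \int[P]_o (phi (U o) `^ p) * expR (p / (p - 1) * K0).

Let bound_ge0 M (phi : (nat -> R) -> R) : (forall a, Hc c a -> `|phi a| <= M) -> 0 <= M.
Proof. by move=> h; apply: le_trans (h _ (ctrunc_Hc c 0 (fun=> 0))). Qed.

Let prob_cst (k : R) : \int[P]_o k = k.
Proof. by rewrite (Rintegral_cst _ measurableT) -[X in fine X]/(P setT) probability_setT mulr1. Qed.

Let bmeas_cst (k : R) : bmeas (fun _ : Omega => k).
Proof. by split; [exact: measurable_cst|exists `|k|]. Qed.

Let Rint_le (A B : Omega -> R) : bmeas A -> bmeas B -> (forall o, A o <= B o) ->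
  \int[P]_o A o <= \int[P]_o B o.
Proof. by move=> bA bB h; apply: le_Rintegral => //; exact: bmeas_integrable. Qed.

Let Rint_add (A : Omega -> R) (k : R) : bmeas A ->
  \int[P]_o (A o + k) = \int[P]_o A o + k.
Proof.
move=> bA; rewrite (RintegralD measurableT (bmeas_integrable P bA) (bmeas_integrable P (bmeas_cst k))).
by rewrite prob_cst.
Qed.

Let bmeas_add (A : Omega -> R) (k : R) : bmeas A -> bmeas (fun o => A o + k).
Proof.
move=> [mA [M hM]]; split; first by apply: measurable_funD => //; exact: measurable_cst.
by exists (M + `|k|) => o; apply: le_trans (ler_normD _ _) _; exact: lerD.
Qed.

Lemma power_harnack (p M : R) phi : 1 < p -> (forall a, Hc c a -> `|phi a| <= M) -> borel_fun phi ->
  (\int[P]_o `|phi (V o)|) `^ p <= \int[P]_o (`|phi (U o)| `^ p) * expR (p / (p - 1) * K0).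
Proof.
move=> p1 bM bphi.
have p0 : 0 < p by exact: lt_trans ltr01 p1.
have M0 := bound_ge0 bM.
set C := expR _; have C0 : 0 < C by exact: expR_gt0.
apply/ler_addgt0Pr => e e0.
(* Replacing [|phi|] by its maximum with [del] raises the right-hand side by at most
   [C * del^p = e]. *)
pose del := (e / C) `^ p^-1.
have del0 : 0 < del by rewrite powR_gt0// divr_gt0.
have delp : del `^ p = e / C by rewrite -powRrM mulVf ?gt_eqF// powRr1// divr_ge0// ltW.
have mg : measurable_fun setT (fun v : R => Num.max `|v| del).
  by apply: measurable_maxr; [exact: normr_measurable|exact: measurable_cst].
pose psi := (fun v : R => Num.max `|v| del) \o phi.
have bpsi : borel_fun psi by exact: borel_fun_comp.
have hpsi : hbd c del (M + del) psi.
  move=> a Ha; rewrite /psi /= le_max lexx orbT/= ge_max lerDr M0 andbT.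
  by apply: (le_trans (bM a Ha)); rewrite lerDl ltW.
have Habs (X : Omega -> nat -> R) : law U V X -> bmeas (fun o => `|phi (X o)|).
  move=> lX; apply: (@bmeas_between _ _ _ _ 0 M).
    by apply: measurableT_comp => //; exact: borel_comp.
  by move=> o; rewrite normr_ge0/=; apply: bM; case: lX => ->.
have Hpsi (X : Omega -> nat -> R) : law U V X -> bmeas (fun o => psi (X o)).
  move=> lX; apply: (bmeas_between (borel_comp lX bpsi)) => o; apply: hpsi; by case: lX => ->.
have pw (A : Omega -> R) (m : R) : 0 <= m -> measurable_fun setT A -> (forall o, 0 <= A o <= m) ->
    bmeas (fun o => A o `^ p).
  move=> m0 mA h; apply: (@bmeas_between _ _ _ _ 0 (m `^ p)).
    exact: measurableT_comp (measurable_powR p) mA.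
  move=> o; have /andP[h1 h2] := h o; rewrite powR_ge0/=.
  by apply: ge0_ler_powR; rewrite ?nnegrE// ltW.
have pU : bmeas (fun o => `|phi (U o)| `^ p).
  apply: (pw _ M) => //; first by case: (Habs U lU).
  by move=> o; rewrite normr_ge0 bM.
have pU' : bmeas (fun o => psi (U o) `^ p).
  apply: (pw _ (M + del)); [by rewrite addr_ge0// ltW|by case: (Hpsi U lU)|move=> o].
  by have /andP[h1 h2] := hpsi _ (UH o); rewrite h2 (le_trans (ltW del0) h1).
apply: (@le_trans _ _ ((\int[P]_o psi (V o)) `^ p)).
  have h : \int[P]_o `|phi (V o)| <= \int[P]_o psi (V o).
    by apply: Rint_le; [exact: Habs|exact: Hpsi|move=> o; rewrite /psi /= le_max lexx].
  have h0 : 0 <= \int[P]_o `|phi (V o)| by apply: Rintegral_ge0.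
  by apply: ge0_ler_powR; rewrite ?nnegrE ?(ltW p0)//; exact: le_trans h.
apply: (le_trans (base p1 del0 hpsi bpsi)); rewrite -/C.
apply: (@le_trans _ _ ((\int[P]_o (`|phi (U o)| `^ p) + e / C) * C)); last first.
  by rewrite mulrDl divfK// gt_eqF.
apply: ler_wpM2r; first exact: ltW.
rewrite -Rint_add//; apply: Rint_le => //; first exact: bmeas_add.
move=> o; rewrite /psi /= -delp; case: (leP `|phi (U o)| del) => h.
  by rewrite lerDr powR_ge0.
by rewrite lerDl powR_ge0.
Qed.

(** Integration of [ln z <= z - 1] at [z = A / I], with [I] the mean of [A]. *)
Lemma jensen_ln (A : Omega -> R) (lo hi : R) : 0 < lo -> measurable_fun setT A ->
  (forall o, lo <= A o <= hi) ->
  bmeas (fun o => ln (A o)) /\ \int[P]_o ln (A o) <= ln (\int[P]_o A o).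
Proof.
move=> lo0 mA bA; set I := \int[P]_o A o.
have /andP[I1 _] := Rintegral_between P mA (ltW lo0) bA.
have I0 : 0 < I by exact: lt_le_trans I1.
have A0 o : 0 < A o by have /andP[h _] := bA o; exact: lt_le_trans h.
have bA' := bmeas_between mA bA.
have bl : bmeas (fun o => ln (A o)).
  apply: (@bmeas_between _ _ _ _ (ln lo) (ln hi)).
    exact: measurableT_comp (@measurable_ln R) mA.
  move=> o; have /andP[h1 h2] := bA o; have h3 := A0 o.
  by rewrite !ler_ln ?posrE// ?h1// (lt_le_trans h3 h2).
split=> //.
have bs : bmeas (fun o => I^-1 * A o).
  have [_ [m hm]] := bA'; split; first by apply: measurable_funM => //; exact: measurable_cst.
  by exists (`|I^-1| * m) => o; rewrite normrM ler_wpM2l.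
apply: (@le_trans _ _ (\int[P]_o (I^-1 * A o + (ln I - 1)))).
  apply: Rint_le => //; first exact: bmeas_add.
  move=> o; have q0 : 0 < I^-1 * A o by rewrite mulr_gt0// invr_gt0.
  have : ln (I^-1 * A o) <= I^-1 * A o - 1.
    have := @le_ln1Dx R (I^-1 * A o - 1); rewrite [1 + _]addrC subrK; apply.
    by rewrite ltrBrDl subrr.
  by rewrite lnM ?posrE ?invr_gt0// lnV ?posrE//; lra.
rewrite Rint_add// (RintegralZl _ measurableT (bmeas_integrable P bA')) mulVf ?gt_eqF//.
by rewrite addrC subrK.
Qed.

Lemma log_harnack (M : R) phi : (forall a, Hc c a -> `|phi a| <= M) -> borel_fun phi ->
  (forall a, Hc c a -> 0 < phi a) ->
  0 < \int[P]_o phi (U o) /\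
  (\int[P]_o (ln (phi (V o)))%:E <= (K0 + ln (\int[P]_o phi (U o)))%:E)%E.
Proof.
move=> bM bphi pos.
have M0 := bound_ge0 bM.
have Hphi (X : Omega -> nat -> R) : law U V X -> bmeas (fun o => phi (X o)).
  move=> lX; split; first exact: borel_comp.
  by exists M => o; apply: bM; case: lX => ->.
set E0 := \int[P]_o phi (U o).
(* A positive function with zero integral would make the whole space negligible. *)
have E00 : 0 < E0.
  have h0 : 0 <= E0 by apply: Rintegral_ge0 => o _; exact: ltW (pos _ (UH o)).
  rewrite lt_neqAle h0 andbT eq_sym; apply/eqP => E0z.
  have iU := bmeas_integrable P (Hphi U lU).
  have := integrable_fin_num measurableT iU => fU.
  have abs0 : (\int[P]_(o in setT) `|(phi (U o))%:E| = 0)%E.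
    rewrite (eq_integral (fun o => (phi (U o))%:E)); last first.
      by move=> o _; rewrite gee0_abs// lee_fin ltW// pos.
    by rewrite -(fineK fU) -[fine _]/E0 E0z.
  have mE : measurable_fun setT (fun o => (phi (U o))%:E).
    by apply/measurable_EFinP; case: (Hphi U lU).
  have := (ae_eq_integral_abs P measurableT mE).1 abs0 => -[N [mN N0 hN]].
  have : P setT = 0%E.
    apply/eqP; rewrite eq_le measure_ge0 andbT -N0; apply: le_measure; rewrite ?inE//.
    by apply: subset_trans hN => o _ /= /(_ I)[] h; have := pos _ (UH o); rewrite h ltxx.
  by rewrite probability_setT => /eqP; rewrite onee_eq0.
split=> //.
(* [ln phi] may be unbounded below, so [phi] is first raised to at least [del]; its mean then grows
   by at most [del], and the logarithm of the mean by at most [del / E0]. *)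
have trunc_case del : 0 < del -> (\int[P]_o (ln (phi (V o)))%:E <= (K0 + ln E0 + del / E0)%:E)%E.
  move=> del0.
  have mg : measurable_fun setT (fun v : R => Num.max v del).
    by apply: measurable_maxr; [exact: measurable_id|exact: measurable_cst].
  pose psi := (fun v : R => Num.max v del) \o phi.
  have bpsi : borel_fun psi by exact: borel_fun_comp.
  have hpsi : hbd c del (M + del) psi.
    move=> a Ha; rewrite /psi /= le_max lexx orbT/= ge_max lerDr M0 andbT.
    by apply: (le_trans (ler_norm _)); apply: (le_trans (bM a Ha)); rewrite lerDl ltW.
  have mpsi (X : Omega -> nat -> R) : law U V X -> measurable_fun setT (fun o => psi (X o)).
    by move=> lX; exact: borel_comp.
  have Hpsi (X : Omega -> nat -> R) : law U V X -> bmeas (fun o => psi (X o)).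
    move=> lX; apply: (bmeas_between (mpsi X lX)) => o; apply: hpsi; by case: lX => ->.
  set E1 := \int[P]_o psi (U o).
  have E10 : 0 < E1.
    have /andP[h _] := Rintegral_between P (mpsi U lU) (ltW del0) (fun o => hpsi _ (UH o)).
    exact: lt_le_trans h.
  have E1E0 : E1 <= E0 + del.
    rewrite /E0 -Rint_add; last exact: Hphi.
    apply: Rint_le; [exact: Hpsi|apply: bmeas_add; exact: Hphi|move=> o].
    by rewrite /psi /= ge_max lerDl lerDr (ltW del0) ltW// pos.
  have lnE1 : ln E1 <= ln E0 + del / E0.
    apply: (@le_trans _ _ (ln (E0 * (1 + del / E0)))).
      by rewrite ler_ln ?posrE ?mulr_gt0 ?addr_gt0 ?divr_gt0// mulrDr mulr1 mulrC divfK// gt_eqF.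
    rewrite lnM ?posrE ?addr_gt0 ?divr_gt0// lerD2l; apply: le_ln1Dx.
    by apply: lt_trans (divr_gt0 del0 E00); rewrite ltrN10.
  have [bl _] := jensen_ln del0 (mpsi V lV) (fun o => hpsi _ (VH o)).
  set J := \int[P]_o ln (psi (V o)).
  have Jp p : 1 < p -> J <= ln E1 + p / (p - 1) * K0.
    move=> p1; have p0 : 0 < p by exact: lt_trans ltr01 p1.
    (* For [psi^(1/p)] the right-hand side of the power inequality contains the mean of [psi].
       Taking logarithms, with Jensen's inequality on the left, leaves a bound in which [p] enters
       only through [p / (p - 1)]. *)
    pose chi := (fun v : R => v `^ p^-1) \o psi.
    have bchi : borel_fun chi by apply: borel_fun_comp => //; exact: measurable_powR.
    have lo1 : 0 < del `^ p^-1 by exact: powR_gt0.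
    have hchi : hbd c (del `^ p^-1) ((M + del) `^ p^-1) chi.
      move=> a Ha; have /andP[h1 h2] := hpsi a Ha.
      have h3 : 0 <= psi a by exact: le_trans (ltW del0) h1.
      by apply/andP; split; apply: ge0_ler_powR; rewrite ?nnegrE ?invr_ge0 ?(ltW p0) ?(ltW del0)//;
        rewrite addr_ge0// ltW.
    have [_ jen] := jensen_ln lo1 (borel_comp lV bchi) (fun o => hchi _ (VH o)).
    have b := base p1 lo1 hchi bchi.
    have eU : \int[P]_o (chi (U o) `^ p) = E1.
      apply: eq_Rintegral => o _; rewrite /chi /= -powRrM mulVf ?gt_eqF// powRr1//.
      by have /andP[h1 _] := hpsi _ (UH o); exact: le_trans (ltW del0) h1.
    rewrite eU in b.
    have /andP[I1 _] := Rintegral_between P (borel_comp lV bchi) (ltW lo1) (fun o => hchi _ (VH o)).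
    have I0 := lt_le_trans lo1 I1.
    have eJ : J = p * \int[P]_o ln (chi (V o)).
      transitivity (p * \int[P]_o (p^-1 * ln (psi (V o)))).
        by rewrite (RintegralZl _ measurableT (bmeas_integrable P bl)) mulrA mulfV ?mul1r// gt_eqF.
      by congr (_ * _); apply: eq_Rintegral => o _; rewrite /chi /= ln_powR.
    rewrite eJ; apply: (le_trans (ler_wpM2l (ltW p0) jen)); rewrite -ln_powR.
    have : ln ((\int[P]_o chi (V o)) `^ p) <= ln (E1 * expR (p / (p - 1) * K0)).
      by rewrite ler_ln ?posrE ?powR_gt0 ?mulr_gt0 ?expR_gt0.
    by rewrite lnM ?posrE ?expR_gt0// expRK.
  have JE : J <= K0 + ln E0 + del / E0.
    rewrite -addrA; apply: (@le_trans _ _ (K0 + ln E1)); last by rewrite lerD2l.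
    apply/ler_addgt0Pr => e e0.
    have k1 : 0 < K0 + 1 by rewrite ltr_wpDl.
    have pe : 0 < (K0 + 1) / e by exact: divr_gt0.
    (* For this power [p / (p - 1) * K0] equals [K0 + K0 / (K0 + 1) * e], at most [K0 + e]. *)
    have := Jp (1 + (K0 + 1) / e); rewrite ltrDl => /(_ pe) h; apply: (le_trans h).
    have -> : (1 + (K0 + 1) / e) / (1 + (K0 + 1) / e - 1) * K0 = K0 + K0 / (K0 + 1) * e.
      by field; rewrite !gt_eqF.
    have : K0 / (K0 + 1) * e <= e.
      by rewrite ler_piMl ?(ltW e0)// ler_pdivrMr// mul1r lerDl.
    by move: (_ * e) => q; lra.
  apply: (@le_trans _ _ J%:E); last by rewrite lee_fin.
  have mphi : measurable_fun setT (fun o => (ln (phi (V o)))%:E).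
    apply/measurable_EFinP; apply: measurableT_comp (@measurable_ln R) _.
    exact: borel_comp.
  have mpsi' : measurable_fun setT (fun o => (ln (psi (V o)))%:E).
    by apply/measurable_EFinP; case: bl.
  have -> : J%:E = (\int[P]_o (ln (psi (V o)))%:E)%E.
    rewrite /J /Rintegral fineK//; exact: integrable_fin_num (bmeas_integrable P bl).
  have le o : ((ln (phi (V o)))%:E <= (ln (psi (V o)))%:E)%E.
    have h := pos _ (VH o); rewrite lee_fin ler_ln ?posrE// /psi /= ?le_max ?lexx//.
    by rewrite lt_max h.
  (* The integral of [ln phi] may be minus infinity, so positive and negative parts are compared
     separately. *)
  rewrite integralE [leRHS]integralE; apply: leeB; apply: ge0_le_integral => //.
  - exact: measurable_funepos.
  - exact: measurable_funepos.
  - by move=> o _; apply: (funepos_le (D := setT)); rewrite ?inE// => z _; exact: le.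
  - exact: measurable_funeneg.
  - exact: measurable_funeneg.
  - by move=> o _; apply: (funeneg_le (D := setT)); rewrite ?inE// => z _; exact: le.
apply/lee_addgt0Pr => e e0; rewrite -EFinD.
have := trunc_case (e * E0); rewrite mulr_gt0// => /(_ isT).
by rewrite mulfK// gt_eqF.
Qed.

End harnack_limits.

(** * Application to the solutions of the equation *)

Section solutions.
Context {R : realType} d (Omega : measurableType d) (P : probability Omega R).
Variables (F : R -> set (set Omega)) (W : (R -> R) -> R -> Omega -> R).
Variables (c lam t : R).
Hypotheses (hP : measure_is_complete P) (hF : filtration F).
Hypotheses (hc : -1 < c < 1) (lam_pi : lam < pi ^+ 2) (t0 : 0 < t).
Local Notation rate := ((pi ^+ 2 - lam) * pi ^+ 2).

Let c1 : `|c| < 1. Proof. by rewrite ltr_norml. Qed.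

Lemma solution_version x u : K x -> Hc c (coef x) ->
  (exists etap etam, weak_solution P lam (graph_powA 1) x F u etap etam W) ->
  exists U : Omega -> nat -> R, [/\ forall o, Hc c (U o), coord_measurable U,
    {ae P, forall o, coef (u o t) = U o} & limit_of_approx P W lam t c1 (coef x) U].
Proof.
move=> Kx [Hx x0] [etap [etam sol]].
have x_adm m : admissible c m (coef x) by exact: K_admissible.
have [s1 _ [_ uF] _ _] := sol.
have mass := mass_ae sol x0 t0.
have uH : {ae P, forall o, Hc c (coef (u o t))}.
  apply: filterS2 s1 mass => o [_ /(_ t t0)[_ _ h3 _ _]] h; split=> //.
  by apply: h3; rewrite lexx ltW.
have [U [UH mU Uu]] := state_version hF uF t0 uH.
exists U; split=> //.
have lim := ae_path_limit c1 (ltW lam_pi) t0 sol x_adm x0.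
by apply: filterS2 Uu lim => o ->.
Qed.

Lemma dist_sqr (a b : nat -> R) : Hc c a -> Hc c b ->
  fine (seminormV (-1) (a - b)) ^+ 2 = fine (hsum (a - b)).
Proof.
move=> Ha Hb; rewrite seminormVE -(fineK (hsum_sub Ha Hb)) poweR_EFin /=.
have h : 0 <= fine (hsum (a - b)) by rewrite fine_ge0 ?hsum_ge0.
by rewrite -powR_mulrn ?powR_ge0// -powRrM mulVf// powRr1.
Qed.

Definition harnack_const (x y : R -> R) : R :=
  rate * fine (seminormV (-1) (coef x - coef y)) ^+ 2 / (2 * (expR (rate * t) - 1)).

Lemma harnack_const_ge0 x y : 0 <= harnack_const x y.
Proof.
have r0 := rate_gt0 lam_pi.
apply: divr_ge0; first by apply: mulr_ge0; [exact: ltW|exact: sqr_ge0].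
by rewrite mulr_ge0// subr_ge0 ltW// expR_gt1 mulr_gt0.
Qed.

(** The cylinder inequality holds for each [s] below [rate * t] up to an arbitrarily small error in
    the exponent; continuity in [s] gives the endpoint, and [borel_harnack] passes to Borel
    functions. *)
Lemma solution_harnack x y U V (p lo hi : R) phi :
  cylindrical_wiener P F W -> Hc c (coef x) -> Hc c (coef y) ->
  (forall o, Hc c (U o)) -> coord_measurable U -> limit_of_approx P W lam t c1 (coef x) U ->
  (forall o, Hc c (V o)) -> coord_measurable V -> limit_of_approx P W lam t c1 (coef y) V ->
  1 < p -> 0 < lo -> hbd c lo hi phi -> borel_fun c phi ->
  (\int[P]_o phi (V o)) `^ p <=
    \int[P]_o (phi (U o) `^ p) * expR (p / (p - 1) * harnack_const x y).
Proof.
move=> hW Hx Hy UH mU hU VH mV hV p1 lo0 bphi mphi.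
have r0 := rate_gt0 lam_pi.
have S0 : 0 < rate * t by exact: mulr_gt0.
have p10 : 0 < p - 1 by rewrite subr_gt0.
have p0 : 0 < p by exact: lt_trans ltr01 p1.
have bh := borel_harnack UH VH mU mV bphi mphi p1 lo0.
apply: bh => f l j l0 fb fl.
pose d2 := fine (hsum (coef x - coef y)).
have d20 : 0 <= d2 by rewrite fine_ge0 ?hsum_ge0.
have hd2 m : nrm2 m (wt m) (coef x - coef y) <= d2.
  by rewrite -lee_fin fineK ?nrm2_le_hsum//; exact: hsum_sub Hx Hy.
pose k := p / (2 * (p - 1)) * rate * d2.
have k0 : 0 <= k.
  by apply: mulr_ge0 => //; apply: mulr_ge0; [apply: divr_ge0; [|apply: mulr_ge0]|]; exact: ltW.
have kE : p / (p - 1) * harnack_const x y = k / (expR (rate * t) - 1).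
  rewrite /harnack_const (dist_sqr Hx Hy) -/d2 /k; field.
  by rewrite !gt_eqF// subr_gt0 expR_gt1.
have iq : 0 <= \int[P]_o (f (U o) `^ p) by apply: Rintegral_ge0 => o _; exact: powR_ge0.
apply: le_mul_expR_eps => // e e0.
have e2 : 0 < e / 2 by rewrite divr_gt0.
have [s s01 hs] := approach_rate k0 S0 e2.
have ch := cylinder_harnack hF hW lam_pi t0 mU mV hU hV p1 lo0 l0 fb fl hd2 e2 s01.
apply: (le_trans ch).
apply: ler_wpM2l => //; rewrite ler_expR kE.
have -> : p / (2 * (p - 1)) * rate / (expR s - 1) * d2 = k / (expR s - 1) by rewrite /k; ring.
rewrite [X in _ <= X + _]splitr -addrA lerD2l addrC; exact: hs.
Qed.

(** Completeness of [P] makes the original integrand measurable, since it agrees almost surely with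
    that of the version [X]. *)
Lemma expectation_version (X : Omega -> nat -> R) (v : Omega -> R -> R) (g : (nat -> R) -> R) :
  {ae P, forall o, coef (v o) = X o} -> measurable_fun setT (fun o => g (X o)) ->
  ('E_P[fun o => g (coef (v o))] = \int[P]_o (g (X o))%:E)%E.
Proof.
move=> vX mg; rewrite unlock.
have gv : {ae P, forall o, g (coef (v o)) = g (X o)} by apply: filterS vX => o ->.
apply: ae_eq_integral => //.
- by apply/measurable_EFinP; exact: complete_measurable hP mg gv.
- exact/measurable_EFinP.
- by apply: filterS gv => o -> _.
Qed.

End solutions.

Unset Implicit Arguments.

Theorem theorem3p3 (R : realType) (d : measure_display)
    (Omega : measurableType d) (P : probability Omega R)
    (F : R -> set (set Omega)) (W : (R -> R) -> R -> Omega -> R)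
    (c lambda : R) (u : (R -> R) -> Omega -> R -> R -> R)
    (hP : measure_is_complete P) (hF : filtration F)
    (hc : -1 < c < 1) (hlambda : 0 < lambda)
    (hu : forall x : R -> R, K x -> Hc c (coef x) ->
       strong_solution P lambda (graph_powA 1) x F (u x) W)
    (hpi : lambda < pi ^+ 2) :
  let rate := (pi ^+ 2 - lambda) * pi ^+ 2 in
  let dist (x y : R -> R) := fine (seminormV (-1) (coef x - coef y)) in
  (forall p : R, 1 < p ->
     forall phi : (nat -> R) -> R, Bb c phi ->
     forall x y : R -> R, K x -> Hc c (coef x) -> K y -> Hc c (coef y) ->
     forall t : R, 0 < t ->
     (`|semigroup P u t phi y| `^ p <=
      semigroup P u t (fun a => (`|phi a| `^ p)%R) x *
      (expR (p * rate * dist x y ^+ 2 /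
             (2 * (p - 1) * (expR (rate * t) - 1))))%:E)%E) /\
  (forall phi : (nat -> R) -> R, Bb c phi ->
     (forall a, Hc c a -> 0 < phi a) ->
     forall x y : R -> R, K x -> Hc c (coef x) -> K y -> Hc c (coef y) ->
     forall t : R, 0 < t ->
     (semigroup P u t (fun a => ln (phi a)) y <=
      (rate * dist x y ^+ 2 / (2 * (expR (rate * t) - 1)))%:E +
      lne (semigroup P u t phi x))%E).
Proof.
move=> rate dist.
have hs x : K x -> Hc c (coef x) ->
    exists etap etam, weak_solution P lambda (graph_powA 1) x F (u x) etap etam W.
  by move=> Kx Hx; case: (hu x Kx Hx).
have hW x : K x -> Hc c (coef x) -> cylindrical_wiener P F W.
  by move=> Kx Hx; have [etap [etam [_ _ [? _] _ _]]] := hs x Kx Hx.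
have bnd (phi : (nat -> R) -> R) (M : R) (X : Omega -> nat -> R) : (forall a, Hc c a -> `|phi a| <= M) ->
    (forall o, Hc c (X o)) -> measurable_fun setT (fun o => phi (X o)) ->
    bmeas (fun o => phi (X o)).
  by move=> bM XH mX; split=> //; exists M => o; exact: bM.
split=> [p p1 phi [[M bM] bphi] x y Kx Hx Ky Hy t t0|phi [[M bM] bphi] pos x y Kx Hx Ky Hy t t0].
- have [U [UH mU uU hU]] := solution_version hF hc hpi t0 Kx Hx (hs x Kx Hx).
  have [V [VH mV uV hV]] := solution_version hF hc hpi t0 Ky Hy (hs y Ky Hy).
  have base (q lo hi : R) psi (q1 : 1 < q) (lo0 : 0 < lo) (bd : hbd c lo hi psi)
      (bf : borel_fun c psi) := solution_harnack hF hpi t0 (hW x Kx Hx) Hx Hy UH mU hU VH mV hV q1 lo0 bd bf.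
  have h := power_harnack UH VH mU mV base p1 bM bphi.
  have mV' := borel_comp_measurable P UH VH mU mV bphi (or_intror erefl).
  have mU' := borel_comp_measurable P UH VH mU mV bphi (or_introl erefl).
  have p0 : 0 < p by exact: lt_trans ltr01 p1.
  have bV := bnd phi M V bM VH mV'.
  have mP : measurable_fun setT (fun o => (`|phi (U o)| `^ p)%R).
    exact: measurableT_comp (measurable_powR p) (measurableT_comp (@normr_measurable R setT) mU').
  have iP : P.-integrable setT (EFin \o (fun o => (`|phi (U o)| `^ p)%R)).
    apply: (bounded_integrableP (M := M `^ p) P mP) => o.
    have M0 : 0 <= M by exact: le_trans (bM _ (UH o)).
    rewrite ger0_norm ?powR_ge0//; apply: ge0_ler_powR; rewrite ?nnegrE ?(ltW p0)//.
    exact: bM.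
  rewrite /semigroup (expectation_version hP uV mV').
  rewrite (expectation_version (g := fun a => (`|phi a| `^ p)%R) hP uU mP).
  have fV := integrable_fin_num measurableT (bmeas_integrable P bV).
  have fU := integrable_fin_num measurableT iP.
  have -> : (\int[P]_o (phi (V o))%:E = (\int[P]_o phi (V o))%R%:E)%E by rewrite /Rintegral fineK.
  have -> : (\int[P]_o (`|phi (U o)| `^ p)%:E = (\int[P]_o (`|phi (U o)| `^ p))%R%:E)%E.
    by rewrite /Rintegral fineK.
  rewrite abse_EFin poweR_EFin -EFinM lee_fin.
  have -> : p * rate * dist x y ^+ 2 / (2 * (p - 1) * (expR (rate * t) - 1)) =
      p / (p - 1) * harnack_const lambda t x y.
    rewrite /harnack_const -/rate -/(dist x y); field.
    by rewrite !gt_eqF ?subr_gt0// expR_gt1 mulr_gt0// rate_gt0.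
  apply: le_trans h.
  have nV : `|\int[P]_o phi (V o)| <= \int[P]_o `|phi (V o)|.
    by apply: le_normr_Rintegral => //; exact: bmeas_integrable.
  by apply: ge0_ler_powR; rewrite ?nnegrE ?(ltW p0)//; exact: le_trans nV.
- have [U [UH mU uU hU]] := solution_version hF hc hpi t0 Kx Hx (hs x Kx Hx).
  have [V [VH mV uV hV]] := solution_version hF hc hpi t0 Ky Hy (hs y Ky Hy).
  (* The logarithmic inequality arises as the power tends to infinity, so the power inequality is
     needed for all [q > 1]. *)
  have base (q lo hi : R) psi (q1 : 1 < q) (lo0 : 0 < lo) (bd : hbd c lo hi psi)
      (bf : borel_fun c psi) := solution_harnack hF hpi t0 (hW x Kx Hx) Hx Hy UH mU hU VH mV hV q1 lo0 bd bf.
  have [E0 h] := log_harnack UH VH mU mV (harnack_const_ge0 hpi t0 x y) base bM bphi pos.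
  have mV' := borel_comp_measurable P UH VH mU mV bphi (or_intror erefl).
  have mU' := borel_comp_measurable P UH VH mU mV bphi (or_introl erefl).
  have mL : measurable_fun setT (fun o => ln (phi (V o))).
    exact: measurableT_comp (@measurable_ln R) mV'.
  have fU := integrable_fin_num measurableT (bmeas_integrable P (bnd phi M U bM UH mU')).
  rewrite /semigroup (expectation_version (g := fun a => ln (phi a)) hP uV mL).
  rewrite (expectation_version hP uU mU').
  have -> : (\int[P]_o (phi (U o))%:E = (\int[P]_o phi (U o))%R%:E)%E by rewrite /Rintegral fineK.
  by rewrite lne_EFin// -EFinD.
Qed.
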